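(* Let $n\ge 1$, let $V=\mathbb{R}^2\cong\mathbb{C}$ and let $f:V^{n+1}\times\mathbb{R}\to V$ be a smooth function with $f(0;\lambda)=0$ for all $\lambda$. Write $\mathfrak{a}_i(\lambda)=D_if(0;\lambda)$ and assume that $\mathfrak{a}_0(0)=D_0f(0;0):V\to V$ has eigenvalues $\pm i\omega_0\neq 0$. Assume moreover the following (generic) conditions, where $\gamma_{\overline f}$ denotes the local normal form of the feed-forward network $\dot x=\gamma_{f(\cdot;\lambda)}(x)$ near $(x;\lambda)=(0;0)$: (1) $\mathfrak{a}_0(0)+\ldots+\mathfrak{a}_n(0)$ is invertible; (2) $\left.\frac{d}{d\lambda}\right|_{\lambda=0}\mathrm{tr}\,\mathfrak{a}_0(\lambda)\neq 0$; (3) $\mathrm{tr}\,\mathfrak{a}_1(0)\neq 0$; (4) $\frac{\partial^3(\mathrm{Re}\,\overline f)(0;0)}{\partial(\mathrm{Re}\,X_0)^3}\neq 0$; (5) $\mathfrak{a}_0(0)+\ldots+\mathfrak{a}_n(0)$ is hyperbolic. Then the local normal form $\dot x=\gamma_{\overline f(\cdot;\lambda)}(x)$ supports a branch of hyperbolic periodic solutions of the form $$x_0(t)\equiv 0,\quad x_1(t)=B_1(\lambda)e^{i\omega(\lambda)t},\ \ldots,\ x_n(t)=B_n(\lambda)e^{i\omega(\lambda)t}$$ of frequency $\omega(\lambda)=\omega_0+\mathcal{O}(|\lambda|)$ and amplitudes $|B_i(\lambda)|\sim|\lambda|^{\kappa_i}$, where $\kappa_i:=\frac12\cdot\frac{1}{3^{i-1}}$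 for $i=1,\ldots,n$.
   Context: Feed-forward network. For a function $h:V^{n+1}\to V$, $(X_0,\ldots,X_n)\mapsto h(X_0,\ldots,X_n)$, the network vector field $\gamma_h:V^{n+1}\to V^{n+1}$ is defined by $$(\gamma_h)_j(x_0,\ldots,x_n)=h(x_j,x_{j-1},\ldots,x_1,x_0,\ldots,x_0),\quad j=0,\ldots,n,$$ i.e. the $i$-th argument ($0\le i\le n$) is $x_{\max\{j-i,0\}}$. The feed-forward network with response function $f$ is $\dot x=\gamma_{f(\cdot;\lambda)}(x)$. $D_if$ denotes the derivative with respect to $X_i$, so $\mathfrak{a}_i(\lambda):V\to V$ is linear (real). Identification with $\mathbb{C}$. A basis of $V=\mathbb{R}^2$ is chosen so that $\mathfrak{a}_0(0)=\begin{pmatrix}0&-\omega_0\\ \omega_0&0\end{pmatrix}$, and $(X^1,X^2)\in\mathbb{R}^2$ is identified with $X^1+iX^2\in\mathbb{C}$, so that $\mathfrak{a}_0(0)$ is multiplication by $i\omega_0$. Local normal form. Let $r_1\ge 2$, $r_2\ge 1$ be finite. A local normal form of $\gamma_f$ near $(0;0)$ is a network vector field $\gamma_{\overline f}$ obtained as follows: there is a family $\Phi(\cdot;\lambda)$ ($\lambda$ near $0$) of local analytic diffeomorphisms of $V^{n+1}$ near $0$ fixing $0$, which is a finite composition of time-$1$ flows of network vector fields $\gamma_{g(\cdot;\lambda)}$ with $g$ polynomial in $(X,\lambda)$ and $g(0;\lambda)=0$, that conjugates $\gamma_{f(\cdot;\lambda)}$ to a network vector field $\gamma_{\hat f(\cdot;\lambda)}$;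 writing $\hat f_{k,l}$ for the part of the Taylor expansion of $\hat f$ that is homogeneous of degree $k+1$ in $X$ and of degree $l$ in $\lambda$, one sets $\overline f=\sum_{0\le k\le r_1,\,0\le l\le r_2}\hat f_{k,l}$; and $\overline f$ has the normal form symmetry $$\overline f(e^{i\omega_0 s}X_0,\ldots,e^{i\omega_0 s}X_{n-1},0;\lambda)=e^{i\omega_0 s}\overline f(X_0,\ldots,X_{n-1},0;\lambda)\quad\text{for all } s\in\mathbb{R}.$$ Branches and asymptotics. The branch is defined for $\lambda$ in a one-sided neighborhood $[0,\lambda_0)$ or $(-\lambda_0,0]$ of $0$ with $\lambda_0>0$. For $\kappa>0$, $B(\lambda)\sim|\lambda|^\kappa$ means that there is a smooth function $B^*$ on $[0,\lambda_0^\kappa)$ with $B(\lambda)=B^*(|\lambda|^\kappa)$ and $\lim_{|\lambda|^\kappa\downarrow 0}B^*(|\lambda|^\kappa)/|\lambda|^\kappa\neq 0$. A linear map is hyperbolic if it has no eigenvalues on the imaginary axis. A branch of periodic solutions is hyperbolic if for all sufficiently small $\lambda\ne0$ in its domain the periodic solution is hyperbolic (exactly one Floquet multiplier, counted with multiplicity, on the unit circle). *)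

(* Defs.v *)
From HB Require Import structures.
From mathcomp Require Import all_boot all_order all_algebra.
From mathcomp Require Import all_classical all_reals all_analysis.
From mathcomp Require Import complex.

Set Implicit Arguments.
Unset Strict Implicit.
Unset Printing Implicit Defensive.

Import Order.TTheory GRing.Theory Num.Theory.
Import numFieldNormedType.Exports.

Local Open Scope classical_set_scope.
Local Open Scope ring_scope.

(* Conventions: V = R^2 is 'rV[R]_2 and V^{n+1} is 'M[R]_(n.+1, 2), whose
   row j is X_j.  A function of (X; lambda) takes a pair in V^{n+1} * R. *)

Section Smoothness.
Context {R : realType} {E F : normedModType R}.

(* On an open set U of a finite-dimensional space this is C^k: the directional
   derivatives of f in all (constant) directions are C^{k-1} on U. *)
Fixpoint Ck_on (U : set E) (k : nat) (f : E -> F) : Prop :=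
  if k is k'.+1 then
    (forall x, U x -> differentiable f x) /\
    (forall v, Ck_on U k' (fun x => 'D_v f x))
  else forall x, U x -> {for x, continuous f}.

Definition smooth_on (U : set E) (f : E -> F) : Prop :=
  forall k, Ck_on U k f.

(* Smoothness on a set that need not be open, such as [0, a). *)
Definition smooth_ext_on (A : set E) (f : E -> F) : Prop :=
  exists U : set E, [/\ open U, A `<=` U & smooth_on U f].

End Smoothness.

Section ComplexIdentification.
Context {R : realType}.

Definition complex_of_row (v : 'rV[R]_2) : R[i] :=
  Complex (v ord0 ord0) (v ord0 ord_max).

Definition row_of_complex (z : R[i]) : 'rV[R]_2 :=
  \row_(k < 2) (if k == ord0 then complex.Re z else complex.Im z).

Definition expi (theta : R) : R[i] := Complex (cos theta) (sin theta).

(* Complex scalar multiplication on V^m = C^m, row by row. *)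
Definition cscale {m : nat} (z : R[i]) (X : 'M[R]_(m, 2)) : 'M[R]_(m, 2) :=
  \matrix_(j < m) row_of_complex (z * complex_of_row (row j X)).

Definition mulI_mx (omega : R) : 'M[R]_2 :=
  \matrix_(k < 2, l < 2)
    (if k == l then 0 else if k == ord0 then - omega else omega).

Definition hyperbolic_mx {m : nat} (A : 'M[R]_m) : Prop :=
  forall z : R[i], eigenvalue (map_mx (real_complex R) A) z ->
    complex.Re z != 0.

End ComplexIdentification.

Section Network.
Context {R : realType} {n : nat}.
Local Notation V := 'rV[R]_2.
Local Notation W := 'M[R]_(n.+1, 2).

(* The truncated subtraction j - i is max{j - i, 0}. *)
Definition network (h : W -> V) (x : W) : W :=
  \matrix_(j < n.+1) h (\matrix_(i < n.+1) row (inord (j - i)) x).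

(* The matrix of D_i f(0; lambda), acting on column vectors. *)
Definition lin_coef (f : W * R -> V) (i : 'I_n.+1) (lam : R) : 'M[R]_2 :=
  \matrix_(k < 2, l < 2)
    ('D_((delta_mx i l : W), (0 : R)) f (0, lam)) ord0 k.

Definition near_origin (P : W -> R -> Prop) : Prop :=
  nbhs ((0, 0) : W * R) (fun p => P p.1 p.2).

Definition dX {F : normedModType R} (X : W) (f : W * R -> F) : W * R -> F :=
  fun p => 'D_(X, (0 : R)) f p.

Definition dlam {F : normedModType R} (f : W * R -> F) : W * R -> F :=
  fun p => 'D_((0 : W), (1 : R)) f p.

(* The part of the Taylor expansion of f at (0; 0) that is homogeneous of
   degree k+1 in X and of degree l in lambda. *)
Definition taylor_part (f : W * R -> V) (k l : nat) (p : W * R) : V :=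
  ((k.+1)`!%:R^-1 * (l`!)%:R^-1 * p.2 ^+ l)
    *: iter k.+1 (dX p.1) (iter l dlam f) (0, 0).

Inductive polynomial_fun : (W * R -> R) -> Prop :=
| poly_const c : polynomial_fun (fun=> c)
| poly_coord i j : polynomial_fun (fun p => p.1 i j)
| poly_param : polynomial_fun (fun p => p.2)
| poly_add g1 g2 : polynomial_fun g1 -> polynomial_fun g2 ->
    polynomial_fun (fun p => g1 p + g2 p)
| poly_mul g1 g2 : polynomial_fun g1 -> polynomial_fun g2 ->
    polynomial_fun (fun p => g1 p * g2 p).

(* Real analyticity: F is near a the sum of a power series in the coordinates
   of h = x - a, with geometrically bounded coefficients c(alpha); the
   multi-exponents alpha are matrices of natural numbers. *)
Definition analytic_at (F : W -> W) (a : W) : Prop :=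
  exists (c : 'M[nat]_(n.+1, 2) -> W) (C M : R),
    (forall alpha, `|c alpha| <= C * M ^+ (\sum_i \sum_j alpha i j)%N) /\
    nbhs (0 : W) (fun h : W =>
      (fun N : nat => \sum_(alpha : 'M['I_N]_(n.+1, 2))
         (\prod_i \prod_j h i j ^+ alpha i j) *: c (map_mx val alpha))
      @ \oo --> F (a + h)).

Definition local_analytic_diffeo (F : W -> W) : Prop :=
  F 0 = 0 /\ analytic_at F 0 /\
  exists G : W -> W, [/\ analytic_at G 0,
    nbhs (0 : W) (fun x : W => G (F x) = x) &
    nbhs (0 : W) (fun y : W => F (G y) = y)].

Definition time1 (F : W -> W) (x y : W) : Prop :=
  exists c : R -> W, [/\ c 0 = x, c 1 = y &
    forall t : R, 0 <= t <= 1 -> is_derive t (1 : R) c (F (c t))].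

Definition network_flow_composition (Phi : W * R -> W) : Prop :=
  exists (m : nat) (g : nat -> W * R -> V),
    (forall k, (k < m)%N ->
       (forall j, polynomial_fun (fun p => g k p ord0 j)) /\
       (forall lam, g k (0, lam) = 0)) /\
    near_origin (fun (x : W) (lam : R) =>
      exists z : nat -> W, [/\ z 0%N = x, z m = Phi (x, lam) &
        forall k, (k < m)%N ->
          time1 (network (fun X => g k (X, lam))) (z k) (z k.+1)]).

(* Phi_* gamma_f = gamma_fhat near (0; 0). *)
Definition conjugates (Phi : W * R -> W) (f fhat : W * R -> V) : Prop :=
  near_origin (fun (x : W) (lam : R) =>
    differentiable (fun x' : W => Phi (x', lam)) x /\
    'd (fun x' : W => Phi (x', lam)) x (network (fun X => f (X, lam)) x) =
      network (fun X => fhat (X, lam)) (Phi (x, lam))).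

Definition normal_form_symmetry (omega0 : R) (fbar : W * R -> V) : Prop :=
  forall (s : R) (X : W) (lam : R), row ord_max X = 0 ->
    fbar (cscale (expi (omega0 * s)) X, lam) =
      cscale (expi (omega0 * s)) (fbar (X, lam)).

Definition local_normal_form (omega0 : R) (r1 r2 : nat)
    (f fbar : W * R -> V) : Prop :=
  exists (Phi : W * R -> W) (fhat : W * R -> V),
    [/\ (\forall lam \near (0 : R),
           local_analytic_diffeo (fun x : W => Phi (x, lam))),
        network_flow_composition Phi,
        (exists U : set (W * R), open_nbhs ((0, 0) : W * R) U /\ smooth_on U fhat),
        conjugates Phi f fhat &
        (forall p, fbar p =
           \sum_(k < r1.+1) \sum_(l < r2.+1) taylor_part fhat k l p) /\
        normal_form_symmetry omega0 fbar].

End Network.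

Section PeriodicSolutions.
Context {R : realType} {n : nat}.
Local Notation W := 'M[R]_(n.+1, 2).

Definition is_solution (F : W -> W) (x : R -> W) : Prop :=
  forall t : R, is_derive t (1 : R) x (F (x t)).

Definition minimal_period (x : R -> W) (T : R) : Prop :=
  [/\ 0 < T, (forall t, x (t + T) = x t) &
    forall S, 0 < S < T -> ~ (forall t, x (t + S) = x t)].

(* Y is the principal fundamental matrix of the variational equation along x.
   The tangent space is vectorized by mxvec and acted on from the right, so
   the equation reads Y' = Y A(t); this is the transpose of the column
   convention and has the same Floquet multipliers. *)
Definition fundamental_mx (F : W -> W) (x : R -> W)
    (Y : R -> 'M[R]_(n.+1 * 2)) : Prop :=
  Y 0 = 1%:M /\
  forall (t : R) i j,
    is_derive t (1 : R) (fun s => Y s i j)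
      ((Y t *m lin_mx ('d F (x t) : W -> W)) i j).

(* The sequence mults lists the Floquet multipliers with multiplicity. *)
Definition hyperbolic_periodic (F : W -> W) (x : R -> W) : Prop :=
  exists (T : R) (Y : R -> 'M[R]_(n.+1 * 2)) (mults : seq R[i]),
    [/\ minimal_period x T, fundamental_mx F x Y,
        char_poly (map_mx (real_complex R) (Y T)) =
          \prod_(z <- mults) ('X - z%:P) &
        count (fun z => ComplexField.Normc.normc z == 1) mults = 1%N].

(* t |-> (0, B_1 e^{i omega t}, ..., B_n e^{i omega t}); B_0 is ignored. *)
Definition rotating_wave (B : nat -> R[i]) (omega : R) (t : R) : W :=
  \matrix_(j < n.+1)
    (if j == ord0 then 0 else row_of_complex (B j * expi (omega * t))).

(* b(lambda) ~ |lambda|^kappa for lambda in D, where D is [0, lam0) or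
   (-lam0, 0]. *)
Definition sim_power (D : set R) (lam0 kappa : R) (b : R -> R) : Prop :=
  exists bs : R -> R,
    [/\ smooth_ext_on [set mu : R | 0 <= mu < lam0 `^ kappa] bs,
        (forall lam, D lam -> b lam = bs (`|lam| `^ kappa)) &
        exists l : R, l != 0 /\ bs mu / mu @[mu --> (0 : R)^'+] --> l].

End PeriodicSolutions.

(* Main.v *)
(** The idea: linearizing the conjugacy at the origin transports the conditions on [f] to
    the normal form [fbar], which is polynomial and commutes with rotations. On a rotating
    wave, node [i] satisfies an algebraic equation; substituting [x_i = mu b],
    [x_(i-l) = mu^(3^l) beta_(i-l)], [lambda = +- mu^(2 3^(i-1))], it becomes [mu^3] times a
    polynomial equation whose limit at [mu = 0] is solvable with invertible derivative
    ([gamma |b|^2 b = - a_1 b_(i-1)] for [i >= 2], the cubic Hopf equation in amplitude and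
    frequency for [i = 1]). The implicit function theorem in [mu] gives the smooth amplitudes,
    node after node. In the rotating frame the variational equation has constant coefficients
    apart from a nilpotent coupling of node [0] to the others, and is block triangular: the
    blocks are [D f] summed over all arguments at node [0], and [mu^2] times the derivative of
    the reduced equation at the other nodes. The only critical direction is the phase, at
    node [1]. *)
Require Import Defs.
From HB Require Import structures.
From mathcomp Require Import all_boot all_order all_algebra.
From mathcomp Require Import all_classical all_reals all_analysis.
From mathcomp Require Import perm spectral complex ring lra.

Set Implicit Arguments.
Unset Strict Implicit.
Unset Printing Implicit Defensive.

Import Order.TTheory GRing.Theory Num.Theory.
Import numFieldNormedType.Exports.

Local Open Scope classical_set_scope.
Local Open Scope ring_scope.

(** The exponents are forced: at node i >= 2 the cubic term, of size |x_i|^3, must balance the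
    coupling a_1 x_(i-1), while lambda x_i is of higher order; so the size of each amplitude is the
    cube root of the previous one. Three obstacles shape the proof. The frequency keeps its sign
    only if the conjugacy preserves orientation; hence the diagonal blocks of its derivative are
    shown to have positive determinant, as blocks of exponentials. The conjugacy equation involves
    the differential of [Phi] at points x != 0, whereas only time-one flows are given; strict
    differentiability at the origin, obtained from Gronwall's inequality, controls these
    differentials. Finally the normal form symmetry requires X_n = 0, and a perturbation of x_0
    enters the last argument of every node; so the coupling out of node 0 does not become constant
    in the rotating frame and is integrated separately. As [fbar] is a polynomial, it is represented
    by syntax: its divided differences are polynomials too, and differentiability and the implicit
    function theorem reduce to continuity of evaluation. *)

(** * Polynomials as syntax: evaluation, divided differences, division by a variable *)

Section PolynomialExpressions.
Context {R : realType}.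

(** Syntax instead of functions, because [hd] and [pexpr_div] are computed by recursion on an
    expression. *)
Inductive pexpr (I : Type) : Type :=
| PC of R
| PV of I
| PA of pexpr I & pexpr I
| PM of pexpr I & pexpr I.

Arguments PC {I}.

Fixpoint ev (I : Type) (e : pexpr I) (v : I -> R) : R :=
  match e with
  | PC c => c
  | PV i => v i
  | PA a b => ev a v + ev b v
  | PM a b => ev a v * ev b v
  end.

Fixpoint psubst (I J : Type) (s : I -> pexpr J) (e : pexpr I) : pexpr J :=
  match e with
  | PC c => PC c
  | PV i => s i
  | PA a b => PA (psubst s a) (psubst s b)
  | PM a b => PM (psubst s a) (psubst s b)
  end.

Lemma ev_psubst (I J : Type) (s : I -> pexpr J) (e : pexpr I) (v : J -> R) :
  ev (psubst s e) v = ev e (fun i => ev (s i) v).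
Proof. by elim: e => //= a -> b ->. Qed.

Lemma ev_ext (I : Type) (e : pexpr I) (v w : I -> R) :
  v =1 w -> ev e v = ev e w.
Proof. by move=> vw; elim: e => //= a -> b ->. Qed.

(* Hadamard's divided differences: hd e v w i is a polynomial in (v, w) that
   restricts to the i-th partial derivative of e on the diagonal. *)
Fixpoint hd (I : eqType) (e : pexpr I) (v w : I -> R) (i : I) : R :=
  match e with
  | PC _ => 0
  | PV j => (j == i)%:R
  | PA a b => hd a v w i + hd b v w i
  | PM a b => hd a v w i * ev b v + ev a w * hd b v w i
  end.

(** An exact identity in place of the mean value theorem: since [hd] is continuous in both
    arguments, contraction estimates and limits of difference quotients come from it. *)
Lemma ev_hd (I : finType) (e : pexpr I) (v w : I -> R) :
  ev e v - ev e w = \sum_i hd e v w i * (v i - w i).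
Proof.
elim: e => [c|j|a IHa b IHb|a IHa b IHb] /=.
- by rewrite subrr big1// => i _; rewrite mul0r.
- rewrite (bigD1 j)//= eqxx mul1r big1 ?addr0// => i /negPf.
  by rewrite eq_sym => ->; rewrite mul0r.
- rewrite opprD addrACA IHa IHb -big_split/=.
  by apply: eq_bigr => i _; rewrite mulrDl.
- have -> : ev a v * ev b v - ev a w * ev b w =
    (ev a v - ev a w) * ev b v + ev a w * (ev b v - ev b w) by ring.
  rewrite IHa IHb mulr_suml mulr_sumr -big_split/=.
  by apply: eq_bigr => i _; ring.
Qed.

Lemma ev_cvg (I T : Type) (F : set_system T) {FF : Filter F} (e : pexpr I)
    (v : I -> T -> R) (l : I -> R) :
  (forall i, v i @ F --> l i) -> (fun t => ev e (v ^~ t)) @ F --> ev e l.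
Proof.
move=> vl; elim: e => [c|j|a IHa b IHb|a IHa b IHb] /=.
- exact: cvg_cst.
- exact: vl.
- exact: cvgD.
- exact: cvgM.
Qed.

Lemma hd_cvg (I : eqType) (T : Type) (F : set_system T) {FF : Filter F}
    (e : pexpr I) (v w : I -> T -> R) (l m : I -> R) i :
  (forall i, v i @ F --> l i) -> (forall i, w i @ F --> m i) ->
  (fun t => hd e (v ^~ t) (w ^~ t) i) @ F --> hd e l m i.
Proof.
move=> vl wm; elim: e => [c|j|a IHa b IHb|a IHa b IHb] /=.
- exact: cvg_cst.
- exact: cvg_cst.
- exact: cvgD.
- by apply: cvgD; apply: cvgM => //; apply: ev_cvg.
Qed.

Lemma is_derive_ev (I : finType) (E : normedModType R) (e : pexpr I)
    (v : I -> E -> R) (dv : I -> R) (x u : E) :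
  (forall i, is_derive x u (v i) (dv i)) ->
  is_derive x u (fun t => ev e (v ^~ t))
    (\sum_i hd e (v ^~ x) (v ^~ x) i * dv i).
Proof.
move=> vd; elim: e => [c|j|a IHa b IHb|a IHa b IHb] /=.
- rewrite big1 => [|i _]; last by rewrite mul0r.
  exact: is_derive_cst.
- rewrite (bigD1 j)//= eqxx mul1r big1 ?addr0// => i /negPf.
  by rewrite eq_sym => ->; rewrite mul0r.
- have := is_deriveD IHa IHb; rewrite -big_split/=.
  by under eq_bigr do rewrite -mulrDl.
- apply: is_derive_eq; rewrite /= /GRing.scale/= !mulr_sumr -big_split/=.
  by apply: eq_bigr => i _; ring.
Qed.

Lemma differentiable_ev (I : Type) (E : normedModType R) (e : pexpr I)
    (v : I -> E -> R) (x : E) :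
  (forall i, differentiable (v i) x) ->
  differentiable (fun t => ev e (v ^~ t)) x.
Proof.
move=> vd; elim: e => [c|j|a IHa b IHb|a IHa b IHb] /=.
- exact: differentiable_cst.
- exact: vd.
- exact: differentiableD.
- exact: differentiableM.
Qed.

Definition pzero (I : eqType) (i0 : I) (e : pexpr I) : pexpr I :=
  psubst (fun i => if i == i0 then PC 0 else PV i) e.

(** For a product, ab - a_0 b_0 = (a - a_0) b + a_0 (b - b_0). Repeated division exposes the power
    of a variable that can be factored out. *)
Lemma pexpr_div (I : eqType) (i0 : I) (e : pexpr I) :
  {q : pexpr I | forall v, ev e v = ev (pzero i0 e) v + v i0 * ev q v}.
Proof.
elim: e => [c|j|a [qa IHa] b [qb IHb]|a [qa IHa] b [qb IHb]] /=.
- by exists (PC 0) => v /=; rewrite mulr0 addr0.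
- rewrite /pzero /=; case: eqVneq => [->|_].
  + by exists (PC 1) => v /=; rewrite mulr1 add0r.
  + by exists (PC 0) => v /=; rewrite mulr0 addr0.
- by exists (PA qa qb) => v /=; rewrite IHa IHb /pzero /=; ring.
- exists (PA (PM qa b) (PM (pzero i0 a) qb)) => v /=.
  by rewrite IHa IHb /pzero /=; ring.
Qed.

Fixpoint psum (I : Type) (s : seq (pexpr I)) : pexpr I :=
  if s is e :: s' then PA e (psum s') else PC 0.

Lemma ev_psum (I : Type) (s : seq (pexpr I)) v :
  ev (psum s) v = \sum_(e <- s) ev e v.
Proof. by elim: s => [|e s IHs] /=; rewrite ?big_nil// big_cons IHs. Qed.

Fixpoint ppow (I : Type) (e : pexpr I) (k : nat) : pexpr I :=
  if k is k'.+1 then PM e (ppow e k') else PC 1.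

Lemma ev_ppow (I : Type) (e : pexpr I) k v : ev (ppow e k) v = ev e v ^+ k.
Proof. by elim: k => [|k IHk] /=; rewrite ?expr0// exprS IHk. Qed.

End PolynomialExpressions.
Arguments PC {R I}.
Arguments pexpr R I : clear implicits.

(** * Smooth functions of one real variable *)

Section SmoothCurves.
Context {R : realType}.
Implicit Types (U : set R) (f g : R -> R).

Lemma open_near (T : topologicalType) (A : set T) x :
  open A -> A x -> \forall y \near x, A y.
Proof. by move=> Ao Ax; apply: open_nbhs_nbhs; split. Qed.

Lemma open_near_eq (T : topologicalType) (Y : Type) (A : set T) (f g : T -> Y) x :
  open A -> A x -> (forall y, A y -> f y = g y) -> \forall y \near x, f y = g y.
Proof. by move=> Ao Ax fg; apply: filterS (open_near Ao Ax) => y /fg. Qed.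

Lemma continuous_open_eq (T Y : topologicalType) (A : set T) (f g : T -> Y) x :
  open A -> A x -> (forall y, A y -> f y = g y) ->
  {for x, continuous f} -> {for x, continuous g}.
Proof.
move=> Ao Ax fg fc; rewrite /prop_for /continuous_at -(fg _ Ax).
exact: cvg_trans (@near_eq_cvg _ _ (nbhs x) _ f g (open_near_eq Ao Ax fg)) fc.
Qed.

Lemma cvg_near_eq (T : Type) (Y : topologicalType) (F : set_system T)
    {FF : Filter F} (f g : T -> Y) (l : Y) :
  (\forall t \near F, f t = g t) -> g @ F --> l -> f @ F --> l.
Proof.
move=> fg; apply: cvg_trans; apply: near_eq_cvg.
by apply: filterS fg => t ->.
Qed.

Lemma cvg_inv (T : Type) (F : set_system T) {FF : Filter F} (f : T -> R) (a : R) :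
  a != 0 -> f @ F --> a -> (fun t => (f t)^-1) @ F --> a^-1.
Proof. by move=> a0 fa; exact: cvgV. Qed.

(** A one-dimensional form of [Ck_on] in which the derivative is a witness, so that products,
    inverses, square roots and compositions go by induction on k; [C1k_Ck_on] leads back. *)
Fixpoint C1k U (k : nat) f : Prop :=
  if k is k'.+1 then
    exists f', (forall x, U x -> is_derive x (1 : R) f (f' x)) /\ C1k U k' f'
  else forall x, U x -> {for x, continuous f}.

Definition smooth1 U f := forall k, C1k U k f.

Lemma is_derive1_continuous f x df :
  is_derive x (1 : R) f df -> {for x, continuous f}.
Proof. by case=> /derivable1_diffP /differentiable_continuous. Qed.

Lemma C1k_lower U k f : C1k U k.+1 f -> C1k U k f.
Proof.
elim: k f => [|k IHk] f [f' [ff' f'k]].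
  by move=> x /ff' /is_derive1_continuous.
by exists f'; split => //; exact: IHk.
Qed.

Lemma C1k_continuous U k f : C1k U k f -> forall x, U x -> {for x, continuous f}.
Proof. by elim: k f => // k IHk f /C1k_lower; exact: IHk. Qed.

Lemma C1k_subset U V k f : V `<=` U -> C1k U k f -> C1k V k f.
Proof.
move=> VU; elim: k f => [|k IHk] f /=.
  by move=> fc x /VU; exact: fc.
by move=> [f' [ff' f'k]]; exists f'; split; [move=> x /VU /ff'|exact: IHk].
Qed.

Lemma C1k_eq U k f g : open U -> (forall x, U x -> f x = g x) ->
  C1k U k f -> C1k U k g.
Proof.
move=> Uo fg; case: k => [|k] /=.
  by move=> fc x Ux; exact: (continuous_open_eq Uo Ux fg (fc x Ux)).
move=> [f' [ff' f'k]]; exists f'; split => // x Ux.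
exact: near_eq_is_derive (open_near_eq Uo Ux fg) (ff' x Ux).
Qed.

Lemma C1k_cst U k (c : R) : C1k U k (fun=> c).
Proof.
elim: k c => [|k IHk] c /=; first by move=> x _; exact: cst_continuous.
by exists (fun=> 0); split => // x _; exact: is_derive_cst.
Qed.

Lemma C1k_id U k : C1k U k id.
Proof.
case: k => [|k] /=; first by move=> x _.
by exists (fun=> 1); split; [move=> x _; exact: is_derive_id|exact: C1k_cst].
Qed.

Lemma C1kD U k f g : C1k U k f -> C1k U k g -> C1k U k (fun x => f x + g x).
Proof.
elim: k f g => [|k IHk] f g /=.
  by move=> fc gc x Ux; apply: continuousD; [exact: fc|exact: gc].
move=> [f' [ff' f'k]] [g' [gg' g'k]].
exists (fun x => f' x + g' x); split; last exact: IHk.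
by move=> x Ux; apply: is_deriveD; [exact: ff'|exact: gg'].
Qed.

Lemma C1kM U k f g : C1k U k f -> C1k U k g -> C1k U k (fun x => f x * g x).
Proof.
elim: k f g => [|k IHk] f g /=.
  by move=> fc gc x Ux; apply: continuousM; [exact: fc|exact: gc].
move=> fk gk; have := C1k_lower fk; have := C1k_lower gk.
move: fk gk => [f' [ff' f'k]] [g' [gg' g'k]] gk fk.
exists (fun x => f x * g' x + g x * f' x); split.
  by move=> x Ux; have := ff' x Ux; have := gg' x Ux => ? ?; apply: is_deriveM.
by apply: C1kD; apply: IHk.
Qed.

Lemma C1kN U k f : C1k U k f -> C1k U k (fun x => - f x).
Proof.
move=> fk; have := C1kM (C1k_cst U k (-1)) fk.
by congr C1k; apply/funext => x; rewrite mulN1r.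
Qed.

Lemma C1kB U k f g : C1k U k f -> C1k U k g -> C1k U k (fun x => f x - g x).
Proof. by move=> fk gk; apply: C1kD => //; exact: C1kN. Qed.

Lemma C1kX U k f m : C1k U k f -> C1k U k (fun x => f x ^+ m).
Proof.
move=> fk; elim: m => [|m IHm].
  by under eq_fun do rewrite expr0; exact: C1k_cst.
by under eq_fun do rewrite exprS; exact: C1kM.
Qed.

Lemma C1kV U k f : (forall x, U x -> f x != 0) ->
  C1k U k f -> C1k U k (fun x => (f x)^-1).
Proof.
move=> f0; elim: k => [|k IHk] /=.
  by move=> fc x Ux; apply: continuousV; [exact: f0|exact: fc].
move=> fk; have fk' := IHk (C1k_lower fk); move: fk => [f' [ff' f'k]].
exists (fun x => - ((f x)^-1 * (f x)^-1 * f' x)); split.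
  move=> x Ux; have := ff' x Ux => ?.
  apply: (is_derive_eq (is_deriveV (f0 x Ux) (ff' x Ux))).
  by rewrite /GRing.scale/= mulNr -exprVn expr2.
by apply: C1kN; apply: C1kM => //; apply: C1kM.
Qed.

Lemma C1k_sqrt U k f : (forall x, U x -> 0 < f x) ->
  C1k U k f -> C1k U k (fun x => Num.sqrt (f x)).
Proof.
move=> f0; elim: k => [|k IHk] /=.
  move=> fc x Ux; apply: (@continuous_comp _ _ _ f Num.sqrt); first exact: fc.
  exact: sqrt_continuous.
move=> fk; have fk' := IHk (C1k_lower fk); move: fk => [f' [ff' f'k]].
exists (fun x => (2 * Num.sqrt (f x))^-1 * f' x); split.
  move=> x Ux.
  have H1 := is_derive1_sqrt (f0 x Ux).
  have := @is_derive1_comp _ Num.sqrt f x _ _ H1 (ff' x Ux).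
  by rewrite mulrC.
apply: C1kM => //; apply: C1kV.
  by move=> x Ux; rewrite mulf_neq0// gt_eqF// sqrtr_gt0 f0.
by apply: C1kM => //; exact: C1k_cst.
Qed.

Lemma C1k_comp U V k f g : (forall x, V x -> U (g x)) ->
  C1k U k f -> C1k V k g -> C1k V k (fun x => f (g x)).
Proof.
move=> VU; elim: k f => [|k IHk] f /=.
  move=> fc gc x Vx; apply: (@continuous_comp _ _ _ g f); first exact: gc.
  by apply: fc; exact: VU.
move=> [f' [ff' f'k]] gk; have gk' := C1k_lower gk; move: gk => [g' [gg' g'k]].
exists (fun x => f' (g x) * g' x); split.
  move=> x Vx.
  exact: (@is_derive1_comp _ f g x _ _ (ff' _ (VU _ Vx)) (gg' x Vx)).
by apply: C1kM => //; exact: IHk.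
Qed.

(** [smooth1] provides a possibly different witness for every order; [derive1 f] serves all orders
    at once. *)
Lemma smooth1_derive U f : open U -> smooth1 U f ->
  exists f', (forall x, U x -> is_derive x (1 : R) f (f' x)) /\ smooth1 U f'.
Proof.
move=> Uo fs; exists (derive1 f); split.
  move=> x Ux; have [f' [/(_ _ Ux) [fd _] _]] := fs 1%N.
  by rewrite derive1E; apply: derivableP.
move=> k; have [f' [ff' f'k]] := fs k.+1.
apply: C1k_eq f'k => // x Ux; rewrite derive1E.
by have [_ ->] := ff' x Ux.
Qed.

Lemma Ck_on_eq U k f g : open U -> (forall x, U x -> f x = g x) ->
  Ck_on U k f -> Ck_on U k g.
Proof.
move=> Uo; elim: k f g => [|k IHk] f g fg /=.
  by move=> fc x Ux; exact: (continuous_open_eq Uo Ux fg (fc x Ux)).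
have D v x : U x -> 'D_v f x = 'D_v g x.
  by move=> Ux; apply: near_eq_derive; exact: open_near_eq fg.
move=> [fd fk]; split; last first.
  by move=> v; apply: IHk (fk v) => x /D.
move=> x Ux; apply/derivable1_diffP.
by apply: near_eq_derivable (open_near_eq Uo Ux fg) _; exact/derivable1_diffP/fd.
Qed.

(** On the line the derivative in direction v is v times f', so the single witness gives all
    directional derivatives. *)
Lemma C1k_Ck_on U k f : open U -> C1k U k f -> Ck_on U k f.
Proof.
move=> Uo; elim: k f => //= k IHk f [f' [ff' f'k]]; split.
  by move=> x /ff' [/derivable1_diffP].
move=> v; apply: (@Ck_on_eq U k (fun x => v * f' x)) => //.
  move=> x Ux; have [fd <-] := ff' x Ux.
  rewrite deriveE; last exact/derivable1_diffP.
  rewrite deriveE; last exact/derivable1_diffP.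
  by rewrite -{2}[v]mulr1 -/(v *: (1 : R)) linearZ.
by apply: IHk; apply: C1kM => //; exact: C1k_cst.
Qed.

Lemma C1k_hd U k (I : eqType) (e : pexpr R I) (v w : I -> R -> R) i :
  (forall i, C1k U k (v i)) -> (forall i, C1k U k (w i)) ->
  C1k U k (fun t => hd e (v ^~ t) (w ^~ t) i).
Proof.
move=> vs ws.
have evk (u : I -> R -> R) e0 : (forall i, C1k U k (u i)) ->
    C1k U k (fun t => ev e0 (u ^~ t)).
  move=> us; elim: e0 => [c|j|a IHa b IHb|a IHa b IHb] /=.
  - exact: C1k_cst.
  - exact: us.
  - exact: C1kD.
  - exact: C1kM.
elim: e => [c|j|a IHa b IHb|a IHa b IHb] /=.
- exact: C1k_cst.
- exact: C1k_cst.
- exact: C1kD.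
- by apply: C1kD; apply: C1kM => //; exact: evk.
Qed.

End SmoothCurves.

(** * Regularity of a continuous solution of two polynomial equations *)

Section ImplicitFunction.
Context {R : realType}.

Lemma is_derive_cvg (E : normedModType R) (f : R -> E) (x : R) (l : E) :
  h^-1 *: (f (h + x) - f x) @[h --> (0 : R)^'] --> l ->
  is_derive x (1 : R) f l.
Proof.
move=> fl.
have fl' : h^-1 *: (f (h *: (1 : R) + x) - f x) @[h --> (0 : R)^'] --> l.
  by under eq_fun do rewrite [_ *: 1]mulr1.
apply: DeriveDef; first by apply/cvg_ex; exists l.
exact: cvg_lim fl'.
Qed.

Lemma is_derive_cvgP (E : normedModType R) (f : R -> E) (x : R) (l : E) :
  is_derive x (1 : R) f l ->
  h^-1 *: (f (h + x) - f x) @[h --> (0 : R)^'] --> l.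
Proof.
move=> [fd <-].
have : h^-1 *: (f (h *: (1 : R) + x) - f x) @[h --> (0 : R)^'] --> 'D_1 f x.
  exact: fd.
by under eq_fun do rewrite [_ *: 1]mulr1.
Qed.

Lemma cvg_shift0 (T : topologicalType) (f : R -> T) (x : R) :
  {for x, continuous f} -> f (h + x) @[h --> (0 : R)^'] --> f x.
Proof.
move=> fc.
have : h + x @[h --> (0 : R)^'] --> x.
  rewrite -[X in _ --> X]add0r; apply: cvgD; last exact: cvg_cst.
  exact: nbhs_dnbhs.
by move=> hx; apply: (cvg_comp _ _ hx fc).
Qed.

Lemma cvg_bigsum (I : Type) (T : Type) (F : set_system T) {FF : Filter F}
    (r : seq I) (f : I -> T -> R) (l : I -> R) :
  (forall i, f i @ F --> l i) ->
  (fun t => \sum_(i <- r) f i t) @ F --> \sum_(i <- r) l i.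
Proof.
by move=> fl; apply: cvg_big => //; exact: add_continuous.
Qed.

Variables (I : finType) (u1 u2 : I).
Hypothesis u12 : u1 != u2.

(** The Jacobian determinant in the two unknowns, formed with divided differences; for v = w it is
    the usual one. *)
Definition jac (G1 G2 : pexpr R I) (v w : I -> R) : R :=
  hd G1 v w u1 * hd G2 v w u2 - hd G1 v w u2 * hd G2 v w u1.

Lemma hd_split (G : pexpr R I) (v w d : I -> R) :
  \sum_i hd G v w i * d i = hd G v w u1 * d u1 + hd G v w u2 * d u2 +
    \sum_i hd G v w i * (if (i == u1) || (i == u2) then 0 else d i).
Proof.
rewrite (bigD1 u1)//= (bigD1 u2)//=; last by rewrite eq_sym.
rewrite -addrA; congr (_ + (_ + _)).
rewrite [RHS](bigD1 u1)//= [X in _ = _ + X](bigD1 u2)//=; last by rewrite eq_sym.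
rewrite !eqxx orbT orTb !mulr0 !add0r.
by apply: eq_bigr => i /andP[/negPf -> /negPf ->].
Qed.

Lemma cramer2 (a b c d x y s t : R) :
  a * d - b * c != 0 -> a * x + b * y + s = 0 -> c * x + d * y + t = 0 ->
  x = - (d * s - b * t) / (a * d - b * c) /\
  y = (c * s - a * t) / (a * d - b * c).
Proof.
move=> D0 e1 e2.
have s1 : s = - (a * x + b * y) by lra.
have t1 : t = - (c * x + d * y) by lra.
rewrite s1 t1; split.
  by apply/(mulIf D0); rewrite mulfVK//; ring.
by apply/(mulIf D0); rewrite mulfVK//; ring.
Qed.

Section Regularity.
Variables (G1 G2 : pexpr R I) (U : set R) (w : I -> R -> R).
Hypothesis Uo : open U.
Hypothesis wc : forall i x, U x -> {for x, continuous (w i)}.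
Hypothesis G10 : forall x, U x -> ev G1 (w ^~ x) = 0.
Hypothesis G20 : forall x, U x -> ev G2 (w ^~ x) = 0.
Hypothesis J0 : forall x, U x -> jac G1 G2 (w ^~ x) (w ^~ x) != 0.

Let S (dw : I -> R) (G : pexpr R I) (v w' : I -> R) :=
  \sum_i hd G v w' i * (if (i == u1) || (i == u2) then 0 else dw i).

(** Cramer's solution of the differentiated equations, where [S] is the contribution of the known
    coordinates. *)
Let DX (dw : I -> R) (v : I -> R) :=
  - (hd G2 v v u2 * S dw G1 v v - hd G1 v v u2 * S dw G2 v v) / jac G1 G2 v v.
Let DY (dw : I -> R) (v : I -> R) :=
  (hd G2 v v u1 * S dw G1 v v - hd G1 v v u1 * S dw G2 v v) / jac G1 G2 v v.

(** Subtracting the equations at x + h and at x and dividing by h gives a linear system for the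
    difference quotients of the unknowns, with divided differences as coefficients. Continuity of
    the unknowns is enough to pass to the limit in Cramer's rule. *)
Lemma implicit_derive (x : R) (dw : I -> R) : U x ->
  (forall i, i != u1 -> i != u2 -> is_derive x (1 : R) (w i) (dw i)) ->
  is_derive x (1 : R) (w u1) (DX dw (w ^~ x)) /\
  is_derive x (1 : R) (w u2) (DY dw (w ^~ x)).
Proof.
move=> Ux wd.
pose D i (h : R) := h^-1 * (w i (h + x) - w i x).
have wh i : w i (h + x) @[h --> (0 : R)^'] --> w i x by apply: cvg_shift0; exact: wc.
have wx i : (fun=> w i x) @ (0 : R)^' --> w i x by exact: cvg_cst.
have Hh (G : pexpr R I) i : hd G (w ^~ (h + x)) (w ^~ x) i @[h --> (0 : R)^']
    --> hd G (w ^~ x) (w ^~ x) i.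
  exact: (hd_cvg (e := G) (i := i) wh wx).
have Sh (G : pexpr R I) : S (D ^~ h) G (w ^~ (h + x)) (w ^~ x) @[h --> (0 : R)^']
    --> S dw G (w ^~ x) (w ^~ x).
  apply: cvg_bigsum => i; apply: cvgM; first exact: Hh.
  case: ifPn => [_|]; first exact: cvg_cst.
  by rewrite negb_or => /andP[i1 i2]; exact: (is_derive_cvgP (wd i i1 i2)).
have Jh : jac G1 G2 (w ^~ (h + x)) (w ^~ x) @[h --> (0 : R)^']
    --> jac G1 G2 (w ^~ x) (w ^~ x).
  by apply: cvgB; apply: cvgM; exact: Hh.
have key : \forall h \near (0 : R)^',
    D u1 h = - (hd G2 (w ^~ (h + x)) (w ^~ x) u2 * S (D ^~ h) G1 (w ^~ (h + x)) (w ^~ x)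
      - hd G1 (w ^~ (h + x)) (w ^~ x) u2 * S (D ^~ h) G2 (w ^~ (h + x)) (w ^~ x))
      / jac G1 G2 (w ^~ (h + x)) (w ^~ x) /\
    D u2 h = (hd G2 (w ^~ (h + x)) (w ^~ x) u1 * S (D ^~ h) G1 (w ^~ (h + x)) (w ^~ x)
      - hd G1 (w ^~ (h + x)) (w ^~ x) u1 * S (D ^~ h) G2 (w ^~ (h + x)) (w ^~ x))
      / jac G1 G2 (w ^~ (h + x)) (w ^~ x).
  have Uh : \forall h \near (0 : R)^', U (h + x).
    have /(_ U) := @cvg_shift0 R id x (@cvg_id _ (nbhs x)).
    by apply; apply: open_nbhs_nbhs; split.
  have Jn : \forall h \near (0 : R)^', jac G1 G2 (w ^~ (h + x)) (w ^~ x) != 0.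
    exact: cvgr_neq0 Jh (J0 Ux).
  near=> h.
  have Uhx : U (h + x) by near: h.
  have eqG (G : pexpr R I) : ev G (w ^~ (h + x)) = 0 -> ev G (w ^~ x) = 0 ->
      hd G (w ^~ (h + x)) (w ^~ x) u1 * D u1 h +
      hd G (w ^~ (h + x)) (w ^~ x) u2 * D u2 h +
      S (D ^~ h) G (w ^~ (h + x)) (w ^~ x) = 0.
    move=> e1 e2; rewrite -(hd_split G _ _ (D ^~ h)).
    transitivity (h^-1 * (ev G (w ^~ (h + x)) - ev G (w ^~ x))).
      by rewrite ev_hd mulr_sumr; apply: eq_bigr => i _; rewrite /D; ring.
    by rewrite e1 e2 subrr mulr0.
  apply: cramer2.
  - by near: h.
  - by apply: eqG; [exact: G10|exact: G10].
  - by apply: eqG; [exact: G20|exact: G20].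
move/near_andP: key => [key1 key2]; split; apply: is_derive_cvg.
  apply: (cvg_near_eq key1); apply: cvgM; last by apply: cvg_inv; [exact: J0|exact: Jh].
  by apply: cvgN; apply: cvgB; apply: cvgM; [exact: Hh|exact: Sh|exact: Hh|exact: Sh].
apply: (cvg_near_eq key2); apply: cvgM; last by apply: cvg_inv; [exact: J0|exact: Jh].
by apply: cvgB; apply: cvgM; [exact: Hh|exact: Sh|exact: Hh|exact: Sh].
Unshelve. all: by end_near. Qed.

Lemma C1k_sum V k (r : seq I) (f : I -> R -> R) :
  (forall i, C1k V k (f i)) -> C1k V k (fun x => \sum_(i <- r) f i x).
Proof.
move=> fk; elim: r => [|i r IHr].
  by under eq_fun do rewrite big_nil; exact: C1k_cst.
by under eq_fun do rewrite big_cons; exact: C1kD.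
Qed.

Hypothesis ws : forall i, i != u1 -> i != u2 -> smooth1 U (w i).

(** Bootstrap: the formulas for the derivatives are of class C^k when the unknowns are, so the
    unknowns are of class C^(k+1). *)
Lemma implicit_smooth : smooth1 U (w u1) /\ smooth1 U (w u2).
Proof.
have /choice[dw dwP] : forall i, exists f', i != u1 -> i != u2 ->
    (forall x, U x -> is_derive x (1 : R) (w i) (f' x)) /\ smooth1 U f'.
  move=> i; have [iu|] := boolP ((i != u1) && (i != u2)).
    move/andP: (iu) => [i1 i2].
    by have [f' f'P] := smooth1_derive Uo (ws i1 i2); exists f'.
  by rewrite negb_and => /orP iu; exists id => i1 i2; move: iu; rewrite i1 i2 => -[].
have step k : C1k U k (w u1) /\ C1k U k (w u2).
  elim: k => [|k [k1 k2]].
    by split => x Ux; exact: wc.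
  have wk i : C1k U k (w i).
    have [->//|i1] := eqVneq i u1; have [->//|i2] := eqVneq i u2.
    exact: ws.
  have Sk G : C1k U k (fun x => S (dw ^~ x) G (w ^~ x) (w ^~ x)).
    apply: C1k_sum => i; apply: C1kM; first exact: C1k_hd.
    have [_|] := boolP ((i == u1) || (i == u2)); first exact: C1k_cst.
    by rewrite negb_or => /andP[i1 i2]; have [_] := dwP i i1 i2; apply.
  have Jk : C1k U k (fun x => (jac G1 G2 (w ^~ x) (w ^~ x))^-1).
    by apply: C1kV => //; apply: C1kB; apply: C1kM; exact: C1k_hd.
  split.
    exists (fun x => DX (dw ^~ x) (w ^~ x)); split.
      move=> x Ux; apply: (implicit_derive Ux _).1 => i i1 i2.
      by have [+ _] := dwP i i1 i2; apply.
    by apply: C1kM => //; apply: C1kN; apply: C1kB; apply: C1kM => //; exact: C1k_hd.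
  exists (fun x => DY (dw ^~ x) (w ^~ x)); split.
    move=> x Ux; apply: (implicit_derive Ux _).2 => i i1 i2.
    by have [+ _] := dwP i i1 i2; apply.
  by apply: C1kM => //; apply: C1kB; apply: C1kM => //; exact: C1k_hd.
by split => k; have [] := step k.
Qed.

End Regularity.

End ImplicitFunction.

(** * The matrix norm as a maximum of entries *)

Section MatrixNorm.
Context {R : realType}.

Lemma mx_norm_leP (m n : nat) (x : 'M[R]_(m, n)) (e : R) :
  0 <= e -> (forall i j, `|x i j| <= e) <-> `|x| <= e.
Proof.
move=> e0; rewrite -[`|x|]/(mx_norm x) mx_normrE; split.
  by move=> xe; apply/bigmax_leP; split => // -[i j] _; exact: xe.
by move=> /bigmax_leP[_ xe] i j; exact: (xe (i, j)).
Qed.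

Lemma mx_entry_le (m n : nat) (x : 'M[R]_(m, n)) i j : `|x i j| <= `|x|.
Proof. by have /(_ (lexx _)) := (mx_norm_leP x (normr_ge0 x)).2; apply. Qed.

End MatrixNorm.

(** * Banach's fixed point theorem in a box of the plane *)

Section FixedPoint.
Context {R : realType}.

Lemma contraction_box (b1 b2 r : R) (N1 N2 : R -> R -> R) : 0 < r ->
  (forall x y, `|x - b1| <= r -> `|y - b2| <= r ->
     `|N1 x y - b1| <= r /\ `|N2 x y - b2| <= r) ->
  (forall x y x' y', `|x - b1| <= r -> `|y - b2| <= r ->
     `|x' - b1| <= r -> `|y' - b2| <= r ->
     `|N1 x y - N1 x' y'| <= 2^-1 * Num.max `|x - x'| `|y - y'| /\
     `|N2 x y - N2 x' y'| <= 2^-1 * Num.max `|x - x'| `|y - y'|) ->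
  exists x y, [/\ `|x - b1| <= r, `|y - b2| <= r, N1 x y = x & N2 x y = y].
Proof.
move=> r0 Nr Nc.
(* Row vectors carry the maximum norm, so the box of the statement is a closed ball. *)
pose X : completeNormedModType R := HB.pack 'rV[R]_2.
pose row2 (x y : R) : 'rV[R]_2 := \row_(k < 2) (if k == ord0 then x else y).
have row2_0 x y : row2 x y ord0 ord0 = x by rewrite mxE.
have row2_1 x y : row2 x y ord0 ord_max = y by rewrite mxE.
have I2 (P : 'I_2 -> Prop) : P ord0 -> P ord_max -> forall k, P k.
  move=> P0 P1 k; have [->//|k0] := eqVneq k ord0.
  suff -> : k = ord_max by [].
  by apply/val_inj; case: k k0 => [[|[|k]] kk].
have row2_eta (z : 'rV[R]_2) : z = row2 (z ord0 ord0) (z ord0 ord_max).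
  by apply/rowP; apply: I2; rewrite mxE.
pose b := row2 b1 b2.
pose U : set X := [set z : 'rV[R]_2 | `|b - z| <= r].
have UP (z : 'rV[R]_2) : U z <->
    `|z ord0 ord0 - b1| <= r /\ `|z ord0 ord_max - b2| <= r.
  rewrite /U /=; split.
    move=> zr; split; rewrite distrC.
      by have := mx_entry_le (b - z) ord0 ord0; rewrite !mxE => /le_trans; apply.
    by have := mx_entry_le (b - z) ord0 ord_max; rewrite !mxE => /le_trans; apply.
  move=> [z1 z2]; apply/mx_norm_leP; first exact: ltW.
  by move=> i; rewrite (ord1 i); apply: I2; rewrite !mxE/= distrC.
pose N (z : X) : X := row2 (N1 ((z : 'rV[R]_2) ord0 ord0) ((z : 'rV[R]_2) ord0 ord_max))
  (N2 ((z : 'rV[R]_2) ord0 ord0) ((z : 'rV[R]_2) ord0 ord_max)).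
have NU : {homo N : z / U z >-> U z}.
  move=> z /UP[z1 z2]; apply/UP; rewrite row2_0 row2_1; exact: Nr.
pose g : {fun U >-> U} := mkfun NU.
have gc : is_contraction g.
  have h0 : (0 : R) <= 2^-1 by rewrite invr_ge0.
  exists (NngNum h0); split; first by rewrite /= invf_lt1 ?ltr1n.
  move=> [z z'] /= [/UP[z1 z2] /UP[z'1 z'2]] /=.
  rewrite -[leLHS]/(`|(N z : 'rV[R]_2) - N z'|).
  have D0 := mx_entry_le ((z : 'rV[R]_2) - z') ord0 ord0.
  have D1 := mx_entry_le ((z : 'rV[R]_2) - z') ord0 ord_max.
  rewrite !mxE in D0 D1.
  have [c1 c2] := Nc _ _ _ _ z1 z2 z'1 z'2.
  have mle : 2^-1 * Num.max `|(z : 'rV[R]_2) ord0 ord0 - (z' : 'rV[R]_2) ord0 ord0|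
      `|(z : 'rV[R]_2) ord0 ord_max - (z' : 'rV[R]_2) ord0 ord_max|
      <= 2^-1 * `|(z : 'rV[R]_2) - z'|.
    by apply: ler_wpM2l => //; rewrite ge_max D0 D1.
  apply/mx_norm_leP; first by rewrite mulr_ge0.
  move=> i; rewrite (ord1 i); apply: I2; rewrite !mxE/=.
    exact: le_trans c1 mle.
  exact: le_trans c2 mle.
have Uc : closed U.
  have -> : U = closed_ball (b : X) r by rewrite closed_ballE.
  exact: closed_ball_closed.
have Un : U !=set0 by exists b; rewrite /U/= subrr normr0 ltW.
have [z /UP[z1 z2] zN] := banach_fixed_point gc Uc Un.
have zN' : (z : 'rV[R]_2) = N z by [].
exists ((z : 'rV[R]_2) ord0 ord0), ((z : 'rV[R]_2) ord0 ord_max); split => //.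
  by rewrite [in RHS]zN' row2_0.
by rewrite [in RHS]zN' row2_1.
Qed.

End FixedPoint.

(** * Existence of an implicit curve *)

Section ImplicitCurve.
Context {R : realType}.
Variables (I : finType) (u1 u2 : I).
Hypothesis u12 : u1 != u2.
Variables (G1 G2 : pexpr R I) (v : I -> R -> R) (d0 : R).
Hypothesis d0_gt0 : 0 < d0.
Hypothesis vs : forall i, i != u1 -> i != u2 -> smooth1 [set x | `|x| < d0] (v i).
Hypothesis G10 : ev G1 (v ^~ 0) = 0.
Hypothesis G20 : ev G2 (v ^~ 0) = 0.
Hypothesis J0 : jac u1 u2 G1 G2 (v ^~ 0) (v ^~ 0) != 0.

(** A point p carries candidate values of the two unknowns and the curve parameter; the other
    coordinates follow the given curves [v]. *)
Let inst (p : R * R * R) (i : I) : R :=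
  if i == u1 then p.1.1 else if i == u2 then p.1.2 else v i p.2.
Let b : R * R * R := (v u1 0, v u2 0, 0).

Let instb : inst b =1 v ^~ 0.
Proof.
move=> i; rewrite /inst /b /=.
by case: eqVneq => [->|_] //; case: eqVneq => [->|_].
Qed.

Let u21 : u2 == u1 = false. Proof. by rewrite eq_sym; exact/negbTE. Qed.

Let inst1 p : inst p u1 = p.1.1. Proof. by rewrite /inst eqxx. Qed.
Let inst2 p : inst p u2 = p.1.2. Proof. by rewrite /inst u21 eqxx. Qed.

Let ball0_open (d : R) : open [set x : R | `|x| < d].
Proof.
have [d_gt0|d_le0] := ltP 0 d.
  have -> : [set x : R | `|x| < d] = ball (0 : R) d.
    by apply/seteqP; split=> x; rewrite /ball/= sub0r normrN.
  exact: ball_open.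
have -> : [set x : R | `|x| < d] = set0; last exact: open0.
apply/seteqP; split=> x //= xd; have := lt_le_trans xd d_le0.
by rewrite normr_lt0.
Qed.

Let inst_cvg i : inst p i @[p --> b] --> v i 0.
Proof.
have p1 : p.1 @[p --> b] --> b.1 by exact: cvg_fst.
have p2 : p.2 @[p --> b] --> b.2 by exact: cvg_snd.
rewrite /inst; case: eqVneq => [->|i1]; first by apply: cvg_comp p1 _; exact: cvg_fst.
case: eqVneq => [->|i2]; first by apply: cvg_comp p1 _; exact: cvg_snd.
apply: (cvg_comp _ _ p2); apply: (C1k_continuous (vs i1 i2 0)).
by rewrite /= normr0.
Qed.

Let a0 := hd G1 (v ^~ 0) (v ^~ 0) u1.
Let b0 := hd G1 (v ^~ 0) (v ^~ 0) u2.
Let c0 := hd G2 (v ^~ 0) (v ^~ 0) u1.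
Let e0 := hd G2 (v ^~ 0) (v ^~ 0) u2.
Let D := a0 * e0 - b0 * c0.

Let D0 : D != 0. Proof. exact: J0. Qed.

(* The Jacobian matrix of the divided differences, multiplied on the left by
   the inverse of the Jacobian matrix at the base point. *)
Let c11 (p q : R * R * R) :=
  (e0 * hd G1 (inst p) (inst q) u1 - b0 * hd G2 (inst p) (inst q) u1) / D.
Let c12 (p q : R * R * R) :=
  (e0 * hd G1 (inst p) (inst q) u2 - b0 * hd G2 (inst p) (inst q) u2) / D.
Let c21 (p q : R * R * R) :=
  (a0 * hd G2 (inst p) (inst q) u1 - c0 * hd G1 (inst p) (inst q) u1) / D.
Let c22 (p q : R * R * R) :=
  (a0 * hd G2 (inst p) (inst q) u2 - c0 * hd G1 (inst p) (inst q) u2) / D.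

Let S G (p q : R * R * R) := \sum_i hd G (inst p) (inst q) i *
   (if (i == u1) || (i == u2) then 0 else v i p.2 - v i q.2).

(** [L1] and [L2] are the two equations multiplied by the inverse Jacobian matrix at the base point;
    (x - [L1], y - [L2]) is the simplified Newton map. *)
Let L1 p := (e0 * ev G1 (inst p) - b0 * ev G2 (inst p)) / D.
Let L2 p := (a0 * ev G2 (inst p) - c0 * ev G1 (inst p)) / D.

Let evB G p q : ev G (inst p) - ev G (inst q) =
  hd G (inst p) (inst q) u1 * (p.1.1 - q.1.1) +
  hd G (inst p) (inst q) u2 * (p.1.2 - q.1.2) + S G p q.
Proof.
rewrite ev_hd (hd_split u12) !inst1 !inst2; congr (_ + _).
apply: eq_bigr => i _; congr (_ * _).
case: ifPn => //; rewrite negb_or /inst => /andP[/negPf -> /negPf ->] //.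
Qed.

Let L1B p q : L1 p - L1 q = c11 p q * (p.1.1 - q.1.1) + c12 p q * (p.1.2 - q.1.2)
  + (e0 * S G1 p q - b0 * S G2 p q) / D.
Proof.
transitivity ((e0 * (ev G1 (inst p) - ev G1 (inst q)) -
  b0 * (ev G2 (inst p) - ev G2 (inst q))) / D); first by rewrite /L1; ring.
by rewrite !evB /c11 /c12; ring.
Qed.

Let L2B p q : L2 p - L2 q = c21 p q * (p.1.1 - q.1.1) + c22 p q * (p.1.2 - q.1.2)
  + (a0 * S G2 p q - c0 * S G1 p q) / D.
Proof.
transitivity ((a0 * (ev G2 (inst p) - ev G2 (inst q)) -
  c0 * (ev G1 (inst p) - ev G1 (inst q))) / D); first by rewrite /L2; ring.
by rewrite !evB /c21 /c22; ring.
Qed.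

Let L0 p : L1 p = 0 -> L2 p = 0 -> ev G1 (inst p) = 0 /\ ev G2 (inst p) = 0.
Proof.
move=> l1 l2; split; apply/(mulfI D0); rewrite mulr0.
  transitivity (D * (a0 * L1 p + b0 * L2 p)); last by rewrite l1 l2; ring.
  by rewrite /L1 /L2 /D; field; exact: D0.
transitivity (D * (c0 * L1 p + e0 * L2 p)); last by rewrite l1 l2; ring.
by rewrite /L1 /L2 /D; field; exact: D0.
Qed.

(** The preconditioned divided differences form the identity matrix at the base point; an error of
    at most 1/4 per entry makes the Newton map a contraction with factor 1/4 + 1/4 = 1/2. *)
Let box : exists r K : R, [/\ 0 < r, 0 < K & forall p q, ball b r p -> ball b r q ->
  [/\ `|c11 p q - 1| <= 4^-1, `|c12 p q| <= 4^-1, `|c21 p q| <= 4^-1,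
      `|c22 p q - 1| <= 4^-1 & forall i, `|hd G1 (inst p) (inst q) i| <= K /\
      `|hd G2 (inst p) (inst q) i| <= K]].
Proof.
pose F := nbhs (b, b).
have f1 i : inst t.1 i @[t --> (b, b)] --> v i 0.
  have p1 : (t : (R * R * R) * (R * R * R)).1 @[t --> (b, b)] --> b by exact: cvg_fst.
  exact: (cvg_comp _ _ p1 (inst_cvg (i := i))).
have f2 i : inst t.2 i @[t --> (b, b)] --> v i 0.
  have p1 : (t : (R * R * R) * (R * R * R)).2 @[t --> (b, b)] --> b by exact: cvg_snd.
  exact: (cvg_comp _ _ p1 (inst_cvg (i := i))).
have H G i : hd G (inst t.1) (inst t.2) i @[t --> (b, b)] --> hd G (v ^~ 0) (v ^~ 0) i.
  exact: (hd_cvg (e := G) (i := i) f1 f2).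
have C1 : c11 t.1 t.2 @[t --> (b, b)] --> (e0 * a0 - b0 * c0) / D.
  by apply: cvgM; [apply: cvgB; apply: cvgM; (exact: H || exact: cvg_cst)|exact: cvg_cst].
have C2 : c12 t.1 t.2 @[t --> (b, b)] --> (e0 * b0 - b0 * e0) / D.
  by apply: cvgM; [apply: cvgB; apply: cvgM; (exact: H || exact: cvg_cst)|exact: cvg_cst].
have C3 : c21 t.1 t.2 @[t --> (b, b)] --> (a0 * c0 - c0 * a0) / D.
  by apply: cvgM; [apply: cvgB; apply: cvgM; (exact: H || exact: cvg_cst)|exact: cvg_cst].
have C4 : c22 t.1 t.2 @[t --> (b, b)] --> (a0 * e0 - c0 * b0) / D.
  by apply: cvgM; [apply: cvgB; apply: cvgM; (exact: H || exact: cvg_cst)|exact: cvg_cst].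
have E1 : (e0 * a0 - b0 * c0) / D = 1 by rewrite [e0 * a0]mulrC divff.
have E2 : (e0 * b0 - b0 * e0) / D = 0 by rewrite [e0 * b0]mulrC subrr mul0r.
have E3 : (a0 * c0 - c0 * a0) / D = 0 by rewrite [a0 * c0]mulrC subrr mul0r.
have E4 : (a0 * e0 - c0 * b0) / D = 1 by rewrite [c0 * b0]mulrC divff.
rewrite E1 in C1; rewrite E2 in C2; rewrite E3 in C3; rewrite E4 in C4.
(* One bound for all divided differences: the sum of their sizes at the base point, with a margin of
   1 for the neighborhood. *)
pose K := \sum_i (`|hd G1 (v ^~ 0) (v ^~ 0) i| + `|hd G2 (v ^~ 0) (v ^~ 0) i|) + 1.
have Ki i : `|hd G1 (v ^~ 0) (v ^~ 0) i| + 1 <= K /\ `|hd G2 (v ^~ 0) (v ^~ 0) i| + 1 <= K.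
  rewrite /K (bigD1 i)//=; set s := \sum_(j | _) _.
  have s0 : 0 <= s by apply: sumr_ge0 => j _; apply: addr_ge0.
  have := normr_ge0 (hd G1 (v ^~ 0) (v ^~ 0) i).
  have := normr_ge0 (hd G2 (v ^~ 0) (v ^~ 0) i).
  by split; lra.
have q0 : (0 : R) < 4^-1 by rewrite invr_gt0.
have near_le (f : (R * R * R) * (R * R * R) -> R) l e : 0 < e ->
    f t @[t --> (b, b)] --> l -> \forall t \near (b, b), `|f t - l| <= e.
  move=> egt0 /cvgrPdist_le /(_ e egt0); apply: filterS => t.
  by rewrite distrC.
have HK : \forall t \near (b, b), forall i,
    `|hd G1 (inst t.1) (inst t.2) i| <= K /\ `|hd G2 (inst t.1) (inst t.2) i| <= K.
  suff hi i : \forall t \near (b, b), `|hd G1 (inst t.1) (inst t.2) i| <= K /\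
      `|hd G2 (inst t.1) (inst t.2) i| <= K by exact: filter_forall hi.
  have [k1 k2] := Ki i.
  have := near_le _ _ _ ltr01 (H G1 i); apply: filterS2 (near_le _ _ _ ltr01 (H G2 i)).
  move=> t h2 h1; split.
    rewrite (le_trans _ k1)// -lerBlDl (le_trans _ h1)// .
    by rewrite lerB_dist.
  rewrite (le_trans _ k2)// -lerBlDl (le_trans _ h2)// .
  by rewrite lerB_dist.
have all : \forall t \near (b, b), [/\ `|c11 t.1 t.2 - 1| <= 4^-1,
    `|c12 t.1 t.2| <= 4^-1, `|c21 t.1 t.2| <= 4^-1,
      `|c22 t.1 t.2 - 1| <= 4^-1 & forall i, `|hd G1 (inst t.1) (inst t.2) i| <= K /\
      `|hd G2 (inst t.1) (inst t.2) i| <= K].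
  move: (near_le _ _ _ q0 C1) (near_le _ _ _ q0 C2) (near_le _ _ _ q0 C3)
    (near_le _ _ _ q0 C4) HK => h1 h2 h3 h4 h5.
  near=> t; split.
  - by near: t.
  - by rewrite -[c12 _ _]subr0; near: t.
  - by rewrite -[c21 _ _]subr0; near: t.
  - by near: t.
  - by near: t.
have [r /= r0 rP] := (nbhs_ballP _ _).1 all.
exists r, K; split => //.
  rewrite /K ltr_wpDl//; apply: sumr_ge0 => j _; exact: addr_ge0.
by move=> p q bp bq; apply: (rP (p, q)).
Unshelve. all: by end_near. Qed.

(** At the two unknowns [v] only supplies the base point. A fixed point of the Newton map is picked
    independently for each parameter; continuity follows from an estimate between any two solutions,
    and smoothness from [implicit_smooth]. *)
Lemma implicit_curve : exists (d : R) (w : I -> R -> R),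
  [/\ 0 < d <= d0, (forall i, i != u1 -> i != u2 -> w i = v i),
      (forall i, w i 0 = v i 0),
      (forall i, smooth1 [set x | `|x| < d] (w i)) &
      forall x, `|x| < d -> ev G1 (w ^~ x) = 0 /\ ev G2 (w ^~ x) = 0].
Proof.
have [r [K [r0 K0 rP]]] := box.
have ballb (x y m : R) : `|x - b.1.1| < r -> `|y - b.1.2| < r -> `|m| < r -> ball b r (x, y, m).
  move=> h1 h2 h3; split; last by rewrite /= /ball/= sub0r normrN.
  by split; rewrite /ball/= distrC.
have Sm G x y x' y' m : S G (x, y, m) (x', y', m) = 0.
  rewrite /S big1// => i _ /=; case: ifP => _; first by rewrite mulr0.
  by rewrite subrr mulr0.
pose r2 := r / 2.
have r20 : 0 < r2 by rewrite divr_gt0.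
have r2r : r2 < r by rewrite /r2; lra.
have L1b : L1 b = 0 by rewrite /L1 !(ev_ext _ instb) G10 G20; ring.
have L2b : L2 b = 0 by rewrite /L2 !(ev_ext _ instb) G10 G20; ring.
have Lc1 : L1 (b.1, m) @[m --> (0 : R)] --> 0.
  rewrite -[X in _ --> X]L1b.
  have bm : (b.1, m) @[m --> (0 : R)] --> b by exact: (cvg_pair (cvg_cst b.1) cvg_id).
  have iv i : inst (b.1, m) i @[m --> (0 : R)] --> inst b i.
    by rewrite instb; exact: (cvg_comp _ _ bm (inst_cvg (i := i))).
  apply: cvgM; last exact: cvg_cst.
  by apply: cvgB; apply: cvgM; (exact: cvg_cst || exact: (ev_cvg (e := G1) iv) ||
    exact: (ev_cvg (e := G2) iv)).
have Lc2 : L2 (b.1, m) @[m --> (0 : R)] --> 0.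
  rewrite -[X in _ --> X]L2b.
  have bm : (b.1, m) @[m --> (0 : R)] --> b by exact: (cvg_pair (cvg_cst b.1) cvg_id).
  have iv i : inst (b.1, m) i @[m --> (0 : R)] --> inst b i.
    by rewrite instb; exact: (cvg_comp _ _ bm (inst_cvg (i := i))).
  apply: cvgM; last exact: cvg_cst.
  by apply: cvgB; apply: cvgM; (exact: cvg_cst || exact: (ev_cvg (e := G1) iv) ||
    exact: (ev_cvg (e := G2) iv)).
have r40 : 0 < r2 / 2 by rewrite divr_gt0.
have small : \forall m \near (0 : R), `|L1 (b.1, m)| <= r2 / 2 /\ `|L2 (b.1, m)| <= r2 / 2.
  apply: filterS2 (cvgr0_norm_le _ Lc1 _ r40) (cvgr0_norm_le _ Lc2 _ r40) => m.
  by split.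
have [d1 /= d10 d1P] := (nbhs_ballP _ _).1 small.
pose d := Num.min (Num.min d0 d1) r2.
have d_gt0 : 0 < d by rewrite !lt_min d0_gt0 d10 r20.
have dP (m : R) : `|m| < d -> [/\ `|m| < d0, `|m| < d1 & `|m| < r2].
  by rewrite !lt_min => /andP[/andP[]].
(* Two solutions in the box, possibly at different parameters, are as close as the contributions of
   the known coordinates: the contraction absorbs the unknowns. *)
have two0 (p q : R * R * R) : ball b r p -> ball b r q -> ev G1 (inst p) = 0 -> ev G2 (inst p) = 0 ->
    ev G1 (inst q) = 0 -> ev G2 (inst q) = 0 ->
    `|p.1.1 - q.1.1| + `|p.1.2 - q.1.2| <=
    2 * (`|(e0 * S G1 p q - b0 * S G2 p q) / D| + `|(a0 * S G2 p q - c0 * S G1 p q) / D|).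
  move=> bp bq p1 p2 q1 q2; have [k1 k2 k3 k4 _] := rP _ _ bp bq.
  have := L1B p q; have := L2B p q.
  rewrite {1 2}/L1 {1 2}/L2 p1 p2 q1 q2 !mulr0 !subr0 mul0r subrr.
  set s1 := (e0 * _ - _) / D; set s2 := (a0 * _ - _) / D.
  set x := p.1.1 - _; set y := p.1.2 - _ => /esym z2 /esym z1.
  have x1 : x = (1 - c11 p q) * x - c12 p q * y - s1 by lra.
  have y1 : y = (1 - c22 p q) * y - c21 p q * x - s2 by lra.
  have bx : `|x| <= 4^-1 * `|x| + 4^-1 * `|y| + `|s1|.
    rewrite [X in `|X| <= _]x1; apply: (le_trans (ler_normB _ _)); rewrite lerD2r.
    apply: (le_trans (ler_normB _ _)); rewrite (normrM _ x) (normrM _ y).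
    by apply: lerD; apply: ler_pM => //; rewrite distrC.
  have by_ : `|y| <= 4^-1 * `|y| + 4^-1 * `|x| + `|s2|.
    rewrite [X in `|X| <= _]y1; apply: (le_trans (ler_normB _ _)); rewrite lerD2r.
    apply: (le_trans (ler_normB _ _)); rewrite (normrM _ x) (normrM _ y).
    by apply: lerD; apply: ler_pM => //; rewrite distrC.
  lra.
(* At m = 0 the base point is picked explicitly, so that the curve starts there without a uniqueness
   argument. *)
have ex (m : R) : exists p : R * R, (m = 0 -> p = b.1) /\ (`|m| < d -> [/\ `|p.1 - b.1.1| <= r2,
    `|p.2 - b.1.2| <= r2, ev G1 (inst (p, m)) = 0 & ev G2 (inst (p, m)) = 0]).
  have [->|m0] := eqVneq m 0.
    exists b.1; split => // _; rewrite !subrr !normr0 !(ev_ext _ instb); split => //.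
      exact: ltW.
    exact: ltW.
  have [md|] := boolP (`|m| < d); last by exists b.1; split => //; move: m0 => /eqP.
  have [md0 md1 mr2] := dP _ md.
  have [s1 s2] : `|L1 (b.1, m)| <= r2 / 2 /\ `|L2 (b.1, m)| <= r2 / 2.
    by apply: d1P; rewrite /ball/= sub0r normrN.
  have mr : `|m| < r := lt_trans mr2 r2r.
  pose N1 x y := x - L1 (x, y, m).
  pose N2 x y := y - L2 (x, y, m).
  have Nc x y x' y' : `|x - b.1.1| <= r2 -> `|y - b.1.2| <= r2 ->
     `|x' - b.1.1| <= r2 -> `|y' - b.1.2| <= r2 ->
     `|N1 x y - N1 x' y'| <= 2^-1 * Num.max `|x - x'| `|y - y'| /\
     `|N2 x y - N2 x' y'| <= 2^-1 * Num.max `|x - x'| `|y - y'|.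
    move=> hx hy hx' hy'.
    have bp : ball b r (x, y, m) by apply: ballb => //; apply: le_lt_trans r2r.
    have bq : ball b r (x', y', m) by apply: ballb => //; apply: le_lt_trans r2r.
    have [k1 k2 k3 k4 _] := rP _ _ bp bq.
    have := L1B (x, y, m) (x', y', m); have := L2B (x, y, m) (x', y', m).
    rewrite !Sm !mulr0 !subrr !mul0r !addr0 /= => l2 l1.
    have n1 : N1 x y - N1 x' y' = (1 - c11 (x, y, m) (x', y', m)) * (x - x')
        - c12 (x, y, m) (x', y', m) * (y - y').
      by rewrite /N1; move: l1; lra.
    have n2 : N2 x y - N2 x' y' = (1 - c22 (x, y, m) (x', y', m)) * (y - y')
        - c21 (x, y, m) (x', y', m) * (x - x').
      by rewrite /N2; move: l2; lra.
    have mx : `|x - x'| <= Num.max `|x - x'| `|y - y'| by rewrite le_max lexx.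
    have my : `|y - y'| <= Num.max `|x - x'| `|y - y'| by rewrite le_max lexx orbT.
    have B (c c' z z' M : R) : `|c - 1| <= 4^-1 -> `|c'| <= 4^-1 -> `|z| <= M -> `|z'| <= M ->
        `|(1 - c) * z - c' * z'| <= 2^-1 * M.
      move=> cc cc' zz zz'; apply: (le_trans (ler_normB _ _)); rewrite !normrM.
      have -> : 2^-1 * M = 4^-1 * M + 4^-1 * M by lra.
      by apply: lerD; apply: ler_pM => //; rewrite distrC.
    by split; [rewrite n1|rewrite n2]; apply: B.
  have Nr x y : `|x - b.1.1| <= r2 -> `|y - b.1.2| <= r2 ->
     `|N1 x y - b.1.1| <= r2 /\ `|N2 x y - b.1.2| <= r2.
    move=> hx hy.
    have b1r : `|b.1.1 - b.1.1| <= r2 by rewrite subrr normr0 ltW.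
    have b2r : `|b.1.2 - b.1.2| <= r2 by rewrite subrr normr0 ltW.
    have [c1 c2] := Nc x y b.1.1 b.1.2 hx hy b1r b2r.
    have M2 : Num.max `|x - b.1.1| `|y - b.1.2| <= r2 by rewrite ge_max hx hy.
    have -> : N1 x y - b.1.1 = (N1 x y - N1 b.1.1 b.1.2) - L1 (b.1, m).
      by rewrite /N1 /=; lra.
    have -> : N2 x y - b.1.2 = (N2 x y - N2 b.1.1 b.1.2) - L2 (b.1, m).
      by rewrite /N2 /=; lra.
    have T (u z : R) : `|u| <= 2^-1 * Num.max `|x - b.1.1| `|y - b.1.2| -> `|z| <= r2 / 2 ->
        `|u - z| <= r2.
      move=> hu hz; apply: (le_trans (ler_normB _ _)); lra.
    by split; apply: T.
  have [x [y [hx hy n1 n2]]] := contraction_box r20 Nr Nc.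
  exists (x, y); split; first by move: m0 => /eqP.
  move=> _; split => //.
    by apply: (L0 _ _).1; [move: n1|move: n2]; rewrite /N1 /N2; lra.
  by apply: (L0 _ _).2; [move: n1|move: n2]; rewrite /N1 /N2; lra.
have [p pP] := choice ex.
pose w i m := inst (p m, m) i.
have dd0 : d <= d0 by rewrite !ge_min lexx.
have bp (m : R) : `|m| < d -> ball b r (p m, m).
  move=> md; have [_ /(_ md)[h1 h2 _ _]] := pP m.
  have [_ _ mr2] := dP _ md.
  rewrite [p m]surjective_pairing; apply: ballb; [exact: le_lt_trans r2r|exact: le_lt_trans r2r|].
  exact: lt_trans mr2 r2r.
have wv i : i != u1 -> i != u2 -> w i = v i.
  by move=> /negPf i1 /negPf i2; apply/funext => m; rewrite /w /inst i1 i2.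
have vc i (x : R) : i != u1 -> i != u2 -> `|x| < d -> {for x, continuous (v i)}.
  move=> i1 i2 xd; apply: (C1k_continuous (vs i1 i2 0)).
  exact: lt_le_trans xd dd0.
have pc (x : R) : `|x| < d -> {for x, continuous (fun m => (p m).1)} /\
    {for x, continuous (fun m => (p m).2)}.
  move=> xd.
  pose T m := \sum_(i : I) K * (if (i == u1) || (i == u2) then 0 else `|v i m - v i x|).
  have T0 : T m @[m --> x] --> 0.
    rewrite -[X in _ --> X](@big1_eq _ _ +%R I (index_enum I) xpredT).
    apply: cvg_bigsum => i; rewrite -[X in _ --> X](mulr0 K).
    apply: cvgM; first exact: cvg_cst.
    have [_|] := boolP ((i == u1) || (i == u2)); first exact: cvg_cst.
    rewrite negb_or => /andP[i1 i2].
    have h : `|v i m - v i x| @[m --> x] --> `|v i x - v i x|.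
      by apply: cvg_norm; apply: cvgB; [exact: vc|exact: cvg_cst].
    by rewrite subrr normr0 in h.
  pose M := 2 * ((`|e0| + `|b0| + (`|a0| + `|c0|)) / `|D|).
  have M0 : 0 <= M by rewrite mulr_ge0// divr_ge0//; rewrite !addr_ge0.
  have ST G m : (forall i, `|hd G (inst (p m, m)) (inst (p x, x)) i| <= K) ->
      `|S G (p m, m) (p x, x)| <= T m.
    move=> hK; apply: (le_trans (ler_norm_sum _ _ _)); apply: ler_sum => i _ /=.
    rewrite normrM; case: ifP => _; first by rewrite normr0 !mulr0.
    by apply: ler_wpM2r.
  have main : \forall m \near x, `|(p m).1 - (p x).1| + `|(p m).2 - (p x).2| <= M * T m.
    near=> m.
    have md : `|m| < d by near: m; apply: (open_nbhs_nbhs); split => //; exact: ball0_open.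
    have [_ /(_ md)[_ _ g1 g2]] := pP m; have [_ /(_ xd)[_ _ g1' g2']] := pP x.
    have [_ _ _ _ hK] := rP _ _ (bp _ md) (bp _ xd).
    have t1 := ST G1 m (fun i => (hK i).1); have t2 := ST G2 m (fun i => (hK i).2).
    apply: (le_trans (two0 _ _ (bp _ md) (bp _ xd) g1 g2 g1' g2')).
    rewrite /M -mulrA; apply: ler_wpM2l => //.
    rewrite !normrM normfV mulrAC -mulrDl; apply: ler_wpM2r; first by rewrite invr_ge0.
    have N (f g u z : R) : `|u| <= T m -> `|z| <= T m -> `|f * u - g * z| <= (`|f| + `|g|) * T m.
      move=> hu hz; apply: (le_trans (ler_normB _ _)); rewrite !normrM mulrDl.
      by apply: lerD; apply: ler_wpM2l.
    by rewrite mulrDl; apply: lerD; apply: N.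
  have MT0 : M * T m @[m --> x] --> 0.
    by rewrite -[X in _ --> X](mulr0 M); apply: cvgM => //; exact: cvg_cst.
  split; apply/cvgrPdist_le => e egt0.
    apply: filterS2 main (cvgr0_norm_le _ MT0 _ egt0) => m h1 h2.
    rewrite distrC (le_trans _ h2)// (le_trans _ (ler_norm _))// (le_trans _ h1)//.
    by rewrite lerDl.
  apply: filterS2 main (cvgr0_norm_le _ MT0 _ egt0) => m h1 h2.
  rewrite distrC (le_trans _ h2)// (le_trans _ (ler_norm _))// (le_trans _ h1)//.
  by rewrite lerDr.
have wc i (x : R) : [set x | `|x| < d] x -> {for x, continuous (w i)}.
  move=> /= xd; rewrite /w /inst; have [p1 p2] := pc x xd.
  case: eqVneq => [_|i1] //; case: eqVneq => [_|i2] //.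
  exact: vc.
have wG (x : R) : [set x | `|x| < d] x -> ev G1 (w ^~ x) = 0 /\ ev G2 (w ^~ x) = 0.
  by move=> /= xd; have [_ /(_ xd)[_ _]] := pP x.
(* In the box [c11] and [c22] are at least 3/4, [c12] and [c21] at most 1/4 in absolute value, so
   the preconditioned determinant cannot vanish. *)
have wJ (x : R) : [set x | `|x| < d] x -> jac u1 u2 G1 G2 (w ^~ x) (w ^~ x) != 0.
  move=> /= xd; have [k1 k2 k3 k4 _] := rP _ _ (bp _ xd) (bp _ xd).
  apply/eqP => j0.
  have e : c11 (p x, x) (p x, x) * c22 (p x, x) (p x, x) =
           c12 (p x, x) (p x, x) * c21 (p x, x) (p x, x).
    apply/eqP; rewrite -subr_eq0; apply/eqP.
    transitivity (jac u1 u2 G1 G2 (w ^~ x) (w ^~ x) / D); last by rewrite j0 mul0r.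
    by rewrite /c11 /c12 /c21 /c22 /jac /w /D; field; exact: D0.
  move: k1 k2 k3 k4; rewrite !ler_norml => /andP[A1 A2] /andP[A3 A4] /andP[A5 A6] /andP[A7 A8].
  move: e; nra.
have [s1 s2] := implicit_smooth u12 (ball0_open (d := d)) wc (fun x xd => (wG x xd).1)
   (fun x xd => (wG x xd).2) wJ
   (fun i i1 i2 => (fun k => (C1k_subset (fun x (xd : `|x| < d) => lt_le_trans xd dd0)
       (eq_ind_r (fun f => C1k _ k f) (vs i1 i2 k) (wv i i1 i2))))).
exists d, w; split => //.
- by rewrite d_gt0.
- by move=> i; rewrite /w; have [-> // _] := pP 0; exact: instb.
- move=> i; have [->//|i1] := eqVneq i u1; have [->//|i2] := eqVneq i u2.
  move=> k; rewrite wv//; apply: (C1k_subset _ (vs i1 i2 k)) => x /=.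
  by move=> xd; exact: lt_le_trans xd dd0.
Unshelve. all: by end_near. Qed.

End ImplicitCurve.

(** * The real matrix exponential *)

Section MatrixExponential.
Context {R : realType}.
Variable (N : nat).
Implicit Types (A B : 'M[R]_N).

(** The power series of A^m exp(tA), entry by entry: termwise differentiation raises m by one, and
    so does multiplication by A on either side. *)
Definition mexp_coef A (m : nat) i j : R^nat :=
  fun k => (A ^+ (m + k)%N) i j / k`!%:R.

Definition mexp A (t : R) : 'M[R]_N :=
  \matrix_(i, j) limn (pseries (mexp_coef A 0 i j) t).

Lemma expmx_bound A p i j :
  `|(A ^+ p) i j| <= (\sum_i \sum_j `|A i j|) ^+ p.
Proof.
set K := \sum_i _.
have K0 : 0 <= K by apply: sumr_ge0 => ? _; apply: sumr_ge0.
elim: p i j => [|p IHp] i j.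
  by rewrite !expr0 mxE; case: (i == j); rewrite /= ?normr1 ?normr0.
rewrite !exprS mxE (le_trans (ler_norm_sum _ _ _))//.
apply: (@le_trans _ _ (\sum_l `|A i l| * K ^+ p)).
  by apply: ler_sum => l _; rewrite normrM ler_wpM2l.
rewrite -mulr_suml ler_wpM2r// ?exprn_ge0//.
by rewrite /K [leRHS](bigD1 i)//= lerDl sumr_ge0// => k _; apply: sumr_ge0.
Qed.

Lemma mexp_coef_cvg A m i j t : cvgn (pseries (mexp_coef A m i j) t).
Proof.
set K := \sum_i \sum_j `|A i j|.
have K0 : 0 <= K by apply: sumr_ge0 => ? _; apply: sumr_ge0.
apply: normed_cvg.
apply: (@series_le_cvg _ _ (fun k => K ^+ m * exp_coeff (K * `|t|) k)).
- by move=> k; exact: normr_ge0.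
- by move=> k; rewrite mulr_ge0 ?exprn_ge0// exp_coeff_ge0// mulr_ge0.
- move=> k; rewrite /mexp_coef /exp_coeff /= !normrM normrX exprMn normfV normr_nat.
  rewrite !mulrA -exprD [leRHS]mulrAC; apply: ler_wpM2r; first exact: exprn_ge0.
  by apply: ler_wpM2r; [rewrite invr_ge0|exact: expmx_bound].
have := @is_cvg_seriesZ _ _ (K ^+ m) (is_cvg_series_exp_coeff (K * `|t|)).
exact.
Qed.

Lemma mexp_coef_diffs A m i j :
  pseries_diffs (mexp_coef A m i j) = mexp_coef A m.+1 i j.
Proof.
apply/funext => k; rewrite /pseries_diffs /mexp_coef addnS addSn factS natrM invfM.
by rewrite mulrCA mulVKf.
Qed.

Lemma mexp_coefS A m i j t :
  limn (pseries (mexp_coef A m.+1 i j) t) =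
  \sum_l A i l * limn (pseries (mexp_coef A m l j) t).
Proof.
apply: cvg_lim => //.
have -> : pseries (mexp_coef A m.+1 i j) t =
    fun n => \sum_l A i l * pseries (mexp_coef A m l j) t n.
  apply/funext => n; rewrite /pseries /series /=.
  under [RHS]eq_bigr do rewrite mulr_sumr.
  rewrite exchange_big/=; apply: eq_bigr => k _.
  rewrite /mexp_coef addSn exprS mxE !mulr_suml.
  by apply: eq_bigr => l _; rewrite !mulrA.
apply: cvg_bigsum => l; apply: cvgM; first exact: cvg_cst.
exact: mexp_coef_cvg.
Qed.

Lemma mexp_coefSr A m i j t :
  limn (pseries (mexp_coef A m.+1 i j) t) =
  \sum_l limn (pseries (mexp_coef A m i l) t) * A l j.
Proof.
apply: cvg_lim => //.
have -> : pseries (mexp_coef A m.+1 i j) t =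
    fun n => \sum_l pseries (mexp_coef A m i l) t n * A l j.
  apply/funext => n; rewrite /pseries /series /=.
  under [RHS]eq_bigr do rewrite mulr_suml.
  rewrite exchange_big/=; apply: eq_bigr => k _.
  rewrite /mexp_coef addSn exprSr mxE !mulr_suml.
  by apply: eq_bigr => l _; ring.
apply: cvg_bigsum => l; apply: cvgM; last exact: cvg_cst.
exact: mexp_coef_cvg.
Qed.

Lemma mexp_comm A t : A *m mexp A t = mexp A t *m A.
Proof.
apply/matrixP => i j; rewrite !mxE.
have := mexp_coefS A 0 i j t; rewrite (mexp_coefSr A 0 i j t) => E.
by under eq_bigr do rewrite mxE; rewrite -E; under [RHS]eq_bigr do rewrite mxE.
Qed.

Lemma mexp0 A : mexp A 0 = 1%:M.
Proof.
apply/matrixP => i j; rewrite mxE.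
have -> : (1%:M : 'M[R]_N) i j = mexp_coef A 0 i j 0.
  by rewrite /mexp_coef addn0 expr0 fact0 divr1.
apply: cvg_lim => //.
apply/cvg_ballP => e e0; near=> n.
have -> : pseries (mexp_coef A 0 i j) 0 n = mexp_coef A 0 i j 0.
  have [k ->] : exists k, n = k.+1 by exists n.-1; rewrite prednK//; near: n; exists 1%N.
  rewrite /pseries /series /= big_nat_recl//= expr0 mulr1 big1 ?addr0// => l _.
  by rewrite exprS mul0r mulr0.
exact: ballxx.
Unshelve. all: by end_near. Qed.

Definition mderive p q (M : R -> 'M[R]_(p, q)) (t : R) (D : 'M[R]_(p, q)) :=
  forall i j, is_derive t (1 : R) (fun s => M s i j) (D i j).

Lemma mexp_derive A t : mderive (mexp A) t (mexp A t *m A).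
Proof.
move=> i j.
have -> : (fun s => mexp A s i j) = (fun s => limn (pseries (mexp_coef A 0 i j) s)).
  by apply/funext => s; rewrite mxE.
have -> : (mexp A t *m A) i j = limn (pseries (pseries_diffs (mexp_coef A 0 i j)) t).
  rewrite mexp_coef_diffs mexp_coefSr mxE.
  by apply: eq_bigr => l _; rewrite mxE.
apply: (@pseries_snd_diffs _ _ (`|t| + 1)); rewrite ?mexp_coef_diffs.
- exact: mexp_coef_cvg.
- exact: mexp_coef_cvg.
- exact: mexp_coef_cvg.
by rewrite [ltRHS]ger0_norm ?addr_ge0// ltrDl.
Qed.

Lemma mderive_eq p q (M : R -> 'M[R]_(p, q)) t D D' : D = D' -> mderive M t D -> mderive M t D'.
Proof. by move=> ->. Qed.

Lemma mderive_cst p q (M : 'M[R]_(p, q)) t : mderive (fun=> M) t 0.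
Proof. by move=> i j; rewrite mxE; exact: is_derive_cst. Qed.

Lemma is_derive_bigsum (I : Type) (r : seq I) (f : I -> R -> R) (df : I -> R) (t : R) :
  (forall i, is_derive t (1 : R) (f i) (df i)) ->
  is_derive t (1 : R) (fun s => \sum_(i <- r) f i s) (\sum_(i <- r) df i).
Proof.
move=> fd; elim: r => [|i r IHr].
  by rewrite big_nil; under eq_fun do rewrite big_nil; exact: is_derive_cst.
rewrite big_cons; under eq_fun do rewrite big_cons.
exact: is_deriveD.
Qed.

Lemma mderiveM p q r (M : R -> 'M[R]_(p, q)) (M' : R -> 'M[R]_(q, r)) t D D' :
  mderive M t D -> mderive M' t D' ->
  mderive (fun s => M s *m M' s) t (D *m M' t + M t *m D').
Proof.
move=> MD MD' i j; rewrite !mxE -big_split/=.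
have -> : (fun s => (M s *m M' s) i j) = fun s => \sum_l M s i l * M' s l j.
  by apply/funext => s; rewrite mxE.
apply: is_derive_bigsum => l.
have h1 := MD i l; have h2 := MD' l j.
by apply: is_derive_eq (is_deriveM h1 h2) _; rewrite /GRing.scale/=; ring.
Qed.

Lemma mderiveD p q (M M' : R -> 'M[R]_(p, q)) t D D' :
  mderive M t D -> mderive M' t D' -> mderive (fun s => M s + M' s) t (D + D').
Proof.
move=> MD MD' i j; rewrite mxE.
have -> : (fun s => (M s + M' s) i j) = fun s => M s i j + M' s i j.
  by apply/funext => s; rewrite mxE.
by apply: is_deriveD; [exact: MD|exact: MD'].
Qed.

Lemma mderive_comp p q (M : R -> 'M[R]_(p, q)) (g : R -> R) t D (d : R) :
  mderive M (g t) D -> is_derive t (1 : R) g d -> mderive (fun s => M (g s)) t (d *: D).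
Proof.
move=> MD gd i j; rewrite mxE mulrC.
exact: (@is_derive1_comp _ (fun s => M s i j) g t _ _ (MD i j) gd).
Qed.

Lemma mderive0_cst p q (M : R -> 'M[R]_(p, q)) : (forall t, mderive M t 0) ->
  forall s t, M s = M t.
Proof.
move=> MD s t; apply/matrixP => i j.
apply: (@is_derive_0_is_cst _ (fun s => M s i j)) => x.
by have := MD x i j; rewrite mxE.
Qed.

(** The product exp(xA) exp((s + t - x)A) has zero derivative in x; compare x = s with x = 0. *)
Lemma mexpD A s t : mexp A s *m mexp A t = mexp A (s + t).
Proof.
pose P x := mexp A x *m mexp A (s + t - x).
have D x : mderive P x 0.
  have h : is_derive x (1 : R) (fun x => s + t - x) (-1).
    by apply: is_derive_eq; rewrite add0r mul1r.
  apply: mderive_eq (mderiveM (@mexp_derive A x) (mderive_comp (@mexp_derive A _) h)).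
  by rewrite scaleN1r mulmxN -(mexp_comm A (s + t - x)) !mulmxA subrr.
have := mderive0_cst D s 0; rewrite /P subr0 mexp0 mul1mx => <-.
by congr (_ *m mexp A _); rewrite addrC addKr.
Qed.

Lemma mexpN A t : mexp A t *m mexp A (- t) = 1%:M.
Proof. by rewrite mexpD subrr mexp0. Qed.

End MatrixExponential.

(** * Single entries of the exponential *)

Section ExponentialEntries.
Context {R : realType}.

Lemma mexp_entry_eq (N N' : nat) (A : 'M[R]_N) (B : 'M[R]_N') i j i' j' t :
  (forall k, (A ^+ k) i j = (B ^+ k) i' j') -> mexp A t i j = mexp B t i' j'.
Proof.
move=> AB; rewrite !mxE; suff -> : mexp_coef A 0 i j = mexp_coef B 0 i' j' by [].
by apply/funext => k; rewrite /mexp_coef AB.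
Qed.

Lemma mexp_entry0 (N : nat) (A : 'M[R]_N) i j t :
  (forall k, (A ^+ k) i j = 0) -> mexp A t i j = 0.
Proof.
move=> A0; rewrite !mxE.
suff -> : pseries (mexp_coef A 0 i j) t = fun=> 0.
  by apply: cvg_lim => //; exact: cvg_cst.
apply/funext => n; rewrite /pseries /series /= big1// => k _.
by rewrite /mexp_coef A0 !mul0r.
Qed.

Lemma mexp_scalar (N : nat) (A : 'M[R]_N) i (c : R) t :
  (forall k, (A ^+ k) i i = c ^+ k) -> mexp A t i i = expR (c * t).
Proof.
move=> Ac; rewrite mxE /expR.
suff -> : pseries (mexp_coef A 0 i i) t = series (exp_coeff (c * t)) by [].
rewrite /pseries; congr series; apply/funext => k.
by rewrite /mexp_coef /= add0n Ac /exp_coeff/= exprMn mulrAC.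
Qed.

End ExponentialEntries.

(** * Exponentials of hyperbolic matrices have no eigenvalue on the unit circle *)

Section SpectralMapping.
Context {R : realType}.
Local Notation C := R[i].

(** An eigenspace of W is invariant under A, so A has an eigenvector inside it. *)
Lemma joint_eigenvector (N : nat) (A W : 'M[C]_N) (w : C) :
  A *m W = W *m A -> eigenvalue W w ->
  exists (v : 'rV[C]_N) (z : C), [/\ v != 0, v *m A = z *: v & v *m W = w *: v].
Proof.
move=> AW wW; pose V := row_base (eigenspace W w).
have VE : (V :=: eigenspace W w)%MS by exact: eq_row_base.
have VW : V *m W = w *: V by apply/eigenspaceP; rewrite VE.
have VA : (V *m A <= V)%MS.
  by rewrite VE; apply/eigenspaceP; rewrite -mulmxA AW mulmxA VW scalemxAl.
have [D DE] := submxP VA.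
have rk : (0 < \rank (eigenspace W w))%N by rewrite lt0n mxrank_eq0.
have [z /eigenvalueP[u uD u0]] := eigenvalue_closed D rk.
exists (u *m V), z; split.
- rewrite -mxrank_eq0 mxrankMfree ?mxrank_eq0//; exact: row_base_free.
- by rewrite -mulmxA DE mulmxA uD scalemxAl.
- by rewrite -mulmxA VW -scalemxAr.
Qed.

(** For a joint eigenvector v of A and exp(TA), the squared norm Q(t) of v exp(tA) satisfies Q' = 2
    Re(z) Q, while |w| = 1 gives Q(T) = Q(0); this contradicts Re(z) != 0. Splitting v into real and
    imaginary parts keeps the exponential real. *)
Lemma hyperbolic_mexp (N : nat) (A : 'M[R]_N) (T : R) (w : C) : T != 0 ->
  hyperbolic_mx A -> eigenvalue (map_mx (real_complex R) (mexp A T)) w ->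
  ComplexField.Normc.normc w != 1.
Proof.
move=> T0 Ah wE; apply/eqP => w1.
have AW : map_mx (real_complex R) A *m map_mx (real_complex R) (mexp A T) =
    map_mx (real_complex R) (mexp A T) *m map_mx (real_complex R) A.
  by rewrite -!map_mxM mexp_comm.
have [v [z [v0 vA vW]]] := joint_eigenvector AW wE.
have zA : eigenvalue (map_mx (real_complex R) A) z by apply/eigenvalueP; exists v.
have z0 := Ah z zA.
pose a : 'rV[R]_N := map_mx (@complex.Re R) v.
pose b : 'rV[R]_N := map_mx (@complex.Im R) v.
have vab : v = map_mx (real_complex R) a + 'i%C *: map_mx (real_complex R) b.
  apply/rowP => j; rewrite !mxE; case: (v 0 j) => p q /=.
  by apply/eqP; rewrite eq_complex/=; apply/andP; split; apply/eqP; ring.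
have ReIm (M : 'M[R]_N) (c : C) :
    v *m map_mx (real_complex R) M = c *: v ->
    a *m M = complex.Re c *: a - complex.Im c *: b /\
    b *m M = complex.Im c *: a + complex.Re c *: b.
  move=> /rowP H; split; apply/rowP => j; have := H j; rewrite !mxE.
    move=> /(congr1 (@complex.Re R)).
    rewrite raddf_sum/= => E.
    transitivity (\sum_j0 complex.Re (v 0 j0 * map_mx (real_complex R) M j0 j)).
      by apply: eq_bigr => l _; rewrite !mxE; case: (v 0 l) => p q /=; rewrite mulr0 subr0.
    by rewrite E; case: c {H E} => c1 c2; case: (v 0 j).
  move=> /(congr1 (@complex.Im R)).
  rewrite raddf_sum/= => E.
  transitivity (\sum_j0 complex.Im (v 0 j0 * map_mx (real_complex R) M j0 j)).
    by apply: eq_bigr => l _; rewrite !mxE; case: (v 0 l) => p q /=; rewrite mulr0 add0r.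
  by rewrite E; case: c {H E} => c1 c2; case: (v 0 j) => p q /=; rewrite addrC.
have [aA bA] := ReIm _ _ vA.
have [aW bW] := ReIm _ _ vW.
pose al t := a *m mexp A t.
pose be t := b *m mexp A t.
pose Q t : R := \sum_j (al t 0 j ^+ 2 + be t 0 j ^+ 2).
have dal t : mderive al t (complex.Re z *: al t - complex.Im z *: be t).
  apply: mderive_eq (mderiveM (mderive_cst a t) (mexp_derive A t)).
  by rewrite mul0mx add0r -mexp_comm mulmxA aA mulmxBl -!scalemxAl.
have dbe t : mderive be t (complex.Im z *: al t + complex.Re z *: be t).
  apply: mderive_eq (mderiveM (mderive_cst b t) (mexp_derive A t)).
  by rewrite mul0mx add0r -mexp_comm mulmxA bA mulmxDl -!scalemxAl.
pose c := 2 * complex.Re z.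
have dQ t : is_derive t (1 : R) Q (c * Q t).
  rewrite /Q mulr_sumr; apply: is_derive_bigsum => j.
  have h1 := dal t 0 j; have h2 := dbe t 0 j.
  have h3 := is_deriveD (is_deriveX 2 h1) (is_deriveX 2 h2).
  apply: is_derive_eq h3 _.
  by rewrite !mxE /= /c /GRing.scale/= expr1; ring.
have Qc : Q T * expR (- (c * T)) = Q 0.
  pose g t := Q t * expR (- (c * t)).
  have dg t : is_derive t (1 : R) g 0.
    have e1 : is_derive t (1 : R) (fun t => - (c * t)) (- c).
      by apply: is_derive_eq; rewrite /GRing.scale/= mulr1.
    have e2 : is_derive t (1 : R) (fun t => expR (- (c * t))) (expR (- (c * t)) * - c).
      exact: (@is_derive1_comp _ expR (fun t => - (c * t)) t _ _ (is_derive_expR _) e1).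
    have h := dQ t.
    apply: is_derive_eq (is_deriveM h e2) _.
    by rewrite /GRing.scale/=; ring.
  have := is_derive_0_is_cst T 0 dg; rewrite /g => ->.
  by rewrite mulr0 oppr0 expR0 mulr1.
have QT : Q T = Q 0.
  rewrite /Q /al /be mexp0 !mulmx1 aW bW; apply: eq_bigr => j _; rewrite !mxE.
  have : complex.Re w ^+ 2 + complex.Im w ^+ 2 = 1.
    move: w1; case: w {wE vW aW bW} => p q /= /(congr1 (fun x => x ^+ 2)).
    by rewrite sqr_sqrtr ?expr1n// addr_ge0 ?sqr_ge0.
  set x := complex.Re (v 0 j); set y := complex.Im (v 0 j).
  set p := complex.Re w; set q := complex.Im w => pq.
  transitivity ((p ^+ 2 + q ^+ 2) * (x ^+ 2 + y ^+ 2)); first by ring.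
  by rewrite pq mul1r.
have Q0 : Q 0 != 0.
  apply: contra_neq v0 => Q0.
  have ab j : a 0 j = 0 /\ b 0 j = 0.
    have : al 0 0 j ^+ 2 + be 0 0 j ^+ 2 = 0.
      have /allP : all (fun j => true ==> (al 0 0 j ^+ 2 + be 0 0 j ^+ 2 == 0)) (index_enum _).
        rewrite -psumr_eq0; first by rewrite -/(Q 0) Q0.
        by move=> i _; rewrite addr_ge0 ?sqr_ge0.
      by move/(_ j); rewrite mem_index_enum => /(_ isT)/= /eqP.
    rewrite /al /be mexp0 !mulmx1 => /eqP.
    by rewrite paddr_eq0 ?sqr_ge0// !sqrf_eq0 => /andP[/eqP -> /eqP ->].
  by apply/rowP => j; rewrite vab !mxE; have [] := ab j; rewrite !mxE => -> ->; rewrite mulr0 addr0.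
move: Qc; rewrite QT -[RHS]mulr1 -[X in _ = _ * X]expR0 => /(mulfI Q0) /expR_inj /eqP.
rewrite oppr_eq0 mulf_eq0 (negPf T0) orbF /c mulf_eq0 (negPf z0) orbF.
by rewrite pnatr_eq0.
Qed.

End SpectralMapping.

(** * Antiderivatives on the whole line *)

Section Antiderivative.
Context {R : realType}.

Lemma is_derive_eq_on_ball (G H g : R -> R) (r : R) :
  G 0 = H 0 -> (forall t, `|t| < r -> is_derive t (1 : R) G (g t)) ->
  (forall t, `|t| < r -> is_derive t (1 : R) H (g t)) ->
  forall t, `|t| < r -> G t = H t.
Proof.
move=> GH0 dG dH.
pose D t := G t - H t.
have dD t : `|t| < r -> is_derive t (1 : R) D 0.
  by move=> tr; have := is_deriveB (dG t tr) (dH t tr); rewrite subrr.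
have cst a b : `|a| < r -> `|b| < r -> a <= b -> D a = D b.
  move=> ar br ab.
  have inr x : x \in `[a, b] -> `|x| < r.
    rewrite in_itv/= => /andP[ax xb]; move: ar br; rewrite !ltr_norml.
    by move=> /andP[r1 r2] /andP[r3 r4]; rewrite (lt_le_trans r1 ax) (le_lt_trans xb r4).
  have dD' x : x \in `]a, b[ -> is_derive x (1 : R) D 0.
    by move=> xab; apply: dD; apply: inr; exact: subset_itv_oo_cc xab.
  have cD : {within `[a, b], continuous D}.
    apply: continuous_in_subspaceT => x xab.
    by apply: is_derive1_continuous; apply: dD; apply: inr; rewrite inE in xab.
  have [c _] := MVT_segment ab dD' cD.
  by rewrite mul0r => /eqP; rewrite subr_eq0 => /eqP ->.
move=> t tr.
have zr : `|0 : R| < r by rewrite normr0 (le_lt_trans _ tr).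
have D0 : D t = D 0.
  by have [t0|/ltW t0] := leP t 0; [exact: cst|apply/esym; exact: cst].
by move: D0; rewrite /D GH0 subrr => /eqP; rewrite subr_eq0 => /eqP.
Qed.

Lemma antiderivative_ball (g : R -> R) (r : R) : 0 < r -> continuous g ->
  exists G, G 0 = 0 /\ forall t, `|t| < r -> is_derive t (1 : R) G (g t).
Proof.
move=> r0 gc.
pose mu := @lebesgue_measure R.
pose F x : R := (\int[mu]_(s in [set` `[- r, x]]) g s)%R.
exists (fun x => F x - F 0); split; first by rewrite subrr.
move=> t; rewrite ltr_norml => /andP[rt tr].
have gi : mu.-integrable `[- r, r] (EFin \o g).
  apply: continuous_compact_integrable; first exact: segment_compact.
  exact: continuous_subspaceT.
have [dF F'] := @continuous_FTC1_closed R g (- r) t r tr gi rt (gc t).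
have dFt : is_derive t (1 : R) F (g t) by apply: DeriveDef; rewrite -?derive1E.
have := is_deriveB dFt (is_derive_cst (F 0) t (1 : R)).
by rewrite subr0.
Qed.

(** On a ball the antiderivative vanishing at 0 is unique, so those on the balls of radius 1, 2, 3
    and so on agree and glue. *)
Lemma antiderivative (g : R -> R) : continuous g ->
  exists G, G 0 = 0 /\ forall t, is_derive t (1 : R) G (g t).
Proof.
move=> gc.
have ex (k : nat) : exists G, G 0 = 0 /\
    forall t, `|t| < k.+1%:R -> is_derive t (1 : R) G (g t).
  by apply: antiderivative_ball.
have [G GP] := choice ex.
pose k (t : R) := Num.truncn `|t|.
have kP t : `|t| < (k t).+1%:R by apply: truncnS_gt.
pose H t := G (k t) t.
have HG m t : (k t <= m)%N -> H t = G m t.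
  move=> ktm; apply: (@is_derive_eq_on_ball (G (k t)) (G m) g (k t).+1%:R).
  - by rewrite (GP (k t)).1 (GP m).1.
  - exact: (GP (k t)).2.
  - by move=> s sk; apply: (GP m).2; rewrite (lt_le_trans sk)// ler_nat ltnS.
  - exact: kP.
exists H; split; first exact: (GP _).1.
move=> t; pose m := (k t).+1.
have tm : `|t| < m.+1%:R by rewrite (lt_trans (kP t))// ltr_nat.
have ne : \forall s \near t, G m s = H s.
  have o : open [set s : R | `|s| < m%:R].
    have -> : [set s : R | `|s| < m%:R] = ball (0 : R) m%:R.
      by apply/seteqP; split => s; rewrite /ball/= sub0r normrN.
    exact: ball_open.
  apply: (open_near_eq o); first exact: kP.
  move=> s /= sm; apply/esym/HG.
  by apply: ltnW; rewrite truncn_lt_nat.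
exact: (near_eq_is_derive ne ((GP m).2 t tm)).
Qed.

End Antiderivative.

(** * Matrices triangular for a grading of the indices *)

Section LevelTriangular.

(** Block triangularity up to a permutation: the indices are graded instead of reordered, and
    several of them may share a level. *)
Definition lvl_tri (K : pzRingType) (N : nat) (lev : 'I_N -> nat) (A : 'M[K]_N) :=
  forall i j, (lev j < lev i)%N -> A i j = 0.

(** A permutation preserves the sum of the levels. So the determinant of a triangular matrix only
    sees level-preserving permutations. *)
Lemma lvl_perm (N : nat) (lev : 'I_N -> nat) (s : 'S_N) :
  (forall i, (lev i <= lev (s i))%N) -> forall i, lev (s i) = lev i.
Proof.
move=> le_s i.
have : (\sum_i lev (s i) <= \sum_i lev i)%N.
  by rewrite [leqRHS](reindex_inj (@perm_inj _ s)).
have := @leqif_sum _ xpredT (fun i => lev i == lev (s i)) lev (fun i => lev (s i)).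
move=> /(_ (fun i _ => leqif_eq (le_s i))) [le1 eq1] le2.
have : (\sum_i lev i == \sum_i lev (s i))%N by rewrite eqn_leq le1 le2.
by rewrite eq1 => /forallP/(_ i) /eqP.
Qed.

(** Every contributing permutation fixes a, which is alone on its level; so the entry at (a, a) is a
    factor of each term. The identity avoids division, as this entry may vanish. *)
Lemma det_lvl (K : comPzRingType) (N : nat) (lev : 'I_N -> nat) (A B : 'M[K]_N) (a : 'I_N) :
  lvl_tri lev A -> lvl_tri lev B -> (forall i, lev i = lev a -> i = a) ->
  (forall i j, lev i = lev j -> i != a -> A i j = B i j) ->
  \det A * B a a = \det B * A a a.
Proof.
move=> At Bt aP AB; rewrite /determinant !mulr_suml; apply: eq_bigr => s _.
rewrite -!mulrA; congr (_ * _).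
have [/forallP le_s|] := boolP [forall i, (lev i <= lev (s i))%N].
  have eq_s := lvl_perm le_s.
  have sa : s a = a by apply: aP; exact: eq_s.
  rewrite (bigD1 a)//= [in RHS](bigD1 a)//= sa.
  rewrite [LHS]mulrC -[RHS]mulrA; congr (_ * _); rewrite mulrC; congr (_ * _).
  by apply: eq_bigr => i ia; apply: AB => //; rewrite eq_s.
move=> /forallPn[ i ]; rewrite -ltnNge => lt_i.
by rewrite (bigD1 i)//= [in RHS](bigD1 i)//= (At i _ lt_i) (Bt i _ lt_i) !mul0r.
Qed.

Lemma det_lvl_eq (K : comPzRingType) (N : nat) (lev : 'I_N -> nat) (A B : 'M[K]_N) :
  lvl_tri lev A -> lvl_tri lev B ->
  (forall i j, lev i = lev j -> A i j = B i j) -> \det A = \det B.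
Proof.
move=> At Bt AB; rewrite /determinant; apply: eq_bigr => s _; congr (_ * _).
have [/forallP le_s|] := boolP [forall i, (lev i <= lev (s i))%N].
  by apply: eq_bigr => i _; rewrite AB// (lvl_perm le_s).
move=> /forallPn[ i ]; rewrite -ltnNge => lt_i.
by rewrite (bigD1 i)//= [in RHS](bigD1 i)//= (At i _ lt_i) (Bt i _ lt_i) !mul0r.
Qed.

Lemma lvl_triM (K : pzRingType) (N : nat) (lev : 'I_N -> nat) (A B : 'M[K]_N) :
  lvl_tri lev A -> lvl_tri lev B -> lvl_tri lev (A *m B).
Proof.
move=> At Bt i j ji; rewrite mxE big1// => l _.
have [li|il] := ltnP (lev l) (lev i); first by rewrite At// mul0r.
by rewrite Bt ?mulr0//; exact: leq_trans ji il.
Qed.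

Lemma lvl_tri1 (K : pzRingType) (N : nat) (lev : 'I_N -> nat) : lvl_tri lev (1%:M : 'M[K]_N).
Proof. by move=> i j; rewrite mxE; case: eqVneq => [->|//]; rewrite ltnn. Qed.

Lemma lvl_triX (K : pzRingType) (N : nat) (lev : 'I_N -> nat) (A : 'M[K]_N) k :
  lvl_tri lev A -> lvl_tri lev (A ^+ k).
Proof.
move=> At; elim: k => [|k IHk]; first by rewrite expr0; exact: lvl_tri1.
by rewrite exprS; exact: lvl_triM.
Qed.

(** A product path between two indices of one level never leaves that level; [P] selects the levels
    on which the two matrices agree. *)
Lemma lvl_triX_eq (K : pzRingType) (N : nat) (lev : 'I_N -> nat) (P : nat -> bool) (A B : 'M[K]_N) k :
  lvl_tri lev A -> lvl_tri lev B ->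
  (forall i j, lev i = lev j -> P (lev i) -> A i j = B i j) ->
  forall i j, lev i = lev j -> P (lev i) -> (A ^+ k) i j = (B ^+ k) i j.
Proof.
move=> At Bt AB; elim: k => [|k IHk] i j ij Pi; first by rewrite !expr0.
rewrite !exprS !mxE; apply: eq_bigr => l _.
have Ak := lvl_triX k At; have Bk := lvl_triX k Bt.
have [li|li|li] := ltngtP (lev l) (lev i).
- by rewrite At// Bt// !mul0r.
- by rewrite Ak -?ij// Bk -?ij// !mulr0.
by rewrite AB// IHk// ?li.
Qed.

Lemma lvl_triX_diag (K : pzRingType) (N : nat) (lev : 'I_N -> nat) (A : 'M[K]_N) (a : 'I_N) k :
  lvl_tri lev A -> (forall i, lev i = lev a -> i = a) -> (A ^+ k) a a = A a a ^+ k.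
Proof.
move=> At aP; elim: k => [|k IHk]; first by rewrite !expr0 mxE eqxx.
rewrite !exprS mxE (bigD1 a)//= big1 ?addr0 ?IHk// => l la.
have [ll|ll|ll] := ltngtP (lev l) (lev a).
- by rewrite At// mul0r.
- by rewrite (lvl_triX k At)// mulr0.
- by move: la; rewrite (aP _ ll) eqxx.
Qed.

End LevelTriangular.

(** * Determinant and trace of two by two matrices *)

Section TwoByTwo.

Lemma det2 (K : comNzRingType) (M : 'M[K]_2) :
  \det M = M ord0 ord0 * M ord_max ord_max - M ord0 ord_max * M ord_max ord0.
Proof.
rewrite (expand_det_row _ ord0) !big_ord_recl big_ord0 addr0 /cofactor !det_mx11 !mxE /=.
have -> : lift ord0 ord0 = ord_max :> 'I_2 by apply/val_inj.
have -> : lift ord_max ord0 = ord0 :> 'I_2 by apply/val_inj.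
by rewrite /= addn0 addn1 expr0 expr1 mul1r mulN1r mulrN.
Qed.

Lemma tr2 (K : comNzRingType) (M : 'M[K]_2) : \tr M = M ord0 ord0 + M ord_max ord_max.
Proof.
rewrite /mxtrace !big_ord_recl big_ord0 addr0; congr (_ + M _ _); exact/val_inj.
Qed.

End TwoByTwo.

(** * Hyperbolicity read off from diagonal blocks *)

Section Hyperbolicity.
Context {R : realType}.
Local Notation C := R[i].

(** The left eigenvector equation at a level involves only this and lower levels. Once the lower
    ones vanish it is the equation of the diagonal block, so the eigenvector vanishes level by
    level. *)
Lemma hyperbolic_lvl (N : nat) (lev : 'I_N -> nat) (E : 'M[R]_N) :
  lvl_tri lev E ->
  (forall (l : nat) (z : C) (u : 'I_N -> C), complex.Re z = 0 ->
    (forall j, lev j = l -> \sum_(i | lev i == l) u i * (E i j)%:C%C = z * u j) ->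
    forall j, lev j = l -> u j = 0) ->
  hyperbolic_mx E.
Proof.
move=> Et El z /eigenvalueP[v vE v0]; apply: contra_neq v0 => z0.
have H (l : nat) : forall j, (lev j <= l)%N -> v 0 j = 0.
  have [n] := ubnP l; elim: n l => // n IHn l ln j jl.
  apply: (El (lev j) z (v 0) z0) => // j' jj'.
  move/rowP/(_ j'): vE; rewrite !mxE => <-.
  rewrite [RHS](bigID (fun i => lev i == lev j))/= [X in _ = _ + X]big1 ?addr0.
    by apply: eq_bigr => i _; rewrite mxE.
  move=> i ij; rewrite mxE.
  have [lt|gt|eq] := ltngtP (lev i) (lev j).
  - rewrite (IHn (lev i)) ?mul0r//.
    by rewrite (leq_trans _ (ln : (l <= n)%N))// (leq_trans lt).
  - by rewrite Et ?jj'//= mulr0.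
  - by rewrite eq eqxx in ij.
by apply/rowP => j; rewrite mxE; exact: H (leqnn _).
Qed.

Lemma hyperbolic_block (p q r s : R) (z u v : C) : complex.Re z = 0 ->
  p * s - q * r < 0 \/ 0 < p * s - q * r /\ p + s != 0 ->
  u * p%:C%C + v * r%:C%C = z * u -> u * q%:C%C + v * s%:C%C = z * v ->
  u = 0 /\ v = 0.
Proof.
case: z => x y /= -> H e1 e2.
(* The characteristic polynomial of the block at z = iy; multiplying the two equations by the
   adjugate gives w u = w v = 0. *)
pose w : C := ((- y ^+ 2 + (p * s - q * r)) +i* (- ((p + s) * y)))%C.
have w0 : w != 0.
  rewrite eq_complex/= negb_and oppr_eq0 mulf_eq0.
  case: H => [d0|[d0 /negPf ->]] /=.
    apply/orP; left; rewrite lt_eqF// .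
    by have := sqr_ge0 y; lra.
  have [->|y0] := eqVneq y 0; last by rewrite orbT.
  by rewrite expr0n/= oppr0 add0r (gt_eqF d0).
have wu : w * u = 0.
  case: u e1 e2 => u1 u2; case: v => v1 v2.
  move=> /eqP; rewrite eq_complex/= => /andP[/eqP a1 /eqP a2].
  move=> /eqP; rewrite eq_complex/= => /andP[/eqP b1 /eqP b2].
  apply/eqP; rewrite eq_complex/=; apply/andP; split; apply/eqP.
    move: (congr1 ( *%R y) a2) (congr1 ( *%R p) a1) (congr1 ( *%R r) b1) (congr1 ( *%R s) a1); lra.
  move: (congr1 ( *%R y) a1) (congr1 ( *%R p) a2) (congr1 ( *%R r) b2) (congr1 ( *%R s) a2); lra.
have wv : w * v = 0.
  case: u e1 e2 {wu} => u1 u2; case: v => v1 v2.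
  move=> /eqP; rewrite eq_complex/= => /andP[/eqP a1 /eqP a2].
  move=> /eqP; rewrite eq_complex/= => /andP[/eqP b1 /eqP b2].
  apply/eqP; rewrite eq_complex/=; apply/andP; split; apply/eqP.
    move: (congr1 ( *%R y) b2) (congr1 ( *%R q) a1) (congr1 ( *%R s) b1) (congr1 ( *%R p) b1); lra.
  move: (congr1 ( *%R y) b1) (congr1 ( *%R q) a2) (congr1 ( *%R s) b2) (congr1 ( *%R p) b2); lra.
by move: wu wv => /eqP; rewrite mulf_eq0 (negPf w0) => /eqP -> /eqP;
  rewrite mulf_eq0 (negPf w0) => /eqP ->.
Qed.

Lemma eigenvalue_det (F : fieldType) (N : nat) (A : 'M[F]_N) (z : F) :
  \det (A - z%:M) = 0 -> eigenvalue A z.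
Proof.
move=> d0; rewrite /eigenvalue /eigenspace kermx_eq0 row_free_unit unitmxE d0.
by rewrite unitr0.
Qed.

(** If det S > 0 and tr S = 0 there are eigenvalues on the axis, and 0 is one if det S = 0. In terms
    of det and tr the condition is visibly open and invariant under conjugation, as its transport
    requires. *)
Lemma hyperbolic_mx2 (S : 'M[R]_2) : hyperbolic_mx S ->
  \det S < 0 \/ 0 < \det S /\ \tr S != 0.
Proof.
move=> Sh; pose d := \det S; pose t := \tr S.
have detE (z : C) : \det (map_mx (real_complex R) S - z%:M) =
    z ^+ 2 - t%:C%C * z + d%:C%C.
  rewrite det2 !mxE /= /t /d det2 tr2.
  by rewrite !rmorphB !rmorphM !rmorphD/= !mulr1n !mulr0n; ring.
have [d0|d0|d0] := ltgtP (\det S) 0; first by left.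
  right; split => //; apply/negP => /eqP t0.
  have zE : eigenvalue (map_mx (real_complex R) S) (0 +i* Num.sqrt d)%C.
    apply: eigenvalue_det; rewrite detE /t t0 mul0r subr0.
    have sd : Num.sqrt d * Num.sqrt d = d by rewrite -expr2 sqr_sqrtr ?(ltW d0).
    by apply/eqP; rewrite expr2 eq_complex/= sd; apply/andP; split; apply/eqP; ring.
  by have := Sh _ zE; rewrite eqxx.
have zE : eigenvalue (map_mx (real_complex R) S) 0.
  by apply: eigenvalue_det; rewrite detE /d d0 expr0n/= mulr0 subr0 addr0.
by have := Sh _ zE; rewrite eqxx.
Qed.

End Hyperbolicity.

(** * Iterated directional derivatives *)

Section DirectionalDerivatives.
Context {R : realType} {E F : normedModType R}.
Implicit Types (U : set E) (f g : E -> F).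

Definition Dv (v : E) f : E -> F := fun x => 'D_v f x.

Lemma smooth_on_Dv U f v : smooth_on U f -> smooth_on U (Dv v f).
Proof. by move=> fs k; have [_] := fs k.+1; exact. Qed.

Lemma smooth_on_differentiable U f x : smooth_on U f -> U x -> differentiable f x.
Proof. by move=> fs; have [+ _] := fs 1%N; apply. Qed.

Lemma smooth_on_iterDv U f v k : smooth_on U f -> smooth_on U (iter k (Dv v) f).
Proof. by move=> fs; elim: k => //= k; exact: smooth_on_Dv. Qed.

Lemma Dv_eq U f g v : open U -> (forall x, U x -> f x = g x) ->
  forall x, U x -> Dv v f x = Dv v g x.
Proof.
move=> Uo fg x Ux; apply: near_eq_derive; exact: open_near_eq Uo Ux fg.
Qed.

Lemma iterDv_eq U f g v k : open U -> (forall x, U x -> f x = g x) ->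
  forall x, U x -> iter k (Dv v) f x = iter k (Dv v) g x.
Proof. by move=> Uo fg; elim: k => //= k IHk; exact: Dv_eq. Qed.

Lemma Dv_sum U (I : Type) (r : seq I) (c : I -> R) (f : I -> E -> F) v :
  (forall i, smooth_on U (f i)) -> forall x, U x ->
  Dv v (fun y => \sum_(i <- r) c i *: f i y) x = \sum_(i <- r) c i *: Dv v (f i) x.
Proof.
move=> fs x Ux.
have fd i : derivable (f i) x v by apply/diff_derivable/(smooth_on_differentiable (fs i)).
suff : is_derive x v (fun y => \sum_(i <- r) c i *: f i y) (\sum_(i <- r) c i *: Dv v (f i) x).
  by case.
elim: r => [|i r IHr].
  by rewrite big_nil; under eq_fun do rewrite big_nil; exact: is_derive_cst.
rewrite big_cons; under eq_fun do rewrite big_cons.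
apply: is_deriveD IHr; apply: is_deriveZ.
exact: derivableP (fd i).
Qed.

Lemma iterDv_sum U (I : Type) (r : seq I) (c : I -> R) (f : I -> E -> F) v k :
  open U -> (forall i, smooth_on U (f i)) -> forall x, U x ->
  iter k (Dv v) (fun y => \sum_(i <- r) c i *: f i y) x =
  \sum_(i <- r) c i *: iter k (Dv v) (f i) x.
Proof.
move=> Uo; elim: k f => //= k IHk f fs x Ux.
rewrite (Dv_eq v Uo (IHk f fs) Ux).
exact: (Dv_sum r c v (fun i => smooth_on_iterDv v k (fs i)) Ux).
Qed.

Lemma iterDv_scale U (c : R) f v k : open U -> smooth_on U f -> forall x, U x ->
  iter k (Dv v) (fun y => c *: f y) x = c *: iter k (Dv v) f x.
Proof.
move=> Uo fs x Ux.
have := @iterDv_sum U unit [:: tt] (fun=> c) (fun=> f) v k Uo (fun=> fs) x Ux.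
rewrite big_seq1 => <-; congr (iter k (Dv v) _ x).
by apply/funext => y; rewrite big_seq1.
Qed.

Lemma Dv_dir_sum (I : Type) (r : seq I) (c : I -> R) (v : I -> E) f x :
  differentiable f x ->
  Dv (\sum_(i <- r) c i *: v i) f x = \sum_(i <- r) c i *: Dv (v i) f x.
Proof.
move=> fd; rewrite /Dv deriveE// linear_sum.
by apply: eq_bigr => i _; rewrite linearZ/= deriveE.
Qed.

Lemma is_derive_line f (x u : E) (t : R) : derivable f (t *: u + x) u ->
  is_derive t (1 : R) (fun s => f (s *: u + x)) ('D_u f (t *: u + x)).
Proof.
move=> fd; apply: is_derive_cvg.
have -> : (fun h : R => h^-1 *: (f ((h + t) *: u + x) - f (t *: u + x))) =
    (fun h : R => h^-1 *: (f (h *: u + (t *: u + x)) - f (t *: u + x))).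
  by apply/funext => h; rewrite scalerDl addrA.
exact: fd.
Qed.

End DirectionalDerivatives.

Section Coordinates.
Context {R : realType} {E : normedModType R}.

Lemma coord_continuous_at (m p : nat) (T : topologicalType) (g : T -> 'M[R]_(m, p)) x i j :
  {for x, continuous g} -> {for x, continuous (fun y => g y i j)}.
Proof.
move=> gc; apply: (@continuous_comp _ _ _ g (fun M : 'M[R]_(m, p) => M i j)) => //.
exact: coord_continuous.
Qed.

Lemma is_derive_coord (m p : nat) (g : E -> 'M[R]_(m, p)) (x v : E) dg i j :
  is_derive x v g dg -> is_derive x v (fun y => g y i j) (dg i j).
Proof.
move=> [gd <-]; rewrite derive_mx// mxE.
by apply: derivableP; move/derivable_mxP: gd; exact.
Qed.

Lemma is_derive_mx (m p : nat) (g : E -> 'M[R]_(m, p)) (x v : E) (dg : 'M[R]_(m, p)) :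
  (forall i j, is_derive x v (fun y => g y i j) (dg i j)) -> is_derive x v g dg.
Proof.
move=> gd.
have gd' : derivable g x v by apply/derivable_mxP => i j; have [] := gd i j.
apply: DeriveDef => //; apply/matrixP => i j; rewrite derive_mx// mxE.
by have [] := gd i j.
Qed.

End Coordinates.

(** * Symmetry of second derivatives *)

Section Schwarz.
Context {R : realType} {E : normedModType R}.

Lemma dist_le_of_common (e a a' w w' : R) :
  w = w' -> `|a - w| <= e / 2 -> `|a' - w'| <= e / 2 -> `|a' - a| <= e.
Proof.
by move=> ->; rewrite !ler_norml => /andP[b1 b2] /andP[b3 b4]; apply/andP; split; lra.
Qed.

(** The second difference over a small square is evaluated by two mean value theorems in either
    order, which gives equal values of the two mixed derivatives at two points of the square; their
    continuity at x concludes. *)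
Lemma Dv_comm (m p : nat) (U : set E) (f : E -> 'M[R]_(m, p)) (u v : E) (x : E) :
  open U -> smooth_on U f -> U x -> Dv u (Dv v f) x = Dv v (Dv u f) x.
Proof.
move=> Uo fs Ux; apply/matrixP => i j.
have fus := smooth_on_Dv u fs; have fvs := smooth_on_Dv v fs.
have fuc : {for x, continuous (fun y => Dv v (Dv u f) y i j)}.
  apply: coord_continuous_at; apply: differentiable_continuous; apply: smooth_on_differentiable Ux.
  exact: smooth_on_Dv.
have fvc : {for x, continuous (fun y => Dv u (Dv v f) y i j)}.
  apply: coord_continuous_at; apply: differentiable_continuous; apply: smooth_on_differentiable Ux.
  exact: smooth_on_Dv.
have line : s.1 *: u + (s.2 *: v + x) @[s --> ((0 : R), (0 : R))] --> x.
  rewrite -[X in _ --> X]add0r -[X in _ --> _ + X]add0r.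
  rewrite -{1}(scale0r u) -(scale0r v).
  apply: cvgD; first by apply: cvgZr_tmp; exact: cvg_fst.
  apply: cvgD; last exact: cvg_cst.
  by apply: cvgZr_tmp; exact: cvg_snd.
apply/eqP; rewrite -subr_eq0 -normr_le0; apply/ler_addgt0Pl => e e0; rewrite addr0.
have e20 : 0 < e / 2 by rewrite divr_gt0.
have near_all : \forall s \near ((0 : R), (0 : R)),
   [/\ U (s.1 *: u + (s.2 *: v + x)),
    `|Dv v (Dv u f) x i j - Dv v (Dv u f) (s.1 *: u + (s.2 *: v + x)) i j| <= e / 2 &
    `|Dv u (Dv v f) x i j - Dv u (Dv v f) (s.1 *: u + (s.2 *: v + x)) i j| <= e / 2].
  have h1 : \forall s \near ((0 : R), (0 : R)), U (s.1 *: u + (s.2 *: v + x)).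
    by apply: line; apply: open_nbhs_nbhs; split.
  have h2 : \forall s \near ((0 : R), (0 : R)),
      `|Dv v (Dv u f) x i j - Dv v (Dv u f) (s.1 *: u + (s.2 *: v + x)) i j| <= e / 2.
    have c := cvg_comp _ _ line fuc.
    by move/cvgrPdist_le: c => /(_ _ e20).
  have h3 : \forall s \near ((0 : R), (0 : R)),
      `|Dv u (Dv v f) x i j - Dv u (Dv v f) (s.1 *: u + (s.2 *: v + x)) i j| <= e / 2.
    have c := cvg_comp _ _ line fvc.
    by move/cvgrPdist_le: c => /(_ _ e20).
  apply: (@filterS3 _ _ _ _ _ _ _ _ h1 h2 h3) => s Us hs1 hs2; split; assumption.
have [r /= r0 rP] := (nbhs_ballP _ _).1 near_all.
pose h := r / 2.
have h0 : 0 < h by rewrite divr_gt0.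
have hr : h < r by rewrite /h; lra.
have box (s t : R) : 0 <= s <= h -> 0 <= t <= h ->
   [/\ U (s *: u + (t *: v + x)),
    `|Dv v (Dv u f) x i j - Dv v (Dv u f) (s *: u + (t *: v + x)) i j| <= e / 2 &
    `|Dv u (Dv v f) x i j - Dv u (Dv v f) (s *: u + (t *: v + x)) i j| <= e / 2].
  move=> /andP[s0 sh] /andP[t0 th]; apply: (rP (s, t)).
  split; rewrite /= /ball/= sub0r normrN ger0_norm//.
    exact: le_lt_trans sh hr.
  exact: le_lt_trans th hr.
have mvt (g dg : R -> R) : (forall s, 0 <= s <= h -> is_derive s (1 : R) g (dg s)) ->
    exists2 c, 0 <= c <= h & g h - g 0 = dg c * h.
  move=> gd.
  have [||c] := @MVT_segment R g dg 0 h (ltW h0).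
  - move=> s; rewrite in_itv/= => /andP[s0 sh]; apply: gd.
    by rewrite (ltW s0) (ltW sh).
  - apply: continuous_in_subspaceT => s; rewrite inE /= in_itv/= => sP.
    by apply: is_derive1_continuous; exact: gd.
  by rewrite in_itv/= subr0 => cP ->; exists c.
have line_u t (g : E -> 'M[R]_(m, p)) : 0 <= t <= h -> smooth_on U g ->
    forall s, 0 <= s <= h -> is_derive s (1 : R) (fun s => g (s *: u + (t *: v + x)) i j)
      (Dv u g (s *: u + (t *: v + x)) i j).
  move=> tP gs s sP; apply: is_derive_coord; apply: is_derive_line; apply: diff_derivable.
  by apply: (smooth_on_differentiable gs); have [] := box s t sP tP.
have line_v s (g : E -> 'M[R]_(m, p)) : 0 <= s <= h -> smooth_on U g ->
    forall t, 0 <= t <= h -> is_derive t (1 : R) (fun t => g (s *: u + (t *: v + x)) i j)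
      (Dv v g (s *: u + (t *: v + x)) i j).
  move=> sP gs t tP.
  have -> : (fun t => g (s *: u + (t *: v + x)) i j) = (fun t => g (t *: v + (s *: u + x)) i j).
    by apply/funext => y; rewrite addrCA.
  rewrite addrCA; apply: is_derive_coord; apply: is_derive_line; apply: diff_derivable.
  apply: (smooth_on_differentiable gs); rewrite addrCA.
  by have [] := box s t sP tP.
have hP : 0 <= h <= h by rewrite (ltW h0) lexx.
have zP : (0 : R) <= 0 <= h by rewrite lexx (ltW h0).
pose P s t := f (s *: u + (t *: v + x)) i j.
pose Delta := P h h - P h 0 - P 0 h + P 0 0.
have [c1 c1P E1] : exists2 c, 0 <= c <= h &
    (P h h - P h 0) - (P 0 h - P 0 0) =
      (Dv u f (c *: u + (h *: v + x)) i j - Dv u f (c *: u + (0 *: v + x)) i j) * h.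
  apply: (mvt (fun s => P s h - P s 0)
    (fun s => Dv u f (s *: u + (h *: v + x)) i j - Dv u f (s *: u + (0 *: v + x)) i j)).
  by move=> s sP; apply: is_deriveB; apply: line_u.
have [c2 c2P E2] := mvt _ _ (line_v c1 (Dv u f) c1P fus).
have [d1 d1P G1] : exists2 c, 0 <= c <= h &
    (P h h - P 0 h) - (P h 0 - P 0 0) =
      (Dv v f (h *: u + (c *: v + x)) i j - Dv v f (0 *: u + (c *: v + x)) i j) * h.
  apply: (mvt (fun t => P h t - P 0 t)
    (fun t => Dv v f (h *: u + (t *: v + x)) i j - Dv v f (0 *: u + (t *: v + x)) i j)).
  by move=> t tP; apply: is_deriveB; apply: line_v.
have [d2 d2P G2] := mvt _ _ (line_u d1 (Dv v f) d1P fvs).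
(* Both sides times h^2 equal the second difference. *)
have EG : Dv v (Dv u f) (c1 *: u + (c2 *: v + x)) i j = Dv u (Dv v f) (d2 *: u + (d1 *: v + x)) i j.
  have hn : h != 0 by rewrite gt_eqF.
  apply: (mulIf hn); apply: (mulIf hn).
  transitivity ((P h h - P h 0) - (P 0 h - P 0 0)).
    by rewrite E1; congr (_ * h); exact: esym E2.
  transitivity ((P h h - P 0 h) - (P h 0 - P 0 0)); last first.
    by rewrite G1; congr (_ * h); exact: G2.
  by move: (P h h) (P h 0) (P 0 h) (P 0 0) => p1 p2 p3 p4; ring.
have [_ A1 _] := box c1 c2 c1P c2P; have [_ _ A2] := box d2 d1 d2P d1P.
exact: dist_le_of_common EG A1 A2.
Qed.

End Schwarz.

Lemma is_derive_pow {R : realType} (k : nat) (x : R) :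
  is_derive x (1 : R) (fun t : R => t ^+ k) (k%:R * x ^+ k.-1).
Proof.
apply: DeriveDef; first exact: exprn_derivable.
by rewrite exp_derive /GRing.scale/= mulr1.
Qed.

(** * Taylor truncations as polynomials *)

Section Truncation.
Context {R : realType} {n : nat}.
Local Notation V := 'rV[R]_2.
Local Notation W := 'M[R]_(n.+1, 2).
Local Notation ix := ('I_n.+1 * 'I_2)%type.

Definition pvars (p : W * R) (i : option ix) : R :=
  if i is Some ij then p.1 ij.1 ij.2 else p.2.

Lemma polynomial_pexpr (g : W * R -> R) : polynomial_fun g ->
  exists e : pexpr R (option ix), forall p, g p = ev e (pvars p).
Proof.
elim=> [c|i j||g1 g2 _ [e1 E1] _ [e2 E2]|g1 g2 _ [e1 E1] _ [e2 E2]].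
- by exists (PC c).
- by exists (PV (Some (i, j))).
- by exists (PV None).
- by exists (PA e1 e2) => p; rewrite E1 E2.
- by exists (PM e1 e2) => p; rewrite E1 E2.
Qed.

Definition evec (ij : ix) : W * R := (delta_mx ij.1 ij.2, 0).

Lemma pair_row_sum (X : W) : (X, 0) = \sum_ij X ij.1 ij.2 *: evec ij :> W * R.
Proof.
have fstE (r : seq ix) (F : ix -> W * R) :
    \sum_(i <- r) F i = (\sum_(i <- r) (F i).1, \sum_(i <- r) (F i).2).
  by elim: r => [|i r IHr]; rewrite ?big_nil// !big_cons IHr.
rewrite fstE/=; congr pair; last by rewrite big1// => i _; rewrite /= scaler0.
rewrite [LHS]matrix_sum_delta pair_bigA /=.
by apply: eq_bigr.
Qed.

Lemma dX_expand (h : W * R -> V) (x : W * R) (X : W) : differentiable h x ->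
  dX X h x = \sum_ij X ij.1 ij.2 *: Dv (evec ij) h x.
Proof. by move=> hd; rewrite /dX pair_row_sum -/(Dv _ h x) Dv_dir_sum. Qed.

(** One derivative in direction X is a combination of partial derivatives with coefficients X_ij,
    which are constants for the remaining derivatives; hence the induction on k for all h at
    once. *)
Lemma iter_dX_pexpr (U : set (W * R)) (h : W * R -> V) (x : W * R) k j :
  open U -> smooth_on U h -> U x ->
  exists e : pexpr R ix, forall X, iter k (dX X) h x ord0 j = ev e (fun ij => X ij.1 ij.2).
Proof.
move=> Uo hs Ux; elim: k h hs => [|k IHk] h hs.
  by exists (PC (h x ord0 j)).
have /choice[e eP] ij : exists e : pexpr R ix, forall X,
    iter k (dX X) (Dv (evec ij) h) x ord0 j = ev e (fun ij => X ij.1 ij.2).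
  exact: IHk (smooth_on_Dv _ hs).
exists (psum [seq PM (PV ij) (e ij) | ij <- index_enum ix]) => X.
rewrite iterSr ev_psum big_map.
rewrite (@iterDv_eq _ _ _ U _ (fun y => \sum_ij X ij.1 ij.2 *: Dv (evec ij) h y) _ _ Uo)//.
  rewrite (@iterDv_sum _ _ _ U _ _ (fun ij => X ij.1 ij.2) (fun ij => Dv (evec ij) h))//.
    by rewrite summxE; apply: eq_bigr => ij _; rewrite mxE /= -eP.
  by move=> ij; exact: smooth_on_Dv.
by move=> y Uy; apply: dX_expand; exact: smooth_on_differentiable hs Uy.
Qed.

Lemma iter_dX_scale (U : set (W * R)) (h : W * R -> V) (x : W * R) k (t : R) (X Y : W) :
  Y = t *: X -> open U -> smooth_on U h -> U x ->
  iter k (dX Y) h x = t ^+ k *: iter k (dX X) h x.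
Proof.
move=> YX Uo hs Ux.
have YX' : (Y, 0) = t *: (X, 0) :> W * R by rewrite YX; congr pair; rewrite /= scaler0.
clear YX; elim: k h hs => [|k IHk] h hs; first exact: esym (scale1r (h x)).
have E y : U y -> dX Y h y = t *: dX X h y.
  move=> Uy; have hd := smooth_on_differentiable hs Uy.
  by rewrite /dX !deriveE// YX' linearZ.
have e1 := congr1 (@^~ x) (iterSr k (dX Y) h).
have e2 := @iterDv_eq _ _ _ U _ (fun y => t *: dX X h y) (Y, 0) k Uo E x Ux.
have e3 := @iterDv_scale _ _ _ U t (dX X h) (Y, 0) k Uo (smooth_on_Dv _ hs) x Ux.
have e4 := congr1 ( *:%R t) (IHk _ (smooth_on_Dv (X, 0) hs)).
have e5 := congr1 (fun F => t ^+ k.+1 *: F x) (iterSr k (dX X) h).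
have e6 : t *: (t ^+ k *: iter k (dX X) (dX X h) x) = t ^+ k.+1 *: iter k (dX X) (dX X h) x.
  by move: (iter k (dX X) (dX X h) x) => z; rewrite scalerA -exprS.
exact: (etrans e1 (etrans e2 (etrans e3 (etrans e4 (etrans e6 (esym e5)))))).
Qed.

Variables (U : set (W * R)) (fhat fbar : W * R -> V) (r1 r2 : nat).
Hypothesis Uo : open U.
Hypothesis U0 : U (0, 0).
Hypothesis fs : smooth_on U fhat.
Hypothesis fbarE : forall p, fbar p =
  \sum_(k < r1.+1) \sum_(l < r2.+1) taylor_part fhat k l p.

Lemma fbar_pexpr : exists e : 'I_2 -> pexpr R (option ix),
  forall p j, fbar p ord0 j = ev (e j) (pvars p).
Proof.
suff /choice[e eP] j : exists e : pexpr R (option ix),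
    forall p, fbar p ord0 j = ev e (pvars p) by exists e.
have /choice[e eP] (kl : 'I_r1.+1 * 'I_r2.+1) : exists e : pexpr R (option ix),
    forall p, taylor_part fhat kl.1 kl.2 p ord0 j = ev e (pvars p).
  have [e eP] := iter_dX_pexpr kl.1.+1 j Uo
    (smooth_on_iterDv ((0, 1) : W * R) kl.2 fs) U0.
  exists (PM (PM (PC ((kl.1.+1)`!%:R^-1 * (kl.2`!)%:R^-1)) (ppow (PV None) kl.2))
    (psubst (fun ij => PV (Some ij)) e)) => p.
  rewrite /taylor_part mxE /= ev_ppow ev_psubst/=; congr (_ * _).
  exact: eP.
exists (psum [seq e kl | kl <- index_enum ('I_r1.+1 * 'I_r2.+1)%type]) => p.
rewrite ev_psum big_map fbarE pair_bigA summxE.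
by apply: eq_bigr => kl _; rewrite -eP.
Qed.

(** On the line t X the part of degree k + 1 is a multiple of t^(k+1), so only k = 0 contributes at
    t = 0. *)
Lemma fbar_dX X lam : is_derive ((0, lam) : W * R) ((X, 0) : W * R) fbar
  (\sum_(l < r2.+1) ((l`!)%:R^-1 * lam ^+ l) *: dX X (iter l dlam fhat) (0, 0)).
Proof.
pose c k : V := \sum_(l < r2.+1)
  ((k.+1)`!%:R^-1 * (l`!)%:R^-1 * lam ^+ l) *: iter k.+1 (dX X) (iter l dlam fhat) (0, 0).
have fE t : fbar (t *: X, lam) = \sum_(k < r1.+1) t ^+ k.+1 *: c k.
  rewrite fbarE; apply: eq_bigr => k _; rewrite scaler_sumr; apply: eq_bigr => l _.
  rewrite /taylor_part (iter_dX_scale k.+1 erefl Uo (smooth_on_iterDv ((0, 1) : W * R) l fs) U0).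
  by rewrite !scalerA mulrC.
have d1 : is_derive (0 : R) (1 : R) (fun t => fbar (t *: X, lam)) (c 0%N).
  have -> : (fun t => fbar (t *: X, lam)) = \sum_(k < r1.+1) (fun t => t ^+ k.+1 *: c k).
    by apply/funext => t; rewrite fE fct_sumE.
  have h (k : 'I_r1.+1) : is_derive (0 : R) (1 : R) (fun t : R => t ^+ k.+1 *: c k)
      ((k == ord0)%:R *: c k).
    apply: is_derive_mx => i j.
    have -> : (fun t : R => (t ^+ k.+1 *: c k) i j) = (fun t : R => t ^+ k.+1 * c k i j).
      by apply/funext => t; rewrite mxE.
    rewrite mxE.
    have h1 : is_derive (0 : R) (1 : R) (fun t : R => t ^+ k.+1) ((k == ord0)%:R).
      apply: (is_derive_eq (is_derive_pow k.+1 0)); rewrite expr0n.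
      have -> : (k == ord0) = (nat_of_ord k == 0%N) by [].
      by case: (nat_of_ord k) => [|k'] /=; rewrite ?mulr1// mulr0.
    by apply: (is_derive_eq (is_deriveM h1 (is_derive_cst (c k i j) (0 : R) (1 : R)))); rewrite /GRing.scale/= mulr0 add0r mulrC.
  apply: (is_derive_eq (is_derive_sum h)); rewrite (bigD1 ord0)//= scale1r big1 ?addr0// => k /negPf ->.
  by rewrite scale0r.
have -> : \sum_(l < r2.+1) ((l`!)%:R^-1 * lam ^+ l) *: dX X (iter l dlam fhat) (0, 0) = c 0%N.
  by apply: eq_bigr => l _; rewrite (_ : 1`!%N = 1%N)// invr1 mul1r.
have cv := is_derive_cvgP d1.
have cv' : h^-1 *: (fbar (h *: ((X, 0) : W * R) + (0, lam)) - fbar (0, lam)) @[h --> (0 : R)^']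
    --> c 0%N.
  move: cv; rewrite scale0r.
  have -> // : (fun h : R => h^-1 *: (fbar ((h + 0) *: X, lam) - fbar (0, lam))) =
    (fun h : R => h^-1 *: (fbar (h *: ((X, 0) : W * R) + (0, lam)) - fbar (0, lam))).
  apply/funext => h; congr (_ *: (fbar _ - _)).
  by rewrite addr0; congr pair; rewrite /= ?addr0// scaler0 add0r.
by apply: DeriveDef; [apply/cvg_ex; exists (c 0%N)|exact: cvg_lim cv'].
Qed.

Lemma fbar0 lam : fbar (0, lam) = 0.
Proof.
rewrite fbarE big1// => k _; rewrite big1// => l _.
rewrite /taylor_part /=.
have -> : dX (0 : W) = Dv (0 : W * R) by [].
by rewrite /Dv derive0 scaler0.
Qed.

Lemma fbar_dX0 X : 'D_(X, 0) fbar (0, 0) = 'D_(X, 0) fhat (0, 0).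
Proof.
have [_ ->] := fbar_dX X 0.
rewrite big_ord_recl /= expr0 fact0 invr1 mulr1 scale1r big1 ?addr0// => l _.
by rewrite /= exprS mul0r mulr0 scale0r.
Qed.

(** Since r2 >= 1 the truncation keeps the terms linear in lambda, which carry the speed of the
    eigenvalue crossing. [taylor_part] differentiates in lambda first, whence [Dv_comm]. *)
Lemma fbar_dX_dlam X j : (1 <= r2)%N ->
  is_derive (0 : R) (1 : R) (fun lam => ('D_(X, 0) fbar (0, lam)) ord0 j)
    (dlam (dX X fhat) (0, 0) ord0 j).
Proof.
move=> r2_gt0.
pose a (l : nat) := (l`!)%:R^-1 * (dX X (iter l dlam fhat) (0, 0)) ord0 j.
have -> : (fun lam => ('D_(X, 0) fbar (0, lam)) ord0 j) =
    \sum_(l < r2.+1) (fun lam : R => lam ^+ l * a l).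
  apply/funext => lam; have [_ ->] := fbar_dX X lam.
  rewrite fct_sumE summxE; apply: eq_bigr => l _; rewrite mxE /a.
  by rewrite mulrA [_ * lam ^+ _]mulrC.
have h (l : 'I_r2.+1) : is_derive (0 : R) (1 : R) (fun lam : R => lam ^+ l * a l)
    ((nat_of_ord l == 1%N)%:R * a l).
  have h1 : is_derive (0 : R) (1 : R) (fun t : R => t ^+ l) ((nat_of_ord l == 1%N)%:R).
    case: (nat_of_ord l) => [|[|k]] /=.
    - by under eq_fun do rewrite expr0; exact: is_derive_cst.
    - exact: is_derive_id.
    by apply: (is_derive_eq (is_derive_pow k.+2 0)); rewrite expr0n/= mulr0.
  by apply: (is_derive_eq (is_deriveM h1 (is_derive_cst (a l) (0 : R) (1 : R)))); rewrite /GRing.scale/= mulr0 add0r mulrC.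
apply: (is_derive_eq (is_derive_sum h)).
have r2lt : (1 < r2.+1)%N by [].
rewrite (bigD1 (Ordinal r2lt))//= mul1r big1 ?addr0.
  rewrite /a (_ : 1`!%N = 1%N)// invr1 mul1r /=.
  have E : dX X (dlam fhat) (0, 0) = dlam (dX X fhat) (0, 0).
    by apply: Dv_comm U0.
  by rewrite E.
move=> l; rewrite -val_eqE /= => /negPf ->.
by rewrite mul0r.
Qed.

End Truncation.

(** * Gronwall's inequality *)

Section Gronwall.
Context {R : realType}.

(** Q e^(-kt) is nonincreasing. *)
Lemma gronwall (Q dQ : R -> R) (k T : R) : 0 <= T ->
  (forall t : R, 0 <= t <= T -> is_derive t (1 : R) Q (dQ t)) ->
  (forall t : R, 0 < t < T -> dQ t <= k * Q t) ->
  Q T <= Q 0 * expR (k * T).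
Proof.
move=> T0 Qd Qk.
pose g t := Q t * expR (- (k * t)).
have gd (t : R) : 0 <= t <= T ->
    is_derive t (1 : R) g ((dQ t - k * Q t) * expR (- (k * t))).
  move=> tT.
  have e1 : is_derive t (1 : R) (fun t => - (k * t)) (- k).
    by apply: is_derive_eq; rewrite /GRing.scale/= mulr1.
  have e2 : is_derive t (1 : R) (fun t => expR (- (k * t))) (expR (- (k * t)) * - k).
    exact: (@is_derive1_comp _ expR (fun t => - (k * t)) t _ _ (is_derive_expR _) e1).
  apply: (is_derive_eq (is_deriveM (Qd t tT) e2)).
  by rewrite /GRing.scale/=; ring.
have cg : {within `[0, T], continuous g}.
  apply: continuous_in_subspaceT => t; rewrite inE /= in_itv/= => tT.
  exact: is_derive1_continuous (gd t tT).
have gT : g T <= g 0.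
  apply: (@ler0_derive1_nincr R g 0 T) => //.
    move=> t; rewrite in_itv/= => /andP[t0 tT]; have [|//] := gd t _.
    by rewrite (ltW t0) (ltW tT).
  move=> t; rewrite in_itv/= => /andP[t0 tT]; rewrite derive1E.
  have [|_ ->] := gd t _; first by rewrite (ltW t0) (ltW tT).
  rewrite mulr_le0_ge0 ?expR_ge0// subr_le0; apply: Qk.
  by rewrite t0 tT.
have g0 : g 0 = Q 0 by rewrite /g mulr0 oppr0 expR0 mulr1.
by rewrite -ler_pdivrMr ?expR_gt0// -expRN -g0.
Qed.

(** The differential inequality is known only while Q < rho. Up to and including the first time at
    which Q could reach rho, the bound Q(0) e^k < rho holds; by continuity there is no such time. *)
Lemma gronwall_bootstrap (Q dQ : R -> R) (k rho : R) : 0 <= k ->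
  (forall t : R, 0 <= t <= 1 -> 0 <= Q t) ->
  (forall t : R, 0 <= t <= 1 -> is_derive t (1 : R) Q (dQ t)) ->
  (forall t : R, 0 <= t <= 1 -> Q t < rho -> dQ t <= k * Q t) ->
  Q 0 * expR k < rho ->
  forall t : R, 0 <= t <= 1 -> Q t <= Q 0 * expR k /\ Q t < rho.
Proof.
move=> k0 Q0 Qd Qk small.
have est (t : R) : 0 <= t <= 1 -> (forall s : R, 0 < s < t -> Q s < rho) -> Q t <= Q 0 * expR k.
  move=> /andP[t0 t1] Qs.
  have h : Q t <= Q 0 * expR (k * t).
    apply: (@gronwall Q dQ k t t0).
    - by move=> s /andP[s0 st]; apply: Qd; rewrite s0 (le_trans st).
    - move=> s /andP[s0 st]; apply: Qk; last by apply: Qs; rewrite s0 st.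
      by rewrite (ltW s0) (ltW (lt_le_trans st t1)).
  rewrite (le_trans h)// ler_wpM2l ?Q0 ?lexx ?ler01// ler_expR.
  by rewrite -[leRHS]mulr1 ler_wpM2l.
suff all (t : R) : 0 <= t <= 1 -> Q t < rho.
  move=> t tP; split; last exact: all.
  apply: est => // s /andP[s0 st]; apply: all.
  by move: tP => /andP[_ t1]; rewrite (ltW s0) (ltW (lt_le_trans st t1)).
move=> tP; rewrite ltNge; apply/negP => Qt.
pose K := [set s : R | 0 <= s <= 1 /\ rho <= Q s].
have Kt : K t by [].
have K0 : lbound K 0 by move=> s [/andP[]].
have Kinf : has_inf K by split; [by exists t|by exists 0].
pose m := inf K.
have m0 : 0 <= m by apply: lb_le_inf => //; exists t.
have m1 : m <= 1.
  by apply: (@le_trans _ _ t); [apply: ge_inf Kt; exists 0|case/andP: tP].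
have mP : 0 <= m <= 1 by rewrite m0 m1.
have Qm : Q m < rho.
  apply: le_lt_trans small; apply: est => // s /andP[s0 sm].
  rewrite ltNge; apply/negP => sr; have : m <= s.
    apply: ge_inf; first by exists 0.
    by split; first by rewrite (ltW s0) (ltW (lt_le_trans sm m1)).
  by rewrite leNgt sm.
have Qc := is_derive1_continuous (Qd m mP).
have : \forall s \near m, Q s < rho by exact: (cvgr_lt _ Qc _ Qm).
move=> /nbhs_ballP[e /= e0 eP].
have [s Ks sm] := inf_adherent e0 Kinf.
have ms : m <= s by apply: ge_inf => //; exists 0.
have : Q s < rho.
  by apply: eP; rewrite /ball/= ltr_norml; move: ms sm; rewrite -/m; lra.
by case: Ks => _; rewrite leNgt => /negP.
Qed.

End Gronwall.

(** * Strict differentiability of time-one flows at an equilibrium *)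

Section FlowLinearization.
Context {R : realType} {N : nat}.
Implicit Types (x y : 'rV[R]_N).

(** Unlike the maximum norm, the squared Euclidean norm is differentiable along solutions;
    [norm_sqn] and [sqn_norm] compare the two. *)
Definition sqn x : R := \sum_i x ord0 i ^+ 2.

Lemma sqn_ge0 x : 0 <= sqn x.
Proof. by apply: sumr_ge0 => i _; exact: sqr_ge0. Qed.

Lemma norm_sqn x : `|x| ^+ 2 <= sqn x.
Proof.
have [->|x0] := eqVneq x 0; first by rewrite normr0 expr0n sqn_ge0.
have xn : mx_norm x != 0 by move: x0; rewrite -normr_eq0.
have [i iE] := mx_norm_neq0 xn.
have -> : `|x| = `|x ord0 i.2| by rewrite -[`|x|]/(mx_norm x) iE (ord1 i.1).
rewrite /sqn (bigD1 i.2)//= real_normK ?num_real// lerDl.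
by apply: sumr_ge0 => j _; exact: sqr_ge0.
Qed.

Lemma sqn_norm x : sqn x <= N%:R * `|x| ^+ 2.
Proof.
have -> : N%:R * `|x| ^+ 2 = \sum_(i < N) `|x| ^+ 2.
  by rewrite sumr_const card_ord mulr_natl.
apply: ler_sum => i _; rewrite -[x ord0 i ^+ 2]real_normK ?num_real//.
by rewrite lerXn2r ?nnegrE ?mx_entry_le.
Qed.

Variable E : 'I_N -> pexpr R 'I_N.
Definition pfield x : 'rV[R]_N := \row_i ev (E i) (x ord0).
(** The transpose of the usual Jacobian matrix at 0: row vectors are acted on from the right. *)
Definition pjac : 'M[R]_N := \matrix_(i, j) hd (E j) (fun=> 0) (fun=> 0) i.
Hypothesis pfield0 : pfield 0 = 0.

Definition ptime1 x y := exists c : R -> 'rV[R]_N, [/\ c 0 = x, c 1 = y &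
  forall t : R, 0 <= t <= 1 -> mderive c t (pfield (c t))].

Lemma hd_near (eta : R) : 0 < eta -> exists2 r, 0 < r & forall x y,
  `|x| < r -> `|y| < r -> forall i j, `|hd (E j) (x ord0) (y ord0) i - pjac i j| <= eta.
Proof.
move=> eta0.
pose z : 'rV[R]_N * 'rV[R]_N := (0, 0).
have f1 i : (fun t : 'rV[R]_N * 'rV[R]_N => t.1 ord0 i) @ z --> (0 : R).
  have p1 : (t : 'rV[R]_N * 'rV[R]_N).1 @[t --> z] --> z.1 by exact: cvg_fst.
  have := cvg_comp _ _ p1 (@coord_continuous _ _ _ ord0 i z.1).
  by rewrite /z /= mxE.
have f2 i : (fun t : 'rV[R]_N * 'rV[R]_N => t.2 ord0 i) @ z --> (0 : R).
  have p1 : (t : 'rV[R]_N * 'rV[R]_N).2 @[t --> z] --> z.2 by exact: cvg_snd.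
  have := cvg_comp _ _ p1 (@coord_continuous _ _ _ ord0 i z.2).
  by rewrite /z /= mxE.
have h (ij : 'I_N * 'I_N) : nbhs z (fun t : 'rV[R]_N * 'rV[R]_N =>
    `|hd (E ij.2) (t.1 ord0) (t.2 ord0) ij.1 - pjac ij.1 ij.2| <= eta).
  have H := hd_cvg (e := E ij.2) (i := ij.1) f1 f2.
  move/cvgrPdist_le : (H (nbhs_filter z)) => /(_ _ eta0); apply: filterS => t.
  by rewrite distrC mxE.
have [r /= r0 rP] := (nbhs_ballP _ _).1 (filter_forall (nbhs_filter z) h).
exists r => // x y xr yr i j.
apply: (rP (x, y) _ (i, j)); split; rewrite /= -ball_normE /ball_/= sub0r normrN//.
Qed.

Lemma pfieldB x y j : (pfield x - pfield y) ord0 j =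
  \sum_i hd (E j) (x ord0) (y ord0) i * (x - y) ord0 i.
Proof. by rewrite !mxE ev_hd; apply: eq_bigr => i _; rewrite !mxE. Qed.

Lemma mexp_bound (A : 'M[R]_N) : exists2 B, 0 <= B &
  forall t : R, 0 <= t <= 1 -> forall i j, `|mexp A (- t) i j| <= B.
Proof.
pose f t := \sum_i \sum_j mexp A (- t) i j ^+ 2.
have fc : continuous f.
  move=> t; apply: cvg_bigsum => i; apply: cvg_bigsum => j.
  have h1 : {for - t, continuous (fun t => mexp A t i j)}.
    exact: is_derive1_continuous (mexp_derive A (- t) i j).
  have h2 : {for t, continuous (fun t => mexp A (- t) i j)}.
    by apply: (@continuous_comp _ _ _ -%R (fun t => mexp A t i j)) => //; exact: opp_continuous.
  by under eq_fun do rewrite expr2; rewrite expr2; exact: cvgM.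
have [|c _ cP] := @EVT_max R f 0 1 ler01; first exact: continuous_subspaceT.
have f0 t i j : mexp A (- t) i j ^+ 2 <= f t.
  rewrite /f (bigD1 i)//= (bigD1 j)//= -addrA lerDl addr_ge0//.
    by apply: sumr_ge0 => ? _; exact: sqr_ge0.
  by apply: sumr_ge0 => ? _; apply: sumr_ge0 => ? _; exact: sqr_ge0.
exists (1 + f c).
  apply: addr_ge0 => //; apply: sumr_ge0 => ? _; apply: sumr_ge0 => ? _; exact: sqr_ge0.
move=> t tP i j; have := cP t; rewrite in_itv/= => /(_ tP) /(le_trans (f0 t i j)).
move: (mexp A (- t) i j) (f c) => a b ab.
have : `|a| <= 1 + a ^+ 2; last by move=> h; rewrite (le_trans h)// lerD2l.
rewrite ler_norml; apply/andP; split.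
  by have := sqr_ge0 (a + 1); rewrite sqrrD; have := sqr_ge0 a; lra.
by have := sqr_ge0 (a - 1); rewrite sqrrB; have := sqr_ge0 a; lra.
Qed.

Lemma mvt_bound (f df : R -> R) (M : R) :
  (forall t : R, 0 <= t <= 1 -> is_derive t (1 : R) f (df t)) ->
  (forall t : R, 0 <= t <= 1 -> `|df t| <= M) -> `|f 1 - f 0| <= M.
Proof.
move=> fd dM.
have [||c] := @MVT_segment R f df 0 1 ler01.
- move=> s; rewrite in_itv/= => /andP[s0 s1]; apply: fd.
  by rewrite (ltW s0) (ltW s1).
- apply: continuous_in_subspaceT => s; rewrite inE /= in_itv/= => sP.
  exact: is_derive1_continuous (fd s sP).
by rewrite in_itv/= subr0 mulr1 => cP ->; exact: dM.
Qed.

(** Uniformity over pairs x, y is what later controls differentials at points other than 0. By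
    divided differences the difference e of two solutions satisfies e' = e A + o(e), and Gronwall's
    inequality bounds e by a multiple of |x - y|. *)
Lemma ptime1_strict (eps : R) : 0 < eps -> exists2 delta, 0 < delta &
  forall x y x' y', `|x| < delta -> `|y| < delta -> ptime1 x x' -> ptime1 y y' ->
  `|x' - y' - (x - y) *m mexp pjac 1| <= eps * `|x - y|.
Proof.
move=> eps0.
pose A := pjac.
have [B B0 BP] := mexp_bound A.
pose B1 := `|mexp A 1|.
have B10 : 0 <= B1 by exact: normr_ge0.
have N0 : 0 <= N%:R :> R by exact: ler0n.
(* [K0] bounds the divided differences near 0, [k] is the resulting growth rate of the squared norm,
   and [Gf] the growth factor of the maximum norm up to time 1. *)
pose K0 := `|A| + 1.
have K00 : 0 <= K0 by rewrite addr_ge0.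
pose k := 2 * (N%:R * N%:R * K0).
have k0 : 0 <= k by rewrite mulr_ge0// mulr_ge0// mulr_ge0.
pose Gf := Num.sqrt (N%:R * expR k).
have Gf0 : 0 <= Gf by exact: sqrtr_ge0.
pose C := N%:R * B1 * (N%:R * B * (N%:R * Gf)).
have C0 : 0 <= C by rewrite !mulr_ge0.
pose eta := Num.min 1 (eps / (C + 1)).
have C10 : 0 < C + 1 by rewrite ltr_wpDl.
have eta0 : 0 < eta by rewrite lt_min ltr01 divr_gt0.
have [r r0 rP] := hd_near eta0.
have hdK x y i j : `|x| < r -> `|y| < r -> `|hd (E j) (x ord0) (y ord0) i| <= K0.
  move=> xr yr; have h := rP x y xr yr i j.
  rewrite -[hd _ _ _ _](subrK (A i j)) (le_trans (ler_normD _ _))// addrC lerD ?mx_entry_le//.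
  by rewrite (le_trans h)// ge_min lexx.
pose rho := r ^+ 2.
have sqn_lt x : sqn x < rho -> `|x| < r.
  move=> h; have := le_lt_trans (norm_sqn x) h.
  by rewrite /rho ltr_pXn2r// ?nnegrE ?normr_ge0 ?(ltW r0).
have dsq (c : R -> 'rV[R]_N) t D : mderive c t D ->
    is_derive t (1 : R) (fun t => sqn (c t)) (\sum_i 2 * (c t ord0 i * D ord0 i)).
  move=> cD; apply: is_derive_bigsum => i.
  have h := cD ord0 i.
  apply: (is_derive_eq (is_deriveX 2 h)).
  by rewrite /GRing.scale/= expr1; ring.
have growth (u v : 'rV[R]_N) (D : 'rV[R]_N) : `|u| < r -> `|v| < r ->
    D = pfield u - pfield v ->
    \sum_i 2 * ((u - v) ord0 i * D ord0 i) <= k * sqn (u - v).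
  move=> ur vr ->.
  have b j : `|(pfield u - pfield v) ord0 j| <= N%:R * K0 * `|u - v|.
    rewrite pfieldB (le_trans (ler_norm_sum _ _ _))//.
    apply: (@le_trans _ _ (\sum_(i < N) K0 * `|u - v|)).
      by apply: ler_sum => i _; rewrite normrM ler_pM ?hdK ?mx_entry_le.
    by rewrite sumr_const card_ord -mulrA mulr_natl.
  apply: (@le_trans _ _ (\sum_(i < N) 2 * (N%:R * K0) * `|u - v| ^+ 2)).
    apply: ler_sum => i _; rewrite -mulrA; apply: ler_wpM2l => //.
    rewrite (le_trans (ler_norm _))// normrM expr2 mulrA [leRHS]mulrC.
    by apply: ler_pM => //; rewrite ?mx_entry_le ?b.
  rewrite sumr_const card_ord -[_ *+ N]mulr_natl mulrA.
  have -> : N%:R * (2 * (N%:R * K0)) = k by rewrite /k; ring.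
  by apply: ler_wpM2l => //; exact: norm_sqn.
(* Solutions starting in the ball of radius [delta] stay in the ball of radius [r] up to time 1. *)
pose delta := Num.min r (r / (Gf + 1)).
have G10 : 0 < Gf + 1 by rewrite ltr_wpDl.
exists delta; first by rewrite lt_min r0 divr_gt0.
have stay x x' (c : R -> 'rV[R]_N) : `|x| < delta -> c 0 = x ->
    (forall t : R, 0 <= t <= 1 -> mderive c t (pfield (c t))) ->
    forall t : R, 0 <= t <= 1 -> `|c t| < r.
  move=> xd c0 cd t tP; apply: (sqn_lt).
  have small : sqn (c 0) * expR k < rho.
    rewrite c0 (le_lt_trans (y := N%:R * `|x| ^+ 2 * expR k))//.
      by rewrite ler_wpM2r ?expR_ge0// sqn_norm.
    have -> : N%:R * `|x| ^+ 2 * expR k = (Gf * `|x|) ^+ 2.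
      by rewrite exprMn sqr_sqrtr ?mulr_ge0 ?expR_ge0//; ring.
    rewrite ltr_pXn2r// ?nnegrE ?mulr_ge0// ?(ltW r0)//.
    have : `|x| < r / (Gf + 1) by rewrite (lt_le_trans xd)// ge_min lexx orbT.
    rewrite ltr_pdivlMr// => h; rewrite (le_lt_trans _ h)// mulrC ler_wpM2l//.
    by rewrite lerDl.
  have := @gronwall_bootstrap R (fun t => sqn (c t))
    (fun t => \sum_i 2 * (c t ord0 i * pfield (c t) ord0 i)) k rho k0
    (fun t _ => sqn_ge0 _) (fun t tP => dsq c t _ (cd t tP)).
  move=> /(_ _ small t tP) []// s sP sr.
  have cr := sqn_lt _ sr.
  have h := growth (c s) 0 (pfield (c s)) cr.
  by rewrite normr0 pfield0 !subr0 in h; exact: h.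
move=> x y x' y' xd yd [c [c0 c1 cd]] [d [d0 d1 dd]].
have cr := stay x x' c xd c0 cd; have dr := stay y y' d yd d0 dd.
pose e t := c t - d t.
have ed (t : R) : 0 <= t <= 1 -> mderive e t (pfield (c t) - pfield (d t)).
  move=> tP i j; rewrite !mxE.
  have -> : (fun s => e s i j) = (fun s => c s i j - d s i j).
    by apply/funext => s; rewrite !mxE.
  by have := is_deriveB (cd t tP i j) (dd t tP i j); rewrite !mxE.
have e0 : e 0 = x - y by rewrite /e c0 d0.
have es (t : R) : 0 <= t <= 1 -> `|e t| <= Gf * `|x - y|.
  move=> tP; move: (tP) => /andP[t0 t1].
  have sub (s : R) : 0 <= s <= t -> 0 <= s <= 1.
    by move=> /andP[s0 st]; rewrite s0 (le_trans st).
  have h := @gronwall R (fun t => sqn (e t))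
    (fun t => \sum_i 2 * (e t ord0 i * (pfield (c t) - pfield (d t)) ord0 i)) k t t0
    (fun s sP => dsq e s _ (ed s (sub s sP))).
  have {}h : sqn (e t) <= sqn (e 0) * expR (k * t).
    apply: h => s /andP[s0 st]; have sP : 0 <= s <= 1.
      by apply: sub; rewrite (ltW s0) (ltW st).
    by apply: growth; [exact: cr|exact: dr|].
  rewrite -(@ler_pXn2r _ 2)// ?nnegrE ?mulr_ge0//.
  apply: (le_trans (norm_sqn _)); apply: (le_trans h).
  have -> : (Gf * `|x - y|) ^+ 2 = N%:R * `|x - y| ^+ 2 * expR k.
    by rewrite exprMn sqr_sqrtr ?mulr_ge0 ?expR_ge0//; ring.
  rewrite e0; apply: ler_pM; [exact: sqn_ge0|exact: expR_ge0| |].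
    exact: (sqn_norm (x - y)).
  by rewrite ler_expR -[leRHS]mulr1 ler_wpM2l.
have rem (t : R) : 0 <= t <= 1 -> forall j,
    `|(pfield (c t) - pfield (d t) - e t *m A) ord0 j| <= N%:R * (eta * (Gf * `|x - y|)).
  move=> tP j; rewrite mxE pfieldB [X in _ + X]mxE [X in _ - X]mxE -sumrB.
  rewrite (le_trans (ler_norm_sum _ _ _))//.
  apply: (@le_trans _ _ (\sum_(i < N) eta * (Gf * `|x - y|))); last first.
    by rewrite sumr_const card_ord mulr_natl.
  apply: ler_sum => i _.
  have -> : hd (E j) (c t ord0) (d t ord0) i * (c t - d t) ord0 i - e t ord0 i * A i j =
      (hd (E j) (c t ord0) (d t ord0) i - A i j) * e t ord0 i by rewrite /e; ring.
  rewrite normrM; apply: ler_pM => //; first by apply: rP; [exact: cr|exact: dr].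
  exact: le_trans (mx_entry_le _ _ _) (es t tP).
(* Variation of constants: only the remainder of the linearization drives [z]. *)
pose z t := e t *m mexp A (- t).
have zd (t : R) : 0 <= t <= 1 ->
    mderive z t ((pfield (c t) - pfield (d t) - e t *m A) *m mexp A (- t)).
  move=> tP; have h : is_derive t (1 : R) (fun s : R => - s) (- 1) by exact: is_deriveNid.
  apply: mderive_eq (mderiveM (ed t tP) (mderive_comp (mexp_derive A _) h)).
  by rewrite scaleN1r mulmxN [RHS]mulmxBl -[in RHS]mulmxA mexp_comm.
pose M := N%:R * (N%:R * (eta * (Gf * `|x - y|)) * B).
have M0 : 0 <= M by rewrite !mulr_ge0// ltW.
have zB j : `|z 1 ord0 j - z 0 ord0 j| <= M.
  apply: (@mvt_bound (fun s => z s ord0 j)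
    (fun t => ((pfield (c t) - pfield (d t) - e t *m A) *m mexp A (- t)) ord0 j)).
    by move=> t tP; exact: zd.
  move=> t tP; rewrite mxE (le_trans (ler_norm_sum _ _ _))//.
  apply: (@le_trans _ _ (\sum_(i < N) N%:R * (eta * (Gf * `|x - y|)) * B)); last first.
    by rewrite sumr_const card_ord -[_ *+ N]mulr_natl.
  apply: ler_sum => i _; rewrite normrM; apply: ler_pM => //; first exact: rem.
  exact: BP.
have -> : x' - y' - (x - y) *m mexp pjac 1 = (z 1 - z 0) *m mexp A 1.
  rewrite [RHS]mulmxBl /z -!mulmxA !mexpD addNr oppr0 add0r mexp0 !mulmx1 -/A -e0.
  by rewrite /e c1 d1.
have CE : N%:R * B1 * M = C * (eta * `|x - y|) by rewrite /C /M; ring.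
apply: (@le_trans _ _ (C * (eta * `|x - y|))); last first.
  rewrite mulrA; apply: ler_wpM2r; first exact: normr_ge0.
  apply: (@le_trans _ _ ((C + 1) * eta)).
    by apply: ler_wpM2r; [exact: ltW|rewrite lerDl ler01].
  by rewrite mulrC -ler_pdivlMr// ge_min lexx orbT.
rewrite -CE; apply/mx_norm_leP; first by apply: mulr_ge0 => //; apply: mulr_ge0.
move=> i j; rewrite (ord1 i) mxE (le_trans (ler_norm_sum _ _ _))//.
apply: (@le_trans _ _ (\sum_(l < N) M * B1)).
  apply: ler_sum => l _; rewrite normrM; apply: ler_pM => //; last exact: mx_entry_le.
  by have := zB l; rewrite !mxE.
by rewrite sumr_const card_ord -[_ *+ N]mulr_natl [M * B1]mulrC mulrA.
Qed.

End FlowLinearization.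

(** * Block matrices over flattened index pairs *)

Section BlockIndices.
Context {m p : nat}.

Definition unidx (x : 'I_(m * p)) : 'I_m * 'I_p :=
  enum_val (cast_ord (esym (mxvec_cast m p)) x).

Lemma mxvec_indexK i j : unidx (mxvec_index i j) = (i, j).
Proof. by rewrite /unidx /mxvec_index cast_ordK enum_rankK. Qed.

Lemma unidxK x : mxvec_index (unidx x).1 (unidx x).2 = x.
Proof.
by rewrite /mxvec_index -surjective_pairing /unidx enum_valK cast_ordKV.
Qed.

(** In a network the first index is the node, and triangularity for [lev] says that no node depends
    on a later one. *)
Definition lev (x : 'I_(m * p)) : nat := (unidx x).1.

Lemma lev_index i j : lev (mxvec_index i j) = i.
Proof. by rewrite /lev mxvec_indexK. Qed.

Lemma sum_mxvec_index (V : nmodType) (F : 'I_(m * p) -> V) :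
  \sum_x F x = \sum_i \sum_j F (mxvec_index i j).
Proof.
rewrite pair_bigA /= (reindex (fun ij : 'I_m * 'I_p => mxvec_index ij.1 ij.2))//=.
by exists unidx => [[i j] _|x _] /=; [exact: mxvec_indexK|exact: unidxK].
Qed.

Definition blk {K : Type} (A : 'M[K]_(m * p)) (i j : 'I_m) : 'M[K]_p :=
  \matrix_(k, l) A (mxvec_index i k) (mxvec_index j l).

Lemma blkM (K : pzRingType) (A B : 'M[K]_(m * p)) i j :
  blk (A *m B) i j = \sum_l blk A i l *m blk B l j.
Proof.
apply/matrixP => k k'; rewrite summxE !mxE sum_mxvec_index; apply: eq_bigr => l _.
by rewrite mxE; apply: eq_bigr => q _; rewrite !mxE.
Qed.

Lemma blk1 (K : pzRingType) i : blk (1%:M : 'M[K]_(m * p)) i i = 1%:M.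
Proof.
apply/matrixP => k l; rewrite !mxE; congr (_%:R); congr nat_of_bool.
apply/eqP/eqP => [/(congr1 unidx)|->//].
by rewrite !mxvec_indexK => -[].
Qed.

Lemma lvl_tri_blk (K : pzRingType) (A : 'M[K]_(m * p)) (i j : 'I_m) :
  lvl_tri lev A -> (j < i)%N -> blk A i j = 0.
Proof. by move=> At ji; apply/matrixP => k l; rewrite !mxE At// !lev_index. Qed.

Lemma blk_diagM (K : pzRingType) (A B : 'M[K]_(m * p)) i :
  lvl_tri lev A -> lvl_tri lev B -> blk (A *m B) i i = blk A i i *m blk B i i.
Proof.
move=> At Bt; rewrite blkM (bigD1 i)//= big1 ?addr0// => l li.
have [lt|gt|/val_inj eq] := ltngtP l i.
- by rewrite (lvl_tri_blk At lt) mul0mx.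
- by rewrite (lvl_tri_blk Bt gt) mulmx0.
- by rewrite eq eqxx in li.
Qed.

Lemma lvl_tri_mexp (R : realType) (A : 'M[R]_(m * p)) t : lvl_tri lev A -> lvl_tri lev (mexp A t).
Proof.
move=> At x y yx; apply: mexp_entry0 => k.
exact: (lvl_triX k At).
Qed.

(** The block is the square of the corresponding block at t/2, which is invertible. Positivity,
    rather than invertibility, fixes the sign of the frequency in [conj_rotation]. *)
Lemma det_blk_mexp_gt0 (R : realType) (A : 'M[R]_(m * p)) i t : lvl_tri lev A ->
  0 < \det (blk (mexp A t) i i).
Proof.
move=> At.
have B2 s s' : blk (mexp A (s + s')) i i = blk (mexp A s) i i *m blk (mexp A s') i i.
  by rewrite -mexpD blk_diagM//; exact: lvl_tri_mexp.
have t2 : t = t / 2 + t / 2 by rewrite -splitr.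
rewrite t2 B2 det_mulmx -expr2 lt_def sqr_ge0 andbT sqrf_eq0.
have := B2 (t / 2) (- (t / 2)); rewrite subrr mexp0 blk1.
move/esym/(congr1 determinant); rewrite det_mulmx det1 => h.
by apply/eqP => d0; move/eqP: h; rewrite d0 mul0r eq_sym oner_eq0.
Qed.

Lemma norm_mxvec (R : realType) (X : 'M[R]_(m, p)) : `|mxvec X| = `|X|.
Proof.
apply/eqP; rewrite eq_le; apply/andP; split; apply/mx_norm_leP; rewrite ?normr_ge0//.
  by move=> i x; rewrite (ord1 i) -(unidxK x) mxvecE mx_entry_le.
by move=> i j; rewrite -mxvecE mx_entry_le.
Qed.

End BlockIndices.

Lemma norm_mulmx_le (R : realType) (N : nat) (x : 'rV[R]_N) (A : 'M[R]_N) :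
  `|x *m A| <= N%:R * `|A| * `|x|.
Proof.
apply/mx_norm_leP; first by rewrite !mulr_ge0.
move=> i j; rewrite mxE (le_trans (ler_norm_sum _ _ _))//.
apply: (@le_trans _ _ (\sum_(l < N) `|A| * `|x|)); last first.
  by rewrite sumr_const card_ord -mulrA -[_ *+ N]mulr_natl.
by apply: ler_sum => l _; rewrite normrM mulrC ler_pM ?mx_entry_le.
Qed.

(** * Compositions of time-one flows *)

Section FlowChains.
Context {R : realType} {N : nat}.
Variable E : nat -> 'I_N -> pexpr R 'I_N.
Hypothesis E0 : forall k, pfield (E k) 0 = 0.

(** A flow composition is given by its intermediate points and not by maps; hence sequences of
    points. *)
Definition pchain (m : nat) (z : nat -> 'rV[R]_N) :=
  forall k, (k < m)%N -> ptime1 (E k) (z k) (z k.+1).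

Fixpoint chain_mx (m : nat) : 'M[R]_N :=
  if m is m'.+1 then chain_mx m' *m mexp (pjac (E m')) 1 else 1%:M.

Lemma pchain0 m : pchain m (fun=> 0).
Proof.
move=> k _; exists (fun=> 0); split => // t _; rewrite E0; exact: mderive_cst.
Qed.

(** Chain rule for strict derivatives: half of [eps] pays for the last flow, half for the error of
    the first m flows propagated by its derivative. Comparison with the zero chain keeps the
    intermediate points small. *)
Lemma pchain_strict (m : nat) (eps : R) : 0 < eps -> exists2 delta, 0 < delta &
  forall z z', `|z 0%N| < delta -> `|z' 0%N| < delta -> pchain m z -> pchain m z' ->
  `|z m - z' m - (z 0%N - z' 0%N) *m chain_mx m| <= eps * `|z 0%N - z' 0%N|.
Proof.
elim: m eps => [|m IHm] eps eps0.
  exists 1 => // z z' _ _ _ _ /=; rewrite mulmx1 subrr normr0.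
  by rewrite mulr_ge0 ?(ltW eps0).
pose L := chain_mx m; pose M := mexp (pjac (E m)) 1.
pose nL := N%:R * `|L|; pose nM := N%:R * `|M|.
have nL0 : 0 <= nL by rewrite mulr_ge0.
have nM0 : 0 <= nM by rewrite mulr_ge0.
have nL1 : 0 < nL + 1 by rewrite ltr_wpDl.
have nM1 : 0 < nM + 1 by rewrite ltr_wpDl.
have e20 : 0 < eps / 2 by rewrite divr_gt0.
pose eps1 := Num.min 1 (eps / 2 / (nM + 1)).
have eps10 : 0 < eps1 by rewrite lt_min ltr01 divr_gt0.
have eps20 : 0 < eps / 2 / (nL + 1) by rewrite divr_gt0.
have [d1 d10 d1P] := IHm _ eps10.
have [d2 d20 d2P] := ptime1_strict (E0 m) eps20.
exists (Num.min d1 (d2 / (nL + 1))); first by rewrite lt_min d10 divr_gt0.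
move=> z z'; rewrite !lt_min => /andP[z1 z2] /andP[z'1 z'2] zc z'c.
have zcm : pchain m z by move=> k km; apply: zc; rewrite ltnS ltnW.
have z'cm : pchain m z' by move=> k km; apply: z'c; rewrite ltnS ltnW.
have growth (u v : nat -> 'rV[R]_N) : `|u 0%N| < d1 -> `|v 0%N| < d1 ->
    pchain m u -> pchain m v -> `|u m - v m| <= (nL + 1) * `|u 0%N - v 0%N|.
  move=> u1 v1 uc vc; have h := d1P u v u1 v1 uc vc.
  rewrite -(subrK ((u 0%N - v 0%N) *m L) (u m - v m)) (le_trans (ler_normD _ _))//.
  rewrite mulrDl addrC mul1r lerD//; first exact: norm_mulmx_le.
  rewrite (le_trans h)// -[leRHS]mul1r ler_wpM2r// ge_min lexx//.
have small u : `|u 0%N| < d1 -> `|u 0%N| < d2 / (nL + 1) -> pchain m u -> `|u m| < d2.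
  move=> u1 u2 uc.
  have z0 : `|(0 : 'rV[R]_N)| < d1 by rewrite normr0.
  have := growth u (fun=> 0) u1 z0 uc (@pchain0 m); rewrite !subr0 => h.
  by rewrite (le_lt_trans h)// mulrC -ltr_pdivlMr.
have h1 := d1P z z' z1 z'1 zcm z'cm.
have h2 := d2P _ _ _ _ (small z z1 z2 zcm) (small z' z'1 z'2 z'cm) (zc m (ltnSn m)) (z'c m (ltnSn m)).
have g := growth z z' z1 z'1 zcm z'cm.
rewrite /= -/L -/M.
have split_err (a b c : 'rV[R]_N) : a - c *m (L *m M) = (a - b *m M) + (b - c *m L) *m M.
  by rewrite mulmxBl mulmxA addrA subrK.
rewrite (split_err _ (z m - z' m)).
rewrite (le_trans (ler_normD _ _))//.
have -> : eps * `|z 0%N - z' 0%N| = eps / 2 * `|z 0%N - z' 0%N| + eps / 2 * `|z 0%N - z' 0%N|.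
  by rewrite -mulrDl -splitr.
apply: lerD.
  rewrite (le_trans h2)//.
  apply: (@le_trans _ _ (eps / 2 / (nL + 1) * ((nL + 1) * `|z 0%N - z' 0%N|))).
    by apply: ler_wpM2l g; exact: ltW.
  by rewrite mulrA divfK// gt_eqF.
rewrite (le_trans (norm_mulmx_le _ _))// -/nM.
apply: (@le_trans _ _ (nM * (eps1 * `|z 0%N - z' 0%N|))).
  exact: ler_wpM2l h1.
rewrite mulrA ler_wpM2r//.
apply: (@le_trans _ _ ((nM + 1) * eps1)).
  by apply: ler_wpM2r; [exact: ltW|rewrite lerDl ler01].
by rewrite mulrC -ler_pdivlMr// ge_min lexx orbT.
Qed.

End FlowChains.

(** * Network vector fields as polynomial fields *)

Section NetworkFlows.
Context {R : realType} {n : nat}.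
Local Notation V := 'rV[R]_2.
Local Notation W := 'M[R]_(n.+1, 2).
Local Notation N := (n.+1 * 2)%N.
Local Notation ix := ('I_n.+1 * 'I_2)%type.

Definition nodearg (j : 'I_n.+1) (x : W) : W := \matrix_(i < n.+1) row (inord (j - i)) x.

Lemma networkE (h : W -> V) x j k : network h x j k = h (nodearg j x) ord0 k.
Proof. by rewrite /network mxE. Qed.

Definition net_pexpr (e : 'I_2 -> pexpr R (option ix)) (lam : R) (y : 'I_N) : pexpr R 'I_N :=
  psubst (fun o : option ix => if o is Some il then PV (mxvec_index (inord ((unidx y).1 - il.1)) il.2)
                   else PC lam) (e (unidx y).2).

Lemma pfield_net (e : 'I_2 -> pexpr R (option ix)) (g : W * R -> V) lam :
  (forall p j, g p ord0 j = ev (e j) (pvars p)) ->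
  forall x : W, pfield (net_pexpr e lam) (mxvec x) = mxvec (network (fun X => g (X, lam)) x).
Proof.
move=> gE x; apply/rowP => y; rewrite -(unidxK y) mxvecE networkE gE mxE.
rewrite /net_pexpr mxvec_indexK /= ev_psubst; apply: ev_ext => -[[i l]|] //=.
by rewrite mxvecE !mxE.
Qed.

Lemma time1_ptime1 e (g : W * R -> V) lam x y :
  (forall p j, g p ord0 j = ev (e j) (pvars p)) ->
  time1 (network (fun X => g (X, lam))) x y ->
  ptime1 (net_pexpr e lam) (mxvec x) (mxvec y).
Proof.
move=> gE [c [c0 c1 cd]]; exists (fun t => mxvec (c t)); split; rewrite ?c0 ?c1//.
move=> t tP i z; rewrite (ord1 i) (pfield_net lam gE) -(unidxK z) mxvecE.
under eq_fun do rewrite mxvecE.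
exact: is_derive_coord (cd t tP).
Qed.

Lemma hd_psubst0 (I : Type) (J : eqType) (s : I -> pexpr R J) (e : pexpr R I) v w i :
  (forall a, hd (s a) v w i = 0) -> hd (psubst s e) v w i = 0.
Proof.
move=> s0; elim: e => [c|a|a IHa b IHb|a IHa b IHb] //=.
  by rewrite IHa IHb addr0.
by rewrite IHa IHb mul0r mulr0 addr0.
Qed.

(** Node j reads only nodes max(j - i, 0) <= j. *)
Lemma lvl_tri_pjac_net e lam : lvl_tri lev (pjac (net_pexpr e lam)).
Proof.
move=> x y yx; rewrite mxE; apply: hd_psubst0 => -[[i l]|] //=.
case: eqP => // /(congr1 lev); rewrite lev_index => xE.
have yn : ((unidx y).1 - i < n.+1)%N by exact: leq_ltn_trans (leq_subr _ _) (ltn_ord _).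
by move: yx; rewrite -xE inordK// ltnNge leq_subr.
Qed.

(** Each flow contributes a triangular derivative whose diagonal blocks have positive determinant,
    and both properties pass to products. *)
Lemma flow_composition_strict (Phi : W * R -> W) : network_flow_composition Phi ->
  \forall lam \near (0 : R), exists L : 'M[R]_N,
    [/\ lvl_tri lev L, (forall j : 'I_n.+1, 0 < \det (blk L j j)) &
     forall eps, 0 < eps -> exists2 delta, 0 < delta & forall x y : W,
       `|x| < delta -> `|y| < delta ->
       `|mxvec (Phi (x, lam) - Phi (y, lam)) - mxvec (x - y) *m L| <= eps * `|x - y|].
Proof.
move=> [m [g [gP near]]].
have /choice[e eP] (k : nat) : exists e : 'I_2 -> pexpr R (option ix), (k < m)%N ->
    forall p j, g k p ord0 j = ev (e j) (pvars p).
  have [km|] := boolP (k < m)%N; last by exists (fun=> PC 0).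
  have [/(_ _)/polynomial_pexpr gp _] := gP k km.
  by have /choice[e eP] := gp; exists e => _ p j; exact: eP.
have [d /= d0 dP] := (nbhs_ballP _ _).1 near.
have : \forall lam \near (0 : R), `|lam| < d.
  apply/nbhs_ballP; exists d => // lam; rewrite /ball/= sub0r normrN//.
apply: filterS => lam lamd.
(* From index m on the field is zero, so that the properties below hold for all k. *)
pose E k := if (k < m)%N then net_pexpr (e k) lam else fun=> PC 0.
have E0 k : pfield (E k) 0 = 0.
  rewrite /E; case: ifP => km; last by apply/rowP => y; rewrite !mxE.
  have -> : (0 : 'rV[R]_N) = mxvec (0 : W) by rewrite linear0.
  rewrite (pfield_net lam (eP k km)); congr mxvec; apply/matrixP => i j.
  rewrite networkE mxE.
  have -> : nodearg i 0 = 0 by apply/matrixP => a b; rewrite !mxE.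
  by rewrite (gP k km).2 mxE.
have Et k : lvl_tri lev (mexp (pjac (E k)) 1).
  apply: lvl_tri_mexp; rewrite /E; case: ifP => km; first exact: lvl_tri_pjac_net.
  by move=> x y _; rewrite mxE.
have Ed k (j : 'I_n.+1) : 0 < \det (blk (mexp (pjac (E k)) 1) j j).
  apply: det_blk_mexp_gt0; rewrite /E; case: ifP => km; first exact: lvl_tri_pjac_net.
  by move=> x y _; rewrite mxE.
have Lt : lvl_tri lev (chain_mx E m) /\ forall j : 'I_n.+1, 0 < \det (blk (chain_mx E m) j j).
  elim: (m) => [|k [IH1 IH2]] /=.
    by split; [exact: lvl_tri1|move=> j; rewrite blk1 det1].
  split; first exact: lvl_triM.
  by move=> j; rewrite blk_diagM// det_mulmx mulr_gt0.
exists (chain_mx E m); split; [exact: Lt.1|exact: Lt.2|].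
move=> eps eps0; have [delta delta0 dlP] := pchain_strict E0 m eps0.
exists (Num.min delta d); first by rewrite lt_min delta0 d0.
move=> x y; rewrite !lt_min => /andP[x1 x2] /andP[y1 y2].
have chain (u : W) : `|u| < d -> exists z : nat -> 'rV[R]_N,
    [/\ z 0%N = mxvec u, z m = mxvec (Phi (u, lam)) & pchain E m z].
  move=> ud; have [|z [z0 zm zc]] := dP (u, lam) _.
    by split; rewrite /= -ball_normE /ball_/= sub0r normrN.
  exists (fun k => mxvec (z k)); split; rewrite ?z0 ?zm// => k km.
  by rewrite /E km; apply: time1_ptime1 (zc k km); exact: eP.
have [z [z0 zm zc]] := chain x x2; have [z' [z'0 z'm z'c]] := chain y y2.
have := dlP z z'; rewrite z0 z'0 zm z'm !norm_mxvec => /(_ x1 y1 zc z'c).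
by rewrite -!linearB/= norm_mxvec.
Qed.

End NetworkFlows.

Lemma differentiable_bound {R : realType} {E F : normedModType R} (f : E -> F) (a : E) (eps : R) :
  differentiable f a -> 0 < eps -> exists2 delta, 0 < delta &
  forall h, `|h| < delta -> `|f (h + a) - f a - 'd f a h| <= eps * `|h|.
Proof.
move=> fd eps0; move/eqaddoP: (diff_locally fd) => /(_ _ eps0) /nbhs_ballP[d /= d0 dP].
exists d => // h hd.
have := dP h; rewrite -ball_normE /ball_/= sub0r normrN => /(_ hd).
by rewrite !fctE /= opprD addrA.
Qed.

(** * Linearization of the network field and of the conjugacy *)

Section NetworkJacobian.
Context {R : realType} {n : nat}.
Local Notation V := 'rV[R]_2.
Local Notation W := 'M[R]_(n.+1, 2).
Local Notation N := (n.+1 * 2)%N.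

Lemma nodearg_norm j (x : W) : `|nodearg j x| <= `|x|.
Proof. by apply/mx_norm_leP => // i k; rewrite !mxE mx_entry_le. Qed.

Lemma nodearg_delta (j i : 'I_n.+1) (k : 'I_2) : nodearg j (delta_mx i k : W) =
  \sum_(i' < n.+1 | inord (j - i') == i) delta_mx i' k.
Proof.
apply/matrixP => a b; rewrite summxE !mxE.
have [eqi|nei] := eqVneq (inord (j - a)) i; last first.
  rewrite big1// => i' ii'; rewrite mxE; case: eqVneq => // ai'.
  by move: nei; rewrite ai' ii'.
rewrite (bigD1 a)/=; last exact/eqP.
rewrite big1 ?addr0; first by rewrite mxE eqxx.
by move=> i' /andP[_ /negPf]; rewrite mxE eq_sym => ->.
Qed.

Lemma nodearg_sum j (x : W) : nodearg j x = \sum_i \sum_k x i k *: nodearg j (delta_mx i k).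
Proof.
apply/matrixP => a b; rewrite !mxE summxE (bigD1 (inord (j - a)))//= [X in _ = _ + X]big1 ?addr0.
  rewrite summxE (bigD1 b)//= big1 ?addr0; first by rewrite !mxE !eqxx mulr1.
  by move=> k /negPf kb; rewrite !mxE eqxx eq_sym kb mulr0.
by move=> i /negPf ia; rewrite summxE big1// => k _; rewrite !mxE eq_sym ia mulr0.
Qed.

(** The linearized network field acting from the right: the row index is the perturbed coordinate,
    the column index the component observed. *)
Definition netjac (f : W * R -> V) (lam : R) : 'M[R]_N :=
  \matrix_(x, y) ('D_(nodearg (unidx y).1 (delta_mx (unidx x).1 (unidx x).2), 0) f (0, lam))
    ord0 (unidx y).2.

(** A perturbation of node i changes every argument of node j that reads node i; for i = 0 there can
    be several, because of the truncated subtraction. *)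
Lemma blk_netjac (f : W * R -> V) lam (i j : 'I_n.+1) : differentiable f (0, lam) ->
  blk (netjac f lam) i j = (\sum_(i' < n.+1 | inord (j - i') == i) lin_coef f i' lam)^T.
Proof.
move=> fd; apply/matrixP => k l; rewrite !mxE !mxvec_indexK /= nodearg_delta.
have -> : (\sum_(i' < n.+1 | inord (j - i') == i) delta_mx i' k, 0) =
    \sum_(i' < n.+1 | inord (j - i') == i) (delta_mx i' k, 0) :> W * R.
  elim/big_ind2 : _ => // a b c d <- <-; congr pair; exact: esym (addr0 _).
by rewrite deriveE// linear_sum summxE !summxE; apply: eq_bigr => i' _; rewrite mxE deriveE.
Qed.

Lemma lvl_tri_netjac (f : W * R -> V) lam : differentiable f (0, lam) ->
  lvl_tri lev (netjac f lam).
Proof.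
move=> fd x y; rewrite /lev => yx.
rewrite -(unidxK x) -(unidxK y).
have := congr1 (fun M : 'M[R]_2 => M (unidx x).2 (unidx y).2) (blk_netjac (unidx x).1 (unidx y).1 fd).
rewrite mxE => ->; rewrite big_pred0 ?mxE// => i'.
apply/eqP => /(congr1 (@nat_of_ord _)); rewrite inordK; last first.
  exact: leq_ltn_trans (leq_subr _ _) (ltn_ord _).
by move=> e; move: yx; rewrite -e ltnNge leq_subr.
Qed.

Lemma network_netjac (f : W * R -> V) lam (eps : R) : differentiable f (0, lam) ->
  f (0, lam) = 0 -> 0 < eps -> exists2 delta, 0 < delta & forall x : W, `|x| < delta ->
  `|mxvec (network (fun X => f (X, lam)) x) - mxvec x *m netjac f lam| <= eps * `|x|.
Proof.
move=> fd f0 eps0; have [d d0 dP] := differentiable_bound fd eps0.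
exists d => // x xd.
apply/mx_norm_leP; first by rewrite mulr_ge0// ltW.
move=> i y; rewrite (ord1 i) -(unidxK y); set j := (unidx y).1; set l := (unidx y).2.
rewrite !mxE mxvecE networkE sum_mxvec_index.
have -> : \sum_i \sum_k mxvec x 0 (mxvec_index i k) * netjac f lam (mxvec_index i k) (mxvec_index j l)
   = ('d f (0, lam) (nodearg j x, 0)) ord0 l.
  have -> : (nodearg j x, 0) = \sum_i \sum_k x i k *: (nodearg j (delta_mx i k), 0) :> W * R.
    rewrite nodearg_sum; elim/big_ind2 : _ => [//|a b c e <- <-|i0 _].
      by congr pair; exact: esym (addr0 _).
    elim/big_ind2 : _ => [//|a b c e <- <-|k0 _].
      by congr pair; exact: esym (addr0 _).
    by congr pair; exact: esym (scaler0 _ _).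
  rewrite linear_sum summxE; apply: eq_bigr => i0 _.
  rewrite linear_sum summxE; apply: eq_bigr => k0 _.
  by rewrite linearZ mxE mxvecE mxE !mxvec_indexK /= deriveE.
have xn : `|((nodearg j x, 0) : W * R)| <= `|x|.
  by rewrite prod_normE /= normr0 ge_max nodearg_norm normr_ge0.
have := dP (nodearg j x, 0) (le_lt_trans xn xd).
have -> : ((nodearg j x, 0) + (0, lam) : W * R) = (nodearg j x, lam).
  by congr pair; rewrite /= ?addr0 ?add0r.
rewrite f0 subr0 => h.
have {}h := le_trans h (ler_wpM2l (ltW eps0) xn).
have := mx_entry_le (f (nodearg j x, lam) - 'd f (0, lam) (nodearg j x, 0)) ord0 l.
by rewrite !mxE => /le_trans; apply.
Qed.

(** A linear map of order o(|x|) vanishes, as small multiples of the basis vectors show; [C] leaves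
    room for a sum of several errors. *)
Lemma lin_small0 (M : 'M[R]_N) (C : R) : 0 <= C ->
  (forall eps, 0 < eps -> exists2 delta, 0 < delta & forall x : W, `|x| < delta ->
     `|mxvec x *m M| <= C * (eps * `|x|)) -> M = 0.
Proof.
move=> C0 h; apply/matrixP => a b; rewrite mxE.
apply/eqP; rewrite -normr_le0; apply/ler_addgt0Pl => e e0; rewrite addr0.
have C1 : 0 < C + 1 by rewrite ltr_wpDl.
have [|d d0 dP] := h (e / (C + 1)); first by rewrite divr_gt0.
pose x : W := (d / 2) *: vec_mx (delta_mx ord0 a).
have d20 : 0 < d / 2 by rewrite divr_gt0.
have dn : `|vec_mx (delta_mx ord0 a) : W| <= 1.
  apply/mx_norm_leP => // i j; rewrite mxE mxE eqxx /=.
  by case: eqP => _; rewrite ?normr1 ?normr0 ?ler01.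
have xn : `|x| <= d / 2.
  by rewrite normrZ gtr0_norm// -[leRHS]mulr1 ler_wpM2l// ltW.
have xd : `|x| < d by rewrite (le_lt_trans xn)//; lra.
have := dP x xd; rewrite /x linearZ/= vec_mxK -scalemxAl => h1.
have := le_trans (mx_entry_le _ ord0 b) h1.
rewrite mxE normrM gtr0_norm// -rowE mxE => h2.
have : d / 2 * `|M a b| <= C * (e / (C + 1) * (d / 2)).
  apply: (le_trans h2); apply: ler_wpM2l => //; apply: ler_wpM2l; last exact: xn.
  by rewrite divr_ge0 ?(ltW e0)// ltW.
have -> : C * (e / (C + 1) * (d / 2)) = d / 2 * (C / (C + 1) * e) by ring.
rewrite ler_pM2l// => /le_trans; apply.
rewrite -[leRHS]mul1r ler_wpM2r ?(ltW e0)// ler_pdivrMr// mul1r lerDl ler01//.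
Qed.

(** The conjugacy equation is compared to first order in x. Its left side contains the differential
    of [Phi] at x and not at 0, which is where strictness of the derivative [L] is needed. *)
Lemma conj_netjac (Phi : W * R -> W) (f fhat : W * R -> V) (lam d : R) (L : 'M[R]_N) :
  0 < d -> Phi (0, lam) = 0 ->
  (forall eps, 0 < eps -> exists2 delta, 0 < delta & forall x y : W,
     `|x| < delta -> `|y| < delta ->
     `|mxvec (Phi (x, lam) - Phi (y, lam)) - mxvec (x - y) *m L| <= eps * `|x - y|) ->
  (forall x : W, `|x| < d -> differentiable (fun x' : W => Phi (x', lam)) x /\
    'd (fun x' : W => Phi (x', lam)) x (network (fun X => f (X, lam)) x) =
      network (fun X => fhat (X, lam)) (Phi (x, lam))) ->
  differentiable f (0, lam) -> f (0, lam) = 0 -> differentiable fhat (0, lam) ->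
  fhat (0, lam) = 0 /\ netjac f lam *m L = L *m netjac fhat lam.
Proof.
move=> d0 Phi0 strict conj fd f0 hd.
have net0 (h : W * R -> V) i k : network (fun X => h (X, lam)) 0 i k = h (0, lam) ord0 k.
  by rewrite networkE; congr (h (_, lam) _ _); apply/matrixP => a b; rewrite !mxE.
have h0 : fhat (0, lam) = 0.
  have [|_] := conj 0; first by rewrite normr0.
  have -> : network (fun X => f (X, lam)) 0 = 0 by apply/matrixP => i k; rewrite net0 f0 !mxE.
  rewrite linear0 Phi0 => /esym e; apply/rowP => k.
  by rewrite -(net0 _ ord0) e !mxE.
split => //; apply/eqP; rewrite -subr_eq0; apply/eqP.
pose A := netjac f lam; pose B := netjac fhat lam.
pose nL := N%:R * `|L|; pose nA := N%:R * `|A|; pose nB := N%:R * `|B|.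
have nL0 : 0 <= nL by rewrite mulr_ge0.
have nA0 : 0 <= nA by rewrite mulr_ge0.
have nB0 : 0 <= nB by rewrite mulr_ge0.
pose C := nL + (nA + 1) + (nL + 1) + nB.
apply: (@lin_small0 _ C); first by rewrite /C !addr_ge0.
move=> eps eps0; pose e := Num.min 1 eps.
have e0 : 0 < e by rewrite lt_min ltr01 eps0.
have e1 : e <= 1 by rewrite ge_min lexx.
have [d1 d10 d1P] := strict e e0.
have [d2 d20 d2P] := network_netjac fd f0 e0.
have [d3 d30 d3P] := network_netjac hd h0 e0.
have nL1 : 0 < nL + 1 by rewrite ltr_wpDl.
exists (Num.min d (Num.min d1 (Num.min d2 (d3 / (nL + 1))))).
  by rewrite !lt_min d0 d10 d20 divr_gt0.
move=> x; rewrite !lt_min => /and4P[xd x1 x2 x3].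
apply: (@le_trans _ _ (C * (e * `|x|))); last first.
  by apply: ler_wpM2l; [rewrite /C !addr_ge0|rewrite ler_wpM2r// ge_min lexx orbT].
pose u := network (fun X => f (X, lam)) x.
pose y := Phi (x, lam).
have z1 : `|(0 : W)| < d1 by rewrite normr0.
(* u = x A + o(x), y = x L + o(x) and dPhi_x u = u L + o(u) *)
have hu : `|mxvec u - mxvec x *m A| <= e * `|x| := d2P x x2.
have hy : `|mxvec y - mxvec x *m L| <= e * `|x|.
  by have := d1P x 0 x1 z1; rewrite Phi0 !subr0.
have yb : `|y| <= (nL + 1) * `|x|.
  rewrite -norm_mxvec -(subrK (mxvec x *m L) (mxvec y)) (le_trans (ler_normD _ _))//.
  rewrite mulrDl addrC mul1r lerD//.
    by rewrite -[X in _ * X]norm_mxvec; exact: norm_mulmx_le.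
  by rewrite (le_trans hy)// -[leRHS]mul1r ler_wpM2r.
have ub : `|u| <= (nA + 1) * `|x|.
  rewrite -norm_mxvec -(subrK (mxvec x *m A) (mxvec u)) (le_trans (ler_normD _ _))//.
  rewrite mulrDl addrC mul1r lerD//.
    by rewrite -[X in _ * X]norm_mxvec; exact: norm_mulmx_le.
  by rewrite (le_trans hu)// -[leRHS]mul1r ler_wpM2r.
have hB : `|mxvec (network (fun X => fhat (X, lam)) y) - mxvec y *m B| <= e * `|y|.
  apply: d3P; rewrite (le_lt_trans yb)// mulrC -ltr_pdivlMr//.
have [Pd Pc] := conj x xd.
(* The strict estimate between x + hu and x, divided by |h|, passes to the limit in h. *)
have hd' : `|mxvec ('d (fun x' : W => Phi (x', lam)) x u) - mxvec u *m L| <= e * `|u|.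
  rewrite -deriveE//.
  have cv : h^-1 *: (Phi (h *: u + x, lam) - Phi (x, lam)) @[h --> (0 : R)^'] -->
      'D_u (fun x' : W => Phi (x', lam)) x by exact: (diff_derivable (v := u) Pd).
  have cv2 : `|mxvec (h^-1 *: (Phi (h *: u + x, lam) - Phi (x, lam))) - mxvec u *m L|
      @[h --> (0 : R)^'] --> `|mxvec ('D_u (fun x' : W => Phi (x', lam)) x) - mxvec u *m L|.
    apply: cvg_norm; apply: cvgB; last exact: cvg_cst.
    apply/cvgrPdist_le => t t0; move/cvgrPdist_le : cv => /(_ _ t0).
    by apply: filterS => h; rewrite -linearB/= norm_mxvec.
  apply: (cvgr_to_le cv2).
  have hx : h *: u + x @[h --> (0 : R)] --> x.
    have hx0 : h *: u + x @[h --> (0 : R)] --> 0 *: u + x.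
      apply: cvgD; last exact: cvg_cst.
      by apply: cvgZr_tmp; exact: cvg_id.
    by rewrite scale0r add0r in hx0.
  have hx1 : \forall h \near (0 : R)^', `|h *: u + x| < d1.
    have h2 : \forall h \near (0 : R), `|h *: u + x| < d1.
      exact: (cvgr_lt _ (cvg_norm hx) _ x1).
    exact: nbhs_dnbhs h2.
  have hn0 : \forall h \near (0 : R)^', h != 0 by exact: nbhs_dnbhs_neq.
  apply: filterS2 hx1 hn0 => h hd1 h0'.
  have := d1P (h *: u + x) x hd1 x1; rewrite addrK => D.
  have -> : mxvec (h^-1 *: (Phi (h *: u + x, lam) - Phi (x, lam))) - mxvec u *m L =
      h^-1 *: (mxvec (Phi (h *: u + x, lam) - Phi (x, lam)) - mxvec (h *: u) *m L).
    by rewrite !linearZ/= -scalemxAl scalerBr scalerA mulVf// scale1r.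
  rewrite normrZ normfV ler_pdivrMl ?normr_gt0//.
  by apply: (le_trans D); rewrite normrZ mulrCA.
(* With [a] the common value of the two sides of the conjugacy equation, each of the four
   differences is small. *)
have key a : mxvec x *m (A *m L - L *m B) =
    (a - mxvec y *m B) - (a - mxvec u *m L)
    - (mxvec u - mxvec x *m A) *m L + (mxvec y - mxvec x *m L) *m B.
  move: (mxvec u) (mxvec y) (mxvec x) => b c v.
  rewrite mulmxBr !mulmxBl !mulmxA; move: (v *m A *m L) (v *m L *m B) (b *m L) (c *m B).
  by move=> p q r s; apply/rowP => k; rewrite !mxE; ring.
rewrite (key (mxvec ('d (fun x' : W => Phi (x', lam)) x u))).
have eq4 : C * (e * `|x|) = (nL + 1) * (e * `|x|) + (nA + 1) * (e * `|x|) +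
    nL * (e * `|x|) + nB * (e * `|x|) by rewrite /C; ring.
rewrite eq4; apply: (le_trans (ler_normD _ _)); apply: lerD; last first.
  apply: (le_trans (norm_mulmx_le _ _)); rewrite -/nB; exact: ler_wpM2l hy.
apply: (le_trans (ler_normB _ _)); apply: lerD; last first.
  apply: (le_trans (norm_mulmx_le _ _)); rewrite -/nL; exact: ler_wpM2l hu.
apply: (le_trans (ler_normB _ _)); apply: lerD.
  rewrite Pc mulrCA; apply: (le_trans hB); apply: ler_wpM2l yb; exact: ltW.
by rewrite mulrCA; apply: (le_trans hd'); apply: ler_wpM2l ub; exact: ltW.
Qed.

End NetworkJacobian.

(** * Transport of the conditions to the normal form *)

Section NormalFormData.
Context {R : realType}.

Lemma conj_trace (M M' P : 'M[R]_2) : \det P != 0 -> M *m P = P *m M' -> \tr M = \tr M'.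
Proof.
move=> P0 MP; have Pu : P \in unitmx by rewrite unitmxE unitfE.
have -> : M = P *m M' *m invmx P by rewrite -MP -mulmxA mulmxV// mulmx1.
by rewrite -mulmxA mxtrace_mulC -mulmxA mulVmx// mulmx1.
Qed.

Lemma conj_det (M M' P : 'M[R]_2) : \det P != 0 -> M *m P = P *m M' -> \det M = \det M'.
Proof.
move=> P0 /(congr1 determinant); rewrite !det_mulmx mulrC => /mulfI; exact.
Qed.

Lemma two_cases (P : 'I_2 -> Prop) : P ord0 -> P ord_max -> forall k, P k.
Proof.
move=> P0 P1 k; have [->//|k0] := eqVneq k ord0.
suff -> : k = ord_max by [].
by apply/val_inj; case: k k0 => [[|[|k]] kk].
Qed.

Lemma conj_rotation (omega a b c d p q : R) : omega != 0 -> 0 < a * d - b * c ->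
  p = 0 -> omega * c = a * p - b * q -> omega * d = a * q + b * p ->
  - omega * a = c * p - d * q -> - omega * b = c * q + d * p -> q = omega.
Proof.
move=> w0 D -> e1 e2 e3 e4.
have f1 : omega ^+ 2 * c = q ^+ 2 * c.
  by move: (congr1 ( *%R omega) e1) (congr1 ( *%R q) e4); lra.
have f2 : omega ^+ 2 * d = q ^+ 2 * d.
  by move: (congr1 ( *%R omega) e2) (congr1 ( *%R q) e3); lra.
have q2 : omega ^+ 2 = q ^+ 2.
  have [c0|c0] := eqVneq c 0; last exact: (mulIf c0).
  have [d0|d0] := eqVneq d 0; last exact: (mulIf d0).
  by move: D; rewrite c0 d0 !mulr0 subrr ltxx.
have : (q - omega) * (q + omega) = 0 by rewrite mulrDr !mulrBl; move: q2; rewrite !expr2; lra.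
move=> /eqP; rewrite mulf_eq0 => /orP[/eqP|/eqP] h; first by lra.
have qw : q = - omega by lra.
have g1 : omega * (d ^+ 2 + c ^+ 2) = - omega * (a * d - b * c).
  rewrite qw in e1 e2; move: (congr1 ( *%R d) e2) (congr1 ( *%R c) e1); lra.
have : d ^+ 2 + c ^+ 2 = - (a * d - b * c).
  by apply: (mulfI w0); rewrite g1 mulrN mulNr.
by have := sqr_ge0 d; have := sqr_ge0 c; lra.
Qed.

(** The entries of M make it multiplication by a complex number p + iq; the trace gives p = 0 and
    the orientation of P the sign of q. *)
Lemma rotation_mx_eq (omega : R) (M P : 'M[R]_2) : omega != 0 -> 0 < \det P ->
  M ord0 ord0 = M ord_max ord_max -> M ord0 ord_max = - M ord_max ord0 ->
  (mulI_mx omega)^T *m P = P *m M^T -> M = mulI_mx omega.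
Proof.
move=> w0 P0 M1 M2 E.
have tr0 : \tr (mulI_mx omega)^T = \tr M^T by apply: conj_trace E; rewrite gt_eqF.
have p0 : M ord0 ord0 = 0.
  by move: tr0; rewrite !tr2 !mxE /= -M1; lra.
have ent k l : ((mulI_mx omega)^T *m P) k l = (P *m M^T) k l by rewrite E.
have S2 (F : 'I_2 -> R) : \sum_i F i = F ord0 + F ord_max.
  by rewrite !big_ord_recl big_ord0 addr0; congr (_ + F _); exact/val_inj.
have e1 := ent ord0 ord0; have e2 := ent ord0 ord_max.
have e3 := ent ord_max ord0; have e4 := ent ord_max ord_max.
rewrite !mxE !S2 !mxE /= in e1 e2 e3 e4.
rewrite det2 in P0.
have q : M ord_max ord0 = omega.
  apply: (conj_rotation w0 P0 p0); move: e1 e2 e3 e4; rewrite -M1 M2;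
    move: (P _ _) (P _ _) (P _ _) (P _ _) (M _ _) (M _ _) => a b c d p r; lra.
apply/matrixP; apply: two_cases; apply: two_cases; rewrite !mxE //= -?M1 ?M2 ?q//.
Qed.

Lemma near_origin_ball (n : nat) (P : 'M[R]_(n.+1, 2) -> R -> Prop) : near_origin P ->
  exists2 d, 0 < d & forall x lam, `|x| < d -> `|lam| < d -> P x lam.
Proof.
move=> /nbhs_ballP[d /= d0 dP]; exists d => // x lam xd ld.
by apply: (dP (x, lam)); split; rewrite /= -ball_normE /ball_/= sub0r normrN.
Qed.

Section Fix_n.
Context {n : nat}.
Local Notation V := 'rV[R]_2.
Local Notation W := 'M[R]_(n.+1, 2).
Local Notation N := (n.+1 * 2)%N.

(** For a > 0 the subtraction is not truncated, so exactly one argument of node b reads node a. *)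
Lemma node_pred (a b : 'I_n.+1) (i' : 'I_n.+1) : (0 < a)%N -> (a <= b)%N ->
  (inord (b - i') == a) = (i' == inord (b - a)).
Proof.
move=> a0 ab; apply/eqP/eqP.
  move/(congr1 (@nat_of_ord _)); rewrite inordK; last first.
    exact: leq_ltn_trans (leq_subr _ _) (ltn_ord _).
  move=> e; apply/val_inj; rewrite /= inordK.
    by rewrite -e subKn//; apply: ltnW; rewrite -subn_gt0 e.
  exact: leq_ltn_trans (leq_subr _ _) (ltn_ord _).
move=> ->; apply/val_inj; rewrite /= [X in (b - X)%N]inordK; last first.
  exact: leq_ltn_trans (leq_subr _ _) (ltn_ord _).
by rewrite subKn// inordK.
Qed.

Lemma blk_netjac_diag (f : W * R -> V) lam (j : 'I_n.+1) : differentiable f (0, lam) ->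
  (0 < j)%N -> blk (netjac f lam) j j = (lin_coef f ord0 lam)^T.
Proof.
move=> fd j0; rewrite blk_netjac//; congr trmx.
rewrite (eq_bigl (pred1 ord0)); first by rewrite big_pred1_eq.
move=> i /=; rewrite node_pred// subnn; congr (_ == _); apply/val_inj; by rewrite /= inordK.
Qed.

Lemma blk_netjac_0 (f : W * R -> V) lam : differentiable f (0, lam) ->
  blk (netjac f lam) ord0 ord0 = (\sum_i lin_coef f i lam)^T.
Proof.
move=> fd; rewrite blk_netjac//; congr trmx; apply: eq_bigl => i.
by rewrite sub0n; apply/eqP/val_inj; rewrite /= inordK.
Qed.

Lemma blk_netjac_sub (f : W * R -> V) lam (i j : 'I_n.+1) : differentiable f (0, lam) ->
  (0 < i)%N -> j = i.+1 :> nat -> blk (netjac f lam) i j = (lin_coef f (inord 1) lam)^T.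
Proof.
move=> fd i0 ji; rewrite blk_netjac//; congr trmx.
rewrite (eq_bigl (pred1 (inord 1))); first by rewrite big_pred1_eq.
by move=> i' /=; rewrite node_pred// ji ?leqnSn// subSn// subnn.
Qed.

(** The relation is needed on a neighborhood of lambda = 0, because condition (2) is about a
    derivative in lambda. *)
Lemma conj_near (Phi : W * R -> W) (f fhat : W * R -> V) (U : set (W * R)) :
  smooth_on setT f -> (forall lam, f (0, lam) = 0) ->
  (\forall lam \near (0 : R), local_analytic_diffeo (fun x : W => Phi (x, lam))) ->
  network_flow_composition Phi -> open U -> U (0, 0) -> smooth_on U fhat ->
  conjugates Phi f fhat ->
  \forall lam \near (0 : R), differentiable fhat (0, lam) /\
    exists L : 'M[R]_N, [/\ lvl_tri lev L, (forall j : 'I_n.+1, 0 < \det (blk L j j)) &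
      netjac f lam *m L = L *m netjac fhat lam].
Proof.
move=> fs f0 diffeo flow Uo U0 fhs conj.
have [d d0 dP] := near_origin_ball conj.
have nU : \forall lam \near (0 : R), differentiable fhat (0, lam).
  have /nbhs_ballP[e /= e0 eP] : nbhs ((0, 0) : W * R) U by apply: open_nbhs_nbhs; split.
  apply/nbhs_ballP; exists e => // lam; rewrite -ball_normE /ball_/= sub0r normrN => le.
  apply: (smooth_on_differentiable fhs); apply: eP.
  by split; rewrite /= -ball_normE /ball_/= sub0r normrN// normr0.
have nd : \forall lam \near (0 : R), `|lam| < d.
  by apply/nbhs_ballP; exists d => // lam; rewrite -ball_normE /ball_/= sub0r normrN.
have nL := flow_composition_strict flow.
apply: filterS2 (filterI diffeo nU) (filterI nd nL).
move=> lam [[P0 _] hd] [ld [L [Lt Ld Ls]]]; split => //.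
exists L; split => //.
have fd : differentiable f (0, lam) by exact: (smooth_on_differentiable fs).
exact: (conj_netjac d0 P0 Ls (fun x xd => dP x lam xd ld) fd (f0 lam) hd).2.
Qed.

(** Differentiating the symmetry at the quarter turn shows that the derivative commutes with
    multiplication by i. The perturbation must keep the last argument zero, hence i < n. *)
Lemma symmetry_lin_coef (omega0 : R) (fbar : W * R -> V) (lam : R) : omega0 != 0 -> (1 <= n)%N ->
  normal_form_symmetry omega0 fbar ->
  (forall X : W, derivable fbar (0, lam) (X, 0)) -> fbar (0, lam) = 0 ->
  forall i : 'I_n.+1, (i < n)%N ->
    lin_coef fbar i lam ord0 ord0 = lin_coef fbar i lam ord_max ord_max /\
    lin_coef fbar i lam ord0 ord_max = - lin_coef fbar i lam ord_max ord0.
Proof.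
move=> w0 n1 sym fd f0 i in_.
pose s := (pi / 2) / omega0.
pose z : R[i] := Complex 0 1.
have expi_s : expi (omega0 * s) = z.
  by rewrite /expi /s mulrC divfK// cos_pihalf sin_pihalf.
have lastrow k : row ord_max (delta_mx i k : W) = 0.
  apply/rowP => l; rewrite !mxE; case: eqVneq => // e.
  by move: in_; rewrite -e /= ltnn.
pose J (v : V) : V := \row_k (if k == ord0 then - v ord0 ord_max else v ord0 ord0).
have rotD (X : W) (Y : W) : row ord_max X = 0 ->
    (forall t : R, Defs.cscale z (t *: X) = t *: Y) ->
    'D_(Y, 0) fbar (0, lam) = J ('D_(X, 0) fbar (0, lam)).
  move=> X0 XY.
  have cX : h^-1 *: (fbar (h *: (X, 0) + (0, lam)) - fbar (0, lam)) @[h --> (0 : R)^'] -->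
      'D_(X, 0) fbar (0, lam) by exact: fd.
  have cY : h^-1 *: (fbar (h *: (Y, 0) + (0, lam)) - fbar (0, lam)) @[h --> (0 : R)^'] -->
      'D_(Y, 0) fbar (0, lam) by exact: fd.
  have pairE (Z : W) (h : R) : h *: (Z, 0) + (0, lam) = (h *: Z, lam) :> W * R.
    by congr pair; rewrite /= ?addr0// scaler0 add0r.
  have fJ (h : R) : fbar (h *: Y, lam) = J (fbar (h *: X, lam)).
    rewrite -XY -expi_s sym; last first.
      by rewrite linearZ/= X0 scaler0.
    apply/rowP => l; rewrite expi_s !mxE /complex_of_row !mxE /=.
    by case: ifP => _; ring.
  apply/rowP => l.
  have cYl : (h^-1 *: (fbar (h *: (Y, 0) + (0, lam)) - fbar (0, lam))) ord0 l @[h --> (0 : R)^'] -->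
      'D_(Y, 0) fbar (0, lam) ord0 l by exact: (cvg_comp _ _ cY (@coord_continuous _ _ _ ord0 l _)).
  have cXl k : (h^-1 *: (fbar (h *: (X, 0) + (0, lam)) - fbar (0, lam))) ord0 k @[h --> (0 : R)^'] -->
      'D_(X, 0) fbar (0, lam) ord0 k by exact: (cvg_comp _ _ cX (@coord_continuous _ _ _ ord0 k _)).
  rewrite -(cvg_lim _ cYl)//; apply: cvg_lim => //.
  have -> : (fun h : R => (h^-1 *: (fbar (h *: (Y, 0) + (0, lam)) - fbar (0, lam))) ord0 l) =
      (fun h : R => (J (h^-1 *: (fbar (h *: (X, 0) + (0, lam)) - fbar (0, lam)))) ord0 l).
    apply/funext => h; rewrite !pairE fJ f0 !subr0 !mxE.
    by case: ifP => _; rewrite ?mulrN.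
  rewrite mxE; case: ifP => l0.
    have -> : (fun h : R => (J (h^-1 *: (fbar (h *: (X, 0) + (0, lam)) - fbar (0, lam)))) ord0 l) =
        (fun h : R => - (h^-1 *: (fbar (h *: (X, 0) + (0, lam)) - fbar (0, lam))) ord0 ord_max).
      by apply/funext => h; rewrite mxE l0.
    exact: cvgN (cXl ord_max).
  have -> : (fun h : R => (J (h^-1 *: (fbar (h *: (X, 0) + (0, lam)) - fbar (0, lam)))) ord0 l) =
      (fun h : R => (h^-1 *: (fbar (h *: (X, 0) + (0, lam)) - fbar (0, lam))) ord0 ord0).
    by apply/funext => h; rewrite mxE l0.
  exact: cXl ord0.
have cs0 (t : R) : Defs.cscale z (t *: delta_mx i ord0 : W) = t *: delta_mx i ord_max.
  apply/matrixP => a b; rewrite !mxE /complex_of_row !mxE /=.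
  by case: (a == i) => /=; move: b; apply: two_cases; rewrite /=; ring.
have h0 := rotD (delta_mx i ord0) (delta_mx i ord_max) (lastrow _) cs0.
rewrite !mxE h0 !mxE /=; split => //.
Qed.

End Fix_n.

End NormalFormData.

Lemma is_derive_dlam (R : realType) (n : nat) (U : set ('M[R]_(n.+1, 2) * R))
    (h : 'M[R]_(n.+1, 2) * R -> 'rV[R]_2) k :
  U (0, 0) -> smooth_on U h ->
  is_derive (0 : R) (1 : R) (fun lam => h (0, lam) ord0 k) (dlam h (0, 0) ord0 k).
Proof.
move=> U0 hs; apply: is_derive_coord.
pose u : 'M[R]_(n.+1, 2) * R := (0, 1).
have E (t : R) : t *: u + (0, 0) = (0, t).
  by congr pair; rewrite /= ?addr0 ?scaler0// [_ *: 1]mulr1.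
have -> : (fun lam => h (0, lam)) = (fun lam => h (lam *: u + (0, 0))).
  by apply/funext => t; rewrite E.
have -> : dlam h (0, 0) = 'D_u h (0 *: u + (0, 0)) by rewrite E.
apply: is_derive_line; rewrite E; apply: diff_derivable.
exact: (smooth_on_differentiable hs).
Qed.

(** With K = Q P^-1 the two relations give B = K A - A K, a commutator. *)
Lemma trace_sylvester (F : fieldType) (m : nat) (A B H P Q : 'M[F]_m) : P \in unitmx ->
  A *m Q + B *m P = Q *m H -> A *m P = P *m H -> \tr B = 0.
Proof.
move=> Pu E1 E2.
have BE : B = Q *m (H *m invmx P) - A *m (Q *m invmx P).
  have : B *m P *m invmx P = (Q *m H - A *m Q) *m invmx P.
    by congr (_ *m _); rewrite -E1 addrAC subrr add0r.
  by rewrite -mulmxA mulmxV// mulmx1 mulmxBl !mulmxA.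
have HE : H *m invmx P = invmx P *m A.
  have : invmx P *m (A *m P) *m invmx P = invmx P *m (P *m H) *m invmx P by rewrite E2.
  by rewrite !mulmxA mulVmx// mul1mx -!mulmxA mulmxV// mulmx1 => <-.
by rewrite BE HE linearB/= [Q *m (_ *m A)]mulmxA mxtrace_mulC subrr.
Qed.

Lemma normal_form_data (R : realType) (n : nat) (hn : (1 <= n)%N)
  (f : 'M[R]_(n.+1, 2) * R -> 'rV[R]_2) (omega0 : R) (r1 r2 : nat)
  (fbar : 'M[R]_(n.+1, 2) * R -> 'rV[R]_2) :
  smooth_on setT f -> (forall lam : R, f (0, lam) = 0) -> omega0 != 0 ->
  lin_coef f ord0 0 = mulI_mx omega0 -> (1 <= r2)%N ->
  local_normal_form omega0 r1 r2 f fbar ->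
  derive1 (fun lam : R => \tr (lin_coef f ord0 lam)) 0 != 0 ->
  \tr (lin_coef f (inord 1) 0) != 0 ->
  hyperbolic_mx (\sum_(i < n.+1) lin_coef f i 0) ->
  [/\ lin_coef fbar ord0 0 = mulI_mx omega0,
      exists2 al : R, al != 0 &
        is_derive (0 : R) (1 : R) (fun lam => \tr (lin_coef fbar ord0 lam)) al,
      (2 <= n)%N -> lin_coef fbar (inord 1) 0 != 0,
      (let S := \sum_(i < n.+1) lin_coef fbar i 0 in
        \det S < 0 \/ 0 < \det S /\ \tr S != 0) &
      (exists e : 'I_2 -> pexpr R (option ('I_n.+1 * 'I_2)),
        forall p j, fbar p ord0 j = ev (e j) (pvars p)) /\
      normal_form_symmetry omega0 fbar /\ (forall lam, fbar (0, lam) = 0)].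
Proof.
move=> fs f0 w0 a0E hr2 [Phi [fhat [diffeo flow [U [[Uo U0] fhs]] conj [fbarE sym]]]] c2 c3 c5.
have near_conj := conj_near fs f0 diffeo flow Uo U0 fhs conj.
have fd lam : differentiable f (0, lam) by exact: (smooth_on_differentiable fs).
pose i1 : 'I_n.+1 := inord 1.
have i1E : i1 = 1%N :> nat by rewrite /i1 inordK.
have i10 : (0 < i1)%N by rewrite i1E.
have trE lam : (differentiable fhat (0, lam) /\ exists L : 'M[R]_(n.+1 * 2),
    [/\ lvl_tri lev L, (forall j : 'I_n.+1, 0 < \det (blk L j j)) &
      netjac f lam *m L = L *m netjac fhat lam]) ->
    \tr (lin_coef f ord0 lam) = \tr (lin_coef fhat ord0 lam).
  move=> [hd [L [Lt Ld LE]]].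
  rewrite -mxtrace_tr -[RHS]mxtrace_tr -(blk_netjac_diag (fd lam) i10) -(blk_netjac_diag hd i10).
  apply: (@conj_trace _ _ _ (blk L i1 i1)); first by rewrite gt_eqF.
  by rewrite -!blk_diagM ?LE//; exact: lvl_tri_netjac.
have [hd0 [L [Lt Ld LE]]] := nbhs_singleton near_conj.
have linE i : lin_coef fbar i 0 = lin_coef fhat i 0.
  by apply/matrixP => k l; rewrite !mxE (fbar_dX0 Uo U0 fhs fbarE).
have diagE (j : 'I_n.+1) : blk (netjac f 0) j j *m blk L j j = blk L j j *m blk (netjac fhat 0) j j.
  by rewrite -!blk_diagM ?LE//; exact: lvl_tri_netjac.
have symL (i : 'I_n.+1) : (i < n)%N ->
    lin_coef fbar i 0 ord0 ord0 = lin_coef fbar i 0 ord_max ord_max /\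
    lin_coef fbar i 0 ord0 ord_max = - lin_coef fbar i 0 ord_max ord0.
  apply: (@symmetry_lin_coef _ _ omega0 fbar 0 w0 hn sym).
    by move=> X; have [] := fbar_dX Uo U0 fhs fbarE X 0.
  exact: (fbar0 fbarE 0).
split.
(* Node 1 is used, since its diagonal block is a_0 alone, whereas that of node 0 is the sum of all
   a_i. *)
- have [s1 s2] := symL ord0 hn.
  apply: (rotation_mx_eq w0 (Ld i1) s1 s2).
  rewrite -a0E linE -(blk_netjac_diag (fd 0) i10) -(blk_netjac_diag hd0 i10).
  exact: diagE.
(* Near lambda = 0 the traces of a_0 for [f] and [fhat] agree, and the truncation keeps the part
   linear in lambda. *)
- exists (dlam (dX (delta_mx ord0 ord0) fhat) (0, 0) ord0 ord0 +
          dlam (dX (delta_mx ord0 ord_max) fhat) (0, 0) ord0 ord_max).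
    have hder k l : is_derive (0 : R) (1 : R) (fun lam => lin_coef fhat ord0 lam k l)
        (dlam (dX (delta_mx ord0 l) fhat) (0, 0) ord0 k).
      under eq_fun do rewrite mxE.
      exact: (is_derive_dlam k U0 (smooth_on_Dv _ fhs)).
    have hder2 : is_derive (0 : R) (1 : R) (fun lam => \tr (lin_coef fhat ord0 lam))
        (dlam (dX (delta_mx ord0 ord0) fhat) (0, 0) ord0 ord0 +
          dlam (dX (delta_mx ord0 ord_max) fhat) (0, 0) ord0 ord_max).
      under eq_fun do rewrite tr2.
      exact: is_deriveD.
    move: c2; rewrite derive1E.
    have -> : 'D_1 (fun lam => \tr (lin_coef f ord0 lam)) (0 : R) =
        'D_1 (fun lam => \tr (lin_coef fhat ord0 lam)) (0 : R).
      by apply: near_eq_derive; apply: filterS near_conj => lam; exact: trE.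
    by have [_ ->] := hder2.
  under eq_fun do rewrite tr2 !mxE.
  by apply: is_deriveD; exact: (fbar_dX_dlam Uo U0 fhs fbarE).
(* If a_1 vanished for [fbar], block (1, 2) of the conjugacy relation would make a_1 of [f] a
   commutator up to transposition, with trace zero. *)
- move=> n2; apply/eqP => a10.
  pose i2 : 'I_n.+1 := inord 2.
  have i2E : i2 = 2%N :> nat by rewrite /i2 inordK.
  have i21 : i2 = i1.+1 :> nat by rewrite i2E i1E.
  have i20 : (0 < i2)%N by rewrite i2E.
  have i12 : i1 != i2 by rewrite -val_eqE /= i1E i2E.
  have subE (A B : 'M[R]_(n.+1 * 2)) : lvl_tri lev A -> lvl_tri lev B ->
      blk (A *m B) i1 i2 = blk A i1 i1 *m blk B i1 i2 + blk A i1 i2 *m blk B i2 i2.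
    move=> At Bt; rewrite blkM (bigD1 i1)//= (bigD1 i2)//=; last by rewrite eq_sym.
    rewrite big1 ?addr0// => l /andP[l1 l2].
    have [lt|gt|/val_inj eq] := ltngtP l i1.
    - by rewrite (lvl_tri_blk At lt) mul0mx.
    - have gt2 : (i2 < l)%N.
        by rewrite ltn_neqAle eq_sym (inj_eq val_inj) l2 i21.
      by rewrite (lvl_tri_blk Bt gt2) mulmx0.
    - by rewrite eq eqxx in l1.
  have ft := lvl_tri_netjac (fd 0); have ht := lvl_tri_netjac hd0.
  have h12 : blk (netjac fhat 0) i1 i2 = 0.
    apply: (etrans (blk_netjac_sub hd0 i10 i21)).
    by apply: (etrans (congr1 trmx (esym (linE (inord 1))))); rewrite a10 trmx0.
  have A12 : blk (netjac f 0) i2 i2 = blk (netjac f 0) i1 i1.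
    exact: etrans (blk_netjac_diag (fd 0) i20) (esym (blk_netjac_diag (fd 0) i10)).
  have P2u : blk L i2 i2 \in unitmx by rewrite unitmxE unitfE gt_eqF.
  have E12 := etrans (esym (subE _ _ ft Lt)) (etrans (congr1 (fun M => blk M i1 i2) LE) (subE _ _ Lt ht)).
  have D2 := diagE i2.
  have B12 := blk_netjac_sub (fd 0) i10 i21.
  have tr0 : \tr (blk (netjac f 0) i1 i2) = 0.
    move: E12 D2 P2u h12 A12; clear.
    move: (blk (netjac f 0) i1 i1) (blk (netjac f 0) i1 i2) (blk (netjac f 0) i2 i2)
      (blk (netjac fhat 0) i1 i2) (blk (netjac fhat 0) i2 i2) (blk L i1 i1) (blk L i1 i2) (blk L i2 i2).
    move=> A B A' Z H P1 Q P E12 D2 Pu Z0 AA; rewrite Z0 mulmx0 add0r in E12; rewrite AA in D2.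
    exact: trace_sylvester Pu E12 D2.
  by move: c3; rewrite -mxtrace_tr -B12 tr0 eqxx.
- have [d h] : \det (\sum_(i < n.+1) lin_coef fbar i 0) = \det (\sum_(i < n.+1) lin_coef f i 0) /\
     \tr (\sum_(i < n.+1) lin_coef fbar i 0) = \tr (\sum_(i < n.+1) lin_coef f i 0).
    have P0 : \det (blk L ord0 ord0) != 0 by rewrite gt_eqF.
    have sE : \sum_(i < n.+1) lin_coef fbar i 0 = \sum_(i < n.+1) lin_coef fhat i 0.
      by apply: eq_bigr => i _; exact: linE.
    have dE := conj_det P0 (diagE ord0); have tE := conj_trace P0 (diagE ord0).
    rewrite (blk_netjac_0 (fd 0)) (blk_netjac_0 hd0) !det_tr in dE.
    rewrite (blk_netjac_0 (fd 0)) (blk_netjac_0 hd0) !mxtrace_tr in tE.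
    by rewrite sE dE tE.
  by rewrite /= d h; exact: hyperbolic_mx2.
- by split; [exact: (fbar_pexpr Uo U0 fhs fbarE)|split; [exact: sym|exact: fbar0 fbarE]].
Qed.

(** * Comparison of coefficients, polar angles *)

Section SmallCoefficients.
Context {R : realType}.

Let cube_assoc (t p : R) : t ^+ 3 * p = t * (t * (t * p)).
Proof. by rewrite !exprS expr0; ring. Qed.

(** Let t tend to 0 and divide by t, three times. *)
Lemma cubic_coefficients (a0 a1 a2 l l' : R) (q phi : R -> R) :
  q t @[t --> (0 : R)^'] --> l' -> phi t @[t --> (0 : R)^'] --> l ->
  (\forall t \near (0 : R)^', a0 + t * (a1 + t * (a2 + t * q t)) = t ^+ 3 * phi t) ->
  [/\ a0 = 0, a1 = 0, a2 = 0 & l' = l].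
Proof.
move=> ql phil E.
have t0 : t @[t --> (0 : R)^'] --> (0 : R) by apply: cvg_within.
have nz : \forall t \near (0 : R)^', t != 0 by exact: nbhs_dnbhs_neq.
have step (a : R) (u w : R -> R) (b m : R) : u t @[t --> (0 : R)^'] --> b ->
    w t @[t --> (0 : R)^'] --> m ->
    (\forall t \near (0 : R)^', a + t * u t = t * w t) ->
    a = 0 /\ (\forall t \near (0 : R)^', u t = w t).
  move=> ub wm e.
  have h1 : a + t * u t @[t --> (0 : R)^'] --> a + 0 * b.
    by apply: cvgD; [exact: cvg_cst|exact: cvgM].
  have h2 : a + t * u t @[t --> (0 : R)^'] --> 0 * m.
    by apply: (cvg_near_eq e); exact: cvgM.
  have a0' : a = 0.
    by have := cvg_unique _ h1 h2; rewrite !mul0r addr0; apply.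
  split => //; apply: filterS2 e nz => t; rewrite a0' add0r => e t0'.
  exact: (mulfI t0').
have c2 : a2 + t * q t @[t --> (0 : R)^'] --> a2 + 0 * l'.
  by apply: cvgD; [exact: cvg_cst|exact: cvgM].
have c1 : a1 + t * (a2 + t * q t) @[t --> (0 : R)^'] --> a1 + 0 * (a2 + 0 * l').
  by apply: cvgD; [exact: cvg_cst|exact: cvgM].
have p1 : t * phi t @[t --> (0 : R)^'] --> 0 * l by exact: cvgM.
have p2 : t * (t * phi t) @[t --> (0 : R)^'] --> 0 * (0 * l) by exact: cvgM.
have [a00 E1] := step a0 _ _ _ _ c1 p2
  (filterS (fun t (e : a0 + t * (a1 + t * (a2 + t * q t)) = t ^+ 3 * phi t) =>
    etrans e (cube_assoc t (phi t))) E).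
have [a10 E2] := step a1 _ _ _ _ c2 p1 E1.
have [a20 E3] := step a2 _ _ _ _ ql phil E2.
split => //; have ql2 : q t @[t --> (0 : R)^'] --> l by exact: (cvg_near_eq E3 phil).
by have := cvg_unique _ ql ql2; apply.
Qed.

Lemma polar (c s : R) : c ^+ 2 + s ^+ 2 = 1 -> exists th, cos th = c /\ sin th = s.
Proof.
move=> cs.
have c1 : -1 <= c <= 1.
  have : `|c| ^+ 2 <= 1 ^+ 2 by rewrite real_normK ?num_real// expr1n -cs lerDl sqr_ge0.
  by rewrite ler_pXn2r ?nnegrE ?normr_ge0 ?ler01// ler_norml.
have s2 : Num.sqrt (1 - c ^+ 2) = `|s| by rewrite -cs addrAC subrr add0r sqrtr_sqr.
have [s0|s0] := leP 0 s.
  by exists (acos c); rewrite acosK ?in_itv// sin_acos// s2 ger0_norm.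
exists (- acos c); rewrite cosN sinN acosK ?in_itv// sin_acos// s2 ltr0_norm//.
by rewrite opprK.
Qed.

End SmallCoefficients.

(** * The normal form as a function of its first argument *)

Section ExpansionOnTheFirstVariable.
Context {R : realType} {n : nat}.
Local Notation V := 'rV[R]_2.
Local Notation W := 'M[R]_(n.+1, 2).
Local Notation ix := ('I_n.+1 * 'I_2)%type.
Variables (omega0 : R) (fbar : W * R -> V) (e : 'I_2 -> pexpr R (option ix)).
Hypothesis w0 : omega0 != 0.
Hypothesis n1 : (1 <= n)%N.
Hypothesis eP : forall p j, fbar p ord0 j = ev (e j) (pvars p).
Hypothesis sym : normal_form_symmetry omega0 fbar.
Hypothesis f0 : forall lam, fbar (0, lam) = 0.
Hypothesis a0E : lin_coef fbar ord0 0 = mulI_mx omega0.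

Let bX (b0 b1 : R) : W := b0 *: delta_mx ord0 ord0 + b1 *: delta_mx ord0 ord_max.

Lemma pvars_derive (X Y : W) (lam mu : R) (o : option ix) :
  is_derive ((X, lam) : W * R) ((Y, mu) : W * R) (fun p => pvars p o) (pvars (Y, mu) o).
Proof.
have lin (g : W * R -> R) (p v : W * R) : (forall h : R, g (h *: v + p) = h * g v + g p) ->
    is_derive p v g (g v).
  move=> gE.
  have cv : h^-1 *: (g (h *: v + p) - g p) @[h --> (0 : R)^'] --> g v.
    apply: (@cvg_near_eq R _ _ _ _ (cst (g v))); last exact: cvg_cst.
    have nz : \forall t \near (0 : R)^', t != 0 by exact: nbhs_dnbhs_neq.
    apply: filterS nz => h h0; rewrite gE addrK /GRing.scale/= mulKf//.
  by apply: DeriveDef; [apply/cvg_ex; exists (g v)|exact: cvg_lim cv].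
by case: o => [[i k]|]; apply: (lin (pvars^~ _)) => h; rewrite /pvars /= ?mxE.
Qed.

Lemma fbar_derive (X Y : W) (lam mu : R) :
  is_derive ((X, lam) : W * R) ((Y, mu) : W * R) fbar
    (\row_k \sum_o hd (e k) (pvars (X, lam)) (pvars (X, lam)) o * pvars (Y, mu) o).
Proof.
apply: is_derive_mx => i k; rewrite (ord1 i) mxE.
have -> : (fun y => fbar y ord0 k) = (fun p => ev (e k) (fun o => pvars p o)).
  by apply/funext => p; rewrite eP.
by apply: (@is_derive_ev _ _ _ (e k) (fun o p => pvars p o)) => o; exact: pvars_derive.
Qed.

Lemma fbar_differentiable p : differentiable fbar p.
Proof.
have dfst : differentiable (fst : W * R -> W) p.
  by apply: linear_differentiable; move=> q; exact: cvg_fst.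
have dsnd : differentiable (snd : W * R -> R) p.
  by apply: linear_differentiable; move=> q; exact: cvg_snd.
have coord (k : 'I_2) : differentiable (fun p => ev (e k) (pvars p)) p.
  apply: (@differentiable_ev _ _ _ (e k) (fun o (p : W * R) => pvars p o)) => -[[i l]|] //=.
  apply: (@differentiable_comp _ _ _ _ fst (fun M : W => M i l)) => //.
  exact: differentiable_coord.
have -> : fbar = (fun p => ev (e ord0) (pvars p) *: (delta_mx ord0 ord0 : V)
    + ev (e ord_max) (pvars p) *: (delta_mx ord0 ord_max : V)).
  apply/funext => q; apply/rowP; apply: two_cases; rewrite !mxE -!eP /=; ring.
by apply: differentiableD; exact: differentiableZl.
Qed.

Lemma lin_coef_hd (i : 'I_n.+1) lam k l :
  lin_coef fbar i lam k l = hd (e k) (pvars (0, lam)) (pvars (0, lam)) (Some (i, l)).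
Proof.
rewrite mxE; have [_ ->] := fbar_derive 0 (delta_mx i l) lam 0.
rewrite mxE (bigD1 (Some (i, l)))//= mxE !eqxx mulr1 big1 ?addr0// => -[[a b]|] /=; last first.
  by rewrite mulr0.
move=> ab; rewrite mxE; case: eqVneq => [ai|]; last by rewrite mulr0.
by case: eqVneq => [bl|]; [move: ab; rewrite ai bl eqxx|rewrite mulr0].
Qed.

(** The symmetry reduces the complex line of X_0 to its real axis; every angle has the form omega0 s
    because omega0 != 0. *)
Lemma fbar_rotate (b0 b1 r lam : R) : b0 ^+ 2 + b1 ^+ 2 = r ^+ 2 -> r != 0 -> forall t,
  fbar (bX (t * b0) (t * b1), lam) ord0 ord0 =
    r^-1 * (b0 * fbar (bX (t * r) 0, lam) ord0 ord0 - b1 * fbar (bX (t * r) 0, lam) ord0 ord_max) /\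
  fbar (bX (t * b0) (t * b1), lam) ord0 ord_max =
    r^-1 * (b1 * fbar (bX (t * r) 0, lam) ord0 ord0 + b0 * fbar (bX (t * r) 0, lam) ord0 ord_max).
Proof.
move=> br r0 t.
have [|th [c s]] := @polar R (r^-1 * b0) (r^-1 * b1).
  by rewrite !exprMn -mulrDr br -exprMn mulVf// expr1n.
have E : (Defs.cscale (expi (omega0 * (th / omega0))) (bX (t * r) 0)) = bX (t * b0) (t * b1).
  rewrite mulrC divfK// /expi c s; apply/matrixP => a b; rewrite !mxE /complex_of_row !mxE /=.
  by case: (a == ord0) => /=; move: b; apply: two_cases; rewrite /=; field.
have last0 : row ord_max (bX (t * r) 0) = 0.
  apply/rowP => k; rewrite !mxE; have -> : (ord_max == ord0 :> 'I_n.+1) = false.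
    by apply/negbTE; rewrite -val_eqE /= -lt0n.
  by rewrite /= !mulr0 addr0.
have := sym (th / omega0) lam last0; rewrite E => ->.
have -> : omega0 * (th / omega0) = th by rewrite mulrC divfK.
rewrite /expi c s !mxE /complex_of_row !mxE /=.
by split; ring.
Qed.

Let vv (x lam : R) (o : bool) : R := if o then x else lam.

Let ev_pzero (i : bool) (q : pexpr R bool) x lam :
  ev (pzero i q) (vv x lam) = ev q (if i then vv 0 lam else vv x 0).
Proof. by rewrite /pzero ev_psubst; apply: ev_ext => -[]; case: i. Qed.

Let G k : pexpr R bool := psubst (fun o : option ix =>
  if o is Some (i, l) then (if (i == ord0) && (l == ord0) then PV true else PC 0)
  else PV false) (e k).

Let GE k x lam : ev (G k) (vv x lam) = fbar (bX x 0, lam) ord0 k.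
Proof.
rewrite eP ev_psubst; apply: ev_ext => -[[i l]|] //=.
by rewrite !mxE; case: eqP => _; case: eqP => _ /=; rewrite ?mulr1 ?mulr0 ?mul0r ?addr0.
Qed.

Let bX00 : bX 0 0 = 0. Proof. by rewrite /bX !scale0r addr0. Qed.

Lemma fbar_odd x lam k : fbar (bX (- x) 0, lam) ord0 k = - fbar (bX x 0, lam) ord0 k.
Proof.
have [->|x0] := eqVneq x 0; first by rewrite oppr0 bX00 f0 mxE oppr0.
have [|A B] := @fbar_rotate (- x) 0 x lam _ x0 1; first by rewrite sqrrN expr0n addr0.
by move: k; apply: two_cases; rewrite !mul1r ?mulr0 in A B; [rewrite A|rewrite B]; field.
Qed.

(** Rotation by pi makes [fbar] odd on the real axis, which removes the quadratic term. At the
    origin [K] and [N] give component k of the coefficients of lambda X_0 and |X_0|^2 X_0. *)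
Lemma first_variable_expansion k : exists c (K N : pexpr R bool),
  (forall x lam, fbar (bX x 0, lam) ord0 k =
     x * (c + lam * ev K (vv 0 lam) + x ^+ 2 * ev N (vv x lam))) /\
  (forall lam, lin_coef fbar ord0 lam k ord0 = c + lam * ev K (vv 0 lam)).
Proof.
have [q0 q0P] := pexpr_div true (G k).
have [q1 q1P] := pexpr_div true q0.
have [q2 q2P] := pexpr_div true q1.
have [K KP] := pexpr_div false q0.
have E0 x lam : ev (G k) (vv x lam) = x * ev q0 (vv x lam).
  by rewrite q0P ev_pzero GE bX00 f0 mxE add0r.
have E1 x lam : ev q0 (vv x lam) = ev q0 (vv 0 lam) + x * (ev q1 (vv 0 lam) + x * ev q2 (vv x lam)).
  by rewrite q1P q2P !ev_pzero.
(* With F(x) the component on the real axis, F(x) + F(-x) = x^2 D(x); oddness makes D vanish for x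
   != 0, and continuity at 0. *)
have m1 lam : ev q1 (vv 0 lam) = 0.
  pose D x := 2 * ev q1 (vv 0 lam) + x * (ev q2 (vv x lam) - ev q2 (vv (- x) lam)).
  have D0 x : x != 0 -> D x = 0.
    move=> x0; apply: (mulfI x0); apply: (mulfI x0); rewrite !mulr0.
    have := fbar_odd x lam k; rewrite -!GE !E0 (E1 x) (E1 (- x)) /D => H.
    by apply/eqP; rewrite -subr_eq0; apply/eqP; move: H; lra.
  have Dc : D x @[x --> (0 : R)^'] --> 2 * ev q1 (vv 0 lam) + 0 * (ev q2 (vv 0 lam) - ev q2 (vv (- 0) lam)).
    apply: cvgD; first exact: cvg_cst.
    have idc : x @[x --> (0 : R)^'] --> (0 : R) by apply: cvg_within.
    apply: cvgM => //; apply: cvgB.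
      by apply: (@ev_cvg _ _ _ _ _ q2 (fun i x => vv x lam i)) => -[] //=; exact: cvg_cst.
    apply: (@ev_cvg _ _ _ _ _ q2 (fun i x => vv (- x) lam i)) => -[] /=; last exact: cvg_cst.
    exact: cvgN.
  have Dz : D x @[x --> (0 : R)^'] --> (0 : R).
    have nz : \forall t \near (0 : R)^', t != 0 by exact: nbhs_dnbhs_neq.
    by apply: (@cvg_near_eq R _ _ _ _ (cst 0)); [apply: filterS nz => x /D0|exact: cvg_cst].
  have : 2 * ev q1 (vv 0 lam) = 0.
    by have := cvg_unique _ Dc Dz; rewrite mul0r addr0; apply.
  by move/eqP; rewrite mulf_eq0 pnatr_eq0/= => /eqP.
exists (ev q0 (vv 0 0)), K, q2.
have E x lam : fbar (bX x 0, lam) ord0 k =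
     x * (ev q0 (vv 0 0) + lam * ev K (vv 0 lam) + x ^+ 2 * ev q2 (vv x lam)).
  by rewrite -GE E0 E1 m1 add0r KP ev_pzero /= expr2 mulrA.
split => // lam.
have bd : is_derive ((0, lam) : W * R) ((delta_mx ord0 ord0 : W, 0) : W * R)
    (fun p => fbar p ord0 k) (lin_coef fbar ord0 lam k ord0).
  rewrite mxE; apply: is_derive_coord; apply: derivableP; apply: diff_derivable.
  exact: fbar_differentiable.
have [bdd bdE] := bd.
have lim1 : h^-1 *: (fbar (h *: (delta_mx ord0 ord0 : W, 0 : R) + (0, lam)) ord0 k - fbar (0, lam) ord0 k)
   @[h --> (0 : R)^'] --> lin_coef fbar ord0 lam k ord0.
  by rewrite -bdE; exact: bdd.
have lim2 : h^-1 *: (fbar (h *: (delta_mx ord0 ord0 : W, 0 : R) + (0, lam)) ord0 k - fbar (0, lam) ord0 k)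
   @[h --> (0 : R)^'] --> ev q0 (vv 0 0) + lam * ev K (vv 0 lam) + 0 ^+ 2 * ev q2 (vv 0 lam).
  have nz : \forall t \near (0 : R)^', t != 0 by exact: nbhs_dnbhs_neq.
  apply: (@cvg_near_eq R _ _ _ _ (fun h => ev q0 (vv 0 0) + lam * ev K (vv 0 lam) + h ^+ 2 * ev q2 (vv h lam))).
    apply: filterS nz => h h0; rewrite f0 mxE subr0.
    have -> : h *: (delta_mx ord0 ord0 : W, 0 : R) + (0, lam) = (bX h 0, lam).
      by congr pair; rewrite /= ?scaler0 ?add0r// /bX scale0r.
    by rewrite E /GRing.scale/= mulKf.
  have idc : x @[x --> (0 : R)^'] --> (0 : R) by apply: cvg_within.
  apply: cvgD; first exact: cvg_cst.
  apply: cvgM; first by rewrite expr2; under eq_fun do rewrite expr2; exact: cvgM.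
  by apply: (@ev_cvg _ _ _ _ _ q2 (fun i x => vv x lam i)) => -[] //=; exact: cvg_cst.
by have := cvg_unique _ lim1 lim2; rewrite expr0n mul0r addr0; apply.
Qed.

Lemma dX_first_row (F : W * R -> R) (q : {poly R}) :
  (forall t, F (bX t 0, 0) = q.[t]) -> forall t, dX (delta_mx ord0 ord0) F (bX t 0, 0) = q^`().[t].
Proof.
move=> FE t; rewrite /dX /derive.
have := derivE q => /(congr1 (fun g : R -> R => g t)) ->.
rewrite derive1E /derive; set G1 := (fun h : R => _); set G2 := (fun h : R => _).
suff -> : G1 = G2 by [].
apply/funext => h; rewrite /G1 /G2 /=.
have -> : h *: (delta_mx ord0 ord0 : W, 0 : R) + (bX t 0, 0) = (bX (h + t) 0, 0).
  by congr pair; rewrite /= ?scaler0 ?add0r// /bX !scale0r !addr0 scalerDl.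
by rewrite !FE /GRing.scale/= mulr1.
Qed.

Fixpoint poly_of_pexpr (q : pexpr R bool) : {poly R} :=
  match q with
  | PC c => c%:P
  | PV i => if i then 'X else 0
  | PA a b => poly_of_pexpr a + poly_of_pexpr b
  | PM a b => poly_of_pexpr a * poly_of_pexpr b
  end.

Lemma horner_poly_of_pexpr q t : (poly_of_pexpr q).[t] = ev q (vv t 0).
Proof.
elim: q => [c|i|a IHa b IHb|a IHa b IHb] /=; rewrite ?hornerE ?IHa ?IHb//.
by case: i; rewrite hornerE.
Qed.

(** Relates condition (4) to the real part of the cubic coefficient: on the real axis [dX]
    differentiates a polynomial in t, and 6 = 3!. *)
Lemma third_derivative (c : R) (K N : pexpr R bool) :
  (forall x lam, fbar (bX x 0, lam) ord0 ord0 =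
     x * (c + lam * ev K (vv 0 lam) + x ^+ 2 * ev N (vv x lam))) ->
  iter 3 (dX (delta_mx ord0 ord0)) (fun p => complex.Re (complex_of_row (fbar p))) (0, 0) =
  6 * ev N (vv 0 0).
Proof.
move=> E; pose p := 'X * (c%:P + 'X^2 * poly_of_pexpr N).
have h0 t : complex.Re (complex_of_row (fbar (bX t 0, 0))) = p.[t].
  rewrite /= E /p !hornerE horner_poly_of_pexpr; ring.
pose F p : R := complex.Re (complex_of_row (fbar p)); pose d : W := delta_mx ord0 ord0.
have h1 := @dX_first_row F _ h0; have h2 := @dX_first_row (dX d F) _ h1.
have h3 := @dX_first_row (dX d (dX d F)) _ h2.
rewrite /= -bX00 [LHS]h3 horner_coef0 !coef_deriv /p coefXM coefD coefC /=.
rewrite -['X^2]/('X^2) coefXnM /= add0r -horner_coef0 horner_poly_of_pexpr.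
by rewrite -!mulrnA mulrC mulr_natr.
Qed.

(** a1 + i a2 and g1 + i g2 are the coefficients of lambda X_0 and |X_0|^2 X_0. When X_0 has size t,
    lambda size t^2 and the other arguments size t^3, exactly these terms and the linear terms in
    [Y] meet at order t^3. *)
Lemma scaling_expansion (al : R) :
  is_derive (0 : R) (1 : R) (fun lam => \tr (lin_coef fbar ord0 lam)) al -> al != 0 ->
  iter 3 (dX (delta_mx ord0 ord0)) (fun p => complex.Re (complex_of_row (fbar p))) (0, 0) != 0 ->
  exists a1 a2 g1 g2 : R, [/\ a1 != 0, g1 != 0 &
    forall (b0 b1 tau : R) (Y : W) (k : 'I_2), exists phi : R -> R,
      phi t @[t --> (0 : R)^'] --> \sum_l \sum_k' lin_coef fbar l 0 k k' * Y l k' +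
        (if k == ord0 then (a1 * tau + g1 * (b0 ^+ 2 + b1 ^+ 2)) * b0
                         - (a2 * tau + g2 * (b0 ^+ 2 + b1 ^+ 2)) * b1
         else (a1 * tau + g1 * (b0 ^+ 2 + b1 ^+ 2)) * b1
            + (a2 * tau + g2 * (b0 ^+ 2 + b1 ^+ 2)) * b0) /\
      \forall t \near (0 : R)^',
        fbar (bX (t * b0) (t * b1) + t ^+ 3 *: Y, t ^+ 2 * tau) ord0 k
        - omega0 * (if k == ord0 then - (t * b1) else t * b0) = t ^+ 3 * phi t].
Proof.
move=> ald al0 c4.
have [c0 [K0 [N0 [E0 L0]]]] := first_variable_expansion ord0.
have [c1 [K1 [N1 [E1 L1]]]] := first_variable_expansion ord_max.
have c0E : c0 = 0 by have := L0 0; rewrite mul0r addr0 a0E mxE.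
have c1E : c1 = omega0 by have := L1 0; rewrite mul0r addr0 a0E mxE.
have idc : x @[x --> (0 : R)^'] --> (0 : R) by apply: cvg_within.
have vvc (q : pexpr R bool) (f g : R -> R) : f t @[t --> (0 : R)^'] --> (0 : R) ->
    g t @[t --> (0 : R)^'] --> (0 : R) -> ev q (vv (f t) (g t)) @[t --> (0 : R)^'] --> ev q (vv 0 0).
  by move=> fc gc; apply: (@ev_cvg _ _ _ _ _ q (fun i t => vv (f t) (g t) i)) => -[].
exists (ev K0 (vv 0 0)), (ev K1 (vv 0 0)), (ev N0 (vv 0 0)), (ev N1 (vv 0 0)); split.
(* By the symmetry the trace of a_0 is twice its real part, so its derivative at 0 is 2 a1. *)
- have trE lam : \tr (lin_coef fbar ord0 lam) = 2 * (lam * ev K0 (vv 0 lam)).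
    have [|M _] := @symmetry_lin_coef _ _ omega0 fbar lam w0 n1 sym _ (f0 lam) ord0 n1.
      by move=> X; apply: diff_derivable; exact: fbar_differentiable.
    by rewrite tr2 -M L0 c0E add0r mulr_natl.
  have [ald' aldE] := ald.
  have lim1 : h^-1 *: (\tr (lin_coef fbar ord0 (h *: 1 + 0)) - \tr (lin_coef fbar ord0 0))
      @[h --> (0 : R)^'] --> al by rewrite -aldE; exact: ald'.
  have lim2 : h^-1 *: (\tr (lin_coef fbar ord0 (h *: 1 + 0)) - \tr (lin_coef fbar ord0 0))
      @[h --> (0 : R)^'] --> 2 * ev K0 (vv 0 0).
    have nz : \forall t \near (0 : R)^', t != 0 by exact: nbhs_dnbhs_neq.
    apply: (@cvg_near_eq R _ _ _ _ (fun h => 2 * ev K0 (vv 0 h))).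
      by apply: filterS nz => h h0; rewrite !trE addr0 /GRing.scale/= mulr1; field.
    by apply: cvgM; [exact: cvg_cst|apply: vvc => //; exact: cvg_cst].
  have alE : al = 2 * ev K0 (vv 0 0) by have := cvg_unique _ lim1 lim2; apply.
  by apply: contraNneq al0 => z; rewrite alE z mulr0.
- by apply: contraNneq c4 => z; rewrite (third_derivative E0) z mulr0.
move=> b0 b1 tau Y k.
pose r := Num.sqrt (b0 ^+ 2 + b1 ^+ 2).
have rE : b0 ^+ 2 + b1 ^+ 2 = r ^+ 2 by rewrite sqr_sqrtr// addr_ge0 ?sqr_ge0.
pose u0 t := tau * ev K0 (vv 0 (t ^+ 2 * tau)) + r ^+ 2 * ev N0 (vv (t * r) (t ^+ 2 * tau)).
pose u1 t := tau * ev K1 (vv 0 (t ^+ 2 * tau)) + r ^+ 2 * ev N1 (vv (t * r) (t ^+ 2 * tau)).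
have ltc : t ^+ 2 * tau @[t --> (0 : R)^'] --> (0 : R).
  have h : t * t * tau @[t --> (0 : R)^'] --> (0 * 0 * tau : R).
    by apply: cvgM; [exact: cvgM|exact: cvg_cst].
  by rewrite !mul0r in h; under eq_fun do rewrite expr2.
have trc : t * r @[t --> (0 : R)^'] --> (0 : R).
  have h : t * r @[t --> (0 : R)^'] --> (0 * r : R) by apply: cvgM => //; exact: cvg_cst.
  by rewrite mul0r in h.
have zc : 0 @[t --> (0 : R)^'] --> (0 : R) by exact: cvg_cst.
have u0c : u0 t @[t --> (0 : R)^'] --> ev K0 (vv 0 0) * tau + ev N0 (vv 0 0) * r ^+ 2.
  rewrite (mulrC _ tau) (mulrC _ (r ^+ 2)).
  by apply: cvgD; apply: cvgM; (exact: cvg_cst || exact: vvc).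
have u1c : u1 t @[t --> (0 : R)^'] --> ev K1 (vv 0 0) * tau + ev N1 (vv 0 0) * r ^+ 2.
  rewrite (mulrC _ tau) (mulrC _ (r ^+ 2)).
  by apply: cvgD; apply: cvgM; (exact: cvg_cst || exact: vvc).
pose s t : R := if k == ord0 then b0 * u0 t - b1 * u1 t else b1 * u0 t + b0 * u1 t.
(* The contribution of X_0 alone; the perturbation t^3 [Y] is added by divided differences, which
   tend to the matrices a_l(0). *)
have pure t : fbar (bX (t * b0) (t * b1), t ^+ 2 * tau) ord0 k
        - omega0 * (if k == ord0 then - (t * b1) else t * b0) = t ^+ 3 * s t.
  have [r0|r0] := eqVneq r 0.
    have [b00 b10] : b0 = 0 /\ b1 = 0.
      move: rE; rewrite r0 expr0n /= => /eqP; rewrite paddr_eq0 ?sqr_ge0// !sqrf_eq0.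
      by move=> /andP[/eqP -> /eqP ->].
    rewrite /s b00 b10 !mulr0 bX00 f0 mxE; case: ifP => _; rewrite ?oppr0; ring.
  have [A B] := fbar_rotate (t ^+ 2 * tau) rE r0 t.
  rewrite /s; move: k @s; apply: two_cases => s /=; rewrite ?A ?B E0 E1 c0E c1E /u0 /u1.
    by rewrite exprMn; field.
  by rewrite exprMn; field.
pose hdt (o : option ix) t := hd (e k) (pvars (bX (t * b0) (t * b1) + t ^+ 3 *: Y, t ^+ 2 * tau))
   (pvars (bX (t * b0) (t * b1), t ^+ 2 * tau)) o.
exists (fun t => \sum_l \sum_k' hdt (Some (l, k')) t * Y l k' + s t); split; last first.
  apply: nearW => t; rewrite mulrDr -pure addrA; congr (_ - _).
  apply/eqP; rewrite -subr_eq; apply/eqP; rewrite !eP ev_hd.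
  rewrite (bigD1 None)//= subrr mulr0 add0r mulr_sumr.
  under [RHS]eq_bigr do rewrite mulr_sumr.
  rewrite pair_bigA /= (reindex_omap Some id)/=; last by case.
  apply: eq_big => [[l k']|[l k'] _] //=; first by rewrite eqxx.
  by rewrite /hdt !mxE; ring.
have tb (b : R) : t * b @[t --> (0 : R)^'] --> (0 : R).
  have h : t * b @[t --> (0 : R)^'] --> (0 * b : R) by apply: cvgM => //; exact: cvg_cst.
  by rewrite mul0r in h.
have t3 (b : R) : t ^+ 3 * b @[t --> (0 : R)^'] --> (0 : R).
  have h : t * (t * (t * b)) @[t --> (0 : R)^'] --> (0 * (0 * 0) : R).
    by apply: cvgM => //; exact: cvgM.
  rewrite !mul0r in h.
  have -> : (fun t => t ^+ 3 * b) = (fun t => t * (t * (t * b))) by apply/funext => t; ring.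
  exact: h.
have p2 (o : option ix) : pvars (bX (t * b0) (t * b1), t ^+ 2 * tau) o @[t --> (0 : R)^'] --> pvars ((0 : W), (0 : R)) o.
  case: o => [[i l]|] /=; last exact: ltc.
  pose d k := (delta_mx ord0 k : W) i l.
  have -> : (fun t => bX (t * b0) (t * b1) i l) = (fun t => t * b0 * d ord0 + t * b1 * d ord_max).
    by apply/funext => t; rewrite mxE [X in X + _]mxE [X in _ + X]mxE.
  have h : t * b0 * d ord0 + t * b1 * d ord_max @[t --> (0 : R)^'] --> 0 * d ord0 + 0 * d ord_max.
    by apply: cvgD; apply: cvgM => //; exact: cvg_cst.
  by rewrite !mul0r addr0 in h; rewrite mxE.
have p1 (o : option ix) : pvars (bX (t * b0) (t * b1) + t ^+ 3 *: Y, t ^+ 2 * tau) o @[t --> (0 : R)^'] --> pvars ((0 : W), (0 : R)) o.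
  case: o => [[i l]|] /=; last exact: ltc.
  have -> : (fun t => (bX (t * b0) (t * b1) + t ^+ 3 *: Y) i l) = 
    fun t => bX (t * b0) (t * b1) i l + t ^+ 3 * Y i l by apply/funext => t; rewrite !mxE.
  have h : bX (t * b0) (t * b1) i l + t ^+ 3 * Y i l @[t --> (0 : R)^'] --> (0 : W) i l + 0.
    by apply: cvgD => //; exact: (p2 (Some (i, l))).
  by rewrite addr0 in h.
apply: cvgD.
  apply: cvg_bigsum => l; apply: cvg_bigsum => k'; apply: cvgM; last exact: cvg_cst.
  by rewrite lin_coef_hd; exact: (hd_cvg (e := e k) (i := Some (l, k')) p1 p2).
rewrite /s !rE; case: ifP => _.
  by apply: cvgB; rewrite mulrC; apply: cvgM => //; exact: cvg_cst.
by apply: cvgD; rewrite mulrC; apply: cvgM => //; exact: cvg_cst.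
Qed.

End ExpansionOnTheFirstVariable.

(** * Partial derivatives independent of the expression *)

Section PartialDerivatives.
Context {R : realType} {I : finType}.

(** [hd] depends on the syntax of the expression, but on the diagonal it is a limit of difference
    quotients and depends only on the function. *)
Lemma hd_slope (e : pexpr R I) (v : I -> R) (i : I) (q : R -> R) (l : R) :
  q h @[h --> (0 : R)^'] --> l ->
  (forall h, ev e (fun j => v j + h * (j == i)%:R) - ev e v = h * q h) ->
  hd e v v i = l.
Proof.
move=> ql E.
have nz : \forall t \near (0 : R)^', t != 0 by exact: nbhs_dnbhs_neq.
have idc : x @[x --> (0 : R)^'] --> (0 : R) by apply: cvg_within.
have c1 : hd e (fun j => v j + h * (j == i)%:R) v i @[h --> (0 : R)^'] --> hd e v v i.
  apply: (@hd_cvg R I _ _ _ e (fun j h => v j + h * (j == i)%:R) (fun j _ => v j) v v i); last first.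
    by move=> j; exact: cvg_cst.
  move=> j; rewrite -[X in _ --> X]addr0; apply: cvgD; first exact: cvg_cst.
  by rewrite -[X in _ --> X](mul0r (j == i)%:R); apply: cvgM => //; exact: cvg_cst.
have c2 : hd e (fun j => v j + h * (j == i)%:R) v i @[h --> (0 : R)^'] --> l.
  apply: cvg_near_eq ql; apply: filterS nz => h h0; apply: (mulfI h0); rewrite -E ev_hd.
  rewrite (bigD1 i)//= eqxx mulr1 addrAC subrr add0r big1 ?addr0 1?mulrC// => j /negPf ->.
  by rewrite mulr0 addr0 subrr mulr0.
by have := cvg_unique _ c1 c2; apply.
Qed.

Lemma hd_eq (e e' : pexpr R I) (c : R) (v : I -> R) (i : I) :
  (forall h, let w := fun j => v j + h * (j == i)%:R in ev e w = c * ev e' w) ->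
  hd e v v i = c * hd e' v v i.
Proof.
move=> E.
have idc : x @[x --> (0 : R)^'] --> (0 : R) by apply: cvg_within.
apply: (@hd_slope e v i (fun h => c * hd e' (fun j => v j + h * (j == i)%:R) v i)).
  apply: cvgM; first exact: cvg_cst.
  apply: (@hd_cvg R I _ _ _ e' (fun j h => v j + h * (j == i)%:R) (fun j _ => v j) v v i); last first.
    by move=> j; exact: cvg_cst.
  move=> j; rewrite -[X in _ --> X]addr0; apply: cvgD; first exact: cvg_cst.
  by rewrite -[X in _ --> X](mul0r (j == i)%:R); apply: cvgM => //; exact: cvg_cst.
move=> h; have v0 : v =1 (fun j => v j + 0 * (j == i)%:R) by move=> j; rewrite mul0r addr0.
rewrite E (ev_ext e v0) E -(ev_ext e' v0) -mulrBr ev_hd (bigD1 i)//= eqxx mulr1.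
rewrite [v i + h]addrC addrK big1 ?addr0; first by rewrite [RHS]mulrCA [h * _]mulrC.
by move=> j /negPf ->; rewrite mulr0 addr0 subrr mulr0.
Qed.

End PartialDerivatives.

Lemma hd_psubst (R : realType) (I J : finType) (s : I -> pexpr R J) (e : pexpr R I) (v w : J -> R) j :
  hd (psubst s e) v w j =
  \sum_i hd e (fun i => ev (s i) v) (fun i => ev (s i) w) i * hd (s i) v w j.
Proof.
elim: e => [c|i|a IHa b IHb|a IHa b IHb] /=.
- by rewrite big1// => i _; rewrite mul0r.
- rewrite (bigD1 i)//= eqxx mul1r big1 ?addr0// => i' /negPf.
  by rewrite eq_sym => ->; rewrite mul0r.
- by rewrite IHa IHb -big_split/=; apply: eq_bigr => i _; rewrite mulrDl.
- rewrite IHa IHb !ev_psubst mulr_suml mulr_sumr -big_split/=.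
  by apply: eq_bigr => i _; ring.
Qed.

(** * The blown-up equation of one node *)

Section ReducedEquation.
Context {R : realType} {n : nat}.
Local Notation V := 'rV[R]_2.
Local Notation W := 'M[R]_(n.+1, 2).
Local Notation ix := ('I_n.+1 * 'I_2)%type.

(* The variables of the blown-up equation of one node: the scale mu, the
   parameter lambda / mu^2, the frequency shift, and the rescaled coordinates. *)
Definition rvar : finType := option (option (option ix)).
Definition vmu : rvar := None.
Definition vtau : rvar := Some None.
Definition vsig : rvar := Some (Some None).
Definition vx (l : 'I_n.+1) (k : 'I_2) : rvar := Some (Some (Some (l, k))).

Definition blowup (v : rvar -> R) : W :=
  \matrix_(l, k) (if l == ord0 then v vmu * v (vx l k) else v vmu ^+ 3 * v (vx l k)).

(** Component k of i b, where b is the rescaled first argument. *)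
Definition turn (v : rvar -> R) (k : 'I_2) : R :=
  if k == ord0 then - v (vx ord0 ord_max) else v (vx ord0 ord0).

Variables (omega0 : R) (fbar : W * R -> V) (e : 'I_2 -> pexpr R (option ix)).
Hypothesis w0 : omega0 != 0.
Hypothesis n1 : (1 <= n)%N.
Hypothesis eP : forall p j, fbar p ord0 j = ev (e j) (pvars p).
Hypothesis sym : normal_form_symmetry omega0 fbar.
Hypothesis f0 : forall lam, fbar (0, lam) = 0.
Hypothesis a0E : lin_coef fbar ord0 0 = mulI_mx omega0.

(** Component k of the limit equation, in complex notation: the sum of a_l(0) x_l over l >= 1, plus
    ((a1 + i a2) tau + (g1 + i g2) |b|^2 - i tau sigma) b. *)
Definition reduced0 (a1 a2 g1 g2 : R) (k : 'I_2) (v : rvar -> R) : R :=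
  let rho := v (vx ord0 ord0) ^+ 2 + v (vx ord0 ord_max) ^+ 2 in
  let A := a1 * v vtau + g1 * rho in
  let C := a2 * v vtau + g2 * rho - v vtau * v vsig in
  \sum_(l | l != ord0) \sum_k' lin_coef fbar l 0 k k' * v (vx l k') +
  (if k == ord0 then A * v (vx ord0 ord0) - C * v (vx ord0 ord_max)
   else A * v (vx ord0 ord_max) + C * v (vx ord0 ord0)).

Definition blowup_subst (o : option ix) : pexpr R rvar :=
  if o is Some (l, k) then
    (if l == ord0 then PM (PV vmu) (PV (vx l k)) else PM (ppow (PV vmu) 3) (PV (vx l k)))
  else PM (ppow (PV vmu) 2) (PV vtau).

Lemma ev_blowup_subst k v : ev (psubst blowup_subst (e k)) v =
  fbar (blowup v, v vmu ^+ 2 * v vtau) ord0 k.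
Proof.
rewrite ev_psubst eP; apply: ev_ext => -[[l k']|] /=; last by rewrite expr2 mulr1.
by rewrite mxE; case: eqP => _ //=; rewrite !exprS expr0.
Qed.

(** Three divisions by mu leave coefficients independent of mu, which [scaling_expansion] forces to
    vanish. Thus [Q] is a polynomial also at mu = 0, where the implicit function theorem is
    applied. *)
Lemma reduced_equation (al : R) :
  is_derive (0 : R) (1 : R) (fun lam => \tr (lin_coef fbar ord0 lam)) al -> al != 0 ->
  iter 3 (dX (delta_mx ord0 ord0)) (fun p => complex.Re (complex_of_row (fbar p))) (0, 0) != 0 ->
  exists (a1 a2 g1 g2 : R) (Q : 'I_2 -> pexpr R rvar), [/\ a1 != 0, g1 != 0,
    (forall k v, fbar (blowup v, v vmu ^+ 2 * v vtau) ord0 k =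
       (omega0 + v vmu ^+ 2 * v vtau * v vsig) * v vmu * turn v k + v vmu ^+ 3 * ev (Q k) v) &
    forall k v, v vmu = 0 -> ev (Q k) v = reduced0 a1 a2 g1 g2 k v].
Proof.
move=> ald al0 c4.
have [a1 [a2 [g1 [g2 [a10 g10 sc]]]]] := scaling_expansion w0 n1 eP sym f0 a0E ald al0 c4.
pose tb (k : 'I_2) : pexpr R rvar := if k == ord0 then PM (PC (-1)) (PV (vx ord0 ord_max)) else PV (vx ord0 ord0).
have tbE (k : 'I_2) (v : rvar -> R) : ev (tb k) v = turn v k by rewrite /tb /turn; case: ifP => _ //=; rewrite mulN1r.
pose P (k : 'I_2) : pexpr R rvar := PA (psubst blowup_subst (e k)) (PM (PC (-1))
  (PM (PA (PC omega0) (PM (PM (ppow (PV vmu) 2) (PV vtau)) (PV vsig))) (PM (PV vmu) (tb k)))).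
have PE (k : 'I_2) (v : rvar -> R) : ev (P k) v = fbar (blowup v, v vmu ^+ 2 * v vtau) ord0 k -
   (omega0 + v vmu ^+ 2 * v vtau * v vsig) * v vmu * turn v k.
  by rewrite /P /= ev_blowup_subst tbE; ring.
have q1 k := pexpr_div vmu (P k).
have q2 k := pexpr_div vmu (sval (q1 k)).
have q3 k := pexpr_div vmu (sval (q2 k)).
pose at_ (v : rvar -> R) t (i : rvar) : R := if i == vmu then t else v i.
have pzE (q : pexpr R rvar) v t : ev (pzero vmu q) (at_ v t) = ev q (at_ v 0).
  by rewrite ev_psubst; apply: ev_ext => i; rewrite /at_; case: eqP => //= /eqP/negPf ->.
have main k v : [/\ ev (P k) (at_ v 0) = 0, ev (sval (q1 k)) (at_ v 0) = 0,
    ev (sval (q2 k)) (at_ v 0) = 0 & ev (sval (q3 k)) (at_ v 0) = reduced0 a1 a2 g1 g2 k v].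
  pose Y : W := \matrix_(l, k) (if l == ord0 then 0 else v (vx l k)).
  have [phi [phil phiE]] := sc (v (vx ord0 ord0)) (v (vx ord0 ord_max)) (v vtau) Y k.
  have b0E t : blowup (at_ v t) = (t * v (vx ord0 ord0)) *: delta_mx ord0 ord0 +
      (t * v (vx ord0 ord_max)) *: delta_mx ord0 ord_max + t ^+ 3 *: Y.
    apply/matrixP => l; apply: two_cases; rewrite !mxE /at_ /= eqxx;
      case: eqVneq => [->|_] /=; rewrite ?mulr1n ?mulr0n; ring.
  apply: (@cubic_coefficients R _ _ _ _ _ (fun t => ev (sval (q3 k)) (at_ v t))
    (fun t => phi t - v vtau * v vsig * turn v k)).
  - apply: (@ev_cvg R _ _ _ _ (sval (q3 k)) (fun i t => at_ v t i)) => i; rewrite /at_.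
    by case: eqP => _; [apply: cvg_within|exact: cvg_cst].
  - have -> : reduced0 a1 a2 g1 g2 k v = (\sum_l \sum_k' lin_coef fbar l 0 k k' * Y l k' +
        (if k == ord0 then (a1 * v vtau + g1 * (v (vx ord0 ord0) ^+ 2 + v (vx ord0 ord_max) ^+ 2)) * v (vx ord0 ord0)
          - (a2 * v vtau + g2 * (v (vx ord0 ord0) ^+ 2 + v (vx ord0 ord_max) ^+ 2)) * v (vx ord0 ord_max)
         else (a1 * v vtau + g1 * (v (vx ord0 ord0) ^+ 2 + v (vx ord0 ord_max) ^+ 2)) * v (vx ord0 ord_max)
            + (a2 * v vtau + g2 * (v (vx ord0 ord0) ^+ 2 + v (vx ord0 ord_max) ^+ 2)) * v (vx ord0 ord0)))
        - v vtau * v vsig * turn v k.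
      have z0 : \sum_k' lin_coef fbar ord0 0 k k' * Y ord0 k' = 0.
        by rewrite big1// => k' _; rewrite [Y _ _]mxE eqxx mulr0.
      rewrite /reduced0 /turn [in RHS](bigD1 ord0)//= z0 add0r.
      have -> : \sum_(l < n.+1 | l != ord0) \sum_k' lin_coef fbar l 0 k k' * v (vx l k') =
         \sum_(i < n.+1 | i != ord0) \sum_k' lin_coef fbar i 0 k k' * Y i k'.
        by apply: eq_bigr => l /negPf l0; apply: eq_bigr => k' _; rewrite [Y _ _]mxE l0.
      by case: ifP => _; ring.
    by apply: cvgB => //; exact: cvg_cst.
  - apply: filterS phiE => t E.
    have aE i : at_ v t i = if i == vmu then t else v i by [].
    have := PE k (at_ v t); rewrite (svalP (q1 k)) (svalP (q2 k)) (svalP (q3 k)) !pzE !aE /=.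
    move=> ->; rewrite b0E mulrBr -E /turn !aE /=.
    by case: ifP => _; ring.
exists a1, a2, g1, g2, (fun k => sval (q3 k)); split => //.
- move=> k v; apply/eqP; rewrite addrC -subr_eq -PE; apply/eqP.
  have vE : v =1 at_ v (v vmu) by move=> i; rewrite /at_; case: eqP => // ->.
  have [A0 A1 A2 _] := main k v.
  rewrite (ev_ext (P k) vE) (svalP (q1 k)) (svalP (q2 k)) (svalP (q3 k)) !pzE A0 A1 A2.
  by rewrite -(ev_ext _ vE) /at_ /=; ring.
- move=> k v v0; have [_ _ _ <-] := main k v.
  by apply: ev_ext => i; rewrite /at_; case: eqP => // ->.
Qed.

End ReducedEquation.

(** * Floquet multipliers *)

Section FloquetMultipliers.
Context {R : realType} {N : nat}.
Local Notation C := (complex R).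
Local Notation Cmx := (map_mx (real_complex R)).

Definition split_by (p : pred 'I_N) (M : 'M[R]_N) := forall x y, p x != p y -> M x y = 0.

Lemma split_byM p (A B : 'M[R]_N) : split_by p A -> split_by p B -> split_by p (A *m B).
Proof.
move=> Ap Bp x y xy; rewrite mxE big1// => l _.
have [e|ne] := eqVneq (p x) (p l); last by rewrite Ap// mul0r.
by rewrite Bp ?mulr0// -e.
Qed.

Lemma split_by_mexp p (A : 'M[R]_N) t : split_by p A -> split_by p (mexp A t).
Proof.
move=> Ap x y xy; apply: mexp_entry0 => k.
elim: k x y xy => [|k IHk] x y xy.
  by rewrite expr0 mxE; case: eqVneq => // xy'; rewrite xy' eqxx in xy.
have Ak : split_by p (A ^+ k) by move=> ? ? ?; exact: IHk.
by rewrite exprS; exact: (split_byM Ap Ak xy).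
Qed.

Lemma char_poly_lvl (lv : 'I_N -> nat) (A B : 'M[R]_N) : lvl_tri lv A -> lvl_tri lv B ->
  (forall x y, lv x = lv y -> A x y = B x y) -> char_poly (Cmx A) = char_poly (Cmx B).
Proof.
have tri (M : 'M[R]_N) : lvl_tri lv M -> lvl_tri lv (char_poly_mx (Cmx M)).
  move=> Mt x y yx; rewrite !mxE Mt//; case: eqVneq yx => [->|_ _]; first by rewrite ltnn.
  by rewrite mulr0n sub0r !rmorph0 ?polyC0 oppr0.
move=> At Bt AB; apply: (det_lvl_eq (tri _ At) (tri _ Bt)) => x y xy.
by rewrite !mxE AB.
Qed.

Lemma char_poly_replace (lv : 'I_N -> nat) (A B : 'M[R]_N) (a : 'I_N) :
  lvl_tri lv A -> lvl_tri lv B -> (forall x, lv x = lv a -> x = a) ->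
  (forall x y, lv x = lv y -> x != a -> A x y = B x y) ->
  char_poly (Cmx A) * ('X - (B a a)%:C%C%:P) = char_poly (Cmx B) * ('X - (A a a)%:C%C%:P).
Proof.
have tri (M : 'M[R]_N) : lvl_tri lv M -> lvl_tri lv (char_poly_mx (Cmx M)).
  move=> Mt x y yx; rewrite !mxE Mt//; case: eqVneq yx => [->|_ _]; first by rewrite ltnn.
  by rewrite mulr0n sub0r !rmorph0 ?polyC0 oppr0.
move=> At Bt aP AB.
have := @det_lvl _ _ lv _ _ a (tri _ At) (tri _ Bt) aP.
rewrite !(mxE, eqxx) /= !mulr1n; apply => x y xy xa.
by rewrite !mxE AB.
Qed.

(** Replacing the neutral entry 0 at (a, a) by 1 gives a hyperbolic matrix H. As a is alone on its
    level, the characteristic polynomials of exp(TE) and exp(TH) differ only by exchanging the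
    factors X - 1 and X - e^T; no root for H lies on the unit circle. *)
Lemma hyperbolic_multipliers (lv : 'I_N -> nat) (E : 'M[R]_N) (a : 'I_N) (T : R) :
  0 < T -> lvl_tri lv E -> (forall x, lv x = lv a -> x = a) -> E a a = 0 ->
  hyperbolic_mx (E + delta_mx a a) ->
  exists mults : seq C, char_poly (Cmx (mexp E T)) = \prod_(z <- mults) ('X - z%:P) /\
    count (fun z => ComplexField.Normc.normc z == 1) mults = 1%N.
Proof.
move=> T0 Et aP Ea Eh.
pose H := E + delta_mx a a.
have Ht : lvl_tri lv H.
  move=> x y yx; rewrite !mxE Et// add0r; case: eqP => // xa; case: eqP => // ya.
  by move: yx; rewrite xa ya ltnn.
have mexp_tri (M : 'M[R]_N) : lvl_tri lv M -> lvl_tri lv (mexp M T).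
  by move=> Mt x y yx; apply: mexp_entry0 => k; exact: (lvl_triX k Mt).
have ea : mexp E T a a = 1.
  by rewrite (@mexp_scalar _ _ E a 0) ?mul0r ?expR0// => k; rewrite (lvl_triX_diag k Et aP) Ea.
have ha : mexp H T a a = expR T.
  rewrite (@mexp_scalar _ _ H a 1) ?mul1r// => k.
  by rewrite (lvl_triX_diag k Ht aP) !mxE Ea !eqxx add0r.
have same x y : lv x = lv y -> x != a -> mexp E T x y = mexp H T x y.
  move=> xy xa; apply: mexp_entry_eq => k.
  apply: (@lvl_triX_eq _ _ lv (fun l => l != lv a) E H k Et Ht) => //.
    move=> i j ij ia; rewrite !mxE; case: eqP => [ia'|_]; last by rewrite addr0.
    by rewrite ia' eqxx in ia.
  by apply: contra xa => /eqP /aP ->.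
have := char_poly_replace (mexp_tri _ Et) (mexp_tri _ Ht) aP same.
rewrite ea ha.
have [rs rsE] := closed_field_poly_normal (char_poly (Cmx (mexp E T))).
have [ws wsE] := closed_field_poly_normal (char_poly (Cmx (mexp H T))).
rewrite (monicP (char_poly_monic _)) scale1r in rsE.
rewrite (monicP (char_poly_monic _)) scale1r in wsE.
move=> EH; exists rs; split => //.
have wh w : w \in ws -> ComplexField.Normc.normc w != 1.
  move=> ww; apply: (@hyperbolic_mexp _ _ H T w); [by rewrite gt_eqF|exact: Eh|].
  by rewrite eigenvalue_root_char wsE root_prod_XsubC.
have pe : perm_eq ((expR T)%:C%C :: rs) (1 :: ws).
  by apply: prod_XsubC_eq; rewrite !big_cons -rsE -wsE mulrC EH mulrC.
have := seq.permP pe (fun z => ComplexField.Normc.normc z == 1).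
have nr (x : R) : ComplexField.Normc.normc x%:C%C = `|x|.
  by rewrite /= expr0n /= addr0 sqrtr_sqr.
have nT : (ComplexField.Normc.normc (expR T)%:C%C == 1) = false.
  rewrite nr ger0_norm ?expR_ge0//; apply/negbTE; rewrite gt_eqF//.
  by rewrite -[X in X < _]expR0 ltr_expR.
have n1 : ComplexField.Normc.normc (1 : C) == 1 by rewrite (nr 1) normr1.
rewrite [LHS]/= [X in _ = X -> _]/= nT n1 add0n => ->; congr (1 + _)%N.
by apply/eqP; rewrite -leqn0 leqNgt -has_count; apply/hasPn => w /wh.
Qed.

Variables (p : pred 'I_N) (A0 J : 'M[R]_N) (F : R -> 'M[R]_N) (T : R).
Variables (lv : 'I_N -> nat) (a : 'I_N).
Hypothesis T0 : 0 < T.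
Hypothesis A0p : split_by p A0.
Hypothesis Jp : split_by p J.
Hypothesis Fp : forall t x y, ~~ (p x && ~~ p y) -> F t x y = 0.
Hypothesis Fc : forall x y, continuous (fun t => F t x y).
Hypothesis JT : mexp J T = 1%:M.
Hypothesis Et : lvl_tri lv (A0 - J).
Hypothesis lvp : forall x y, p x -> ~~ p y -> (lv x < lv y)%N.
Hypothesis aP : forall x, lv x = lv a -> x = a.
Hypothesis Ea : (A0 - J) a a = 0.
Hypothesis Eh : hyperbolic_mx (A0 - J + delta_mx a a).

Let E := A0 - J.
(** The fundamental matrix without the coupling [F]: in the rotating frame its equation has the
    constant matrix [E]. [Ui] is its inverse. *)
Let U t := mexp E t *m mexp J t.
Let Ui t := mexp J (- t) *m mexp E (- t).

Let Up t : split_by p (U t).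
Proof.
have Ep : split_by p E by move=> x y xy; rewrite !mxE A0p// Jp// subrr.
by apply: split_byM; exact: split_by_mexp.
Qed.

Let UiK t : Ui t *m U t = 1%:M.
Proof.
have inv (M : 'M[R]_N) s : mexp M (- s) *m mexp M s = 1%:M by rewrite mexpD addNr mexp0.
by rewrite /Ui /U mulmxA -(mulmxA _ (mexp E (- t))) inv mulmx1 inv.
Qed.

Let U_derive t : mderive U t (U t *m (mexp J (- t) *m A0 *m mexp J t)).
Proof.
apply: mderive_eq (mderiveM (mexp_derive E t) (mexp_derive J t)).
rewrite -(mexp_comm J t) /U !mulmxA -(mulmxA (mexp E t) (mexp J t) (mexp J (- t))) mexpN mulmx1.
by rewrite -mulmxDl -mulmxDr /E subrK.
Qed.

Let G t := U t *m F t *m Ui t.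

Let mexp_cont (M : 'M[R]_N) x y : continuous (fun t => mexp M t x y).
Proof. by move=> t; apply: is_derive1_continuous; exact: mexp_derive. Qed.

Let mulmx_cont (A B : R -> 'M[R]_N) : (forall x y, continuous (fun t => A t x y)) ->
  (forall x y, continuous (fun t => B t x y)) -> forall x y, continuous (fun t => (A t *m B t) x y).
Proof.
move=> Ac Bc x y t; rewrite /continuous_at mxE; under eq_fun do rewrite mxE.
by apply: cvg_bigsum => l; apply: cvgM; [exact: Ac|exact: Bc].
Qed.

Let G_cont x y : continuous (fun t => G t x y).
Proof.
have oppc (A : R -> 'M[R]_N) : (forall x y, continuous (fun t => A t x y)) ->
    forall x y, continuous (fun t => A (- t) x y).
  move=> Ac x' y' t; apply: (@continuous_comp _ _ _ -%R (fun t => A t x' y')).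
    exact: opp_continuous.
  exact: Ac.
have Uc := @mulmx_cont (mexp E) (mexp J) (@mexp_cont E) (@mexp_cont J).
have Uic := @mulmx_cont (fun t => mexp J (- t)) (fun t => mexp E (- t))
  (oppc _ (@mexp_cont J)) (oppc _ (@mexp_cont E)).
exact: (@mulmx_cont (fun t => U t *m F t) Ui (@mulmx_cont U F Uc Fc) Uic).
Qed.

(** Ansatz Y = (1 + Z) U with Z' = U F U^-1. [F], and hence Z, has entries only from [p] to its
    complement; so Z U F = 0 and the ansatz solves the equation. At time T the frame has returned,
    and Y(T) has the diagonal blocks of exp(TE). *)
Lemma floquet_multipliers : exists (Y : R -> 'M[R]_N) (mults : seq C),
  [/\ Y 0 = 1%:M,
      (forall t x y, is_derive t (1 : R) (fun s => Y s x y)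
        ((Y t *m (mexp J (- t) *m A0 *m mexp J t + F t)) x y)),
      char_poly (Cmx (Y T)) = \prod_(z <- mults) ('X - z%:P) &
      count (fun z => ComplexField.Normc.normc z == 1) mults = 1%N].
Proof.
have [z zP] := choice (fun xy : 'I_N * 'I_N => antiderivative (@G_cont xy.1 xy.2)).
pose Z t : 'M[R]_N := \matrix_(x, y) (if p x && ~~ p y then z (x, y) t else 0).
have Z0 t x y : ~~ (p x && ~~ p y) -> Z t x y = 0 by rewrite mxE => /negPf ->.
have Uip t : split_by p (Ui t).
  have Ep : split_by p E by move=> x y xy; rewrite !mxE A0p// Jp// subrr.
  by apply: split_byM; exact: split_by_mexp.
have ZM t (M : 'M[R]_N) : split_by p M -> forall x y, ~~ (p x && ~~ p y) -> (Z t *m M) x y = 0.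
  move=> Mp x y xy; rewrite mxE big1// => l _.
  have [e|ne] := eqVneq (p l) (p y); last by rewrite Mp// mulr0.
  by rewrite Z0 ?mul0r// e.
have MF t (M : 'M[R]_N) : split_by p M -> forall x y, ~~ (p x && ~~ p y) -> (M *m F t) x y = 0.
  move=> Mp x y xy; rewrite mxE big1// => l _.
  have [e|ne] := eqVneq (p x) (p l); last by rewrite Mp// mul0r.
  by rewrite Fp ?mulr0// -e.
have G0 t x y : ~~ (p x && ~~ p y) -> G t x y = 0.
  move=> xy; rewrite mxE big1// => l _.
  have [e|ne] := eqVneq (p l) (p y); last by rewrite Uip// mulr0.
  by rewrite MF ?mul0r// e.
have Zd t : mderive Z t (G t).
  move=> x y; have [xy|xy] := boolP (p x && ~~ p y).
    have -> : (fun s => Z s x y) = z (x, y) by apply/funext => s; rewrite mxE xy.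
    by have [_ /(_ t)] := zP (x, y).
  have -> : (fun s => Z s x y) = cst 0 by apply/funext => s; rewrite Z0.
  by rewrite G0//; exact: is_derive_cst.
have Zz : Z 0 = 0.
  by apply/matrixP => x y; rewrite !mxE; case: ifP => // _; have [] := zP (x, y).
have ZUF t : Z t *m U t *m F t = 0.
  apply/matrixP => x y; rewrite mxE mxE big1// => l _.
  have [pl|npl] := boolP (p l); first by rewrite ZM ?mul0r// pl andbF.
  by rewrite Fp ?mulr0// (negPf npl).
pose Y t := (1%:M + Z t) *m U t.
have UT : U T = mexp E T by rewrite /U JT mulmx1.
have Etri : lvl_tri lv (mexp E T).
  by move=> x y yx; apply: mexp_entry0 => k; exact: (lvl_triX k Et).
have YT x y : ~~ (p x && ~~ p y) -> Y T x y = mexp E T x y.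
  by move=> xy; rewrite /Y mulmxDl mul1mx mxE ZM// addr0 UT.
have Ytri : lvl_tri lv (Y T).
  move=> x y yx; rewrite YT; first exact: Etri.
  by apply: contraL yx => /andP[px py]; rewrite -leqNgt ltnW// lvp.
have [mults [mE mc]] := hyperbolic_multipliers T0 Et aP Ea Eh.
exists Y, mults; split => //.
- by rewrite /Y Zz addr0 mul1mx /U !mexp0 mulmx1.
- move=> t x y.
  suff : mderive Y t (Y t *m (mexp J (- t) *m A0 *m mexp J t + F t)) by exact.
  have ZD : mderive (fun s => 1%:M + Z s) t (0 + G t).
    by apply: mderiveD; [exact: mderive_cst|exact: Zd].
  apply: mderive_eq (mderiveM ZD (U_derive t)).
  have YF : Y t *m F t = G t *m U t.
    rewrite /Y mulmxDl mul1mx [LHS]mulmxDl ZUF addr0.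
    by rewrite /G -[RHS]mulmxA UiK mulmx1.
  rewrite add0r mulmxDr YF [RHS]addrC; congr (_ + _); exact: mulmxA.
- rewrite -mE; apply: (char_poly_lvl Ytri Etri) => x y xy; apply: YT.
  by apply/negP => /andP[px py]; have := lvp px py; rewrite xy ltnn.
Qed.

End FloquetMultipliers.

(** * Construction of the branch, node by node *)

Section Branch.
Context {R : realType} {n : nat}.
Local Notation V := 'rV[R]_2.
Local Notation W := 'M[R]_(n.+1, 2).
Local Notation rvar := (@rvar n).
Variables (fbar : W * R -> V) (Q : 'I_2 -> pexpr R rvar) (a1 a2 g1 g2 : R).
Hypothesis a10 : a1 != 0.
Hypothesis g10 : g1 != 0.
Hypothesis QE : forall k v, v (@vmu n) = 0 -> ev (Q k) v = reduced0 fbar a1 a2 g1 g2 k v.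

Lemma hd_quadratic (I : finType) (e : pexpr R I) v i (c0 c1 c2 : R) :
  (forall h, ev e (fun j => v j + h * (j == i)%:R) - ev e v = h * (c0 + h * (c1 + h * c2))) ->
  hd e v v i = c0.
Proof.
move=> E; apply: (hd_slope _ E).
have idc : x @[x --> (0 : R)^'] --> (0 : R) by apply: cvg_within.
rewrite -[X in _ --> X]addr0; apply: cvgD; first exact: cvg_cst.
rewrite -[X in _ --> X](mul0r (c1 + 0 * c2)); apply: cvgM => //.
by apply: cvgD; [exact: cvg_cst|apply: cvgM => //; exact: cvg_cst].
Qed.

Section PartialDerivativesAtZero.
Variable v : rvar -> R.
Hypothesis v0 : v (@vmu n) = 0.
Let b0 := v (vx ord0 ord0).
Let b1 := v (vx ord0 ord_max).
Let tau := v (@vtau n).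
Let A := a1 * tau + g1 * (b0 ^+ 2 + b1 ^+ 2).
Let C := a2 * tau + g2 * (b0 ^+ 2 + b1 ^+ 2) - tau * v (@vsig n).

Let core (k : 'I_2) (x y t u : R) : R :=
  let A := a1 * t + g1 * (x ^+ 2 + y ^+ 2) in
  let C := a2 * t + g2 * (x ^+ 2 + y ^+ 2) - t * u in
  if k == ord0 then A * x - C * y else A * y + C * x.

Let same k i h : i != @vmu n -> (forall l k', l != ord0 -> i != vx l k') ->
  let w := fun j => v j + h * (j == i)%:R in
  ev (Q k) w - ev (Q k) v =
  core k (w (vx ord0 ord0)) (w (vx ord0 ord_max)) (w (@vtau n)) (w (@vsig n)) -
  core k b0 b1 tau (v (@vsig n)).
Proof.
move=> imu il w; rewrite !QE//; last by rewrite /w v0 add0r eq_sym (negPf imu) mulr0.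
rewrite /reduced0 -/(core k _ _ _ _) -/(core k _ _ _ _) opprD addrACA -[RHS]add0r.
congr (_ + _); apply/eqP; rewrite subr_eq0; apply/eqP.
apply: eq_bigr => l l0; apply: eq_bigr => k' _; congr (_ * _).
by rewrite /w eq_sym (negPf (il _ _ l0)) mulr0 addr0.
Qed.

Lemma hd_reduced : [/\ hd (Q ord0) v v (vx ord0 ord0) = A + 2 * g1 * b0 ^+ 2 - 2 * g2 * b0 * b1,
  hd (Q ord0) v v (vx ord0 ord_max) = 2 * g1 * b0 * b1 - C - 2 * g2 * b1 ^+ 2,
  hd (Q ord_max) v v (vx ord0 ord0) = 2 * g1 * b0 * b1 + C + 2 * g2 * b0 ^+ 2 &
  hd (Q ord_max) v v (vx ord0 ord_max) = A + 2 * g1 * b1 ^+ 2 + 2 * g2 * b0 * b1] /\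
  hd (Q ord0) v v (@vsig n) = tau * b1 /\ hd (Q ord_max) v v (@vsig n) = - (tau * b0).
Proof.
have x0 k l k' : l != ord0 -> vx (n := n) ord0 k != vx l k'.
  by move=> /eqP l0; apply/eqP => -[/esym].
have s0 (l : 'I_n.+1) k' : l != ord0 -> @vsig n != vx l k' by [].
split; [split|split].
- apply: (@hd_quadratic _ _ _ _ _ (3 * g1 * b0 - g2 * b1) g1) => h.
  rewrite same//; last exact: x0.
  by rewrite /core /= ?eqxx -/b0 -/b1 -/tau ?mulr0 ?addr0 ?mulr1 /A /C; ring.
- apply: (@hd_quadratic _ _ _ _ _ (g1 * b0 - 3 * g2 * b1) (- g2)) => h.
  rewrite same//; last exact: x0.
  by rewrite /core /= ?eqxx -/b0 -/b1 -/tau ?mulr0 ?addr0 ?mulr1 /A /C; ring.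
- apply: (@hd_quadratic _ _ _ _ _ (g1 * b1 + 3 * g2 * b0) g2) => h.
  rewrite same//; last exact: x0.
  by rewrite /core /= ?eqxx -/b0 -/b1 -/tau ?mulr0 ?addr0 ?mulr1 /A /C; ring.
- apply: (@hd_quadratic _ _ _ _ _ (3 * g1 * b1 + g2 * b0) g1) => h.
  rewrite same//; last exact: x0.
  by rewrite /core /= ?eqxx -/b0 -/b1 -/tau ?mulr0 ?addr0 ?mulr1 /A /C; ring.
- apply: (@hd_quadratic _ _ _ _ _ 0 0) => h.
  rewrite same//.
  by rewrite /core /= ?eqxx -/b0 -/b1 -/tau ?mulr0 ?addr0 ?mulr1; ring.
- apply: (@hd_quadratic _ _ _ _ _ 0 0) => h.
  rewrite same//.
  by rewrite /core /= ?eqxx -/b0 -/b1 -/tau ?mulr0 ?addr0 ?mulr1; ring.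
Qed.

End PartialDerivativesAtZero.

(** Here mu is the scale of node i, so that node i - l has scale mu^(3^l), and the frequency shift
    is a function of the scale of node 1. Slot l holds x_(i-l) / mu^3, and zero if it reads node 0.
    The subtractions in the exponents are exact, as l >= 1 gives 3^l >= 3. *)
Definition node_vars (s : R) (beta : nat -> 'I_2 -> R -> R) (sigma : R -> R) (i : nat)
    (v : rvar) (mu : R) : R :=
  match v with
  | None => mu
  | Some None => s * mu ^+ (2 * 3 ^ i.-1 - 2)
  | Some (Some None) => sigma (mu ^+ (3 ^ i.-1))
  | Some (Some (Some (l, k))) =>
      if l == ord0 then beta i k mu
      else if (l < i)%N then mu ^+ (3 ^ l - 3) * beta (i - l)%N k (mu ^+ (3 ^ l)) else 0
  end.

(** [s] is the sign of lambda; d <= 1 keeps the powers of mu in the domain; the zero second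
    component at node 1 fixes the phase of the wave. *)
Definition is_branch (m : nat) (s d : R) (beta : nat -> 'I_2 -> R -> R) (sigma : R -> R) :=
  [/\ 0 < d <= 1, smooth1 [set x | `|x| < d] sigma, (forall mu, beta 1%N ord_max mu = 0) &
    forall i, (1 <= i <= m)%N ->
      [/\ forall k, smooth1 [set x | `|x| < d] (beta i k),
         beta i ord0 0 ^+ 2 + beta i ord_max 0 ^+ 2 != 0 &
         forall k mu, `|mu| < d -> ev (Q k) (node_vars s beta sigma i ^~ mu) = 0]].

(** In complex notation h |c|^2 c = -(x + iy). With u = -(x + iy)/h the solution is c = r u, where
    r^3 |u|^2 = 1. *)
Lemma cube_solve (h1 h2 x y : R) : h1 != 0 -> x ^+ 2 + y ^+ 2 != 0 -> exists c0 c1 : R,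
  [/\ c0 ^+ 2 + c1 ^+ 2 != 0,
    x + (h1 * c0 - h2 * c1) * (c0 ^+ 2 + c1 ^+ 2) = 0 &
    y + (h1 * c1 + h2 * c0) * (c0 ^+ 2 + c1 ^+ 2) = 0].
Proof.
move=> h10 xy0.
pose hh := h1 ^+ 2 + h2 ^+ 2.
have hh0 : hh != 0 by rewrite /hh paddr_eq0 ?sqr_ge0// sqrf_eq0 (negPf h10).
pose u0 := - (x * h1 + y * h2) / hh; pose u1 := - (y * h1 - x * h2) / hh.
have uE : u0 ^+ 2 + u1 ^+ 2 = (x ^+ 2 + y ^+ 2) / hh.
  by rewrite /u0 /u1 /hh; field; exact: hh0.
pose t := u0 ^+ 2 + u1 ^+ 2.
have t0 : 0 < t.
  rewrite lt_def /t addr_ge0 ?sqr_ge0// andbT uE mulf_neq0 ?invr_eq0//.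
pose r := t `^ (- 3^-1).
have r3 : r ^+ 3 = t^-1.
  by rewrite /r -powR_mulrn ?powR_ge0// -powRrM mulNr mulVf ?pnatr_eq0// powR_inv1// ltW.
have rn : r != 0 by rewrite gt_eqF// powR_gt0.
have cE : (r * u0) ^+ 2 + (r * u1) ^+ 2 = r ^+ 2 * t by rewrite /t; ring.
have tr : r ^+ 3 * t = 1 by rewrite r3 mulVf// gt_eqF.
exists (r * u0), (r * u1); rewrite cE; split.
- by rewrite mulf_neq0// ?expf_neq0// gt_eqF.
- transitivity (x + (h1 * u0 - h2 * u1) * (r ^+ 3 * t)); first by ring.
  by rewrite tr /u0 /u1 /hh; field; exact: hh0.
- transitivity (y + (h1 * u1 + h2 * u0) * (r ^+ 3 * t)); first by ring.
  by rewrite tr /u0 /u1 /hh; field; exact: hh0.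
Qed.

(** With the phase fixed, the unknowns at node 1 are the real amplitude and the frequency shift. *)
Lemma branch_first : exists s d beta sigma, (s = 1 \/ s = -1) /\ is_branch 1 s d beta sigma.
Proof.
(* The side of lambda = 0 on which a1 s + g1 |b|^2 = 0 has a solution b != 0; then |b|^2 is [q]. *)
pose s : R := if 0 < - (a1 / g1) then 1 else -1.
have s1 : s = 1 \/ s = -1 by rewrite /s; case: ifP; [left|right].
have sneq0 : s != 0 by case: s1 => ->; rewrite ?oppr_eq0 oner_eq0.
pose q := - (a1 / g1) * s.
have q0 : 0 < q.
  rewrite /q /s; have [h|h] := boolP (0 < - (a1 / g1)); first by rewrite mulr1.
  rewrite mulrN1 opprK lt_def mulf_neq0 ?invr_eq0//= -oppr_le0 leNgt//.
pose c0 := Num.sqrt q.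
have c00 : c0 != 0 by rewrite gt_eqF// sqrtr_gt0.
have c02 : c0 ^+ 2 = q by rewrite sqr_sqrtr// ltW.
(* The frequency shift that cancels the imaginary part of the reduced equation. *)
pose sg := a2 + g2 * q / s.
pose be0 (i : nat) (k : 'I_2) (x : R) : R := if k == ord0 then c0 else 0.
pose v0 (v : rvar) mu := node_vars s be0 (fun=> sg) 1 v mu.
have v0x l k mu : l != ord0 -> v0 (vx l k) mu = 0.
  by move=> l0; rewrite /v0 /= (negPf l0) ltnS leqn0 (negPf (_ : l != 0%N :> nat)).
have v00 : v0 (@vmu n) 0 = 0 by [].
have Ln k : \sum_(l | l != ord0) \sum_k' lin_coef fbar l 0 k k' * v0 (vx l k') 0 = 0.
  by rewrite big1// => l l0; rewrite big1// => k' _; rewrite v0x// mulr0.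
have b0E : v0 (vx ord0 ord0) 0 = c0 by [].
have b1E : v0 (vx ord0 ord_max) 0 = 0 by [].
have tE mu : v0 (@vtau n) mu = s by rewrite /v0 /= muln1 subnn expr0 mulr1.
have AE : a1 * s + g1 * (c0 ^+ 2 + 0 ^+ 2) = 0.
  by rewrite c02 expr0n addr0 /q; field.
have CE : a2 * s + g2 * (c0 ^+ 2 + 0 ^+ 2) - s * sg = 0.
  by rewrite c02 expr0n addr0 /sg; field.
have Q0 k : ev (Q k) (v0 ^~ 0) = 0.
  by rewrite (QE k v00) /reduced0 Ln b0E b1E tE [v0 (@vsig n) 0]/= AE CE; case: ifP => _; ring.
have [[h1 _ h3 _] [h5 h6]] := @hd_reduced (v0 ^~ 0) v00.
rewrite b0E b1E tE AE in h1.
rewrite b1E tE in h5; rewrite b0E tE in h6.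
(* The frequency shift does not enter the first equation to first order, so the determinant is the
   product of 2 g1 c0^2 and - s c0. *)
have J : jac (vx ord0 ord0) (@vsig n) (Q ord0) (Q ord_max) (v0 ^~ 0) (v0 ^~ 0) != 0.
  rewrite /jac h1 h5 h6.
  have -> (z : R) : (0 + 2 * g1 * c0 ^+ 2 - 2 * g2 * c0 * 0) * - (s * c0) - s * 0 * z =
    - (2 * g1 * c0 ^+ 2 * (s * c0)) by ring.
  by rewrite oppr_eq0 !mulf_neq0 ?pnatr_eq0// expf_neq0.
have sm i : i != vx ord0 ord0 -> i != @vsig n -> smooth1 [set x | `|x| < 1] (v0 i).
  move=> i1 i2 k; case: i i1 i2 => [[[[l k']|]|]|] // i1 _.
  - have [l0|l0] := eqVneq l ord0.
      have -> : v0 (Some (Some (Some (l, k')))) = cst 0; last exact: C1k_cst.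
      apply/funext => mu; rewrite /v0 /= l0 eqxx /be0; case: eqVneq => // k0.
      by move: i1; rewrite l0 k0 eqxx.
    have -> : v0 (Some (Some (Some (l, k')))) = cst 0; last exact: C1k_cst.
    by apply/funext => mu; exact: (v0x l k').
  - have -> : v0 (Some None) = cst s; last exact: C1k_cst.
    by apply/funext => mu; exact: tE.
  - exact: C1k_id.
have [d [w [dd wv w0 ws wQ]]] := implicit_curve (isT : vx ord0 ord0 != @vsig n) ltr01 sm (Q0 ord0) (Q0 ord_max) J.
pose beta (i : nat) (k : 'I_2) (x : R) : R := if k == ord0 then w (vx ord0 ord0) x else 0.
exists s, d, beta, (w (@vsig n)); split => //; split => //.
move=> i /andP[i1]; rewrite leq_eqVlt ltnNge i1 orbF => /eqP ->; split.
- by move=> k m; rewrite /beta; case: (k == ord0); [exact: ws|exact: C1k_cst].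
- by rewrite /beta /= w0 b0E c02 expr0n addr0 gt_eqF.
- move=> k mu mud; have [E1 E2] := wQ mu mud.
  have vE : node_vars s beta (w (@vsig n)) 1 ^~ mu =1 w ^~ mu.
    move=> [[[[l k']|]|]|] //=.
    + have [->|l0] := eqVneq l ord0.
        rewrite /beta; case: eqVneq => [->//|k0].
        have n0 : vx ord0 k' != vx (n := n) ord0 ord0.
          by apply/eqP => -[e]; rewrite e eqxx in k0.
        rewrite (wv _ n0)//.
        by rewrite /v0 /= /be0 (negPf k0).
      have n0 : vx l k' != vx (n := n) ord0 ord0.
        by apply/eqP => -[e]; rewrite e eqxx in l0.
      rewrite (wv _ n0)//.
      by rewrite ltnS leqn0 (negPf (_ : l != 0%N :> nat))// [RHS](v0x l k').
    + by rewrite wv.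
    + by rewrite wv.
  by rewrite (ev_ext _ vE); move: k; exact: two_cases.
Qed.

Lemma expr_lt (d mu : R) k : (0 < k)%N -> d <= 1 -> `|mu| < d -> `|mu ^+ k| < d.
Proof.
move=> k0 d1 md; apply: le_lt_trans (md); rewrite normrX.
by rewrite -[leRHS]expr1 ler_wiXn2l// ltW// (lt_le_trans md).
Qed.

(** At the new node the frequency and the earlier amplitudes are known curves, and both components
    of its amplitude are unknown. At mu = 0 the terms in tau and all slots l >= 2 vanish, which
    leaves a_1 beta_m + (g1 + i g2) |b|^2 b = 0. *)
Lemma branch_step m s d beta sigma : (1 <= m < n)%N ->
  lin_coef fbar (inord 1) 0 ord0 ord0 = lin_coef fbar (inord 1) 0 ord_max ord_max ->
  lin_coef fbar (inord 1) 0 ord0 ord_max = - lin_coef fbar (inord 1) 0 ord_max ord0 ->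
  lin_coef fbar (inord 1) 0 != 0 ->
  is_branch m s d beta sigma -> exists d' beta', is_branch m.+1 s d' beta' sigma.
Proof.
move=> /andP[m1 mn] M1 M2 M0 [/andP[d0 d1] ss b1 H].
have [_ bm0 _] := H m (introT andP (conj m1 (leqnn m))).
set p := lin_coef fbar (inord 1) 0 ord0 ord0 in M1 M0 *.
set q := lin_coef fbar (inord 1) 0 ord_max ord0 in M2 M0 *.
(* a_1 is multiplication by the nonzero complex number p + iq, hence a_1 beta_m != 0. *)
have pq0 : p ^+ 2 + q ^+ 2 != 0.
  apply: contraNneq M0 => /eqP; rewrite paddr_eq0 ?sqr_ge0// !sqrf_eq0 => /andP[/eqP p0 /eqP q0].
  apply/eqP/matrixP => i j; rewrite [RHS]mxE; move: i j; apply: two_cases; apply: two_cases => //.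
    by rewrite M2 q0 oppr0.
  by rewrite -M1.
pose y0 := beta m ord0 0; pose y1 := beta m ord_max 0.
have [|c0 [c1 [c0' E0 E1]]] := @cube_solve g1 g2 (p * y0 - q * y1) (q * y0 + p * y1) g10.
  have -> : (p * y0 - q * y1) ^+ 2 + (q * y0 + p * y1) ^+ 2 = (p ^+ 2 + q ^+ 2) * (y0 ^+ 2 + y1 ^+ 2).
    by ring.
  by rewrite mulf_neq0.
pose be0 (i : nat) (k : 'I_2) (x : R) : R :=
  if i == m.+1 then (if k == ord0 then c0 else c1) else beta i k x.
pose v0 (v : rvar) mu := node_vars s be0 sigma m.+1 v mu.
have v00 : v0 (@vmu n) 0 = 0 by [].
have b0E : v0 (vx ord0 ord0) 0 = c0 by rewrite /v0 /= /be0 eqxx.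
have b1E : v0 (vx ord0 ord_max) 0 = c1 by rewrite /v0 /= /be0 eqxx.
have m3 : (1 < 3 ^ m)%N by rewrite -(expn0 3) ltn_exp2l.
have tE : v0 (@vtau n) 0 = 0.
  rewrite /v0 /= expr0n subn_eq0 leqNgt [(2 < _)%N](_ : _ = true) ?mulr0//.
  by rewrite -[X in (X < _)%N]muln1 ltn_mul2l.
have be0E i k : (i <= m)%N -> be0 i k = beta i k.
  by move=> im; rewrite /be0 ltn_eqF// ltnS.
pose l1 : 'I_n.+1 := inord 1.
have l1E : l1 = 1%N :> nat by rewrite inordK// ltnS (leq_trans m1)// ltnW.
have Ln k : \sum_(l | l != ord0) \sum_k' lin_coef fbar l 0 k k' * v0 (vx l k') 0 =
    \sum_k' lin_coef fbar l1 0 k k' * beta m k' 0.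
  rewrite (bigD1 l1); last by rewrite -val_eqE /= l1E.
  rewrite -[LHS]/(_ + _) [X in _ + X]big1 ?addr0 => [|l /andP[l0 ll1]].
    apply: eq_bigr => k' _; congr (_ * _).
    rewrite /v0 /= -val_eqE /= l1E /= !ltnS m1 expn1 subnn expr0 mul1r subn1 /=.
    by rewrite be0E// expr0n.
  rewrite big1// => k' _; suff -> : v0 (vx l k') 0 = 0 by rewrite mulr0.
  rewrite /v0 /= (negPf l0); case: ifP => // lm; rewrite expr0n.
  rewrite subn_eq0 leqNgt [(3 < _)%N](_ : _ = true) ?mul0r//.
  rewrite -[X in (X < _)%N]expn1 ltn_exp2l//.
  by move: l0 ll1; rewrite -!val_eqE /= l1E; case: (nat_of_ord l) => [|[|]].
have sum2 (F : 'I_2 -> R) : \sum_k' F k' = F ord0 + F ord_max.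
  by rewrite !big_ord_recl big_ord0 addr0; congr (_ + F _); exact/val_inj.
have Q0 k : ev (Q k) (v0 ^~ 0) = 0.
  rewrite (QE k v00) /reduced0 Ln b0E b1E tE sum2 -/y0 -/y1.
  move: k; apply: two_cases => /=.
    by rewrite -[RHS]E0 -/l1 -/p M2; ring.
  by rewrite -[RHS]E1 -/l1 -/q -M1; ring.
have [[h1 h2 h3 h4] _] := @hd_reduced (v0 ^~ 0) v00.
rewrite b0E b1E tE in h1; rewrite b0E b1E tE in h2.
rewrite b0E b1E tE in h3; rewrite b0E b1E tE in h4.
(* The real Jacobian of b -> g |b|^2 b is 3 |g|^2 |b|^4. *)
have J : jac (vx ord0 ord0) (vx ord0 ord_max) (Q ord0) (Q ord_max) (v0 ^~ 0) (v0 ^~ 0) != 0.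
  rewrite /jac h1 h2 h3 h4.
  set z := (X in X != 0).
  have -> : z = 3 * (g1 ^+ 2 + g2 ^+ 2) * (c0 ^+ 2 + c1 ^+ 2) ^+ 2 by rewrite /z; ring.
  rewrite !mulf_neq0 ?pnatr_eq0 ?expf_neq0//.
  by rewrite paddr_eq0 ?sqr_ge0// sqrf_eq0 (negPf g10).
have sX k (f : R -> R) : (0 < k)%N -> smooth1 [set x | `|x| < d] f ->
    smooth1 [set x | `|x| < d] (fun x => f (x ^+ k)).
  move=> k0 fs j; apply: (C1k_comp _ (fs j)); last by apply: C1kX; exact: C1k_id.
  by move=> x xd; exact: expr_lt.
have sm i : i != vx ord0 ord0 -> i != vx ord0 ord_max -> smooth1 [set x | `|x| < d] (v0 i).
  move=> i1 i2 k; case: i i1 i2 => [[[[l k']|]|]|] // i1 i2.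
  - have l0 : l != ord0.
      apply/eqP => l0; move: i1 i2; rewrite l0.
      by move: k'; apply: two_cases; rewrite eqxx.
    rewrite /v0 /= (negPf l0); case: (boolP (l < m.+1)%N) => lm; last exact: C1k_cst.
    apply: C1kM; first by apply: C1kX; exact: C1k_id.
    have lpos : (0 < l)%N by rewrite lt0n.
    apply: sX; first by rewrite expn_gt0.
    have im : (1 <= m.+1 - l <= m)%N by rewrite subn_gt0 lm leq_subLR -addn1 addnC leq_add2r.
    rewrite be0E; last by case/andP: im.
    by have [] := H _ im.
  - by apply: sX => //; rewrite expn_gt0.
  - by apply: C1kM; [exact: C1k_cst|apply: C1kX; exact: C1k_id].
  - exact: C1k_id.
have u12 : vx (n := n) ord0 ord0 != vx ord0 ord_max by [].
have [d' [w [/andP[d'0 d'd] wv w0 ws wQ]]] := implicit_curve u12 d0 sm (Q0 ord0) (Q0 ord_max) J.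
have sub : [set x : R | `|x| < d'] `<=` [set x | `|x| < d].
  by move=> x xd; exact: lt_le_trans xd d'd.
pose beta' (i : nat) (k : 'I_2) (x : R) : R :=
  if i == m.+1 then w (vx ord0 k) x else beta i k x.
have be'E i k : (i <= m)%N -> beta' i k = beta i k.
  by move=> im; rewrite /beta' ltn_eqF// ltnS.
exists d', beta'; split.
- by rewrite d'0 (le_trans d'd).
- by move=> k; exact: C1k_subset sub (ss k).
- by move=> mu; rewrite be'E.
move=> i /andP[i1]; rewrite leq_eqVlt ltnS => /orP[/eqP ->|im].
  split.
  - by move=> k j; rewrite /beta' eqxx; exact: ws.
  - by rewrite /beta' eqxx !w0 b0E b1E.
  - move=> k mu mud; have [F1 F2] := wQ mu mud.
    have vE : node_vars s beta' sigma m.+1 ^~ mu =1 w ^~ mu.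
      move=> [[[[l k']|]|]|] /=; try by rewrite wv.
      have [->|l0] := eqVneq l ord0; first by rewrite /beta' eqxx.
      rewrite wv; last 2 first.
      - by apply/eqP => -[e _]; rewrite e eqxx in l0.
      - by apply/eqP => -[e _]; rewrite e eqxx in l0.
      rewrite /v0 /= (negPf l0); case: ifP => // lm.
      have lpos : (0 < l)%N by rewrite lt0n.
      have im : (m.+1 - l <= m)%N by rewrite leq_subLR -addn1 addnC leq_add2r.
      by rewrite be'E// be0E.
    by rewrite (ev_ext _ vE); move: k; exact: two_cases.
have [Hs Hn HQ] := H i (introT andP (conj i1 im)).
split.
- by move=> k j; rewrite be'E//; exact: C1k_subset sub (Hs k j).
- by rewrite !be'E.
- move=> k mu mud; rewrite -[RHS](HQ k mu (lt_le_trans mud d'd)); apply: ev_ext.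
  move=> [[[[l k']|]|]|] //=; have [_|l0] := eqVneq l ord0; first by rewrite be'E.
  by case: ifP => // li; rewrite be'E// (leq_trans (leq_subr _ _)).
Qed.

Lemma branch_exists : (1 <= n)%N ->
  ((1 < n)%N -> [/\ lin_coef fbar (inord 1) 0 ord0 ord0 = lin_coef fbar (inord 1) 0 ord_max ord_max,
   lin_coef fbar (inord 1) 0 ord0 ord_max = - lin_coef fbar (inord 1) 0 ord_max ord0 &
   lin_coef fbar (inord 1) 0 != 0]) ->
  exists s d beta sigma, (s = 1 \/ s = -1) /\ is_branch n s d beta sigma.
Proof.
move=> n1 M; have [s [d [beta [sigma [s1 B]]]]] := branch_first.
suff all m : (1 <= m <= n)%N -> exists d beta, is_branch m s d beta sigma.
  have [|d' [beta' B']] := all n; first by rewrite n1 /=.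
  by exists s, d', beta', sigma.
elim: m => // m IHm /andP[_ mn].
case: m IHm mn => [|m] IHm mn; first by exists d, beta.
have [|d' [beta' B']] := IHm; first by rewrite /= ltnW.
have [M1 M2 M3] := M (leq_trans (isT : (1 < m.+2)%N) mn).
exact: (branch_step _ M1 M2 M3 B').
Qed.

End Branch.

(** * Nondegeneracy along the branch *)

Section NondegenerateBranch.
Context {R : realType} {n : nat}.
Local Notation V := 'rV[R]_2.
Local Notation W := 'M[R]_(n.+1, 2).
Local Notation rvar := (@rvar n).
Variables (fbar : W * R -> V) (Q : 'I_2 -> pexpr R rvar) (a1 a2 g1 g2 : R).
Hypothesis a10 : a1 != 0.
Hypothesis g10 : g1 != 0.
Hypothesis QE : forall k v, v (@vmu n) = 0 -> ev (Q k) v = reduced0 fbar a1 a2 g1 g2 k v.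

Lemma node_vars_smooth m s d beta sigma i (v : rvar) : is_branch Q m s d beta sigma ->
  (1 <= i <= m)%N -> smooth1 [set x | `|x| < d] (fun mu => node_vars s beta sigma i v mu).
Proof.
move=> [/andP[d0 d1] ss _ H] /andP[i1 im].
have sX k (f : R -> R) : (0 < k)%N -> smooth1 [set x | `|x| < d] f ->
    smooth1 [set x | `|x| < d] (fun x => f (x ^+ k)).
  move=> k0 fs j; apply: (C1k_comp _ (fs j)); last by apply: C1kX; exact: C1k_id.
  by move=> x xd; exact: expr_lt.
move=> k; case: v => [[[[l k']|]|]|] /=.
- case: (boolP (l == ord0)) => l0; first by have [h _ _] := H i (introT andP (conj i1 im)); exact: (h k' k).
  case: (boolP (l < i)%N) => li; last exact: C1k_cst.
  apply: C1kM; first by apply: C1kX; exact: C1k_id.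
  apply: sX; first by rewrite expn_gt0.
  have il : (1 <= i - l <= m)%N by rewrite subn_gt0 li (leq_trans (leq_subr _ _)).
  by have [h _ _] := H _ il; exact: (h k').
- by apply: sX => //; rewrite expn_gt0.
- by apply: C1kM; [exact: C1k_cst|apply: C1kX; exact: C1k_id].
- exact: C1k_id.
Qed.

Definition node_block (s : R) (beta : nat -> 'I_2 -> R -> R) (sigma : R -> R) (i : nat) (mu : R) (k k' : 'I_2) : R :=
  hd (Q k) (node_vars s beta sigma i ^~ mu) (node_vars s beta sigma i ^~ mu) (vx ord0 k').

(** What hyperbolicity needs of node i, as open conditions that persist for small mu. At node 1 the
    phase direction is neutral and only the amplitude direction is constrained; at later nodes det >
    0 and tr != 0 exclude imaginary eigenvalues. *)
Definition nondegenerate (s : R) (beta : nat -> 'I_2 -> R -> R) (sigma : R -> R) (i : nat) (mu : R) : Prop :=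
  [/\ 0 < beta i ord0 mu ^+ 2 + beta i ord_max mu ^+ 2,
     i = 1%N -> node_block s beta sigma i mu ord0 ord0 != 0 &
     (1 < i)%N ->
       0 < node_block s beta sigma i mu ord0 ord0 * node_block s beta sigma i mu ord_max ord_max
         - node_block s beta sigma i mu ord0 ord_max * node_block s beta sigma i mu ord_max ord0 /\
       node_block s beta sigma i mu ord0 ord0 + node_block s beta sigma i mu ord_max ord_max != 0].

(** At node 1 the entry is 2 g1 |b|^2, since the reduced equation cancels a1 tau + g1 |b|^2. At
    later nodes tau = 0, the determinant is 3 (g1^2 + g2^2) |b|^4 and the trace 4 g1 |b|^2. *)
Lemma nondegenerate0 m s d beta sigma i : is_branch Q m s d beta sigma -> (1 <= i <= m)%N ->
  nondegenerate s beta sigma i 0.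
Proof.
move=> [/andP[d0 d1] ss b1 H] im; have [bs b0 Q0] := H i im.
have r0 : 0 < beta i ord0 0 ^+ 2 + beta i ord_max 0 ^+ 2.
  by rewrite lt_def b0 addr_ge0 ?sqr_ge0.
have [[h1 h2 h3 h4] _] := hd_reduced QE (v := node_vars s beta sigma i ^~ 0) erefl.
split => // i1; rewrite /node_block h1 ?h2 ?h3 ?h4 /=.
  have := Q0 ord0 0; rewrite normr0 => /(_ d0).
  rewrite (QE ord0 (v := node_vars s beta sigma i ^~ 0) erefl) /reduced0 /= i1 big1 => [|l l0]; last first.
    by rewrite big1// => k' _; rewrite (negPf l0) ltnS leqn0 (negPf (_ : l != 0%N :> nat))// mulr0.
  rewrite b1 !mulr0 add0r subr0 => /eqP; rewrite mulf_eq0.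
  have c0 : beta 1%N ord0 0 != 0.
    by move: r0; rewrite i1 b1 expr0n addr0; apply: contraTneq => ->; rewrite expr0n ltxx.
  rewrite (negPf c0) orbF => /eqP ->.
  by rewrite add0r subr0 !mulf_neq0 ?pnatr_eq0 ?expf_neq0.
have -> : (s * 0 ^+ (2 * 3 ^ i.-1 - 2)) = 0.
  rewrite expr0n subn_eq0 leqNgt [(2 < _)%N](_ : _ = true) ?mulr0//.
  rewrite -[X in (X < _)%N]muln1 ltn_mul2l /= -[X in (X < _)%N](expn0 3) ltn_exp2l//.
  by rewrite -ltnS prednK// (leq_trans _ i1).
move: r0; set c0 := beta i ord0 0; set c1 := beta i ord_max 0 => r0.
have g0 : 0 < g1 ^+ 2 + g2 ^+ 2.
  by rewrite lt_def addr_ge0 ?sqr_ge0// andbT paddr_eq0 ?sqr_ge0// sqrf_eq0 (negPf g10).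
split.
  set z := (X in 0 < X).
  have -> : z = 3 * (g1 ^+ 2 + g2 ^+ 2) * (c0 ^+ 2 + c1 ^+ 2) ^+ 2 by rewrite /z; ring.
  by rewrite !mulr_gt0// exprn_gt0.
set z := (X in X != 0).
have -> : z = 4 * g1 * (c0 ^+ 2 + c1 ^+ 2) by rewrite /z; ring.
by rewrite !mulf_neq0 ?pnatr_eq0// gt_eqF.
Qed.

Let everywhere (P : R -> Prop) : (forall mu, P mu) -> \forall mu \near (0 : R), P mu.
Proof. by move=> h; apply/nbhs_ballP; exists 1; [exact: ltr01|move=> mu _; exact: h]. Qed.

Lemma nondegenerate_near m s d beta sigma i : is_branch Q m s d beta sigma -> (1 <= i <= m)%N ->
  \forall mu \near (0 : R), nondegenerate s beta sigma i mu.
Proof.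
move=> br im; have [n1 n2 n3] := nondegenerate0 br im.
have [/andP[d0 _] _ _ H] := br; have [bs _ _] := H i im.
have in0 : [set x : R | `|x| < d] 0 by rewrite /= normr0.
have bc k : beta i k mu @[mu --> (0 : R)] --> beta i k 0.
  exact: (C1k_continuous (bs k 0%N) in0).
have blc k k' : node_block s beta sigma i mu k k' @[mu --> (0 : R)] --> node_block s beta sigma i 0 k k'.
  have vs v := C1k_continuous (node_vars_smooth v br im 0%N) in0.
  exact: (@hd_cvg R rvar _ _ _ (Q k) (node_vars s beta sigma i) (node_vars s beta sigma i) _ _ (vx ord0 k') vs vs).
have pos (f : R -> R) : f mu @[mu --> (0 : R)] --> f 0 -> 0 < f 0 -> \forall mu \near (0 : R), 0 < f mu.
  by move=> fc f0; apply: (@cvgr_gt _ _ (nbhs (0 : R)) (nbhs_filter (0 : R)) f (f 0) fc).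
have nz (f : R -> R) : f mu @[mu --> (0 : R)] --> f 0 -> f 0 != 0 -> \forall mu \near (0 : R), f mu != 0.
  by move=> fc f0; apply: (@cvgr_neq0 _ _ _ (nbhs (0 : R)) (nbhs_filter (0 : R)) f (f 0) fc).
have N1 : \forall mu \near (0 : R), 0 < beta i ord0 mu ^+ 2 + beta i ord_max mu ^+ 2.
  apply: (@pos (fun mu => beta i ord0 mu ^+ 2 + beta i ord_max mu ^+ 2)) => //.
  by under eq_fun do rewrite !expr2; rewrite !expr2; apply: cvgD; exact: cvgM.
have N2 : \forall mu \near (0 : R), i = 1%N -> node_block s beta sigma i mu ord0 ord0 != 0.
  have [i1|i1] := eqVneq i 1%N; last by apply: everywhere => mu /eqP; rewrite (negPf i1).
  have := @nz _ (blc ord0 ord0) (n2 i1); apply: filterS => mu h _; exact: h.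
have N3 : \forall mu \near (0 : R), (1 < i)%N ->
     0 < node_block s beta sigma i mu ord0 ord0 * node_block s beta sigma i mu ord_max ord_max
         - node_block s beta sigma i mu ord0 ord_max * node_block s beta sigma i mu ord_max ord0 /\
       node_block s beta sigma i mu ord0 ord0 + node_block s beta sigma i mu ord_max ord_max != 0.
  have [i1|i1] := boolP (1 < i)%N; last by apply: everywhere => mu.
  have [p1 p2] := n3 i1.
  have c1 := @pos (fun mu => node_block s beta sigma i mu ord0 ord0 * node_block s beta sigma i mu ord_max ord_max
         - node_block s beta sigma i mu ord0 ord_max * node_block s beta sigma i mu ord_max ord0)
     (ltac:(by apply: cvgB; apply: cvgM; exact: blc)) p1.
  have c2 := @nz (fun mu => node_block s beta sigma i mu ord0 ord0 + node_block s beta sigma i mu ord_max ord_max)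
     (ltac:(by apply: cvgD; exact: blc)) p2.
  have c12 := @filterI _ _ (nbhs_filter (0 : R)) _ _ c1 c2.
  by apply: filterS c12 => mu [h1 h2] _; split.
by apply: (@filterS3 _ _ (nbhs_filter (0 : R)) _ _ _ _ _ N1 N2 N3) => mu h1 h2 h3; split.
Qed.

Lemma nondegenerate_branch s d beta sigma : is_branch Q n s d beta sigma ->
  exists d', is_branch Q n s d' beta sigma /\
    forall i mu, (1 <= i <= n)%N -> `|mu| < d' -> nondegenerate s beta sigma i mu.
Proof.
move=> br.
have ex (i : 'I_n.+1) : \forall mu \near (0 : R), (1 <= i)%N -> nondegenerate s beta sigma i mu.
  have [i1|i1] := boolP (1 <= i)%N; last by apply: everywhere => mu.
  have := nondegenerate_near br (introT andP (conj i1 (ltnSE (ltn_ord i)))).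
  by apply: filterS => mu h _.
have := filter_forall (nbhs_filter (0 : R)) ex => /nbhs_ballP[d1 /= d10 d1P].
have [/andP[d0 dle] ss b1 H] := br.
exists (Num.min d d1); split; last first.
  move=> i mu /andP[i1 im]; rewrite lt_min => /andP[_ md].
  have := d1P mu; rewrite /ball/= sub0r normrN => /(_ md (Ordinal (im : (i < n.+1)%N)) i1).
  by [].
have sub : [set x : R | `|x| < Num.min d d1] `<=` [set x | `|x| < d].
  by move=> x /=; rewrite lt_min => /andP[].
split => //.
- by rewrite lt_min d0 d10 ge_min dle.
- by move=> k; exact: C1k_subset sub (ss k).
- move=> i im; have [h1 h2 h3] := H i im; split => //.
    by move=> k j; exact: C1k_subset sub (h1 k j).
  by move=> k mu /sub; exact: h3.
Qed.

End NondegenerateBranch.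

(** * Equivariance of the variational equation *)

Section Linearization.
Context {R : realType} {n : nat}.
Local Notation V := 'rV[R]_2.
Local Notation W := 'M[R]_(n.+1, 2).
Local Notation ix := ('I_n.+1 * 'I_2)%type.
Local Notation N := (n.+1 * 2)%N.
Variables (omega0 : R) (fbar : W * R -> V) (e : 'I_2 -> pexpr R (option ix)).
Hypothesis w0 : omega0 != 0.
Hypothesis eP : forall p j, fbar p ord0 j = ev (e j) (pvars p).
Hypothesis sym : normal_form_symmetry omega0 fbar.
Variable lam : R.

Definition rotation (th : R) : 'M[R]_2 := \matrix_(k, l)
  (if k == l then cos th else if k == ord0 then - sin th else sin th).

Lemma cscale_expiE m th (X : 'M[R]_(m, 2)) : Defs.cscale (expi th) X = X *m (rotation th)^T.
Proof.
apply/matrixP => j; apply: two_cases; rewrite !mxE /complex_of_row !mxE /=;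
  rewrite !big_ord_recl big_ord0 !mxE /= (_ : lift ord0 ord0 = ord_max) ?addr0; try exact/val_inj; ring.
Qed.

Lemma rotationN th : rotation th *m rotation (- th) = 1%:M.
Proof.
have cs := cos2Dsin2 th; rewrite !expr2 in cs.
apply/matrixP; apply: two_cases; apply: two_cases; rewrite !mxE !big_ord_recl big_ord0 !mxE /=
  ?cosN ?sinN ?addr0 ?mulr1n ?mulr0n; rewrite -?cs; ring.
Qed.

Lemma fbar_rotation th (X : W) : row ord_max X = 0 ->
  fbar (X *m (rotation th)^T, lam) = fbar (X, lam) *m (rotation th)^T.
Proof.
move=> X0; rewrite -!cscale_expiE.
by have := sym (th / omega0) lam X0; rewrite mulrCA divff// mulr1.
Qed.

Lemma nodearg_mul j (x : W) (M : 'M[R]_2) : nodearg j (x *m M) = nodearg j x *m M.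
Proof. by apply/matrixP => a k; rewrite !mxE; apply: eq_bigr => l _; rewrite !mxE. Qed.

Lemma nodearg_last j (x : W) : row ord0 x = 0 -> row ord_max (nodearg j x) = 0.
Proof.
move=> x0; apply/rowP => k; rewrite !mxE /= (_ : (j - n)%N = 0%N).
  have -> : inord 0 = ord0 :> 'I_n.+1 by apply/val_inj; rewrite /= inordK.
  by have := congr1 (fun v : V => v ord0 k) x0; rewrite !mxE.
by apply/eqP; rewrite subn_eq0 -ltnS.
Qed.

Lemma nodearg0 (x : W) : row ord0 x = 0 -> nodearg ord0 x = 0.
Proof.
move=> x0; apply/matrixP => a k; rewrite !mxE sub0n.
have -> : inord 0 = ord0 :> 'I_n.+1 by apply/val_inj; rewrite /= inordK.
by have := congr1 (fun v : V => v ord0 k) x0; rewrite !mxE.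
Qed.

Definition dslot (a : 'I_n.+1) (Z : W) : 'M[R]_2 :=
  \matrix_(k, l) hd (e k) (pvars (Z, lam)) (pvars (Z, lam)) (Some (a, l)).

Lemma dslotE a (Z : W) (u : V) :
  is_derive ((Z, lam) : W * R) ((delta_mx a ord0 *m u : W, 0 : R)) fbar (u *m (dslot a Z)^T).
Proof.
have := fbar_derive eP Z (delta_mx a ord0 *m u) lam 0.
set r := (X in is_derive _ _ _ X -> _); suff -> : r = u *m (dslot a Z)^T by [].
apply/rowP => k; rewrite !mxE (bigD1 None)//= mulr0 add0r.
rewrite (reindex_omap Some id)/=; last by case.
pose F (il : ix) := hd (e k) (pvars (Z, lam)) (pvars (Z, lam)) (Some il) * (delta_mx a ord0 *m u : W) il.1 il.2.
transitivity (\sum_(il : ix) F (il.1, il.2)).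
  by apply: eq_big => [il|[i l] _] //=; rewrite eqxx.
rewrite -(pair_bigA _ (fun i l => F (i, l))) /= (bigD1 a)//= [X in _ + X]big1 ?addr0.
  apply: eq_bigr => l _; rewrite /F /= !mxE mulrC; congr (_ * _).
  by rewrite big_ord1 mxE !eqxx mul1r.
by move=> i /negPf ia; rewrite big1// => l _; rewrite /F /= !mxE big_ord1 mxE ia mul0r mulr0.
Qed.

(** The derivative of an equivariant map is equivariant; a < n keeps the perturbed argument in the
    set X_n = 0 where the symmetry holds. *)
Lemma dslot_rotation (th : R) (a : 'I_n.+1) (Z : W) : row ord_max Z = 0 -> (a < n)%N ->
  dslot a (Z *m (rotation th)^T) *m rotation th = rotation th *m dslot a Z.
Proof.
move=> Z0 an; apply/trmx_inj; apply/row_matrixP => i; rewrite !trmx_mul !row_mul.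
set u := row i (rotation th)^T; rewrite rowE; set u0 := delta_mx 0 i.
have uE : u = u0 *m (rotation th)^T by rewrite /u rowE.
have fE (h : R) : fbar (h *: (delta_mx a ord0 *m u : W, 0 : R) + (Z *m (rotation th)^T, lam))
    - fbar (Z *m (rotation th)^T, lam) =
    (fbar (h *: (delta_mx a ord0 *m u0 : W, 0 : R) + (Z, lam)) - fbar (Z, lam)) *m (rotation th)^T.
  rewrite mulmxBl -fbar_rotation//; congr (_ - _).
  have -> : h *: (delta_mx a ord0 *m u : W, 0 : R) + (Z *m (rotation th)^T, lam) =
     ((h *: (delta_mx a ord0 *m u0) + Z) *m (rotation th)^T, lam).
    by congr pair; rewrite /= ?scaler0 ?add0r// mulmxDl uE -scalemxAl mulmxA.
  have -> : h *: (delta_mx a ord0 *m u0 : W, 0 : R) + (Z, lam) = (h *: (delta_mx a ord0 *m u0) + Z, lam).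
    by congr pair; rewrite /= scaler0 add0r.
  apply: fbar_rotation; apply/rowP => k; have := congr1 (fun v : V => v ord0 k) Z0.
  rewrite !mxE => ->; rewrite big_ord1 !mxE (_ : (ord_max == a) = false) ?mul0r ?mulr0 ?addr0//.
  by apply/negbTE; rewrite -val_eqE /= eq_sym ltn_eqF.
have lim (Z' : W) (u' : V) k :
    h^-1 * (fbar (h *: (delta_mx a ord0 *m u' : W, 0 : R) + (Z', lam)) - fbar (Z', lam)) ord0 k
    @[h --> (0 : R)^'] --> (u' *m (dslot a Z')^T) ord0 k.
  have [d E] := is_derive_coord ord0 k (dslotE a Z' u').
  rewrite -E; under eq_fun do rewrite mxE [X in _ + X]mxE; exact: d.
apply/rowP => k.
have sum2 (M : V) : (M *m (rotation th)^T) ord0 k = \sum_l M ord0 l * rotation th k l.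
  by rewrite mxE; apply: eq_bigr => l _; rewrite mxE.
rewrite sum2.
have l2 : h^-1 * (fbar (h *: (delta_mx a ord0 *m u : W, 0 : R) + (Z *m (rotation th)^T, lam))
    - fbar (Z *m (rotation th)^T, lam)) ord0 k @[h --> (0 : R)^'] -->
    \sum_l (u0 *m (dslot a Z)^T) ord0 l * rotation th k l.
  have -> : (fun h : R => h^-1 * (fbar (h *: (delta_mx a ord0 *m u : W, 0 : R) + (Z *m (rotation th)^T, lam))
    - fbar (Z *m (rotation th)^T, lam)) ord0 k) = (fun h : R => \sum_l (h^-1 *
    (fbar (h *: (delta_mx a ord0 *m u0 : W, 0 : R) + (Z, lam)) - fbar (Z, lam)) ord0 l) * rotation th k l).
    apply/funext => h; rewrite fE sum2 mulr_sumr; apply: eq_bigr => l _; exact: mulrA.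
  by apply: cvg_bigsum => l; apply: cvgM; [exact: lim|exact: cvg_cst].
by have := cvg_unique _ (lim (Z *m (rotation th)^T) u k) l2; apply.
Qed.

Definition net_slot (j : 'I_n.+1) (k : 'I_2) : pexpr R ix :=
  psubst (fun o : option ix => if o is Some (a, l) then PV (inord (j - a), l) else PC lam) (e k).

Let coords (x : W) (il : ix) : R := x il.1 il.2.

Let net_slotE (x : W) j k : network (fun X => fbar (X, lam)) x j k = ev (net_slot j k) (coords x).
Proof.
rewrite networkE eP ev_psubst; apply: ev_ext => -[[a l]|] //=.
by rewrite !mxE.
Qed.

Lemma network_differentiable (x : W) : differentiable (network (fun X => fbar (X, lam))) x.
Proof.
have -> : network (fun X => fbar (X, lam)) =
    \sum_(jk : ix) (fun y : W => ev (net_slot jk.1 jk.2) (coords y) *: (delta_mx jk.1 jk.2 : W)).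
  apply/funext => y; rewrite fct_sumE [LHS]matrix_sum_delta pair_bigA /=.
  by apply: eq_bigr => jk _; rewrite net_slotE.
apply: (big_ind (fun g : W -> W => differentiable g x)); first exact: differentiable_cst.
  by move=> g h; exact: differentiableD.
move=> jk _; apply: differentiableZl.
apply: (@differentiable_ev _ _ _ (net_slot jk.1 jk.2) (fun il (y : W) => coords y il)) => il.
exact: differentiable_coord.
Qed.

Definition dnet (x : W) : 'M[R]_N := lin_mx ('d (network (fun X => fbar (X, lam))) x : W -> W).

Lemma blk_dnet (x : W) (i j : 'I_n.+1) :
  blk (dnet x) i j = (\sum_(a < n.+1 | inord (j - a) == i) dslot a (nodearg j x))^T.
Proof.
pose F := network (fun X => fbar (X, lam)).
apply/matrixP => l k; pose v : W := delta_mx i l.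
transitivity (('d F x : W -> W) v j k).
  by rewrite mxE mxE /= mxvecE vec_mx_delta.
have cd (il : ix) : is_derive x v (fun y : W => coords y il) (v il.1 il.2).
  by apply: (@is_derive_coord _ _ _ _ id); exact: is_derive_id.
have D1 := @is_derive_ev _ _ _ (net_slot j k) (fun il (y : W) => coords y il) _ _ _ cd.
have D2 : is_derive x v (fun y => F y j k) (('d F x : W -> W) v j k).
  apply: is_derive_coord; rewrite -deriveE; last exact: network_differentiable.
  by apply: derivableP; apply: diff_derivable; exact: network_differentiable.
have [_ <-] := D2; have [_ E1] := D1.
have -> : (fun y => F y j k) = (fun y => ev (net_slot j k) (fun il => coords y il)).
  by apply/funext => y; exact: net_slotE.
rewrite E1 mxE summxE (bigD1 (i, l))//= [X in _ + X]big1 ?addr0; last first.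
  move=> -[a b] /= ab; rewrite mxE -pair_eqE /= in ab *.
  by rewrite (negPf ab) mulr0.
rewrite mxE !eqxx mulr1 hd_psubst (bigD1 None)//= mulr0 add0r.
rewrite (reindex_omap Some id)/=; last by case.
have vE : (fun o : option ix => ev (if o is Some (a, l0) then PV (inord (j - a), l0) else PC lam)
    (fun il : ix => coords x il)) = pvars (nodearg j x, lam).
  by apply/funext => -[[a b]|] //=; rewrite !mxE.
rewrite vE.
pose G (il : ix) := hd (e k) (pvars (nodearg j x, lam)) (pvars (nodearg j x, lam)) (Some il) *
   ((inord (j - il.1), il.2) == (i, l))%:R.
transitivity (\sum_(il : ix) G (il.1, il.2)).
  by apply: eq_big => [il|[a b] _] //=; rewrite eqxx.
rewrite -(pair_bigA _ (fun a b => G (a, b))) /= [RHS]big_mkcond; apply: eq_bigr => a _.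
rewrite (bigD1 l)//= big1 ?addr0 => [|b bl]; last by rewrite /G xpair_eqE /= (negPf bl) andbF mulr0.
by rewrite /G xpair_eqE /= eqxx andbT; case: eqP => _; rewrite ?mulr1 ?mulr0// mxE.
Qed.

Lemma blk_dnet_lt (x : W) (i j : 'I_n.+1) : (j < i)%N -> blk (dnet x) i j = 0.
Proof.
move=> ji; rewrite blk_dnet big1 ?trmx0// => a /eqP/(congr1 val) /=.
rewrite inordK; last exact: leq_ltn_trans (leq_subr _ _) (ltn_ord _).
by move=> E; move: ji; rewrite -E ltnNge leq_subr.
Qed.

Lemma blk_dnet_diag (x : W) (j : 'I_n.+1) : (0 < j)%N ->
  blk (dnet x) j j = (dslot ord0 (nodearg j x))^T.
Proof.
move=> j0; rewrite blk_dnet; congr trmx; rewrite (eq_bigl (pred1 ord0)) ?big_pred1_eq//.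
move=> i /=; rewrite node_pred// subnn; congr (_ == _); apply/val_inj; by rewrite /= inordK.
Qed.

(** A slot a of node j that reads a node i > 0 satisfies a < j <= n, so the symmetry applies to it.
    For i = 0 slot n is involved as well. *)
Lemma blk_dnet_rotation (th : R) (x : W) (i j : 'I_n.+1) : row ord0 x = 0 -> (0 < i)%N ->
  blk (dnet (x *m (rotation th)^T)) i j =
  (rotation (- th))^T *m blk (dnet x) i j *m (rotation th)^T.
Proof.
move=> x0 i0.
have key : \sum_(a < n.+1 | inord (j - a) == i) dslot a (nodearg j x *m (rotation th)^T) =
    rotation th *m ((\sum_(a < n.+1 | inord (j - a) == i) dslot a (nodearg j x)) *m rotation (- th)).
  rewrite mulmx_suml mulmx_sumr; apply: eq_bigr => a /eqP/(congr1 val) /=.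
  rewrite inordK; last exact: leq_ltn_trans (leq_subr _ _) (ltn_ord _).
  move=> ai; have an : (a < n)%N.
    have aj : (a < j)%N by rewrite -subn_gt0 ai.
    by rewrite (leq_trans aj)// -ltnS.
  have E := dslot_rotation th (nodearg_last j x0) an.
  by rewrite (mulmxA (rotation th)) -E -mulmxA rotationN mulmx1.
apply: (etrans (blk_dnet (x *m (rotation th)^T) i j)).
rewrite nodearg_mul key trmx_mul trmx_mul; congr (_ *m _ *m _).
exact: esym (blk_dnet x i j).
Qed.

End Linearization.

(** * Multipliers of a wave in the rotating frame *)

Section WaveMultipliers.
Context {R : realType} {n : nat}.
Local Notation N := (n.+1 * 2)%N.
Local Notation C := (complex R).
Local Notation Cmx := (map_mx (real_complex R)).

Definition bmx (B : 'I_n.+1 -> 'I_n.+1 -> 'M[R]_2) : 'M[R]_N :=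
  \matrix_(x, y) B (unidx x).1 (unidx y).1 (unidx x).2 (unidx y).2.

Lemma bmxE B x y : bmx B x y = B (unidx x).1 (unidx y).1 (unidx x).2 (unidx y).2.
Proof. by rewrite mxE. Qed.

Lemma blk_bmx B i j : blk (bmx B) i j = B i j.
Proof. by apply/matrixP => k l; rewrite !mxE !mxvec_indexK. Qed.

Lemma blk_inj (A B : 'M[R]_N) : (forall i j, blk A i j = blk B i j) -> A = B.
Proof.
move=> AB; apply/matrixP => x y; rewrite -(unidxK x) -(unidxK y).
by have := congr1 (fun M : 'M[R]_2 => M (unidx x).2 (unidx y).2) (AB (unidx x).1 (unidx y).1); rewrite !mxE.
Qed.

Lemma blk_diag_mulmx (B1 B2 : 'I_n.+1 -> 'M[R]_2) (A : 'M[R]_N) i j :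
  blk (bmx (fun i j => if i == j then B1 i else 0) *m A *m bmx (fun i j => if i == j then B2 i else 0)) i j =
  B1 i *m blk A i j *m B2 j.
Proof.
rewrite blkM (bigD1 j)//= [X in _ + X]big1 ?addr0 => [|l lj]; last first.
  by rewrite [X in _ *m X]blk_bmx (negPf lj) mulmx0.
rewrite [X in _ *m X]blk_bmx eqxx blkM (bigD1 i)//= [X in _ + X]big1 ?addr0 => [|l li]; last first.
  by rewrite [X in X *m _]blk_bmx eq_sym (negPf li) mul0mx.
by rewrite [X in X *m _ *m _]blk_bmx eqxx.
Qed.

Variables (D : R -> 'M[R]_N) (omega T : R).
Hypothesis n1 : (1 <= n)%N.
Hypothesis D_lt : forall t (i j : 'I_n.+1), (j < i)%N -> blk (D t) i j = 0.
Hypothesis D_rot : forall t (i j : 'I_n.+1), (0 < i)%N -> blk (D t) i j =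
  (rotation (- (omega * t)))^T *m blk (D 0) i j *m (rotation (omega * t))^T.
Hypothesis D_00 : forall t, blk (D t) ord0 ord0 = blk (D 0) ord0 ord0.
Hypothesis D_cont : forall x y, continuous (fun t => D t x y).
Hypothesis T0 : 0 < T.
Hypothesis cosT : cos (omega * T) = 1.
Hypothesis sinT : sin (omega * T) = 0.

(** The rotating frame: node 0 rests and all other nodes turn. [RRE] identifies it with the
    exponential of [J]. *)
Let RR t := bmx (fun i j => if i == j then (if i == ord0 then 1%:M else (rotation (omega * t))^T) else 0).
Let J := bmx (fun i j => if i == j then (if i == ord0 then 0 else (mulI_mx omega)^T) else 0).

Let RR_derive t : mderive RR t (RR t *m J).
Proof.
have -> : RR t *m J = bmx (fun i j => if i == j then
    (if i == ord0 then 0 else (rotation (omega * t))^T *m (mulI_mx omega)^T) else 0).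
  apply: blk_inj => i j; rewrite blk_bmx blkM (bigD1 i)//= big1 ?addr0 => [|l li]; last first.
    by rewrite [X in X *m _]blk_bmx eq_sym (negPf li) mul0mx.
  rewrite !blk_bmx eqxx; case: (i == j); last by rewrite mulmx0.
  by case: (i == ord0); rewrite ?mulmx0.
move=> x y.
have -> : (fun s => RR s x y) = (fun s => (if (unidx x).1 == (unidx y).1 then
    (if (unidx x).1 == ord0 then 1%:M else (rotation (omega * s))^T) else 0) (unidx x).2 (unidx y).2).
  by apply/funext => s; rewrite mxE.
rewrite bmxE; case: (_ == (unidx y).1); last by rewrite [X in is_derive _ _ _ X]mxE; exact: is_derive_cst.
case: (_ == ord0); first by rewrite [X in is_derive _ _ _ X]mxE; exact: is_derive_cst.
have wt : is_derive t (1 : R) (fun t => omega * t) omega.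
  by apply: is_derive_eq; rewrite /GRing.scale/= mulr1.
have dc : is_derive t (1 : R) (fun t => cos (omega * t)) (- sin (omega * t) * omega).
  exact: (@is_derive1_comp _ cos (fun t => omega * t) t _ _ (is_derive_cos _) wt).
have ds : is_derive t (1 : R) (fun t => sin (omega * t)) (cos (omega * t) * omega).
  exact: (@is_derive1_comp _ sin (fun t => omega * t) t _ _ (is_derive_sin _) wt).
have E k l : ((rotation (omega * t))^T *m (mulI_mx omega)^T) k l =
    if k == l then - sin (omega * t) * omega else if l == ord0 then - (cos (omega * t) * omega)
    else cos (omega * t) * omega.
  move: k l; apply: two_cases; apply: two_cases;
    rewrite !mxE !big_ord_recl big_ord0 !mxE /= ?addr0; ring.
have -> : (fun s => (rotation (omega * s))^T (unidx x).2 (unidx y).2) = (fun s =>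
    if (unidx x).2 == (unidx y).2 then cos (omega * s) else
    if (unidx y).2 == ord0 then - sin (omega * s) else sin (omega * s)).
  by apply/funext => s; rewrite !mxE eq_sym.
rewrite E; case: (_ == (unidx y).2) => //.
by case: (_ == ord0) => //; exact: is_deriveN.
Qed.

Let RR0 : RR 0 = 1%:M.
Proof.
apply: blk_inj => i j; rewrite blk_bmx; have [->|ij] := eqVneq i j.
  rewrite blk1; case: ifP => // _; rewrite mulr0; apply/matrixP; apply: two_cases; apply: two_cases;
    by rewrite !mxE /= ?cos0 ?sin0 ?oppr0.
apply/matrixP => k l; rewrite !mxE; case: eqP => // /(congr1 unidx).
by rewrite !mxvec_indexK => -[e]; rewrite e eqxx in ij.
Qed.

Let RRE t : RR t = mexp J t.
Proof.
have Nd s : is_derive s (1 : R) (fun s : R => - s) (-1) by apply: is_derive_eq.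
have P0 s : mderive (fun s => RR s *m mexp J (- s)) s 0.
  apply: mderive_eq (mderiveM (RR_derive s) (mderive_comp (mexp_derive J (- s)) (Nd s))).
  by rewrite scaleN1r mulmxN -(mexp_comm J) mulmxA subrr.
have := mderive0_cst P0 t 0; rewrite oppr0 RR0 mexp0 mulmx1 => E.
by rewrite -[RHS]mul1mx -E -mulmxA mexpD addNr mexp0 mulmx1.
Qed.

Let A0 := bmx (fun i j => if (i == ord0) == (j == ord0) then blk (D 0) i j else 0).
(** The coupling out of node 0, the part of [D] that the frame does not make constant. *)
Let F t := bmx (fun i j => if (i == ord0) && (j != ord0) then blk (D t) i j else 0).

Let DE t : D t = mexp J (- t) *m A0 *m mexp J t + F t.
Proof.
apply: blk_inj => i j; rewrite -!RRE.
have -> (A B : 'M[R]_N) : blk (A + B) i j = blk A i j + blk B i j.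
  by apply/matrixP => k l; rewrite !mxE.
rewrite (blk_diag_mulmx (fun i => if i == ord0 then 1%:M else (rotation (omega * - t))^T)
  (fun i => if i == ord0 then 1%:M else (rotation (omega * t))^T)) !blk_bmx mulrN.
have [->|i0] := eqVneq i ord0; have [->|j0] := eqVneq j ord0 => /=.
- by rewrite mul1mx mulmx1 addr0 D_00.
- by rewrite mulmx0 mul0mx add0r.
- by rewrite mulmx0 mul0mx add0r D_lt// lt0n.
- by rewrite addr0 D_rot// lt0n.
Qed.

Let E (j : 'I_n.+1) := blk (D 0) j j - (mulI_mx omega)^T.
Let one : 'I_n.+1 := inord 1.
Hypothesis H0 : \det (blk (D 0) ord0 ord0) < 0 \/
  0 < \det (blk (D 0) ord0 ord0) /\ \tr (blk (D 0) ord0 ord0) != 0.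
Hypothesis H1 : E one ord0 ord0 != 0 /\ forall k, E one ord_max k = 0.
Hypothesis H2 : forall j : 'I_n.+1, (1 < j)%N -> 0 < \det (E j) /\ \tr (E j) != 0.

Let p : pred 'I_N := fun x => (unidx x).1 == ord0.
(** Node j sits on the even level 2j, except that the phase component of node 1 is moved to level 3,
    where it is alone, as [hyperbolic_multipliers] requires. *)
Let lv (x : 'I_N) : nat := (2 * (unidx x).1 + (((unidx x).1 == one) && ((unidx x).2 == ord_max)))%N.
Let a : 'I_N := mxvec_index one ord_max.

Let oneE : one = 1%N :> nat. Proof. by rewrite inordK// ltnS. Qed.

Let EE x y : (A0 - J) x y = if (unidx x).1 == (unidx y).1 then
     (if (unidx x).1 == ord0 then blk (D 0) ord0 ord0 else E (unidx x).1) (unidx x).2 (unidx y).2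
   else if ((unidx x).1 == ord0) == ((unidx y).1 == ord0) then
     blk (D 0) (unidx x).1 (unidx y).1 (unidx x).2 (unidx y).2 else 0.
Proof.
have -> : (A0 - J) x y = A0 x y - J x y by rewrite mxE [X in _ + X]mxE.
rewrite /A0 /J !bmxE; have [<-|xy] := eqVneq (unidx x).1 (unidx y).1.
  rewrite eqxx; have [->|x0] := eqVneq (unidx x).1 ord0; first by rewrite [X in _ - X]mxE subr0.
  by rewrite /E [in RHS]mxE [X in _ = _ + X]mxE.
by rewrite [X in _ - X]mxE subr0; case: ifP => // _; rewrite mxE.
Qed.

Lemma wave_multipliers : exists (Y : R -> 'M[R]_N) (mults : seq C),
  [/\ Y 0 = 1%:M,
      (forall t x y, is_derive t (1 : R) (fun s => Y s x y) ((Y t *m D t) x y)),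
      char_poly (Cmx (Y T)) = \prod_(z <- mults) ('X - z%:P) &
      count (fun z => ComplexField.Normc.normc z == 1) mults = 1%N].
Proof.
have split_bmx (B : 'I_n.+1 -> 'I_n.+1 -> 'M[R]_2) :
    (forall i j, (i == ord0) != (j == ord0) -> B i j = 0) -> split_by p (bmx B).
  by move=> B0 x y xy; rewrite mxE B0 ?mxE.
have A0p : split_by p A0 by apply: split_bmx => i j /negPf ->.
have Jp : split_by p J.
  by apply: split_bmx => i j; case: (eqVneq i j) => // ->; rewrite eqxx.
have Fp t x y : ~~ (p x && ~~ p y) -> F t x y = 0 by rewrite /p mxE => /negPf ->; rewrite mxE.
have Fc x y : continuous (fun t => F t x y).
  have -> : (fun t => F t x y) =
      (fun t => if ((unidx x).1 == ord0) && ((unidx y).1 != ord0) then D t x y else 0).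
    by apply/funext => t; rewrite bmxE; case: ifP => _; rewrite mxE// !unidxK.
  by case: (_ && _); [exact: D_cont|move=> t; exact: cst_continuous].
have JT : mexp J T = 1%:M.
  have rT : rotation (omega * T) = rotation 0.
    by apply/matrixP => k l; rewrite !mxE cosT sinT cos0 sin0.
  by rewrite -RRE -RR0 /RR mulr0 rT.
have lvp x y : p x -> ~~ p y -> (lv x < lv y)%N.
  rewrite /p /lv => /eqP ->; rewrite -lt0n => y0.
  have -> : (ord0 == one) = false by apply/negbTE; rewrite -val_eqE /= oneE.
  by rewrite /= muln0 addn0 addn_gt0 muln_gt0 y0.
have aE : unidx a = (one, ord_max) by rewrite mxvec_indexK.
have lva : lv a = 3 by rewrite /lv aE /= !eqxx oneE.
have aP x : lv x = lv a -> x = a.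
  rewrite lva /lv; case: (boolP (_ && _)) => [/andP[/eqP x1 /eqP x2] _|_].
    by rewrite -(unidxK x) x1 x2.
  by rewrite addn0 => /(congr1 odd); rewrite oddM.
have one0 : (one == ord0) = false by apply/negbTE; rewrite -val_eqE /= oneE.
have Et : lvl_tri lv (A0 - J).
  move=> x y yx; rewrite EE; case: eqVneq => [xy|xy].
    move: yx; rewrite /lv -xy ltn_add2l; case: (eqVneq (unidx x).1 one) => // -> /=.
    by case: (eqVneq (unidx x).2 ord_max) => // -> _; rewrite one0; have [_] := H1.
  case: ifP => // _; rewrite D_lt ?mxE//.
  have : (unidx y).1 != (unidx x).1 :> nat by rewrite eq_sym.
  rewrite neq_ltn => /orP[//|xy']; exfalso; move: yx; rewrite ltnNge => /negP; apply.
  rewrite /lv; apply: (@leq_trans (2 * (unidx x).1).+1).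
    by case: (_ && _); rewrite ?addn1 ?addn0 ?leqnSn.
  apply: (@leq_trans (2 * (unidx y).1)); last exact: leq_addr.
  by rewrite ltn_mul2l.
have Ea : (A0 - J) a a = 0 by rewrite EE aE /= eqxx one0; have [_] := H1.
(* Here the grading by nodes suffices, and each diagonal block is a two by two matrix. *)
have Eh : hyperbolic_mx (A0 - J + delta_mx a a).
  apply: (@hyperbolic_lvl _ _ (fun x => nat_of_ord (unidx x).1)).
    move=> x y yx; have xy : (unidx x).1 == (unidx y).1 = false by apply/negbTE; rewrite -val_eqE /= gt_eqF.
    rewrite mxE EE xy [X in _ + X]mxE.
    have -> : (x == a) && (y == a) = false.
      by apply/negbTE/negP => /andP[/eqP xa /eqP ya]; rewrite xa ya eqxx in xy.
    by rewrite addr0; case: ifP => // _; rewrite D_lt ?mxE.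
  move=> l z u z0 Hu.
  have [ln|ln] := ltnP l n.+1; last first.
    by move=> j jl; have := ltn_ord (unidx j).1; rewrite jl ltnNge ln.
  pose j : 'I_n.+1 := Ordinal ln.
  pose M := if j == ord0 then blk (D 0) ord0 ord0 else E j + (if j == one then delta_mx ord_max ord_max else 0).
  have ME k k' : (A0 - J + delta_mx a a) (mxvec_index j k) (mxvec_index j k') = M k k'.
    rewrite mxE EE !mxvec_indexK /= eqxx [X in _ + X]mxE.
    have aeq k0 : (mxvec_index j k0 == a) = (j == one) && (k0 == ord_max).
      apply/eqP/andP => [/(congr1 unidx)|[/eqP -> /eqP ->]//].
      by rewrite !mxvec_indexK => -[-> ->].
    rewrite !aeq /M; case: (boolP (j == ord0)) => j0.
      have -> : (j == one) = false by rewrite (eqP j0) eq_sym.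
      by rewrite /= addr0.
    case: (j == one) => /=.
      by rewrite [in RHS]mxE [X in _ = _ + X]mxE.
    by rewrite !addr0.
  have sumE k' : \sum_(i | (unidx i).1 == l :> nat) u i * ((A0 - J + delta_mx a a) i (mxvec_index j k'))%:C%C
     = u (mxvec_index j ord0) * (M ord0 k')%:C%C + u (mxvec_index j ord_max) * (M ord_max k')%:C%C.
    rewrite big_mkcond sum_mxvec_index (bigD1 j)//= [X in _ + X]big1 ?addr0 => [|i ij]; last first.
      rewrite big1// => k _; rewrite mxvec_indexK /=; case: eqP => // il.
      by move: ij; rewrite -val_eqE /= il eqxx.
    rewrite !big_ord_recl big_ord0 addr0 !mxvec_indexK /= eqxx !ME.
    by rewrite (_ : lift ord0 ord0 = ord_max) //; exact/val_inj.
  have e0 := Hu (mxvec_index j ord0); have e1 := Hu (mxvec_index j ord_max).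
  rewrite sumE !mxvec_indexK /= in e0; rewrite sumE !mxvec_indexK /= in e1.
  have cond : M ord0 ord0 * M ord_max ord_max - M ord0 ord_max * M ord_max ord0 < 0 \/
     0 < M ord0 ord0 * M ord_max ord_max - M ord0 ord_max * M ord_max ord0 /\
     M ord0 ord0 + M ord_max ord_max != 0.
    rewrite /M; case: eqVneq => [j0|j0]; first by rewrite -det2 -tr2.
    case: eqVneq => [j1|j1]; last first.
      have [|d t] := H2 (j := j); last by right; rewrite addr0 -det2 -tr2.
      rewrite ltn_neqAle eq_sym lt0n; apply/andP; split; last by rewrite -val_eqE in j0.
      by rewrite -oneE val_eqE.
    (* With the neutral entry replaced by 1, the block of node 1 is triangular with diagonal h, 1:
       its determinant is h and its trace h + 1. *)
    have [e00 em] := H1; pose h := E one ord0 ord0; pose h' := E one ord0 ord_max.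
    have dE k k' : (E j + delta_mx ord_max ord_max) k k' =
        E one k k' + ((k == ord_max) && (k' == ord_max))%:R by rewrite j1 !mxE.
    rewrite !dE !em /= !addr0 !add0r -/h -/h' !mulr1 mulr0 subr0.
    have [h0|h0] := ltP h 0; [by left|right].
    have hp : 0 < h by rewrite lt_def e00.
    by split=> //; rewrite gt_eqF// addr_gt0.
  have [u0 u1] := @hyperbolic_block R _ _ _ _ z _ _ z0 cond (e0 erefl) (e1 erefl).
  move=> x xl; rewrite -(unidxK x); have -> : (unidx x).1 = j by apply/val_inj.
  by move: (unidx x).2; apply: two_cases.
have [Y [mults [Y0 Yd Yc Ym]]] := floquet_multipliers T0 A0p Jp Fp Fc JT Et lvp aP Ea Eh.
by exists Y, mults; split => // t x y; rewrite DE.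
Qed.

End WaveMultipliers.

(** * Rotating waves: solution, period, hyperbolicity *)

Section RotatingWaves.
Context {R : realType} {n : nat}.
Local Notation V := 'rV[R]_2.
Local Notation W := 'M[R]_(n.+1, 2).
Local Notation ix := ('I_n.+1 * 'I_2)%type.
Variables (omega0 : R) (fbar : W * R -> V) (e : 'I_2 -> pexpr R (option ix)).
Hypothesis n1 : (1 <= n)%N.
Hypothesis w0 : omega0 != 0.
Hypothesis eP : forall p j, fbar p ord0 j = ev (e j) (pvars p).
Hypothesis sym : normal_form_symmetry omega0 fbar.
Variables (lam omega : R) (X : W).
Hypothesis w_neq0 : omega != 0.
Hypothesis X0 : row ord0 X = 0.

Let x (t : R) : W := X *m (rotation (omega * t))^T.
Let F := network (fun X => fbar (X, lam)).

Let rot0 : (rotation 0)^T = 1%:M :> 'M[R]_2.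
Proof. by apply/matrixP; apply: two_cases; apply: two_cases; rewrite !mxE /= ?cos0 ?sin0 ?oppr0. Qed.

Let x0E : x 0 = X. Proof. by rewrite /x mulr0 rot0 mulmx1. Qed.

Let xrow t : row ord0 (x t) = 0.
Proof. by rewrite /x row_mul X0 mul0mx. Qed.

(** On x_0 = 0 the network field commutes with rotations, so the equation at the single profile [X]
    holds along its whole orbit. *)
Lemma wave_solution : F X = X *m (mulI_mx omega)^T -> is_solution F x.
Proof.
move=> FX t.
have -> : F (x t) = X *m (mulI_mx omega)^T *m (rotation (omega * t))^T.
  rewrite -FX; apply/matrixP => j k; rewrite [LHS]networkE nodearg_mul (fbar_rotation w0 sym); last first.
    exact: nodearg_last.
  by rewrite !mxE; apply: eq_bigr => l _; rewrite [F X j l]networkE.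
apply: is_derive_mx => j k.
have wt : is_derive t (1 : R) (fun t => omega * t) omega.
  by apply: is_derive_eq; rewrite /GRing.scale/= mulr1.
have dc : is_derive t (1 : R) (fun t => cos (omega * t)) (- sin (omega * t) * omega).
  exact: (@is_derive1_comp _ cos (fun t => omega * t) t _ _ (is_derive_cos _) wt).
have ds : is_derive t (1 : R) (fun t => sin (omega * t)) (cos (omega * t) * omega).
  exact: (@is_derive1_comp _ sin (fun t => omega * t) t _ _ (is_derive_sin _) wt).
have -> : (fun t => x t j k) = (fun t => \sum_l X j l * (rotation (omega * t))^T l k).
  by apply/funext => s; rewrite mxE.
rewrite -mulmxA mxE; apply: is_derive_bigsum => l.
have dr : is_derive t (1 : R) (fun t => (rotation (omega * t))^T l k)
    (((mulI_mx omega)^T *m (rotation (omega * t))^T) l k).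
  have -> : ((mulI_mx omega)^T *m (rotation (omega * t))^T) l k =
      if l == k then - sin (omega * t) * omega else if k == ord0 then - (cos (omega * t) * omega)
      else cos (omega * t) * omega.
    move: k l; apply: two_cases; apply: two_cases;
      rewrite !mxE !big_ord_recl big_ord0 !mxE /= ?addr0; ring.
  have -> : (fun s => (rotation (omega * s))^T l k) = (fun s =>
      if l == k then cos (omega * s) else if k == ord0 then - sin (omega * s) else sin (omega * s)).
    by apply/funext => s; rewrite !mxE eq_sym.
  case: (l == k) => //; by case: (k == ord0) => //; exact: is_deriveN.
exact: (is_deriveZ (X j l) dr).
Qed.

(** The absolute value is there because the frequency may be negative. *)
Let T := 2 * pi / `|omega|.

Let T0 : 0 < T. Proof. by rewrite divr_gt0 ?mulr_gt0 ?pi_gt0// normr_gt0. Qed.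

Let wT : omega * T = 2 * pi \/ omega * T = - (2 * pi).
Proof.
have [wp|wn] := ltP 0 omega; [left|right].
  by rewrite /T gtr0_norm//; field.
by rewrite /T ler0_norm//; field.
Qed.

Let cos2pi' : cos (2 * pi) = 1 :> R.
Proof. by rewrite mulr_natl mulr2n cosDpi cospi opprK. Qed.

Let sin2pi' : sin (2 * pi) = 0 :> R.
Proof. by rewrite mulr_natl mulr2n sinDpi sinpi oppr0. Qed.

Let cosT : cos (omega * T) = 1.
Proof. by case: wT => ->; rewrite ?cosN cos2pi'. Qed.

Let sinT : sin (omega * T) = 0.
Proof. by case: wT => ->; rewrite ?sinN sin2pi' ?oppr0. Qed.

Let cos_lt1 (th : R) : 0 < th < 2 * pi -> cos th != 1.
Proof.
move=> /andP[t0 t2]; apply/eqP => c1.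
have s0 : 0 < sin (th / 2) by apply: sin_gt0_pi; rewrite divr_gt0//= ltr_pdivrMr// mulrC.
have := cos_mulr2n (th / 2).
have -> : th / 2 *+ 2 = th by rewrite -mulr_natr divfK// pnatr_eq0.
rewrite c1 => h.
have := cos2Dsin2 (th / 2); move: h; move: (cos (th / 2)) (sin (th / 2)) s0 => c s s0 h h'.
have : s ^+ 2 = 0 by move: h h'; rewrite mulr2n; lra.
by move/eqP; rewrite sqrf_eq0 gt_eqF.
Qed.

Hypothesis Xnz : exists j, X j ord0 ^+ 2 + X j ord_max ^+ 2 != 0.

Let period : minimal_period x T.
Proof.
split=> //.
  move=> t; rewrite /x; congr (_ *m _^T); apply/matrixP => k l; rewrite !mxE mulrDr.
  by rewrite cosD sinD cosT sinT !mulr0 !mulr1 subr0 addr0.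
move=> S /andP[S0 ST] per; have := per 0; rewrite add0r x0E => E.
have [j Xj] := Xnz.
have c1 : cos (omega * S) = 1.
  have E0 := congr1 (fun M : W => M j ord0) E; have E1 := congr1 (fun M : W => M j ord_max) E.
  move: E0 E1; rewrite /x !mxE !big_ord_recl !big_ord0 !mxE /= !addr0.
  rewrite (_ : lift ord0 ord0 = ord_max); last exact/val_inj.
  move: (cos2Dsin2 (omega * S)) Xj; move: (cos _) (sin _) (X j ord0) (X j ord_max) => c s u v cs uv.
  (* The identity |e^(i omega S) - 1|^2 |z|^2 = |(e^(i omega S) - 1) z|^2 in real coordinates. *)
  move=> E0 E1; have : ((c - 1) ^+ 2 + s ^+ 2) * (u ^+ 2 + v ^+ 2) = 0.
    have e0 : u * c - v * s - u = 0 by move: E0; lra.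
    have e1 : u * s + v * c - v = 0 by move: E1; lra.
    transitivity ((u * c - v * s - u) ^+ 2 + (u * s + v * c - v) ^+ 2); first by ring.
    by rewrite e0 e1 expr0n addr0.
  move/eqP; rewrite mulf_eq0 (negPf uv) orbF paddr_eq0 ?sqr_ge0// sqrf_eq0 subr_eq0.
  by move=> /andP[/eqP].
have : cos (`|omega| * S) != 1.
  apply: cos_lt1; rewrite mulr_gt0 ?normr_gt0//=.
  by rewrite mulrC -ltr_pdivlMr ?normr_gt0.
by have [wp|wn] := ltP 0 omega; [rewrite gtr0_norm//|rewrite ler0_norm// mulNr cosN]; rewrite c1 eqxx.
Qed.

Let D t := dnet fbar lam (x t).

Let DE t (i j : 'I_n.+1) k l : D t (mxvec_index i k) (mxvec_index j l) =
  \sum_(a < n.+1) if inord (j - a) == i then dslot e lam a (nodearg j (x t)) l k else 0.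
Proof.
have := congr1 (fun M : 'M[R]_2 => M k l) (blk_dnet eP lam (x t) i j).
rewrite [X in X = _ -> _]mxE => ->; rewrite mxE summxE [LHS]big_mkcond.
by apply: eq_bigr => a _; case: ifP.
Qed.

Let D_cont y z : continuous (fun t => D t y z).
Proof.
move=> t; pose G s := \sum_(a < n.+1) if inord ((unidx z).1 - a) == (unidx y).1 then
  dslot e lam a (nodearg (unidx z).1 (x s)) (unidx z).2 (unidx y).2 else 0.
have DG : (fun s => D s y z) = G.
  by apply/funext => s; rewrite -[in LHS](unidxK y) -[in LHS](unidxK z); exact: DE.
suff : G s @[s --> t] --> G t by rewrite -DG.
apply: cvg_bigsum => a.
case: (_ == _); last exact: cvg_cst.
have -> : (fun t => dslot e lam a (nodearg (unidx z).1 (x t)) (unidx z).2 (unidx y).2) =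
  (fun t => hd (e (unidx z).2) (pvars (nodearg (unidx z).1 (x t), lam)) (pvars (nodearg (unidx z).1 (x t), lam)) (Some (a, (unidx y).2))).
  by apply/funext => s; rewrite mxE.
rewrite mxE.
have pc (o : option ix) : pvars (nodearg (unidx z).1 (x s), lam) o @[s --> t] --> pvars (nodearg (unidx z).1 (x t), lam) o.
  case: o => [[b k]|] /=; last exact: cvg_cst.
  have E s : nodearg (unidx z).1 (x s) b k = \sum_l X (inord ((unidx z).1 - b)) l * rotation (omega * s) k l.
    by rewrite !mxE; apply: eq_bigr => l _; rewrite mxE.
  rewrite E; under eq_fun do rewrite E.
  apply: cvg_bigsum => l; apply: cvgM; first exact: cvg_cst.
  have wc : omega * s @[s --> t] --> omega * t by apply: cvgM => //; exact: cvg_cst.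
  have cc : cos (omega * s) @[s --> t] --> cos (omega * t).
    by apply: (cvg_comp _ _ wc); exact: continuous_cos.
  have sc : sin (omega * s) @[s --> t] --> sin (omega * t).
    by apply: (cvg_comp _ _ wc); exact: continuous_sin.
  under eq_fun do rewrite mxE; rewrite mxE; case: (k == l) => //.
  by case: (k == ord0) => //; exact: cvgN.
exact: (@hd_cvg R _ _ _ _ (e (unidx z).2) (fun o s => pvars (nodearg (unidx z).1 (x s), lam) o)
  (fun o s => pvars (nodearg (unidx z).1 (x s), lam) o) _ _ _ pc pc).
Qed.

Lemma wave_hyperbolic :
  (let S := \sum_i lin_coef fbar i lam in \det S < 0 \/ 0 < \det S /\ \tr S != 0) ->
  (let E1 := dslot e lam ord0 (nodearg (inord 1) X) - mulI_mx omega in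
     E1 ord0 ord0 != 0 /\ forall k, E1 k ord_max = 0) ->
  (forall j : 'I_n.+1, (1 < j)%N -> let E1 := dslot e lam ord0 (nodearg j X) - mulI_mx omega in
     0 < \det E1 /\ \tr E1 != 0) ->
  hyperbolic_periodic F x.
Proof.
move=> C0 C1 C2.
have D00 t : blk (D t) ord0 ord0 = (\sum_i lin_coef fbar i lam)^T.
  apply: (etrans (blk_dnet eP lam (x t) ord0 ord0)); rewrite (nodearg0 (xrow t)); congr trmx.
  rewrite (eq_bigl xpredT) => [|i]; last by rewrite sub0n; apply/eqP/val_inj; rewrite /= inordK.
  by apply: eq_bigr => i _; apply/matrixP => k l; rewrite mxE (lin_coef_hd eP).
have Djj (j : 'I_n.+1) : (0 < j)%N -> blk (D 0) j j - (mulI_mx omega)^T =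
    (dslot e lam ord0 (nodearg j X) - mulI_mx omega)^T.
  move=> j0; have -> : blk (D 0) j j = (dslot e lam ord0 (nodearg j X))^T.
    by apply: (etrans (blk_dnet_diag eP lam (x 0) j0)); rewrite x0E.
  by apply/matrixP => k l; rewrite !mxE.
have H0 : \det (blk (D 0) ord0 ord0) < 0 \/
  0 < \det (blk (D 0) ord0 ord0) /\ \tr (blk (D 0) ord0 ord0) != 0.
  by rewrite D00 det_tr mxtrace_tr.
have one1 : (0 < (inord 1 : 'I_n.+1))%N by rewrite inordK// ltnS.
have H1 : (blk (D 0) (inord 1) (inord 1) - (mulI_mx omega)^T) ord0 ord0 != 0 /\
    forall k, (blk (D 0) (inord 1) (inord 1) - (mulI_mx omega)^T) ord_max k = 0.
  rewrite Djj//; have [c1 c2] := C1; split; first by rewrite mxE.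
  by move=> k; rewrite mxE.
have H2 (j : 'I_n.+1) : (1 < j)%N -> 0 < \det (blk (D 0) j j - (mulI_mx omega)^T) /\
    \tr (blk (D 0) j j - (mulI_mx omega)^T) != 0.
  by move=> j1; rewrite Djj ?(ltn_trans _ j1)// det_tr mxtrace_tr; exact: C2.
have D_rot t (i j : 'I_n.+1) : (0 < i)%N -> blk (D t) i j =
    (rotation (- (omega * t)))^T *m blk (D 0) i j *m (rotation (omega * t))^T.
  move=> i0; apply: (etrans (blk_dnet_rotation w0 eP sym lam (omega * t) j X0 i0)).
  by rewrite /D x0E.
have D_lt t (i j : 'I_n.+1) : (j < i)%N -> blk (D t) i j = 0 by exact: blk_dnet_lt.
have D_00 t : blk (D t) ord0 ord0 = blk (D 0) ord0 ord0 := etrans (D00 t) (esym (D00 0)).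
have [Y [mults [Y0 Yd Yc Ym]]] := wave_multipliers n1 D_lt D_rot D_00 D_cont T0 cosT sinT H0 H1 H2.
by exists T, Y, mults; split; [exact: period|split|exact: Yc|exact: Ym].
Qed.


(** Differentiating fbar(e^(i th) Z) = e^(i th) i omega c at th = 0 shows that D_0 fbar - i omega
    kills the phase direction. This yields the one multiplier on the unit circle. *)
Lemma slot_rotation (c : R) (Z : W) : c != 0 -> Z = c *: delta_mx ord0 ord0 ->
  fbar (Z, lam) ord0 ord0 = 0 -> fbar (Z, lam) ord0 ord_max = omega * c ->
  forall k, dslot e lam ord0 Z k ord_max = mulI_mx omega k ord_max.
Proof.
move=> c0 ZE f0 f1 k.
have ZM (M : 'M[R]_2) i l : (Z *m M) i l = if i == ord0 then c * M ord0 l else 0.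
  rewrite mxE (bigD1 ord0)//= big1 ?addr0 => [|j j0]; last first.
    by rewrite ZE !mxE (negPf j0) andbF mulr0 mul0r.
  by rewrite ZE !mxE eqxx andbT; case: (i == ord0); rewrite ?mulr1 ?mulr0 ?mul0r.
have Zlast : row ord_max Z = 0.
  apply/rowP => l; rewrite ZE !mxE (_ : (ord_max == ord0 :> 'I_n.+1) = false) ?mulr0//.
  by apply/negbTE; rewrite -val_eqE /= -lt0n.
pose d (o : option ix) : R := if o is Some (i, l) then (if (i == ord0) && (l == ord_max) then c else 0) else 0.
have pd o : is_derive (0 : R) (1 : R) (fun th => pvars (Z *m (rotation th)^T, lam) o) (d o).
  case: o => [[i l]|] /=; last exact: is_derive_cst.
  have -> : (fun th => (Z *m (rotation th)^T) i l) = (fun th => if i == ord0 then c * rotation th l ord0 else 0).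
    by apply/funext => th; rewrite ZM mxE.
  case: (i == ord0) => /=; last exact: is_derive_cst.
  have -> : (if l == ord_max then c else 0) = c *: (if l == ord_max then 1 else 0 : R).
    by rewrite /GRing.scale/=; case: ifP; rewrite ?mulr1 ?mulr0.
  apply: is_deriveZ; move: l; apply: two_cases => /=.
    have -> : (fun th : R => rotation th ord0 ord0) = cos by apply/funext => th; rewrite mxE.
    by apply: is_derive_eq; rewrite sin0 oppr0.
  have -> : (fun th : R => rotation th ord_max ord0) = sin by apply/funext => th; rewrite mxE.
  by apply: is_derive_eq; rewrite cos0.
have D1 := @is_derive_ev _ _ _ (e k) (fun o th => pvars (Z *m (rotation th)^T, lam) o) d 0 1 pd.
have D2 : is_derive (0 : R) (1 : R) (fun th => ev (e k) (pvars (Z *m (rotation th)^T, lam)))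
    (c * mulI_mx omega k ord_max).
  have -> : (fun th => ev (e k) (pvars (Z *m (rotation th)^T, lam))) =
      (fun th => omega * c * rotation th k ord_max).
    apply/funext => th; rewrite -eP (fbar_rotation w0 sym)// mxE (bigD1 ord_max)//= f1 [_^T _ _]mxE big1 ?addr0//.
    by apply: two_cases => //= _; rewrite f0 mul0r.
  move: k {D1}; apply: two_cases.
    have -> : (fun th : R => omega * c * rotation th ord0 ord_max) = (fun th : R => - (omega * c) * sin th).
      by apply/funext => th; rewrite mxE /=; ring.
    have := is_deriveZ (- (omega * c)) (is_derive_sin (0 : R)).
    by rewrite cos0 /GRing.scale/= mulr1 mxE /= mulrN [c * _]mulrC.
  have -> : (fun th : R => omega * c * rotation th ord_max ord_max) = (fun th : R => (omega * c) * cos th).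
    by apply/funext => th; rewrite mxE /=; ring.
  have := is_deriveZ (omega * c) (is_derive_cos (0 : R)).
  by rewrite sin0 oppr0 /GRing.scale/= mulr0 mxE /= mulr0.
have [_ E1] := D1; have [_ E2] := D2; apply: (mulfI c0); rewrite -E2 E1 mxE.
have z0 : pvars (Z *m (rotation 0)^T, lam) = pvars (Z, lam) by rewrite rot0 mulmx1.
rewrite z0 (bigD1 (Some (ord0, ord_max)))//= ?eqxx mulrC big1 ?addr0// => -[[i l]|] /=; last by rewrite mulr0.
by rewrite -[Some _ != _]/((i, l) != (ord0, ord_max)) xpair_eqE => /negPf ->; rewrite mulr0.
Qed.

End RotatingWaves.

(** * Powers of |lambda| and amplitudes *)

Section Amplitudes.
Context {R : realType}.

Definition kap (i : nat) : R := 2^-1 * (3 ^+ i.-1)^-1.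

Lemma kap_gt0 i : 0 < kap i.
Proof. by rewrite mulr_gt0 ?invr_gt0 ?exprn_gt0. Qed.

(** The exponents satisfy kappa_i 3^l = kappa_(i-l): this is the relation between the scales of
    nodes i and i - l assumed in [node_vars]. *)
Lemma powR_kap_sub (x : R) i l : (l < i)%N -> (x `^ kap i) ^+ (3 ^ l) = x `^ kap (i - l).
Proof.
move=> li; rewrite -powR_mulrn ?powR_ge0// -powRrM; congr (_ `^ _).
rewrite /kap natrX; have -> : i.-1 = ((i - l).-1 + l)%N by move: li; case: i => // i; rewrite ltnS => li; rewrite subSn//= subnK.
by rewrite exprD invfM -!mulrA mulVf ?mulr1// expf_neq0// pnatr_eq0.
Qed.

Lemma powR_kap_all (x : R) i : 0 <= x -> (x `^ kap i) ^+ (2 * 3 ^ i.-1) = x.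
Proof.
move=> x0; rewrite -powR_mulrn ?powR_ge0// -powRrM.
rewrite (_ : kap i * _ = 1) ?powRr1// /kap natrM natrX.
by rewrite mulrACA mulVf ?pnatr_eq0// mulVf ?mulr1// expf_neq0// pnatr_eq0.
Qed.

Lemma exp_le_chain (d : R) i n : 0 < d <= 1 -> (1 <= i <= n)%N ->
  d ^+ (2 * 3 ^ n.-1) <= d ^+ (2 * 3 ^ i.-1).
Proof.
move=> /andP[d0 d1] /andP[i1 im]; apply: ler_wiXn2l; rewrite ?(ltW d0)//.
by rewrite leq_mul2l leq_exp2l// -!subn1 leq_sub2r.
Qed.

(** As d <= 1, the last node, with the smallest exponent, imposes the strongest restriction on
    |lambda|. *)
Lemma powR_kap_lt (x d : R) i n : 0 < d <= 1 -> (1 <= i <= n)%N -> 0 <= x ->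
  x < d ^+ (2 * 3 ^ n.-1) -> x `^ kap i < d.
Proof.
move=> d01 im x0 xd; have /andP[d0 _] := d01.
have k0 : (0 < 2 * 3 ^ i.-1)%N by rewrite muln_gt0 expn_gt0.
rewrite -(ltr_pXn2r k0) ?nnegrE ?powR_ge0 ?(ltW d0)// powR_kap_all//.
exact: lt_le_trans (exp_le_chain d01 im).
Qed.

Lemma powR_kap_le (d : R) i n : 0 < d <= 1 -> (1 <= i <= n)%N ->
  (d ^+ (2 * 3 ^ n.-1)) `^ kap i <= d.
Proof.
move=> d01 im; have /andP[d0 _] := d01.
have k0 : (0 < 2 * 3 ^ i.-1)%N by rewrite muln_gt0 expn_gt0.
rewrite -(ler_pXn2r k0) ?nnegrE ?powR_ge0 ?(ltW d0)// powR_kap_all ?exprn_ge0 ?(ltW d0)//.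
exact: exp_le_chain.
Qed.

Lemma continuous_normR_powR (k : R) : 0 < k -> continuous (fun lam : R => `|lam| `^ k).
Proof.
move=> k0 x; have [->|x0] := eqVneq x 0.
  rewrite /continuous_at normr0 powR0 ?gt_eqF//; apply/cvgr0Pnorm_lt => eps eps0.
  apply/nbhs_ballP; exists (eps `^ k^-1); first by rewrite /= powR_gt0.
  move=> y; rewrite /ball/= sub0r normrN => yd.
  rewrite ger0_norm ?powR_ge0//.
  have -> : eps = (eps `^ k^-1) `^ k by rewrite -powRrM mulVf ?gt_eqF// powRr1// ltW.
  by apply: gt0_ltr_powR; rewrite // ?nnegrE ?normr_ge0 ?powR_ge0.
have oA : open [set y : R | y != 0] by exact: open_neq.
have eA (y : R) : [set y : R | y != 0] y -> expR (k * ln `|y|) = `|y| `^ k.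
  by move=> /= y0; rewrite /powR normr_eq0 (negPf y0).
apply: (continuous_open_eq oA x0 eA).
apply: (@continuous_comp _ _ _ (fun y : R => k * ln `|y|) expR); last exact: continuous_expR.
apply: cvgM; first exact: cvg_cst.
apply: (@continuous_comp _ _ _ (fun y : R => `|y|) (@ln R)); first exact: norm_continuous.
by apply: continuous_ln; rewrite normr_gt0.
Qed.

(** The square root of a positive smooth function is smooth; its value at 0 is the nonzero limit of
    the quotient. *)
Lemma amplitude_sim_power (D : set R) (lam0 k d : R) (b0 b1 : R -> R) (b : R -> R) :
  0 < d -> lam0 `^ k <= d ->
  smooth1 [set x | `|x| < d] b0 -> smooth1 [set x | `|x| < d] b1 ->
  (forall x, `|x| < d -> 0 < b0 x ^+ 2 + b1 x ^+ 2) ->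
  (forall lam, D lam -> b lam = `|lam| `^ k * Num.sqrt (b0 (`|lam| `^ k) ^+ 2 + b1 (`|lam| `^ k) ^+ 2)) ->
  sim_power D lam0 k b.
Proof.
move=> d0 ld s0 s1 pos bE.
pose q x := Num.sqrt (b0 x ^+ 2 + b1 x ^+ 2).
have oU : open [set x : R | `|x| < d].
  have -> : [set x : R | `|x| < d] = ball (0 : R) d.
    by apply/seteqP; split=> x; rewrite /ball/= sub0r normrN.
  exact: ball_open.
have qs : smooth1 [set x | `|x| < d] q.
  by move=> j; apply: C1k_sqrt => // ; apply: C1kD; apply: C1kX; [exact: s0|exact: s1].
exists (fun x => x * q x); split => //.
  exists [set x : R | `|x| < d]; split => //.
    by move=> x /= /andP[x0 xl]; rewrite ger0_norm// (lt_le_trans xl).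
  by move=> j; apply: C1k_Ck_on => //; apply: C1kM; [exact: C1k_id|exact: qs].
have in0 : [set x : R | `|x| < d] 0 by rewrite /= normr0.
exists (q 0); split; first by rewrite gt_eqF// sqrtr_gt0 pos// normr0.
have qc : q x @[x --> (0 : R)] --> q 0 by exact: (C1k_continuous (qs 0%N) in0).
have qr : q x @[x --> (0 : R)^'+] --> q 0 by apply: cvg_at_right_filter.
apply: (@cvg_near_eq R _ _ _ _ q) => //.
by near=> x; rewrite mulrAC divff ?mul1r// gt_eqF//; near: x; exact: nbhs_right_gt.
Unshelve. all: by end_near. Qed.

End Amplitudes.

(** * From the blown-up equations back to the network *)

Section BlownUpNodes.
Context {R : realType} {n : nat}.
Local Notation V := 'rV[R]_2.
Local Notation W := 'M[R]_(n.+1, 2).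
Local Notation ix := ('I_n.+1 * 'I_2)%type.
Local Notation rvar := (@rvar n).
Variables (omega0 : R) (fbar : W * R -> V) (e : 'I_2 -> pexpr R (option ix)) (Q : 'I_2 -> pexpr R rvar).
Hypothesis eP : forall p j, fbar p ord0 j = ev (e j) (pvars p).
Hypothesis RE : forall k v, fbar (blowup v, v (@vmu n) ^+ 2 * v (@vtau n)) ord0 k =
  (omega0 + v (@vmu n) ^+ 2 * v (@vtau n) * v (@vsig n)) * v (@vmu n) * turn v k + v (@vmu n) ^+ 3 * ev (Q k) v.

(** The blown-up identity is differentiated in a component of b and divided by mu. Its two sides are
    different expressions of one function, which [hd_eq] permits. *)
Lemma hd_blowup v k k' : v (@vmu n) != 0 ->
  hd (e k) (pvars (blowup v, v (@vmu n) ^+ 2 * v (@vtau n))) (pvars (blowup v, v (@vmu n) ^+ 2 * v (@vtau n)))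
    (Some (ord0, k')) =
  mulI_mx (omega0 + v (@vmu n) ^+ 2 * v (@vtau n) * v (@vsig n)) k k' + v (@vmu n) ^+ 2 * hd (Q k) v v (vx ord0 k').
Proof.
move=> mu0; set mu := v (@vmu n) in mu0 *.
pose S : pexpr R rvar := PA (PC omega0) (PM (PM (ppow (PV (@vmu n)) 2) (PV (@vtau n))) (PV (@vsig n))).
pose tb : pexpr R rvar := if k == ord0 then PM (PC (-1)) (PV (vx ord0 ord_max)) else PV (vx ord0 ord0).
pose P' : pexpr R rvar := PA (PM (PM S (PV (@vmu n))) tb) (PM (ppow (PV (@vmu n)) 3) (Q k)).
have E : hd (psubst (@blowup_subst R n) (e k)) v v (vx ord0 k') = 1 * hd P' v v (vx ord0 k').
  apply: hd_eq => h w; clearbody w.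
  rewrite mul1r (ev_blowup_subst eP) RE /P' /S /= /tb /turn.
  by case: (k == ord0) => /=; ring.
have F : hd P' v v (vx ord0 k') = mu * (mulI_mx (omega0 + mu ^+ 2 * v (@vtau n) * v (@vsig n)) k k'
    + mu ^+ 2 * hd (Q k) v v (vx ord0 k')).
  rewrite /P' /S /= -/mu /tb mxE.
  by move: k k' {E P' tb}; apply: two_cases => k'; [|]; move: k'; apply: two_cases => /=; rewrite ?eqxx /=; ring.
have vE : (fun o => ev (@blowup_subst R n o) v) = pvars (blowup v, mu ^+ 2 * v (@vtau n)).
  apply/funext => -[[l k0]|] /=; last by rewrite -/mu expr2 mulr1.
  by rewrite mxE -/mu; case: (l == ord0) => //=; rewrite !exprS expr0.
apply: (mulfI mu0); rewrite -F -[RHS]mul1r -E hd_psubst vE (bigD1 (Some (ord0, k')))//= eqxx.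
rewrite [X in _ + X]big1 ?addr0.
  by rewrite ?eqxx /= mul0r add0r mulr1 mulrC.
move=> [[l k0]|]; last by move=> _ /=; ring.
move=> ne; have ne' : vx l k0 == vx ord0 k' = false.
  by apply/negbTE; apply: contra ne => /eqP[-> ->].
have hz (q : pexpr R rvar) : hd q v v (vx ord0 k') = 0 ->
    hd (PM q (PV (vx l k0))) v v (vx ord0 k') = 0.
  move=> q0; change (hd q v v (vx ord0 k') * v (vx l k0) + ev q v * (vx l k0 == vx ord0 k')%:R = 0).
  by rewrite q0 ne' mul0r mulr0 addr0.
have q1 : hd (PV (@vmu n)) v v (vx ord0 k') = 0 :> R by [].
have q3 : hd (ppow (PV (@vmu n)) 3) v v (vx ord0 k') = 0 :> R.
  have zz (z : R) : 0 * (z * (z * 1)) + z * (0 * (z * 1) + z * (0 * 1 + z * 0)) = 0 by ring.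
  exact: zz.
have z : hd (@blowup_subst R n (Some (l, k0))) v v (vx ord0 k') = 0.
  by rewrite /blowup_subst; case: (l == ord0); apply: hz.
by rewrite z mulr0.
Qed.

Variables (s x : R) (m : nat -> R) (beta : nat -> 'I_2 -> R -> R) (sigma : R -> R).
Hypothesis m_sub : forall i l, (l < i)%N -> m i ^+ (3 ^ l) = m (i - l)%N.
Hypothesis m_all : forall i, m i ^+ (2 * 3 ^ i.-1) = x.

Let lam := s * x.
Let omega := omega0 + lam * sigma (m 1%N).

Definition wave_profile : W :=
  \matrix_(j, k) (if j == ord0 then 0 else m j * beta j k (m j)).

Let nv (j : nat) := node_vars (n := n) s beta sigma j ^~ (m j).

(** The scale of node j - l is m_j^(3^l) = m_j^3 m_j^(3^l - 3), so slot l has the form required by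
    [blowup]. *)
Lemma nodearg_profile (j : 'I_n.+1) : (0 < j)%N -> nodearg j wave_profile = blowup (nv j).
Proof.
move=> j0; apply/matrixP => l k; rewrite !mxE /nv /=.
have val : (inord (j - l) : 'I_n.+1) = (j - l)%N :> nat.
  by rewrite inordK// (leq_ltn_trans (leq_subr _ _) (ltn_ord j)).
have [->|l0] := eqVneq l ord0.
  rewrite subn0 (_ : inord j = j); last by apply/val_inj; rewrite /= inordK.
  by rewrite -[j == ord0]/(j == 0%N :> nat) gtn_eqF.
have [lj|jl] := ltnP l j; last first.
  rewrite mulr0 (_ : (inord (j - l) == ord0 :> 'I_n.+1) = true)//.
  by rewrite -val_eqE /= val subn_eq0.
have -> : (inord (j - l) == ord0 :> 'I_n.+1) = false.
  by apply/negbTE; rewrite -val_eqE /= val subn_eq0 -ltnNge.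
have l3 : (3 <= 3 ^ l)%N by rewrite -[X in (X <= _)%N]expn1 leq_exp2l// lt0n.
by rewrite val mulrA -exprD subnKC// m_sub.
Qed.

Let lamE j : (0 < j)%N -> m j ^+ 2 * (s * m j ^+ (2 * 3 ^ j.-1 - 2)) = lam.
Proof.
move=> j0; rewrite mulrCA -exprD subnKC ?m_all//.
by rewrite -[X in (X <= _)%N]muln1 leq_mul2l expn_gt0.
Qed.

Let sigE j : (0 < j)%N -> m j ^+ (3 ^ j.-1) = m 1%N.
Proof. by move=> j0; rewrite m_sub ?prednK// -subn1 subKn. Qed.

Let nv_lam j : (0 < j)%N -> nv j (@vmu n) ^+ 2 * nv j (@vtau n) = lam.
Proof. exact: lamE. Qed.

Let nv_sig j : (0 < j)%N -> nv j (@vsig n) = sigma (m 1%N).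
Proof. by move=> j0; rewrite -(sigE j0). Qed.

Lemma row0_profile : row ord0 wave_profile = 0.
Proof. by apply/rowP => k; rewrite !mxE. Qed.

Lemma profile_network : (forall lam, fbar (0, lam) = 0) ->
  (forall j k, (1 <= j <= n)%N -> ev (Q k) (nv j) = 0) ->
  network (fun X => fbar (X, lam)) wave_profile = wave_profile *m (mulI_mx omega)^T.
Proof.
move=> f0 Q0; apply/matrixP => j k; rewrite networkE.
have [j0|j0] := posnP j.
  have -> : j = ord0 by exact/val_inj.
  rewrite nodearg0 ?f0; last exact: row0_profile.
  by rewrite !mxE big1// => l _; rewrite !mxE mul0r.
rewrite nodearg_profile//.
have jn : (1 <= j <= n)%N by apply/andP; split => //; exact: ltnSE (ltn_ord j).
have := RE k (nv j); rewrite (Q0 j k jn) mulr0 addr0 (nv_lam j0) (nv_sig j0) => ->.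
rewrite mxE (_ : \sum_l _ = wave_profile j ord0 * mulI_mx omega k ord0 + wave_profile j ord_max * mulI_mx omega k ord_max).
  have j00 : (j == ord0) = false by rewrite -[j == ord0]/(j == 0%N :> nat) gtn_eqF.
  rewrite !mxE j00 /turn /nv /= -/omega; move: k; apply: two_cases => /=; ring.
rewrite !big_ord_recl big_ord0 addr0 !mxE (_ : lift ord0 ord0 = ord_max) //; exact/val_inj.
Qed.

(** These are, up to transposition, the diagonal blocks in the rotating frame; the factor m_j^2 > 0
    affects neither the sign of the determinant nor the vanishing of the trace. *)
Lemma profile_slot (j : 'I_n.+1) k k' : (0 < j)%N -> m j != 0 ->
  (dslot e lam ord0 (nodearg j wave_profile) - mulI_mx omega) k k' =
  m j ^+ 2 * node_block Q s beta sigma j (m j) k k'.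
Proof.
move=> j0 mj; have := @hd_blowup (nv j) k k' mj.
rewrite (nv_lam j0) (nv_sig j0) -(nodearg_profile j0) => E.
have -> (A B : 'M[R]_2) : (A - B) k k' = A k k' - B k k' by rewrite mxE [X in _ + X]mxE.
by rewrite [dslot _ _ _ _ _ _]mxE E addrAC subrr add0r.
Qed.

End BlownUpNodes.

Lemma rotating_waveE (R : realType) (n : nat) (B : nat -> complex R) (w : R) (X : 'M[R]_(n.+1, 2)) :
  (forall (j : 'I_n.+1), row j X = if j == ord0 then 0 else row_of_complex (B j)) ->
  rotating_wave B w = fun t => X *m (rotation (w * t))^T.
Proof.
move=> XE; apply/funext => t; rewrite -cscale_expiE; apply/matrixP => j k.
rewrite !mxE XE; case: (j == ord0); move: k; apply: two_cases; rewrite /complex_of_row ?mxE /=;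
  case: (B j) => p q /=; ring.
Qed.

Lemma hyperbolic_sum_near (R : realType) (n : nat) (fbar : 'M[R]_(n.+1, 2) * R -> 'rV[R]_2)
    (e : 'I_2 -> pexpr R (option ('I_n.+1 * 'I_2))) :
  (forall p j, fbar p ord0 j = ev (e j) (pvars p)) ->
  (let S := \sum_(i < n.+1) lin_coef fbar i 0 in \det S < 0 \/ 0 < \det S /\ \tr S != 0) ->
  \forall lam \near (0 : R), let S := \sum_(i < n.+1) lin_coef fbar i lam in
    \det S < 0 \/ 0 < \det S /\ \tr S != 0.
Proof.
move=> eP /= H; pose S lam := \sum_(i < n.+1) lin_coef fbar i lam.
have Sc k l : S lam k l @[lam --> (0 : R)] --> S 0 k l.
  have SE lam : S lam k l = \sum_(i < n.+1) hd (e k) (pvars (0, lam)) (pvars (0, lam)) (Some (i, l)).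
    by rewrite summxE; apply: eq_bigr => i _; exact: lin_coef_hd.
  rewrite SE; under eq_fun do rewrite SE; apply: cvg_bigsum => i.
  have pc (o : option ('I_n.+1 * 'I_2)) :
      pvars ((0 : 'M[R]_(n.+1, 2)), lam) o @[lam --> (0 : R)] --> pvars ((0 : 'M[R]_(n.+1, 2)), (0 : R)) o.
    by case: o => [[a b]|] /=; [exact: cvg_cst|exact: cvg_id].
  exact: (@hd_cvg R _ _ _ _ (e k) (fun o lam => pvars (0, lam) o) (fun o lam => pvars (0, lam) o) _ _ _ pc pc).
have dc : \det (S lam) @[lam --> (0 : R)] --> \det (S 0).
  by rewrite det2; under eq_fun do rewrite det2; apply: cvgB; apply: cvgM; exact: Sc.
have tc : \tr (S lam) @[lam --> (0 : R)] --> \tr (S 0).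
  by rewrite tr2; under eq_fun do rewrite tr2; apply: cvgD; exact: Sc.
case: H => [d|[d t]].
  have : \forall lam \near (0 : R), \det (S lam) < 0 by apply: (cvgr_lt _ dc).
  by apply: filterS => lam; left.
have h1 : \forall lam \near (0 : R), 0 < \det (S lam) by apply: (cvgr_gt _ dc).
have h2 : \forall lam \near (0 : R), \tr (S lam) != 0 by apply: (cvgr_neq0 _ tc).
by apply: filterS2 h1 h2 => lam; right.
Qed.

Theorem theorem1p1 (R : realType) (n : nat) (hn : (1 <= n)%N)
  (f : 'M[R]_(n.+1, 2) * R -> 'rV[R]_2)
  (f_smooth : smooth_on setT f)
  (f0 : forall lam : R, f (0, lam) = 0)
  (omega0 : R) (omega0_neq0 : omega0 != 0)
  (a0E : lin_coef f ord0 0 = mulI_mx omega0)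
  (r1 r2 : nat) (hr1 : (2 <= r1)%N) (hr2 : (1 <= r2)%N)
  (fbar : 'M[R]_(n.+1, 2) * R -> 'rV[R]_2)
  (fbar_nf : local_normal_form omega0 r1 r2 f fbar)
  (cond1 : \sum_(i < n.+1) lin_coef f i 0 \in unitmx)
  (cond2 : derive1 (fun lam : R => \tr (lin_coef f ord0 lam)) 0 != 0)
  (cond3 : \tr (lin_coef f (inord 1) 0) != 0)
  (cond4 : iter 3 (dX (delta_mx ord0 ord0))
             (fun p => complex.Re (complex_of_row (fbar p))) (0, 0) != 0)
  (cond5 : hyperbolic_mx (\sum_(i < n.+1) lin_coef f i 0)) :
  exists (lam0 : R) (D : set R) (B : nat -> R -> R[i]) (omega : R -> R),
    [/\ 0 < lam0,
        D = [set lam | 0 <= lam < lam0] \/ D = [set lam | - lam0 < lam <= 0],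
        {within D, continuous omega} /\
        (forall i, (1 <= i <= n)%N ->
           {within D, continuous (fun lam => row_of_complex (B i lam))}),
        (forall lam, D lam ->
           is_solution (network (fun X => fbar (X, lam)))
             (rotating_wave (fun i => B i lam) (omega lam))) &
        [/\ (\forall lam \near (0 : R)^', D lam ->
               hyperbolic_periodic (network (fun X => fbar (X, lam)))
                 (rotating_wave (n := n) (fun i => B i lam) (omega lam))),
            (exists K : R, \forall lam \near (0 : R), D lam ->
               `|omega lam - omega0| <= K * `|lam|) &
            forall i, (1 <= i <= n)%N ->
              sim_power D lam0 (2^-1 * (3 ^+ i.-1)^-1)
                (fun lam => ComplexField.Normc.normc (B i lam))]].
Proof.
have [L0 [al al0 ald] L1 S0 [[e eP] [sym f0b]]] :=
  normal_form_data hn f_smooth f0 omega0_neq0 a0E hr2 fbar_nf cond2 cond3 cond5.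
have [a1 [a2 [g1 [g2 [Q [a10 g10 RE QE]]]]]] :=
  reduced_equation omega0_neq0 hn eP sym f0b L0 ald al0 cond4.
have [|s [d' [beta [sigma [s1 br']]]]] := branch_exists a10 g10 QE hn.
  move=> n2; have [|||A B] := @symmetry_lin_coef _ _ omega0 fbar 0 omega0_neq0 hn sym _ _ (inord 1).
  - by move=> X; apply: diff_derivable; exact: (fbar_differentiable eP).
  - exact: f0b.
  - by rewrite inordK// ltnS.
  by split => //; exact: L1.
have [d [br nd]] := nondegenerate_branch g10 QE br'.
have [d01 ss b1 H] := br; have /andP[d0 d1] := d01.
(* Chosen so that |lambda| < [lam0] puts the scales |lambda|^kappa_i of all nodes i = 1, ..., n
   below [d]. *)
pose lam0 := d ^+ (2 * 3 ^ n.-1).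
have lam00 : 0 < lam0 by rewrite exprn_gt0.
pose D : set R := if s == 1 then [set lam | 0 <= lam < lam0] else [set lam | - lam0 < lam <= 0].
have DP lam : D lam -> `|lam| < lam0 /\ lam = s * `|lam|.
  rewrite /D; case: s1 => ->.
    by rewrite eqxx /= => /andP[l0 ll]; rewrite ger0_norm// mul1r.
  rewrite (_ : (-1 == 1 :> R) = false) /= => [/andP[l0 ll]|].
    by rewrite ler0_norm// mulN1r opprK ltrNl.
  by apply/negbTE; rewrite lt_eqF// (lt_trans (ltrN10 _)) ?ltr01.
pose m (lam : R) (i : nat) : R := `|lam| `^ @kap R i.
pose B (i : nat) (lam : R) : complex R := Complex (m lam i * beta i ord0 (m lam i)) (m lam i * beta i ord_max (m lam i)).
(* The frequency shift was measured in units of lambda, which gives the order |lambda| of omega -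
   omega0. *)
pose omega (lam : R) : R := omega0 + lam * sigma (m lam 1%N).
have md lam i : (1 <= i <= n)%N -> `|lam| < lam0 -> `|m lam i| < d.
  by move=> im ll; rewrite ger0_norm ?powR_ge0//; exact: (powR_kap_lt d01 im).
have mc i lam : m l i @[l --> lam] --> m lam i by exact: continuous_normR_powR (kap_gt0 i) lam.
have fc (g : R -> R) i lam : (1 <= i <= n)%N -> smooth1 [set x | `|x| < d] g -> `|lam| < lam0 ->
    g (m l i) @[l --> lam] --> g (m lam i).
  by move=> im gs ll; apply: (cvg_comp _ _ (mc i lam)); apply: (C1k_continuous (gs 0%N)); exact: md.
have n11 : (1 <= 1 <= n)%N by rewrite hn.
have omc lam : `|lam| < lam0 -> omega l @[l --> lam] --> omega lam.
  move=> ll; apply: cvgD; first exact: cvg_cst.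
  by apply: cvgM; [exact: cvg_id|exact: fc].
have l00 : `|0 : R| < lam0 by rewrite normr0.
have near0 : \forall lam \near (0 : R), `|lam| < lam0.
  by apply/nbhs_ballP; exists lam0 => // lam; rewrite /ball/= sub0r normrN.
pose X (lam : R) := @wave_profile R n (m lam) beta.
have waveE (lam : R) : rotating_wave (n := n) (fun i => B i lam) (omega lam) =
    fun t => X lam *m (rotation (omega lam * t))^T.
  apply: rotating_waveE => j; apply/rowP => k; rewrite !mxE; case: (j == ord0); rewrite mxE//=.
  by move: k; apply: two_cases.
have FX (lam : R) : D lam -> network (fun Z => fbar (Z, lam)) (X lam) = X lam *m (mulI_mx (omega lam))^T.
  move=> Dl; have [ll lE] := DP _ Dl.
  have := @profile_network R n omega0 fbar Q RE s `|lam| (m lam) beta sigma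
    (@powR_kap_sub R `|lam|) (fun i => @powR_kap_all R `|lam| i (normr_ge0 lam)) f0b.
  rewrite -lE; apply => j k jn.
  have [_ _ h] := H j jn; exact: (h k _ (md _ _ jn ll)).
exists lam0, D, B, omega; split => //.
- by rewrite /D; case: s1 => ->; [left; rewrite eqxx|right; rewrite lt_eqF// (lt_trans (ltrN10 _)) ?ltr01].
- split.
    by apply: continuous_in_subspaceT => lam; rewrite inE => /DP[ll _]; exact: omc.
  move=> i im; apply: continuous_in_subspaceT => lam; rewrite inE => /DP[ll _].
  have [bs _ _] := H i im.
  have -> : (fun l => row_of_complex (B i l)) = (fun l =>
      (m l i * beta i ord0 (m l i)) *: (delta_mx ord0 ord0 : 'rV[R]_2)
      + (m l i * beta i ord_max (m l i)) *: (delta_mx ord0 ord_max : 'rV[R]_2)).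
    by apply/funext => l; apply/rowP; apply: two_cases; rewrite !mxE /=; ring.
  apply: cvgD; apply: cvgZ; try exact: cvg_cst.
    by apply: cvgM; [exact: mc|exact: fc im (bs ord0) ll].
  by apply: cvgM; [exact: mc|exact: fc im (bs ord_max) ll].
- move=> lam Dl; rewrite waveE; apply: (wave_solution omega0_neq0 sym) => //.
    exact: row0_profile.
  exact: FX.
split.
(* The frequency tends to omega0 != 0, so the period 2 pi / |omega| makes sense for small lambda. *)
- have omn : \forall lam \near (0 : R), omega lam != 0.
    apply: (cvgr_neq0 _ (omc 0 l00)); by rewrite /omega mul0r addr0.
  have Sn := hyperbolic_sum_near eP S0.
  have both : \forall lam \near (0 : R), omega lam != 0 /\ (let S := \sum_(i < n.+1) lin_coef fbar i lam in
    \det S < 0 \/ 0 < \det S /\ \tr S != 0) by apply: filterS2 omn Sn => lam; split.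
  rewrite near_withinE; apply: filterS both => lam [on Sl] ln Dl.
  have [ll lE] := DP _ Dl.
  have mp i : 0 < m lam i by rewrite powR_gt0// normr_gt0.
  have mn i : m lam i != 0 by rewrite gt_eqF.
  have X0 : row ord0 (X lam) = 0 by exact: row0_profile.
  have slot (j : 'I_n.+1) k k' : (0 < j)%N ->
      (dslot e lam ord0 (nodearg j (X lam)) - mulI_mx (omega lam)) k k' =
      m lam j ^+ 2 * node_block Q s beta sigma j (m lam j) k k'.
    move=> j0; have := @profile_slot R n omega0 fbar e Q eP RE s `|lam| (m lam) beta sigma
      (@powR_kap_sub R `|lam|) (fun i => @powR_kap_all R `|lam| i (normr_ge0 lam)) j k k' j0 (mn j).
    by rewrite -lE.
  have ndj (j : 'I_n.+1) : (0 < j)%N -> nondegenerate Q s beta sigma j (m lam j).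
    move=> j0; have jn : (1 <= j <= n)%N by apply/andP; split => //; exact: ltnSE (ltn_ord j).
    exact: nd _ _ jn (md _ _ jn ll).
  pose one : 'I_n.+1 := inord 1.
  have oneE : one = 1%N :> nat by rewrite inordK// ltnS.
  have one0 : (0 < one)%N by rewrite oneE.
  have onef : (one == ord0) = false by apply/negbTE; rewrite -val_eqE /= oneE.
  pose c := X lam one ord0.
  have cE : c = m lam 1%N * beta 1%N ord0 (m lam 1%N) by rewrite /c mxE onef oneE.
  have X1 : X lam one ord_max = 0 by rewrite mxE onef oneE b1 mulr0.
  have c0 : c != 0.
    rewrite cE mulf_neq0//; have [p _ _] := ndj one one0; move: p; rewrite oneE b1 expr0n addr0.
    by apply: contraTneq => ->; rewrite expr0n ltxx.
  rewrite waveE; apply: (wave_hyperbolic hn omega0_neq0 eP sym on X0) => //.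
  + by exists one; rewrite X1 expr0n addr0 expf_neq0.
  + split.
      rewrite slot// mulf_neq0 ?expf_neq0//; have [_ h _] := ndj one one0; exact: (h oneE).
    (* All slots of node 1 but the first read node 0, which rests at 0, and the phase normalization
       makes the first one real. *)
    have Z1 : nodearg one (X lam) = c *: delta_mx ord0 ord0.
      apply/matrixP => l k; rewrite [LHS]mxE [LHS]mxE [RHS]mxE [delta_mx _ _ _ _]mxE.
      have [->|l0] := eqVneq l ord0.
        rewrite subn0 (_ : inord one = one); last by apply/val_inj; rewrite /= inordK.
        by move: k; apply: two_cases => /=; rewrite ?mulr1 ?mulr0.
      rewrite /= mulr0 (_ : inord (one - l) = ord0); first by rewrite mxE.
      apply/val_inj; rewrite /= oneE (_ : (1 - l)%N = 0%N) ?inordK//.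
      by apply/eqP; rewrite subn_eq0 lt0n.
    have fZ k : fbar (nodearg one (X lam), lam) ord0 k = (X lam *m (mulI_mx (omega lam))^T) one k.
      by rewrite -FX// networkE.
    have fZ2 k : fbar (nodearg one (X lam), lam) ord0 k = c * mulI_mx (omega lam) k ord0.
      rewrite fZ mxE (bigD1 ord0)//= big1 ?addr0 => [|l]; first by rewrite [_^T _ _]mxE.
      by move: l; apply: two_cases => //= _; rewrite X1 mul0r.
    have h := slot_rotation hn omega0_neq0 eP sym (omega := omega lam) c0 Z1.
    have p1 : fbar (nodearg one (X lam), lam) ord0 ord0 = 0 by rewrite fZ2 mxE /= mulr0.
    have p2 : fbar (nodearg one (X lam), lam) ord0 ord_max = omega lam * c by rewrite fZ2 mxE /= mulrC.
    by move=> k; rewrite [LHS]mxE [X in _ + X]mxE (h lam p1 p2 k) subrr.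
  + move=> j j1; have j0 : (0 < j)%N by exact: ltn_trans j1.
    have [_ _ /(_ j1) [h1 h2]] := ndj j j0; split.
      rewrite det2 !slot//.
      set z := (X in 0 < X).
      have -> : z = m lam j ^+ 4 * (node_block Q s beta sigma j (m lam j) ord0 ord0 *
        node_block Q s beta sigma j (m lam j) ord_max ord_max - node_block Q s beta sigma j (m lam j) ord0 ord_max *
        node_block Q s beta sigma j (m lam j) ord_max ord0) by rewrite /z; ring.
      by rewrite mulr_gt0// exprn_gt0.
    by rewrite tr2 !slot// -mulrDr mulf_neq0// expf_neq0.
(* By continuity sigma stays within 1 of its value at 0. *)
- exists (`|sigma 0| + 1).
  have sc : sigma (m l 1%N) @[l --> (0 : R)] --> sigma 0.
    have := fc sigma 1%N 0 n11 ss l00; by rewrite {2}/m normr0 powR0// gt_eqF// kap_gt0.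
  have sn : \forall l \near (0 : R), `|sigma 0 - sigma (m l 1%N)| <= 1.
    by move/cvgrPdist_le: sc; apply.
  apply: filterS sn => lam h _; rewrite /omega addrC addKr normrM mulrC ler_wpM2r//.
  have -> : sigma (m lam 1%N) = sigma 0 - (sigma 0 - sigma (m lam 1%N)) by rewrite subKr.
  by rewrite (le_trans (ler_normB _ _))// lerD2l.
- move=> i im; have [bs _ _] := H i im.
  apply: (@amplitude_sim_power R D lam0 (kap i) d (beta i ord0) (beta i ord_max)) => //.
  + exact: (powR_kap_le d01 im).
  + by move=> y yd; have [] := nd i y im yd.
  move=> lam Dl; rewrite /= !exprMn -mulrDr sqrtrM ?sqr_ge0// sqrtr_sqr ger0_norm// powR_ge0//.
Qed.
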